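(* Let $G$ be a locally compact, Hausdorff, second countable groupoid with left Haar system $\lambda$, and let $\mu$ be a quasi-invariant measure on $G^0$ with full support. Let $\mathfrak b=(\mathfrak K,\mathfrak B,\mathfrak B^\dagger)$, $H$, $\widehat\beta,\alpha,\beta$ be the data associated to $(G,\lambda,\mu)$ in the context, and identify $H\,{}_{\widehat\beta}\otimes_{\alpha}H$ with $L^2(G\,{}_s\!\times_r G,\nu^2_{s,r})$ and $H\,{}_{\alpha}\otimes_{\beta}H$ with $L^2(G\,{}_r\!\times_r G,\nu^2_{r,r})$ as described there. Then there exists a $C^*$-pseudo-multiplicative unitary $(\mathfrak b,H,\widehat\beta,\alpha,\beta,V)$ such that $(V\omega)(x,y)=\omega(x,x^{-1}y)$ for all $\omega\in C_c(G\,{}_s\!\times_r G)$ and $(x,y)\in G\,{}_r\!\times_r G$.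
   Context: General notions. $[Y]$ denotes the closed linear span of $Y$; products of sets of operators are elementwise. A $C^*$-base is a triple $\mathfrak b=(\mathfrak K,\mathfrak B,\mathfrak B^\dagger)$ of a Hilbert space and two commuting nondegenerate $C^*$-algebras $\mathfrak B,\mathfrak B^\dagger\subseteq\mathcal L(\mathfrak K)$; $\mathfrak b^\dagger=(\mathfrak K,\mathfrak B^\dagger,\mathfrak B)$. A $C^*$-$\mathfrak b$-module $H_\alpha=(H,\alpha)$ is a Hilbert space $H$ with a closed subspace $\alpha\subseteq\mathcal L(\mathfrak K,H)$ such that $[\alpha\mathfrak K]=H$, $[\alpha\mathfrak B]=\alpha$, $[\alpha^*\alpha]=\mathfrak B$; it carries the representation $\rho_\alpha\colon\mathfrak B^\dagger\to\mathcal L(H)$, $\rho_\alpha(b^\dagger)\xi\zeta=\xi b^\dagger\zeta$ ($\xi\in\alpha,\zeta\in\mathfrak K$). For $C^*$-$\mathfrak b^\dagger$-modules the roles of $\mathfrak B,\mathfrak B^\dagger$ are swapped. A $C^*$-$(\mathfrak b_1,\dots,\mathfrak b_n)$-module is a tuple $(H,\alpha_1,\dots,\alpha_n)$ with each $(H,\alpha_i)$ a $C^*$-$\mathfrak b_i$-module and $[\rho_{\alpha_i}(\mathfrak B_i^\dagger)\alpha_j]=\alpha_j$ for $i\neq j$. Relative tensor product. For a $C^*$-$\mathfrak b$-module $H_\beta$ and a $C^*$-$\mathfrak b^\dagger$-module $K_\gamma$, $H\,{}_\beta\otimes_\gamma K$ (the base is suppressed in the notation; the same definition applies with $\mathfrak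 b$, $\mathfrak b^\dagger$ interchanged) is the Hilbert space generated by elements $\xi\otimes\zeta\otimes\eta$ ($\xi\in\beta,\zeta\in\mathfrak K,\eta\in\gamma$) with $\langle\xi\otimes\zeta\otimes\eta|\xi'\otimes\zeta'\otimes\eta'\rangle=\langle\zeta|\xi^*\xi'\eta^*\eta'\zeta'\rangle$. The operators $|\xi\rangle_1\colon K\to H\,{}_\beta\otimes_\gamma K$ and $|\eta\rangle_2\colon H\to H\,{}_\beta\otimes_\gamma K$ are given by $|\xi\rangle_1\eta\zeta=\xi\otimes\zeta\otimes\eta=|\eta\rangle_2\xi\zeta$; put $|\beta\rangle_1=\{|\xi\rangle_1:\xi\in\beta\}$, $|\gamma\rangle_2=\{|\eta\rangle_2:\eta\in\gamma\}$. For further module structures $\alpha$ on $H$, $\delta$ on $K$ put $\alpha\triangleleft\gamma=[|\gamma\rangle_2\alpha]$, $\beta\triangleright\delta=[|\beta\rangle_1\delta]$; these are module structures on $H\,{}_\beta\otimes_\gamma K$. Operators $S\otimes\mathrm{id}$ and $\mathrm{id}\otimes T$ are determined by $(S\otimes\mathrm{id})|\eta\rangle_2=|\eta\rangle_2S$ and $(\mathrm{id}\otimes T)|\xi\rangle_1=|\xi\rangle_1T$ whenever $S$ intertwines the representations $\rho_\beta$ of the first leg, resp. $T$ the representations $\rho_\gamma$ of the second leg. Iterated relative tensor products are identified via the canonical associativity isomorphisms; $\Sigma$ denotes the flip $\xi\otimes\zeta\otimes\eta\mapsto\eta\otimes\zeta\otimes\xi$. $C^*$-pseudo-multiplicative unitary: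 a tuple $(\mathfrak b,H,\widehat\beta,\alpha,\beta,V)$ with $\mathfrak b$ a $C^*$-base, $(H,\widehat\beta,\alpha,\beta)$ a $C^*$-$(\mathfrak b^\dagger,\mathfrak b,\mathfrak b^\dagger)$-module and $V\colon H\,{}_{\widehat\beta}\otimes_\alpha H\to H\,{}_\alpha\otimes_\beta H$ a unitary with $V(\alpha\triangleleft\alpha)=\alpha\triangleright\alpha$, $V(\widehat\beta\triangleright\beta)=\widehat\beta\triangleleft\beta$, $V(\widehat\beta\triangleright\widehat\beta)=\alpha\triangleright\widehat\beta$, $V(\beta\triangleleft\alpha)=\beta\triangleleft\beta$, satisfying the pentagon equation $V_{23}V_{12}=V_{12}V_{13}V_{23}$ as operators $H\,{}_{\widehat\beta}\otimes_\alpha H\,{}_{\widehat\beta}\otimes_\alpha H\to H\,{}_\alpha\otimes_\beta H\,{}_\alpha\otimes_\beta H$. Here $V_{12}=V\otimes\mathrm{id}$, $V_{23}=\mathrm{id}\otimes V$, and $V_{13}\colon H\,{}_{\widehat\beta}\otimes_{\alpha\triangleright\alpha}(H\,{}_\alpha\otimes_\beta H)\to(H\,{}_{\widehat\beta}\otimes_\alpha H)\,{}_{\alpha\triangleleft\alpha}\otimes_\beta H$ is $\Sigma_{23}(V\otimes\mathrm{id})(\mathrm{id}\otimes\Sigma)$, where $\Sigma_{23}\colon(H\,{}_\alpha\otimes_\beta H)\,{}_{\widehat\beta\triangleleft\beta}\otimes_\alpha H\to(H\,{}_{\widehat\beta}\otimes_\alpha H)\,{}_{\alpha\triangleleft\alpha}\otimes_\beta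 H$ sends $|\eta\rangle_2|\xi\rangle_2\omega$ to $|\xi\rangle_2|\eta\rangle_2\omega$ ($\omega\in H,\xi\in\beta,\eta\in\alpha$). Groupoid data. $G^0$ is the unit space, $r,s$ are the range and source maps, $G^u=r^{-1}(u)$, $G_u=s^{-1}(u)$, $\lambda^{-1}$ is the right Haar system associated to $\lambda$ ($\lambda^{-1}_u$ is the image of $\lambda^u$ under inversion). Measures are Radon measures. Define measures on $G$ by $\int f\,d\nu=\int_{G^0}\int_{G^u}f\,d\lambda^u\,d\mu(u)$, $\int f\,d\nu^{-1}=\int_{G^0}\int_{G_u}f\,d\lambda_u^{-1}\,d\mu(u)$. Quasi-invariance of $\mu$ means that $\nu,\nu^{-1}$ are equivalent; $D=d\nu/d\nu^{-1}$. Put $\mathfrak K=L^2(G^0,\mu)$, $\mathfrak B=\mathfrak B^\dagger=C_0(G^0)$ acting by multiplication, $H=L^2(G,\nu)$. $L^2(G,\lambda)$ and $L^2(G,\lambda^{-1})$ are the Hilbert $C^*$-modules over $C_0(G^0)$ obtained by completing $C_c(G)$ with $\langle\xi'|\xi\rangle(u)=\int_{G^u}\overline{\xi'}\xi\,d\lambda^u$, $\xi f=(f\circ r)\xi$, resp. $\langle\xi'|\xi\rangle(u)=\int_{G_u}\overline{\xi'}\xi\,d\lambda^{-1}_u$, $\xi f=(f\circ s)\xi$. There are isometric embeddings $j\colon L^2(G,\lambda)\to\mathcal L(\mathfrak K,H)$, $\hat\jmath\colon L^2(G,\lambda^{-1})\to\mathcal L(\mathfrak K,H)$ with $(j(\xi)\zeta)(x)=\xi(x)\zeta(r(x))$,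 $(\hat\jmath(\xi)\zeta)(x)=\xi(x)D^{-1/2}(x)\zeta(s(x))$ for $\xi\in C_c(G)$, $\zeta\in C_c(G^0)$. Put $\alpha=\beta=j(L^2(G,\lambda))$, $\widehat\beta=\hat\jmath(L^2(G,\lambda^{-1}))$. $G\,{}_s\!\times_rG=\{(x,y):s(x)=r(y)\}$ and $G\,{}_r\!\times_rG=\{(x,y):r(x)=r(y)\}$ carry the measures $\int f\,d\nu^2_{s,r}=\int_{G^0}\int_{G^u}\int_{G^{s(x)}}f(x,y)\,d\lambda^{s(x)}(y)d\lambda^u(x)d\mu(u)$, $\int g\,d\nu^2_{r,r}=\int_{G^0}\int_{G^u}\int_{G^u}g(x,y)\,d\lambda^u(y)d\lambda^u(x)d\mu(u)$. The identifications are the unitaries given for $\eta,\xi\in C_c(G),\zeta\in C_c(G^0)$ by $\hat\jmath(\eta)\otimes\zeta\otimes j(\xi)\mapsto[(x,y)\mapsto\eta(x)D^{-1/2}(x)\zeta(s(x))\xi(y)]$ and $j(\eta)\otimes\zeta\otimes j(\xi)\mapsto[(x,y)\mapsto\eta(x)\zeta(r(x))\xi(y)]$. *)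

(* Defs.v *)
From HB Require Import structures.
From mathcomp Require Import all_boot all_order all_algebra.
From mathcomp Require Import all_classical all_reals all_analysis measurable_realfun.
From mathcomp Require Import complex ring_quotient generic_quotient.

Set Implicit Arguments.
Unset Strict Implicit.
Unset Printing Implicit Defensive.

Import Order.TTheory GRing.Theory Num.Theory.
Import numFieldNormedType.Exports.

Local Open Scope classical_set_scope.
Local Open Scope complex_scope.
Local Open Scope ring_scope.

Section Operators.
Variable R : realType.
Local Notation C := R[i].

Record ipSpace := IpSpace {
  ips_sort :> lmodType C;
  ips_form : {dot ips_sort for (@conjc R)} }.

(* [{dot _ for _}] is linear on the left; [ip] is linear on the right. *)
Definition ip (H : ipSpace) (x y : H) : C := ips_form H y x.

Definition hnorm (H : ipSpace) (x : H) : R := Num.sqrt (complex.Re (ip x x)).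

Definition hilbert (H : ipSpace) : Prop := forall u : nat -> H,
  (forall e : R, 0 < e -> exists N : nat, forall m n : nat,
     (N <= m)%N -> (N <= n)%N -> hnorm (u m - u n) < e) ->
  exists x : H, (fun n => hnorm (u n - x)) @ \oo --> (0 : R).

Definition lspan (V : lmodType C) (Y : set V) : set V :=
  [set v | exists n (c : 'I_n -> C) (y : 'I_n -> V),
     (forall i, Y (y i)) /\ v = \sum_(i < n) c i *: y i].

(* closed linear span, in norm for vectors and in operator norm for operators *)
Definition hspan (H : ipSpace) (Y : set H) : set H :=
  [set x | forall e : R, 0 < e -> exists2 y, lspan Y y & hnorm (x - y) <= e].

Definition bounded_op (H K : ipSpace) (T : H -> K) : Prop :=
  linear T /\ exists M : R, forall x, hnorm (T x) <= M * hnorm x.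

(* ||T - S|| <= e *)
Definition op_close (H K : ipSpace) (T S : H -> K) (e : R) : Prop :=
  forall x, hnorm (T x - S x) <= e * hnorm x.

Definition opspan (H K : ipSpace) (Y : set (H -> K)) : set (H -> K) :=
  [set T | bounded_op T /\
     forall e : R, 0 < e -> exists2 S, lspan (Y : set (H -> K : lmodType C)) S &
       op_close T S e].

Definition opmul (H K L : ipSpace) (X : set (K -> L)) (Y : set (H -> K)) :
  set (H -> L) := [set S \o T | S in X & T in Y].

Definition opapp (H K : ipSpace) (X : set (H -> K)) : set K :=
  [set T x | T in X & x in [set: H]].

(* The junk value [0] of [xget] is only taken when there is no adjoint, which
   does not happen for bounded operators between Hilbert spaces. *)
Definition adj (H K : ipSpace) (T : H -> K) : K -> H :=
  xget (fun=> 0) [set S : K -> H | forall x y, ip (T x) y = ip x (S y)].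

Definition unitary (H K : ipSpace) (U : H -> K) : Prop :=
  [/\ linear U, forall x y, ip (U x) (U y) = ip x y & forall y, exists x, U x = y].

Definition is_nondegenerate_Calgebra (K : ipSpace) (B : set (K -> K)) : Prop :=
  [/\ opspan B = B, opmul B B `<=` B, [set adj T | T in B] `<=` B &
      hspan (opapp B) = [set: K]].

Record baseData := BaseData {
  base_space : ipSpace;
  base_alg : set (base_space -> base_space);
  base_opalg : set (base_space -> base_space) }.
Arguments base_alg : clear implicits.
Arguments base_opalg : clear implicits.

Definition base_op (b : baseData) : baseData :=
  @BaseData (base_space b) (base_opalg b) (base_alg b).

Definition is_Cbase (b : baseData) : Prop :=
  [/\ hilbert (base_space b),
      is_nondegenerate_Calgebra (base_alg b),
      is_nondegenerate_Calgebra (base_opalg b) &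
      forall S T, base_alg b S -> base_opalg b T -> S \o T = T \o S].

Definition is_Cmodule (b : baseData) (H : ipSpace) (a : set (base_space b -> H)) :
    Prop :=
  [/\ hilbert H, opspan a = a, hspan (opapp a) = [set: H],
      opspan (opmul a (base_alg b)) = a &
      opspan (opmul [set adj xi | xi in a] a) = base_alg b].

(* rho_a(B^dagger) *)
Definition rho_image (b : baseData) (H : ipSpace) (a : set (base_space b -> H)) :
    set (H -> H) :=
  [set T | bounded_op T /\
     exists2 c, base_opalg b c & forall xi, a xi -> T \o xi = xi \o c].

Record opSet (H : ipSpace) := OpSet {
  opset_base : baseData;
  opset_set : set (base_space opset_base -> H) }.
Arguments opset_set {H} _.

Definition is_Cmultimodule (H : ipSpace) (n : nat) (a : 'I_n -> opSet H) : Prop :=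
  (forall i, is_Cmodule (opset_set (a i))) /\
  (forall i j, i != j ->
     opspan (opmul (rho_image (opset_set (a i))) (opset_set (a j))) =
     opset_set (a j)).

(* [T], with [t xi z eta] for xi (x) z (x) eta, is the Hilbert space generated by
   these elements; the values of [t] outside [be] and [ga] are irrelevant. *)
Definition is_rtp (B H K T : ipSpace) (be : set (B -> H)) (ga : set (B -> K))
    (t : (B -> H) -> B -> (B -> K) -> T) : Prop :=
  [/\ hilbert T,
      forall xi xi' z z' eta eta', be xi -> be xi' -> ga eta -> ga eta' ->
        ip (t xi z eta) (t xi' z' eta') =
        ip z (adj xi (xi' (adj eta (eta' z')))) &
      hspan [set x | exists xi z eta, [/\ be xi, ga eta & x = t xi z eta]] =
      [set: T]].

Record rtp (B H K : ipSpace) (be : set (B -> H)) (ga : set (B -> K)) := Rtp {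
  rtp_space :> ipSpace;
  rtp_tens : (B -> H) -> B -> (B -> K) -> rtp_space;
  rtp_ax : is_rtp be ga rtp_tens }.

Section Kets.
Variables (B H K : ipSpace) (be : set (B -> H)) (ga : set (B -> K)) (X : rtp be ga).

(* |xi>_1 and |eta>_2: the bounded operators with the given values, which exist
   for [xi] in [be] and [eta] in [ga] and are unique since [ga B] and [be B]
   span [K] and [H]. *)
Definition ket1 (xi : B -> H) : K -> X :=
  xget (fun=> 0) [set F : K -> X | bounded_op F /\
    forall eta z, ga eta -> F (eta z) = rtp_tens X xi z eta].
Definition ket2 (eta : B -> K) : H -> X :=
  xget (fun=> 0) [set F : H -> X | bounded_op F /\
    forall xi z, be xi -> F (xi z) = rtp_tens X xi z eta].

(* al <| ga *)
Definition tril (al : set (B -> H)) : set (B -> X) :=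
  opspan (opmul [set ket2 eta | eta in ga] al).

(* be |> de *)
Definition trir (de : set (B -> K)) : set (B -> X) :=
  opspan (opmul [set ket1 xi | xi in be] de).

End Kets.
Arguments tril {B H K be ga} X al.
Arguments trir {B H K be ga} X de.

(* In each of the following predicates the conditions determine [F], because the
   ranges of the kets span. *)
Definition is_tens_id (B H H' K : ipSpace) (be : set (B -> H)) (be' : set (B -> H'))
    (ga : set (B -> K)) (X : rtp be ga) (Y : rtp be' ga) (S : H -> H')
    (F : X -> Y) : Prop :=
  bounded_op F /\ forall eta, ga eta -> F \o ket2 X eta = ket2 Y eta \o S.

Definition is_id_tens (B H K K' : ipSpace) (be : set (B -> H)) (ga : set (B -> K))
    (ga' : set (B -> K')) (X : rtp be ga) (Y : rtp be ga') (S : K -> K')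
    (F : X -> Y) : Prop :=
  bounded_op F /\ forall xi, be xi -> F \o ket1 X xi = ket1 Y xi \o S.

Definition is_flip (B H K : ipSpace) (be : set (B -> H)) (ga : set (B -> K))
    (X : rtp be ga) (Y : rtp ga be) (F : X -> Y) : Prop :=
  bounded_op F /\ forall xi z eta, be xi -> ga eta ->
    F (rtp_tens X xi z eta) = rtp_tens Y eta z xi.

(* F is the associativity isomorphism (H (x) K) (x) L -> H (x) (K (x) L), where [de]
   is the module structure of the middle leg used on the right. *)
Definition is_assoc (B H K L : ipSpace) (be : set (B -> H)) (ga de : set (B -> K))
    (ep : set (B -> L)) (X : rtp be ga) (Y : rtp de ep)
    (XL : rtp (trir X de) ep) (XR : rtp be (tril Y ga)) (F : XL -> XR) : Prop :=
  unitary F /\ forall xi eta, be xi -> ep eta ->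
    F \o ket2 XL eta \o ket1 X xi = ket1 XR xi \o ket2 Y eta.

(* F = Sigma_23 : |eta>_2 |xi>_2 w |-> |xi>_2 |eta>_2 w *)
Definition is_flip23 (B H K L : ipSpace) (be be' : set (B -> H)) (ga : set (B -> K))
    (ep : set (B -> L)) (X : rtp be ga) (Y : rtp be' ep)
    (XL : rtp (tril X be') ep) (YK : rtp (tril Y be) ga) (F : XL -> YK) : Prop :=
  bounded_op F /\ forall xi eta, ga xi -> ep eta ->
    F \o ket2 XL eta \o ket2 X xi = ket2 YK xi \o ket2 Y eta.

Section Pmu.
Variables (b : baseData) (H : ipSpace) (hbe al be : set (base_space b -> H)).
Variables (X : rtp hbe al) (Y : rtp al be) (V : X -> Y).

(* The spaces and operators asserted to exist are unique up to unique compatible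
   unitaries, so the choice does not matter:
     T1 = (H hbe(x)al H) hbe(x)al H       T1' = H hbe(x)al (H hbe(x)al H)
     T2 = (H al(x)be H) hbe(x)al H        T2' = H al(x)be (H hbe(x)al H)
     T3 = (H al(x)be H) al(x)be H         T3' = H al(x)be (H al(x)be H)
     T4 = H hbe(x) (H al(x)be H)
     Z  = H be(x)al H
     T5 = (H hbe(x)al H) be(x)al H        T5' = H hbe(x)al (H be(x)al H)
     T6 = (H al(x)be H) (x)al H           T7 = (H hbe(x)al H) (x)be H
   where the module structures are as indicated by the types below. *)
Definition pentagon : Prop :=
  exists (Z : rtp be al)
    (T1 : rtp (trir X hbe) al) (T1' : rtp hbe (tril X al))
    (T2 : rtp (trir Y hbe) al) (T2' : rtp al (tril X be))
    (T3 : rtp (trir Y al) be) (T3' : rtp al (tril Y be))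
    (T4 : rtp hbe (trir Y al))
    (T5 : rtp (trir X be) al) (T5' : rtp hbe (tril Z al))
    (T6 : rtp (tril Y hbe) al) (T7 : rtp (tril X al) be),
  exists (a1 : T1 -> T1') (a2 : T2 -> T2') (a3 : T3 -> T3') (a5 : T5 -> T5')
    (a5i : T5' -> T5),
    [/\ is_assoc a1, is_assoc a2, is_assoc a3, is_assoc a5 & cancel a5 a5i] /\
  exists (V12 : T1 -> T2) (V23 : T2' -> T3') (V23' : T1' -> T4) (V12' : T7 -> T3),
    [/\ is_tens_id V V12, is_id_tens V V23, is_id_tens V V23' & is_tens_id V V12'] /\
  exists (sigma : Y -> Z) (sigma' : T4 -> T5') (W : T5 -> T6) (sigma23 : T6 -> T7),
    [/\ is_flip sigma, is_id_tens sigma sigma', is_tens_id V W &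
        is_flip23 sigma23] /\
  let V13 := sigma23 \o W \o a5i \o sigma' in
  V23 \o a2 \o V12 = a3 \o V12' \o V13 \o V23' \o a1.

Definition is_Cpmu : Prop :=
  [/\ is_Cbase b,
      is_Cmultimodule (fun i : 'I_3 => match val i with
        | 0 => OpSet (hbe : set (base_space (base_op b) -> H))
        | 1 => OpSet (al : set (base_space b -> H))
        | _ => OpSet (be : set (base_space (base_op b) -> H)) end),
      unitary V,
      [/\ [set V \o T | T in tril X al] = trir Y al,
          [set V \o T | T in trir X be] = tril Y hbe,
          [set V \o T | T in trir X hbe] = trir Y hbe &
          [set V \o T | T in tril X be] = tril Y be] &
      pentagon].

End Pmu.

End Operators.

Section L2.
Context d (T : measurableType d) (R : realType).
Variable mu : {measure set T -> \bar R}.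
Local Notation C := R[i].

Definition sqint : {pred T -> C} :=
  [pred f | ((@complex.Re R \o f) \in Lfun mu 2%:E) && ((@complex.Im R \o f) \in Lfun mu 2%:E)].

Lemma le12 : (1 <= 2%:E :> \bar R)%E. Proof. by rewrite lee_fin ler1n. Qed.

Lemma sqint_submod_closed : submod_closed sqint.
Proof.
have [z s] := Lfun_submod_closed mu le12.
split=> [|a f g].
  by rewrite inE /=; apply/andP.
rewrite !inE /= => /andP[f1 f2] /andP[g1 g2]; apply/andP; split.
  have -> : @complex.Re R \o (a *: f + g) = complex.Re a *: (@complex.Re R \o f)
      + (- complex.Im a *: (@complex.Im R \o f) + (@complex.Re R \o g)).
    apply/funext => x; rewrite -[LHS]/(complex.Re (a * f x + g x)) /=.
    rewrite !fctE /= /GRing.scale /=.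
    by case: a (f x) (g x) => a b [? ?] [? ?] /=; rewrite mulNr addrA.
  exact: (s _ _ _ f1 (s _ _ _ f2 g1)).
have -> : @complex.Im R \o (a *: f + g) = complex.Re a *: (@complex.Im R \o f)
    + (complex.Im a *: (@complex.Re R \o f) + (@complex.Im R \o g)).
  apply/funext => x; rewrite -[LHS]/(complex.Im (a * f x + g x)) /=.
  rewrite !fctE /= /GRing.scale /=.
  by case: a (f x) (g x) => a b [? ?] [? ?] /=; rewrite addrA.
exact: (s _ _ _ f2 (s _ _ _ f1 g2)).
Qed.
HB.instance Definition _ := GRing.isSubmodClosed.Build _ _ sqint sqint_submod_closed.

Record sqfun := Sqfun { sqfun_val :> T -> C; _ : sqfun_val \in sqint }.
HB.instance Definition _ := [isSub for sqfun_val].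
HB.instance Definition _ := [Choice of sqfun by <:].
HB.instance Definition _ := [SubChoice_isSubLmodule of sqfun by <:].

Definition nullfun : {pred sqfun} := [pred f : sqfun | `[< \forall x \ae mu, f x = 0 >]].

Lemma nullfun_zmod_closed : zmod_closed nullfun.
Proof.
split; first by apply/asboolP; apply: nearW.
move=> f g /asboolP f0 /asboolP g0; apply/asboolP.
by apply: filterS2 f0 g0 => x; rewrite -[(f - g) x]/(f x - g x) => -> ->; rewrite subr0.
Qed.
HB.instance Definition _ := GRing.isZmodClosed.Build _ nullfun nullfun_zmod_closed.

Definition L2 := Quotient.quot nullfun.
HB.instance Definition _ := GRing.Zmodule.on L2.
HB.instance Definition _ := ZmodQuotient.on L2.
Local Open Scope quotient_scope.

Lemma L2P (f g : sqfun) : \pi_L2 f = \pi_L2 g <-> \forall x \ae mu, f x = g x.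
Proof.
split=> h.
  have : f - g \in nullfun by rewrite Quotient.idealrBE; exact/eqP.
  move=> /asboolP h0; apply: filterS h0 => x.
  by rewrite -[(f - g) x]/(f x - g x) => /eqP; rewrite subr_eq0 => /eqP.
apply/eqP; rewrite -Quotient.idealrBE; apply/asboolP.
by apply: filterS h => x; rewrite -[(f - g) x]/(f x - g x) => ->; rewrite subrr.
Qed.

Definition L2scale (a : C) (x : L2) : L2 := \pi_L2 (a *: repr x).

Lemma pi_scale a f : \pi_L2 (a *: f) = L2scale a (\pi_L2 f).
Proof.
have /L2P h : \pi_L2 f = \pi_L2 (repr (\pi_L2 f)) by rewrite reprK.
by apply/L2P; apply: filterS h => x e; rewrite -[LHS]/(a * f x) e.
Qed.

Let scA a b v : L2scale a (L2scale b v) = L2scale (a * b) v.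
Proof. by rewrite -[v]reprK -(pi_scale b) -(pi_scale a) -pi_scale scalerA. Qed.
Let sc1 : left_id 1 L2scale.
Proof. by move=> v; rewrite -[v]reprK -pi_scale scale1r. Qed.
Let piD (f g : sqfun) : \pi_L2 (f + g) = \pi_L2 f + \pi_L2 g.
Proof. exact: (raddfD (\pi_L2 : {additive _ -> _})). Qed.
Let scDr : right_distributive L2scale +%R.
Proof.
move=> a u v; rewrite -[u]reprK -[v]reprK -piD -(pi_scale a (repr u)).
by rewrite -(pi_scale a (repr v)) -pi_scale -piD scalerDr.
Qed.
Let scDl v : {morph L2scale^~ v : a b / a + b}.
Proof.
move=> a b /=; rewrite -[v]reprK -(pi_scale a) -(pi_scale b) -(pi_scale (a + b)).
by rewrite -piD scalerDl.
Qed.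
HB.instance Definition _ := GRing.Zmodule_isLmodule.Build C L2 scA sc1 scDr scDl.

End L2.

Section L2dot.
Context d (T : measurableType d) (R : realType).
Local Notation C := R[i].

Definition cint (m : set T -> \bar R) (D : set T) (f : T -> C) : C :=
  fine (\int[m]_(x in D) (complex.Re (f x))%:E)%E
    +i* fine (\int[m]_(x in D) (complex.Im (f x))%:E)%E.

Variable mu : {measure set T -> \bar R}.
Local Notation cform f g := (cint mu setT (fun x => f x * conjc (g x))).

Definition L2form (u v : L2 mu) : C := cform (repr u) (repr v).

Let int2 (f g : T -> R) : f \in Lfun mu 2%:E -> g \in Lfun mu 2%:E ->
  mu.-integrable setT (EFin \o (f \* g)).
Proof. by move=> f2 g2; apply/Lfun1_integrable; exact: Lfun2_mul_Lfun1. Qed.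

Let intRe (f g : sqfun mu) :
  mu.-integrable setT (fun x => (complex.Re (f x * conjc (g x)))%:E).
Proof.
case: f g => [f /andP[f1 f2]] [g /andP[g1 g2]] /=.
have -> : (fun x => (complex.Re (f x * conjc (g x)))%:E) =
  (EFin \o ((@complex.Re R \o f) \* (@complex.Re R \o g))) \+
  (EFin \o ((@complex.Im R \o f) \* (@complex.Im R \o g))).
  by apply/funext => x /=; case: (f x) (g x) => ? ? [? ?] /=; rewrite mulrN opprK EFinD.
by apply: integrableD => //; exact: int2.
Qed.

Let intIm (f g : sqfun mu) :
  mu.-integrable setT (fun x => (complex.Im (f x * conjc (g x)))%:E).
Proof.
case: f g => [f /andP[f1 f2]] [g /andP[g1 g2]] /=.
have -> : (fun x => (complex.Im (f x * conjc (g x)))%:E) =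
  (EFin \o ((@complex.Im R \o f) \* (@complex.Re R \o g))) \+
  (EFin \o ((fun x => - complex.Re (f x)) \* (@complex.Im R \o g))).
  by apply/funext => x /=; case: (f x) (g x) => ? ? [? ?] /=; rewrite mulrN addrC mulNr EFinD.
have f1' : - (@complex.Re R \o f) \in Lfun mu 2%:E by rewrite rpredN.
by apply: integrableD => //; exact: int2.
Qed.

Let cform_ae (f f' g g' : sqfun mu) : (\forall x \ae mu, f x = f' x) ->
  (\forall x \ae mu, g x = g' x) -> cform f g = cform f' g'.
Proof.
move=> ff gg; congr (fine _ +i* fine _); apply: ae_eq_integral => //.
- by have /integrableP[] := intRe f g.
- by have /integrableP[] := intRe f' g'.
- by apply: filterS2 ff gg => x -> ->.
- by have /integrableP[] := intIm f g.
- by have /integrableP[] := intIm f' g'.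
- by apply: filterS2 ff gg => x -> ->.
Qed.

Lemma L2formE (f g : sqfun mu) :
  L2form (\pi_(L2 mu)%qT f) (\pi_(L2 mu)%qT g) = cform f g.
Proof. by apply: cform_ae; apply/L2P; rewrite reprK. Qed.

Let ReD (x y : C) : complex.Re (x + y) = complex.Re x + complex.Re y.
Proof. by case: x y => ? ? []. Qed.
Let ImD (x y : C) : complex.Im (x + y) = complex.Im x + complex.Im y.
Proof. by case: x y => ? ? []. Qed.
Let ReM (x y : C) :
  complex.Re (x * y) = complex.Re x * complex.Re y + (- complex.Im x) * complex.Im y.
Proof. by case: x y => ? ? [? ?] /=; rewrite mulNr. Qed.
Let ImM (x y : C) :
  complex.Im (x * y) = complex.Re x * complex.Im y + complex.Im x * complex.Re y.
Proof. by case: x y => ? ? [? ?]. Qed.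

Let cform_linear (a : C) (f f' g : sqfun mu) :
  cform (a *: f + f') g = a * cform f g + cform f' g.
Proof.
have e x : (a *: f + f') x * conjc (g x) = a * (f x * conjc (g x)) + f' x * conjc (g x).
  by rewrite mulrA -mulrDl.
have lin (b c : R) (u v w : T -> R) :
    mu.-integrable setT (EFin \o u) -> mu.-integrable setT (EFin \o v) ->
    mu.-integrable setT (EFin \o w) ->
    (\int[mu]_x (b * u x + c * v x + w x) =
     b * \int[mu]_x u x + c * \int[mu]_x v x + \int[mu]_x w x).
  move=> iu iv iw.
  have ib : mu.-integrable setT (EFin \o (fun x => b * u x)) by exact: (integrableZl measurableT b iu).
  have ic : mu.-integrable setT (EFin \o (fun x => c * v x)) by exact: (integrableZl measurableT c iv).
  have ibc : mu.-integrable setT (EFin \o (fun x => b * u x + c * v x)) by exact: (integrableD measurableT ib ic).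
  by rewrite RintegralD// RintegralD// RintegralZl// RintegralZl.
have re := lin (complex.Re a) (- complex.Im a) _ _ _ (intRe f g) (intIm f g) (intRe f' g).
have im := lin (complex.Re a) (complex.Im a) _ _ _ (intIm f g) (intRe f g) (intIm f' g).
rewrite /cint; under [X in fine X +i* _]eq_integral do rewrite e ReD ReM.
under [X in _ +i* fine X]eq_integral do rewrite e ImD ImM.
rewrite -!/(Rintegral _ _ _) {}re {}im {lin e}; case: a => a1 a2 /=.
by rewrite mulNr.
Qed.

Let cform_sym (f g : sqfun mu) : cform f g = conjc (cform g f).
Proof.
have im := RintegralZl (-1) measurableT (intIm g f).
rewrite /cint /=; congr (_ +i* _).
  congr fine; apply: eq_integral => x _; congr EFin.
  by case: (f x) (g x) => ? ? [? ?] /=; rewrite !mulrN !opprK; congr (_ + _); rewrite mulrC.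
rewrite -!/(Rintegral _ _ _) -mulN1r -im; apply: eq_Rintegral => x _.
by case: (f x) (g x) => ? ? [? ?] /=; rewrite !mulrN mulN1r opprD opprK addrC mulrC; congr (_ - _); rewrite mulrC.
Qed.

Let cform_gt0 (f : sqfun mu) : \pi_(L2 mu)%qT f != 0 -> 0 < cform f f.
Proof.
move=> f0; have im0 : complex.Im (cform f f) = 0.
  have := cform_sym f f; case: (cform _ _) => a b /= [] /eqP.
  by rewrite -subr_eq0 opprK -mulr2n mulrn_eq0 => /eqP.
have sq x : complex.Re (f x * conjc (f x)) = complex.Re (f x) ^+ 2 + complex.Im (f x) ^+ 2.
  by case: (f x) => ? ? /=; rewrite mulrN opprK !expr2.
have sq0 x : 0 <= complex.Re (f x * conjc (f x)) by rewrite sq addr_ge0 ?sqr_ge0.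
suff : 0 < complex.Re (cform f f).
  by move: im0; case: (cform _ _) => a b /= -> ?; rewrite ltcE /= eqxx.
rewrite lt_neqAle Rintegral_ge0// andbT eq_sym; apply: contra f0 => /eqP i0.
have [mf _] := integrableP _ _ _ (intRe f f).
have : (\int[mu]_x `|(complex.Re (f x * conjc (f x)))%:E| = 0)%E.
  under eq_integral do rewrite gee0_abs ?lee_fin//.
  rewrite -[LHS]fineK; first by congr EFin; exact: i0.
  exact: (integrable_fin_num measurableT (intRe f f)).
move/(ae_eq_integral_abs mu measurableT mf) => h.
have <- : \pi_(L2 mu)%qT (0 : sqfun mu) = 0.
  exact: (raddf0 (\pi_(L2 mu)%qT : {additive _ -> _})).
apply/eqP/L2P; apply: filterS h => x /(_ I) /= [].
rewrite sq => /eqP; rewrite paddr_eq0 ?sqr_ge0// !sqrf_eq0.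
by case: (f x) => a b /= /andP[/eqP-> /eqP->].
Qed.

Let piK (u : L2 mu) : \pi_(L2 mu)%qT (repr u) = u. Proof. exact: reprK. Qed.

Let pi_lin (a : C) (f g : sqfun mu) :
  \pi_(L2 mu)%qT (a *: f + g) = a *: \pi_(L2 mu)%qT f + \pi_(L2 mu)%qT g.
Proof.
rewrite -[a *: \pi_(L2 mu)%qT f]/(L2scale a _) -pi_scale.
exact: (raddfD (\pi_(L2 mu)%qT : {additive _ -> _})).
Qed.

Let L2form_lin (a : C) (u u' v : L2 mu) :
  L2form (a *: u + u') v = a * L2form u v + L2form u' v.
Proof. by rewrite -[u]piK -[u']piK -[v]piK -pi_lin !L2formE cform_linear. Qed.

Let L2form_sym (u v : L2 mu) : L2form u v = conjc (L2form v u).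
Proof. exact: cform_sym. Qed.

Let L2form_bilinear : bilinear_for
  ( *%R : GRing.Scale.law C C) (@conjc R \; *%R : GRing.Scale.law C C) L2form.
Proof.
split=> [v a u u'|u a v v'] /=; first exact: L2form_lin.
rewrite L2form_sym L2form_lin rmorphD rmorphM /=.
by rewrite (L2form_sym u v) (L2form_sym u v').
Qed.

HB.instance Definition _ := bilinear_isBilinear.Build C (L2 mu) (L2 mu) C
  ( *%R) (@conjc R \; *%R) L2form L2form_bilinear.

Let L2form_hermitian (u v : L2 mu) : L2form u v = (-1) ^+ false * conjc (L2form v u).
Proof. by rewrite expr0 mul1r -L2form_sym. Qed.
HB.instance Definition _ := isHermitianSesquilinear.Build C (L2 mu) false (@conjc R)
  L2form L2form_hermitian.

Let L2form_gt0 (u : L2 mu) : u != 0 -> 0 < L2form u u.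
Proof. by move=> u0; apply: cform_gt0; rewrite piK. Qed.
HB.instance Definition _ := isDotProduct.Build C (L2 mu) L2form L2form_gt0.

Definition L2space : ipSpace R := IpSpace L2form.

(* The class of [f]; it is [0] when [f] is not square integrable. *)
Definition cls (f : T -> C) : L2space := \pi_(L2 mu)%qT (insubd (0 : sqfun mu) f).

End L2dot.

Notation borel X := (g_sigma_algebraType (@open X)).

Section Topology.
Variables (R : realType) (X : ptopologicalType).
Local Notation C := R[i].

Definition ccontinuous (f : X -> C) : Prop :=
  continuous (fun x => complex.Re (f x)) /\ continuous (fun x => complex.Im (f x)).

Definition Cc : set (X -> C) :=
  [set f | ccontinuous f /\ compact (closure [set x | f x != 0])].

Definition C0 : set (X -> C) :=
  [set f | ccontinuous f /\
     forall e : R, 0 < e -> compact [set x | e%:C <= `|f x|]].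

Definition radon (m : {measure set (borel X) -> \bar R}) : Prop :=
  [/\ forall A, compact A -> (m A < +oo)%E,
      forall A : set (borel X), measurable A ->
        m A = ereal_inf [set m U | U in [set U | open (U : set X) /\ A `<=` U]] &
      forall U : set X, open U ->
        m U = ereal_sup [set m A | A in [set A | compact (A : set X) /\ A `<=` U]]].

Definition full_support (m : {measure set (borel X) -> \bar R}) : Prop :=
  forall U : set X, open U -> U !=set0 -> (0 < m U)%E.

Definition mulC0 (m : {measure set (borel X) -> \bar R}) :
    set (L2space m -> L2space m) :=
  [set M | exists2 f, C0 f &
     forall g, g \in sqint m -> M (cls m g) = cls m (fun x => f x * g x)].

End Topology.
Arguments mulC0 {R X} m _.

(* The unit space is a separate space [gunits]; [gid] identifies it with a
   subspace of [garr], being continuous with continuous left inverse [gr].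
   [gmul x y] is only meaningful when [gs x = gr y]. *)
Record topGroupoid := TopGroupoid {
  gunits : ptopologicalType;
  garr :> ptopologicalType;
  gr : garr -> gunits;
  gs : garr -> gunits;
  gid : gunits -> garr;
  ginv : garr -> garr;
  gmul : garr -> garr -> garr;
  gr_id : forall u, gr (gid u) = u;
  gs_id : forall u, gs (gid u) = u;
  gr_mul : forall x y, gs x = gr y -> gr (gmul x y) = gr x;
  gs_mul : forall x y, gs x = gr y -> gs (gmul x y) = gs y;
  gmulA : forall x y z, gs x = gr y -> gs y = gr z ->
    gmul x (gmul y z) = gmul (gmul x y) z;
  gmul1l : forall x, gmul (gid (gr x)) x = x;
  gmul1r : forall x, gmul x (gid (gs x)) = x;
  gr_inv : forall x, gr (ginv x) = gs x;
  gs_inv : forall x, gs (ginv x) = gr x;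
  gmulVl : forall x, gmul (ginv x) x = gid (gs x);
  gmulVr : forall x, gmul x (ginv x) = gid (gr x);
  gr_cont : continuous gr;
  gs_cont : continuous gs;
  gid_cont : continuous gid;
  ginv_cont : continuous ginv;
  gmul_cont : {within [set p : garr * garr | gs p.1 = gr p.2],
    continuous (fun p => gmul p.1 p.2)} }.

(* [set_type] carries the subspace topology. *)
Definition fib_sr (G : topGroupoid) : Type := [set p : G * G | gs p.1 = gr p.2].
Definition fib_rr (G : topGroupoid) : Type := [set p : G * G | gr p.1 = gr p.2].

Section Fibres.
Variable G : topGroupoid.

Lemma fib_sr_pt : (gid (gr (point : G)), point : G) \in
  [set p : G * G | gs p.1 = gr p.2].
Proof. by rewrite inE /= gs_id. Qed.
Lemma fib_rr_pt : (point, point) \in [set p : G * G | gr p.1 = gr p.2].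
Proof. by rewrite inE. Qed.

HB.instance Definition _ := Topological.on (fib_sr G).
HB.instance Definition _ := isPointed.Build (fib_sr G) (exist (fun p : G * G => p \in _) _ fib_sr_pt).
HB.instance Definition _ := Topological.on (fib_rr G).
HB.instance Definition _ := isPointed.Build (fib_rr G) (exist (fun p : G * G => p \in _) _ fib_rr_pt).

Lemma shear_subproof (p : fib_rr G) :
  ((val p).1, gmul (ginv (val p).1) (val p).2) \in
    [set p : G * G | gs p.1 = gr p.2].
Proof.
have := valP p; move: (val p) => -[x y]; rewrite !inE /= => e.
by rewrite gr_mul ?gr_inv ?gs_inv.
Qed.

Definition shear (p : fib_rr G) : fib_sr G :=
  exist (fun q : G * G => q \in _) _ (shear_subproof p).

End Fibres.

Section GroupoidMeasures.
Variables (R : realType) (G : topGroupoid).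
Local Notation C := R[i].
Local Notation U := (gunits G).

(* [lam u] is a measure on G concentrated on G^u. *)
Definition is_Haar_system (lam : U -> {measure set (borel G) -> \bar R}) : Prop :=
  [/\ forall u, radon (lam u),
      forall u, lam u [set x : G | gr x != u] = 0%E /\
        forall W : set G, open W -> (exists2 x, W x & gr x = u) -> (0 < lam u W)%E,
      forall f : G -> C, Cc f -> ccontinuous (fun u => cint (lam u) setT f) &
      forall (f : G -> C) (x : G), Cc f ->
        cint (lam (gs x)) [set y : G | gr y = gs x] (fun y => f (gmul x y)) =
        cint (lam (gr x)) [set y : G | gr y = gr x] f].

(* lambda^{-1}_u is concentrated on G_u. *)
Definition haar_inv (lam : U -> {measure set (borel G) -> \bar R}) (u : U) :
    set (borel G) -> \bar R :=
  pushforward (lam u) (@ginv G : borel G -> borel G).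

Variable mu : {measure set (borel U) -> \bar R}.

Definition is_nu (k : U -> set (borel G) -> \bar R)
    (n : {measure set (borel G) -> \bar R}) : Prop :=
  forall f : borel G -> \bar R, measurable_fun [set: borel G] f -> (forall x, 0 <= f x)%E ->
    (\int[n]_x f x = \int[mu]_u \int[k u]_x f x)%E.

(* Every nonnegative Borel function on a fibre product is the restriction of one
   on G x G. *)
Definition is_nu2_sr (lam : U -> {measure set (borel G) -> \bar R})
    (n : {measure set (borel (fib_sr G)) -> \bar R}) : Prop :=
  forall f : borel (G * G)%type -> \bar R,
    measurable_fun [set: borel (G * G)%type] f -> (forall p, 0 <= f p)%E ->
    (\int[n]_p f (val (p : fib_sr G)) =
     \int[mu]_u \int[lam u]_x \int[lam (gs x)]_y f (x, y))%E.

Definition is_nu2_rr (lam : U -> {measure set (borel G) -> \bar R})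
    (n : {measure set (borel (fib_rr G)) -> \bar R}) : Prop :=
  forall f : borel (G * G)%type -> \bar R,
    measurable_fun [set: borel (G * G)%type] f -> (forall p, 0 <= f p)%E ->
    (\int[n]_p f (val (p : fib_rr G)) =
     \int[mu]_u \int[lam u]_x \int[lam u]_y f (x, y))%E.

Definition is_density (nu nu' : {measure set (borel G) -> \bar R}) (D : G -> R) :
    Prop :=
  [/\ measurable_fun [set: borel G] (D : borel G -> R), forall x, 0 <= D x &
      forall A : set (borel G), measurable A ->
        (nu A = \int[nu']_(x in A) (D x)%:E)%E].

Variables (nu : {measure set (borel G) -> \bar R}) (D : G -> R).
Local Notation K := (L2space mu).
Local Notation H := (L2space nu).

(* D^{-1/2}; the value [0] where D = 0 only matters on a null set. *)
Definition Dm12 (x : G) : C := (D x `^ (- 2^-1))%:C.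

Definition is_j (xi : G -> C) (T : K -> H) : Prop := bounded_op T /\
  forall z : U -> C, Cc z -> T (cls mu z) = cls nu (fun x => xi x * z (gr x)).

Definition is_jhat (xi : G -> C) (T : K -> H) : Prop := bounded_op T /\
  forall z : U -> C, Cc z ->
    T (cls mu z) = cls nu (fun x => xi x * Dm12 x * z (gs x)).

Definition mod_ip (k : U -> set (borel G) -> \bar R) (xi' xi : G -> C) (u : U) : C :=
  cint (k u) setT (fun x => conjc (xi' x) * xi x).

(* The image of the completion of C_c(G) for the norm sup_u <xi|xi>(u)^(1/2) under
   the continuous extension of [J]: an element of the completion is given by a
   Cauchy sequence in C_c(G). *)
Definition completed_image (k : U -> set (borel G) -> \bar R)
    (J : (G -> C) -> (K -> H) -> Prop) : set (K -> H) :=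
  [set T | bounded_op T /\ exists (xi : nat -> G -> C) (S : nat -> K -> H),
    [/\ forall n, Cc (xi n) /\ J (xi n) (S n),
        forall e : R, 0 < e -> exists N : nat, forall m n : nat,
          (N <= m)%N -> (N <= n)%N -> forall u,
          complex.Re (mod_ip k (xi m \- xi n) (xi m \- xi n) u) <= e ^+ 2 &
        forall e : R, 0 < e -> exists N : nat, forall n : nat,
          (N <= n)%N -> op_close (S n) T e]].

Variable lam : U -> {measure set (borel G) -> \bar R}.

Definition gpd_base : baseData R := BaseData (mulC0 mu) (mulC0 mu).
Definition gpd_alpha : set (K -> H) := completed_image lam is_j.
Definition gpd_beta : set (K -> H) := gpd_alpha.
Definition gpd_hbeta : set (K -> H) := completed_image (haar_inv lam) is_jhat.

Definition identifies_sr (n : {measure set (borel (fib_sr G)) -> \bar R})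
    (t : (K -> H) -> K -> (K -> H) -> L2space n) : Prop :=
  forall (eta xi : G -> C) (z : U -> C) (S T : K -> H),
    Cc eta -> Cc xi -> Cc z -> is_jhat eta S -> is_j xi T ->
    t S (cls mu z) T = cls n (fun p : fib_sr G =>
      eta (val p).1 * Dm12 (val p).1 * z (gs (val p).1) * xi (val p).2).

Definition identifies_rr (n : {measure set (borel (fib_rr G)) -> \bar R})
    (t : (K -> H) -> K -> (K -> H) -> L2space n) : Prop :=
  forall (eta xi : G -> C) (z : U -> C) (S T : K -> H),
    Cc eta -> Cc xi -> Cc z -> is_j eta S -> is_j xi T ->
    t S (cls mu z) T = cls n (fun p : fib_rr G =>
      eta (val p).1 * z (gr (val p).1) * xi (val p).2).

End GroupoidMeasures.
Arguments gpd_alpha {R G} mu nu lam _.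
Arguments gpd_beta {R G} mu nu lam _.
Arguments gpd_hbeta {R G} mu nu D lam _.

(* Main.v *)
(* Every operator in sight is a weighted composition operator f |-> c (f o phi)
   between L^2 spaces, or a limit of such. V is composition with the shear
   (x, y) |-> (x, x^{-1} y), which is measure preserving by left invariance of the
   Haar system. Each module structure on a relative tensor product is the closed
   span of the operators z |-> W w (z o Q), with w continuous of compact support,
   W a weight and Q a map to the unit space; composition with the shear carries
   these data into one another. For the structure hbeta |> hbeta the weights match
   because D^{-1/2} is almost everywhere multiplicative, which follows from
   quasi-invariance of mu. For the pentagon equation all relative tensor products
   are realized on one L^2 space of triples; both sides become composition
   operators, and their equality is the associativity of the groupoid. *)
From HB Require Import structures.
Require Import Defs.
From mathcomp Require Import all_boot all_order all_algebra.
From mathcomp Require Import all_classical all_reals all_analysis measurable_realfun.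
From mathcomp Require Import complex ring lra generic_quotient.

Set Implicit Arguments.
Unset Strict Implicit.
Unset Printing Implicit Defensive.

Import Order.TTheory GRing.Theory Num.Theory.
Import numFieldNormedType.Exports.

Local Open Scope classical_set_scope.
Local Open Scope complex_scope.
Local Open Scope ring_scope.

(** * Hilbert spaces and relative tensor products *)

Section Hilbert.
Variable R : realType.
Local Notation C := R[i].
Implicit Types H K L : ipSpace R.

(** The tensors in a relative tensor product must exist for all elements of the closed modules,
    while formulas are at hand only for functions in C_c. They are therefore built as limits
    ([dense_rtp]), with error estimates drawn from the inner product formula. Measures and Haar
    systems are given only through nonnegative functions or functions in C_c, so sesquilinear
    identities are obtained by polarization from identities of norms. Full support of [mu] turns
    operator norms into suprema: this makes [mulC0 mu] closed and lets approximation in a module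
    pass to kets. The shear does not map products xi(x) eta(y) to products; hence each span of kets
    is first shown to contain the operators for every w in C_c of the fibre product, by
    approximating w by sums of products under a compactly supported majorant. Multiplicativity of
    D^{-1/2} rests on a braid relation between two involutions of the composable pairs. In the
    pentagon, flips, transport along V and associativity can all be arranged to keep the underlying
    Hilbert space; every structural map is then the identity and one equation between kets
    remains. *)

Lemma le_eps (x y : R) : (forall e : R, 0 < e -> x <= y + e) -> x <= y.
Proof. by move=> h; apply/ler_addgt0Pr => e; exact: h. Qed.

Section IP.
Variable H : ipSpace R.
Implicit Types x y z : H.

Lemma ipDZr x (a : C) y z : ip x (a *: y + z) = a * ip x y + ip x z.
Proof. exact: linearPl. Qed.

Lemma ipC x y : ip x y = conjc (ip y x).
Proof. by rewrite /ip (hermC (ips_form H)) /= expr0 mul1r. Qed.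

Lemma ipDZl x (a : C) y z : ip (a *: y + z) x = conjc a * ip y x + ip z x.
Proof. by rewrite ipC ipDZr rmorphD rmorphM /= -!ipC. Qed.

Lemma ipDr x y z : ip x (y + z) = ip x y + ip x z.
Proof. by rewrite -[y]scale1r ipDZr mul1r scale1r. Qed.
Lemma ip0r x : ip x 0 = 0.
Proof. by apply: (addrI (ip x 0)); rewrite -ipDr !addr0. Qed.
Lemma ipZr x a y : ip x (a *: y) = a * ip x y.
Proof. by rewrite -[a *: y]addr0 ipDZr ip0r addr0. Qed.
Lemma ipNr x y : ip x (- y) = - ip x y.
Proof. by rewrite -scaleN1r ipZr mulN1r. Qed.
Lemma ipBr x y z : ip x (y - z) = ip x y - ip x z.
Proof. by rewrite ipDr ipNr. Qed.
Lemma ipDl x y z : ip (y + z) x = ip y x + ip z x.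
Proof. by rewrite ipC ipDr rmorphD /= -!ipC. Qed.
Lemma ip0l x : ip 0 x = 0. Proof. by rewrite ipC ip0r rmorph0. Qed.
Lemma ipZl x a y : ip (a *: y) x = conjc a * ip y x.
Proof. by rewrite ipC ipZr rmorphM /= -ipC. Qed.
Lemma ipNl x y : ip (- y) x = - ip y x.
Proof. by rewrite ipC ipNr rmorphN /= -ipC. Qed.
Lemma ipBl x y z : ip (y - z) x = ip y x - ip z x.
Proof. by rewrite ipDl ipNl. Qed.

Lemma ip_ge0 x : 0 <= ip x x.
Proof.
have [->|x0] := eqVneq x 0; first by rewrite ip0r.
exact/ltW/(@neq0_dnorm_gt0 _ _ _ (ips_form H)).
Qed.

Lemma hnorm_ge0 x : 0 <= hnorm x. Proof. exact: sqrtr_ge0. Qed.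

Lemma hnorm2 x : (hnorm x ^+ 2)%:C = ip x x.
Proof.
have := ip_ge0 x; rewrite /hnorm; case: (ip x x) => a b; rewrite lecE /=.
by move=> /andP[/eqP-> a0]; rewrite sqr_sqrtr.
Qed.

Lemma hnormC2 x : (hnorm x)%:C ^+ 2 = ip x x.
Proof. by rewrite -hnorm2 rmorphXn. Qed.

Lemma ip_eq0 x : (ip x x == 0) = (x == 0).
Proof.
apply/idP/idP => [|/eqP->]; last by rewrite ip0r.
by apply: contraLR => x0; rewrite gt_eqF// (@neq0_dnorm_gt0 _ _ _ (ips_form H)).
Qed.

Lemma hnorm_eq0 x : (hnorm x == 0) = (x == 0).
Proof.
rewrite -ip_eq0 -hnorm2; apply/idP/idP => [/eqP->|]; first by rewrite expr0n.
by move=> /eqP[] /eqP; rewrite sqrf_eq0.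
Qed.

Lemma ipI x y : (forall z, ip z x = ip z y) -> x = y.
Proof.
move=> e; apply/eqP; rewrite -subr_eq0 -ip_eq0; apply/eqP.
by rewrite ipBr e subrr.
Qed.

Lemma hnorm_sqr x : hnorm x ^+ 2 = complex.Re (ip x x).
Proof. by rewrite -hnorm2. Qed.

Lemma ip_CS x y : `|ip x y| <= (hnorm x * hnorm y)%:C.
Proof.
have [->|y0] := eqVneq y 0; first by rewrite ip0r normr0 lecR mulr_ge0 ?hnorm_ge0.
have Ny : 0 < ip y y by rewrite lt_def ip_eq0 y0 ip_ge0.
(* This quantity is the squared norm of [ip y y *: x - ip y x *: y], a multiple of the component of
   [x] orthogonal to [y]. *)
have : 0 <= ip y y * (ip x x * ip y y - `|ip x y| ^+ 2).
  rewrite sqr_normc; apply: le_trans (ip_ge0 (ip y y *: x - ip y x *: y)) _.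
  rewrite le_eqVlt; apply/orP; left; apply/eqP.
  by rewrite !(ipBl, ipBr, ipZl, ipZr) -!ipC; ring.
rewrite pmulr_rge0// subr_ge0 -!hnorm2 -rmorphM -exprMn rmorphXn.
by rewrite /= ler_sqr// ?nnegrE// lecR mulr_ge0 ?hnorm_ge0.
Qed.

Lemma Re_ip_le x y : complex.Re (ip x y) <= hnorm x * hnorm y.
Proof.
have := le_trans (normc_ge_Re (ip x y)) (ip_CS x y).
by rewrite lecR => /(le_trans (ler_norm _)).
Qed.

Lemma hnormD_sqr x y :
  hnorm (x + y) ^+ 2 = hnorm x ^+ 2 + hnorm y ^+ 2 + 2 * complex.Re (ip x y).
Proof.
rewrite !hnorm_sqr !(ipDl, ipDr) [ip y x]ipC.
by case: (ip x x) (ip y y) (ip x y) => a b [c d] [e f] /=; ring.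
Qed.

Lemma hnormD x y : hnorm (x + y) <= hnorm x + hnorm y.
Proof.
rewrite -ler_sqr ?nnegrE ?addr_ge0 ?hnorm_ge0// hnormD_sqr.
have := Re_ip_le x y; nra.
Qed.

Lemma hnormZ a x : (hnorm (a *: x))%:C = `|a| * (hnorm x)%:C.
Proof.
have h0 z : 0 <= (hnorm z)%:C by rewrite lecR hnorm_ge0.
apply/eqP; rewrite -(@eqrXn2 _ 2)//; last by rewrite mulr_ge0.
rewrite exprMn sqr_normc !hnormC2 ipZl ipZr.
by rewrite mulrA [conjc _ * _]mulrC.
Qed.

Lemma hnormN x : hnorm (- x) = hnorm x.
Proof. by rewrite /hnorm ipNl ipNr opprK. Qed.

Lemma hdistC x y : hnorm (x - y) = hnorm (y - x).
Proof. by rewrite -hnormN opprB. Qed.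

Lemma hdistD y x z : hnorm (x - z) <= hnorm (x - y) + hnorm (y - z).
Proof. by rewrite -(subrKA y x (- z)) hnormD. Qed.

Lemma hnorm0 : hnorm (0 : H) = 0.
Proof. by apply/eqP; rewrite hnorm_eq0. Qed.

Lemma hnorm_le0 x : (forall e : R, 0 < e -> hnorm x <= e) -> x = 0.
Proof.
move=> h; apply/eqP; rewrite -hnorm_eq0 eq_le hnorm_ge0 andbT.
by apply: le_eps => e /h; rewrite add0r.
Qed.

Definition subsp (A : set H) : Prop :=
  A 0 /\ forall a x y, A x -> A y -> A (a *: x + y).
Definition hclosed (A : set H) : Prop :=
  forall x, (forall e : R, 0 < e -> exists2 y, A y & hnorm (x - y) <= e) -> A x.

End IP.

Section LSpan.
Variable V : lmodType C.

Lemma lspan_sub (Y : set V) : Y `<=` lspan Y.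
Proof.
by move=> y Yy; exists 1%N, (fun=> 1), (fun=> y); split=> //; rewrite big_ord1 scale1r.
Qed.

Lemma lspan0 (Y : set V) : lspan Y 0.
Proof. by exists 0%N, (fun=> 0), (fun=> 0); split=> [[]|]//; rewrite big_ord0. Qed.

Lemma lspanP (Y : set V) a x y : lspan Y x -> lspan Y y -> lspan Y (a *: x + y).
Proof.
move=> [n [c [u [Yu ->]]]] [m [d [w [Yw ->]]]].
exists (n + m)%N, (fun i => match fintype.split i with inl j => a * c j | inr j => d j end),
  (fun i => match fintype.split i with inl j => u j | inr j => w j end); split.
  by move=> i; case: (fintype.split i).
rewrite big_split_ord scaler_sumr; congr (_ + _); apply: eq_bigr => i _.
  by rewrite (unsplitK (inl i)) scalerA.
by rewrite (unsplitK (inr i)).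
Qed.

Lemma lspan_min (Y A : set V) : A 0 -> (forall a x y, A x -> A y -> A (a *: x + y)) ->
  Y `<=` A -> lspan Y `<=` A.
Proof.
move=> A0 AD YA x [n [c [u [Yu ->]]]]; elim/big_ind: _ => //.
- by move=> v w Av Aw; rewrite -[v]scale1r; exact: AD.
- by move=> i _; rewrite -[_ *: _]addr0; apply: AD => //; exact: YA.
Qed.

End LSpan.

Lemma hspan_sub H (Y : set H) : Y `<=` hspan Y.
Proof.
by move=> y Yy e e0; exists y; [exact: lspan_sub|rewrite subrr hnorm0 ltW].
Qed.

(** Dividing by [|c| + 1] instead of [|c|] covers [c = 0]. This supplies the tolerance for the
    scaled summand whenever a combination [a *: x + y] is approximated. *)
Lemma scale_small (c : C) (e : R) : 0 < e ->
  exists2 d, 0 < d & forall r : R, 0 <= r <= d -> `|c| * r%:C <= e%:C.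
Proof.
move=> e0; pose m : R := complex.Re `|c|.
have mE : `|c| = m%:C by rewrite /m RRe_real// normr_real.
have m0 : 0 <= m by rewrite -lecR -mE; exact: normr_ge0.
exists (e / (m + 1)) => [|r /andP[r0 rd]]; first by rewrite divr_gt0// ltr_wpDl.
rewrite mE -rmorphM lecR (le_trans (ler_wpM2l m0 rd))// mulrCA ler_piMr ?(ltW e0)//.
by rewrite ler_pdivrMr ?ltr_wpDl// mul1r lerDl.
Qed.

Lemma hspan_closed H (Y : set H) : hclosed (hspan Y).
Proof.
move=> x h e e0; have e20 : 0 < e / 2 by rewrite divr_gt0.
have [y Yy xy] := h _ e20; have [z Yz yz] := Yy _ e20; exists z => //.
by rewrite (le_trans (hdistD y _ _))// [e]splitr lerD.
Qed.

Lemma hspan_subsp H (Y : set H) : subsp (hspan Y).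
Proof.
split=> [e e0|a x y hx hy e e0].
  by exists 0; [exact: lspan0|rewrite subr0 hnorm0 ltW].
have e20 : 0 < e / 2 by rewrite divr_gt0.
have [d d0 hd] := scale_small a e20.
have [x' Yx xx] := hx _ d0; have [y' Yy yy] := hy _ e20.
exists (a *: x' + y'); first exact: lspanP.
rewrite opprD addrACA -scalerBr (le_trans (hnormD _ _))// [leRHS]splitr lerD//.
by rewrite -lecR hnormZ hd// hnorm_ge0.
Qed.

Lemma hspan_min H (Y A : set H) : subsp A -> hclosed A -> Y `<=` A -> hspan Y `<=` A.
Proof.
move=> [A0 AD] Acl YA x hx; apply: Acl => e /hx[y Yy xy]; exists y => //.
exact: lspan_min Yy.
Qed.

Section Bounded.
Variables (H K : ipSpace R).
Implicit Types T S : H -> K.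

Lemma bop_lin T : bounded_op T -> forall a x y, T (a *: x + y) = a *: T x + T y.
Proof. by case=> lT _ a x y; rewrite lT. Qed.
Lemma bopD T : bounded_op T -> forall x y, T (x + y) = T x + T y.
Proof. by move=> bT x y; have := bop_lin bT 1 x y; rewrite !scale1r. Qed.
Lemma bop0 T : bounded_op T -> T 0 = 0.
Proof. by move=> bT; apply: (addrI (T 0)); rewrite -bopD// !addr0. Qed.
Lemma bopZ T : bounded_op T -> forall a x, T (a *: x) = a *: T x.
Proof. by move=> bT a x; rewrite -[a *: x]addr0 bop_lin// bop0// addr0. Qed.
Lemma bopB T : bounded_op T -> forall x y, T (x - y) = T x - T y.
Proof. by move=> bT x y; rewrite -scaleN1r bopD// bopZ// scaleN1r. Qed.
Lemma bop_bound T : bounded_op T -> exists2 M : R, 0 < M & forall x, hnorm (T x) <= M * hnorm x.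
Proof.
case=> _ [M hM]; exists (Num.max M 1) => [|x]; first by rewrite lt_max ltr01 orbT.
by rewrite (le_trans (hM x))// ler_wpM2r ?hnorm_ge0// le_max lexx.
Qed.

Lemma bopP a T S : bounded_op T -> bounded_op S -> bounded_op (a *: T + S : H -> K).
Proof.
move=> bT bS; split.
  move=> c x y; rewrite -[(_ + _ : H -> K) (c *: x + y)]/(a *: T _ + S _).
  rewrite -[(_ + _ : H -> K) x]/(a *: T _ + S _) -[(_ + _ : H -> K) y]/(a *: T _ + S _).
  by rewrite !bop_lin// !scalerDr !scalerA [c * a]mulrC addrACA.
have [M M0 hM] := bop_bound bT; have [N N0 hN] := bop_bound bS.
pose m : R := complex.Re `|a|.
have mE : `|a| = m%:C by rewrite /m RRe_real// normr_real.
exists (m * M + N) => x.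
rewrite (le_trans (hnormD _ _))// mulrDl lerD//.
have m0 : 0 <= m by rewrite -lecR -mE; exact: normr_ge0.
by rewrite -lecR hnormZ mE -rmorphM lecR -mulrA ler_wpM2l.
Qed.

Lemma bop_0 : bounded_op (0 : H -> K).
Proof.
split=> [a x y|]; first by rewrite scaler0 addr0.
by exists 0 => x; rewrite mul0r hnorm0.
Qed.

Lemma bop_isub_hclosed T (A : set K) : bounded_op T -> hclosed A -> hclosed (T @^-1` A).
Proof.
move=> bT Acl x h; apply: Acl => e e0.
have [M M0 hM] := bop_bound bT.
have [y Ay xy] := h (e / M) (divr_gt0 e0 M0); exists (T y) => //.
by rewrite -bopB// (le_trans (hM _))// mulrC -ler_pdivlMr.
Qed.

Lemma bop_ext_on T S (Y : set H) : bounded_op T -> bounded_op S ->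
  hspan Y = setT -> (forall y, Y y -> T y = S y) -> T = S.
Proof.
move=> bT bS Y1 TS; apply/funext => x.
have : hspan Y x by rewrite Y1.
apply: (@hspan_min _ _ [set x | T x = S x]) => //.
  by split=> [|a y z]; rewrite /= ?bop0// !bop_lin// => -> ->.
move=> y h; apply/eqP; rewrite -subr_eq0; apply/eqP/hnorm_le0 => e e0.
have bTS := bopP (-1) bS bT.
have [M M0 hM] := bop_bound bTS.
have [z zE yz] := h (e / M) (divr_gt0 e0 M0).
have E u : T u - S u = (-1 *: S + T : H -> K) u.
  by rewrite -[RHS]/(-1 *: S u + T u) scaleN1r addrC.
have -> : T y - S y = (-1 *: S + T : H -> K) (y - z).
  by rewrite (bopB bTS) -!E zE subrr subr0.
by rewrite (le_trans (hM _))// mulrC -ler_pdivlMr.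
Qed.

Lemma op_close_sym T S e : op_close T S e -> op_close S T e.
Proof. by move=> h x; rewrite hdistC. Qed.
Lemma op_close_trans S T U e f : op_close T S e -> op_close S U f -> op_close T U (e + f).
Proof. by move=> h k x; rewrite (le_trans (hdistD (S x) _ _))// mulrDl lerD. Qed.
Lemma op_close_refl T e : 0 <= e -> op_close T T e.
Proof. by move=> e0 x; rewrite subrr hnorm0 mulr_ge0 ?hnorm_ge0. Qed.

(** Norm-closed subspaces in the form that [opspan_min] consumes: limits are tested only at bounded
    operators because [opspan] admits no others. Most inclusions between operator spaces below are
    proved by exhibiting such a set. *)
Definition opclosed (A : set (H -> K)) : Prop :=
  [/\ A 0, forall a S T, A S -> A T -> A (a *: S + T : H -> K) &
   forall T, bounded_op T ->
     (forall e : R, 0 < e -> exists2 S, A S & op_close T S e) -> A T].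

Lemma opspan_bounded (Y : set (H -> K)) : opspan Y `<=` (@bounded_op R H K).
Proof. by move=> T []. Qed.

Lemma opspan_sub (Y : set (H -> K)) T : bounded_op T -> Y T -> opspan Y T.
Proof.
move=> bT YT; split=> // e e0; exists T; first exact: lspan_sub.
by apply: op_close_refl; exact: ltW.
Qed.

Lemma op_closeP a T T' S S' (e d : R) : 0 < e -> 0 < d ->
  (forall r : R, 0 <= r <= d -> `|a| * r%:C <= (e / 2)%:C) ->
  op_close T T' d -> op_close S S' (e / 2) ->
  op_close (a *: T + S : H -> K) (a *: T' + S') e.
Proof.
move=> e0 d0 hd TT SS x.
rewrite -[(_ + _ : H -> K) x]/(a *: T x + S x).
rewrite -[X in _ - X]/(a *: T' x + S' x) opprD addrACA -scalerBr.
rewrite (le_trans (hnormD _ _))// [e]splitr mulrDl lerD//.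
rewrite -lecR hnormZ; have := TT x.
rewrite -lecR => /(ler_wpM2l (normr_ge0 a))/le_trans; apply.
by rewrite rmorphM mulrA rmorphM ler_wpM2r ?lecR ?hnorm_ge0// hd// lexx ltW.
Qed.

Lemma opspan_opclosed (Y : set (H -> K)) : opclosed (opspan Y).
Proof.
split=> [|a S T [bS hS] [bT hT]|T bT h].
- split; first exact: bop_0.
  by move=> e e0; exists 0; [exact: lspan0|exact/op_close_refl/ltW].
- split; first exact: bopP.
  move=> e e0; have e20 : 0 < e / 2 by rewrite divr_gt0.
  have [d d0 hd] := scale_small a e20.
  have [S' YS SS] := hS _ d0; have [T' YT TT] := hT _ e20.
  by exists (a *: S' + T'); [exact: lspanP|exact: op_closeP hd _ _].
- split=> // e e0; have e20 : 0 < e / 2 by rewrite divr_gt0.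
  have [S [bS hS] TS] := h _ e20; have [S' YS SS'] := hS _ e20.
  by exists S' => //; rewrite [e]splitr; exact: op_close_trans TS SS'.
Qed.

Lemma opspan_min (Y A : set (H -> K)) : opclosed A -> Y `<=` A -> opspan Y `<=` A.
Proof.
move=> [A0 AD Acl] YA T [bT h]; apply: Acl => // e /h[S YS TS]; exists S => //.
exact: (lspan_min (V := H -> K : lmodType C)) YS.
Qed.

End Bounded.

Lemma bop_comp H K L (T : K -> L) (S : H -> K) :
  bounded_op T -> bounded_op S -> bounded_op (T \o S).
Proof.
move=> bT bS; split=> [a x y|]; first by rewrite /= !bop_lin//.
have [M M0 hM] := bop_bound bT; have [N N0 hN] := bop_bound bS.
exists (M * N) => x; rewrite -mulrA; exact: le_trans (hM _) (ler_wpM2l (ltW M0) (hN _)).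
Qed.

Lemma bop_id H : bounded_op (@id H).
Proof. by split=> //; exists 1 => x; rewrite mul1r. Qed.

(** Turns a property of composites into an induction predicate for [opspan_min]. Boundedness of [S]
    is recorded in the set because it does not follow from a property of [T \o S]. *)
Lemma opcomp_closedl H K L (A : set (H -> L)) (T : K -> L) : bounded_op T ->
  opclosed A -> opclosed [set S : H -> K | bounded_op S /\ A (T \o S)].
Proof.
move=> bT [A0 AD Acl]; split=> [|a S S' [bS AS] [bS' AS']|S bS h].
- split; first exact: bop_0.
  by rewrite (_ : T \o 0 = 0)//; apply/funext => x; rewrite /= bop0.
- split; first exact: bopP.
  rewrite (_ : T \o _ = a *: (T \o S) + (T \o S')); first exact: AD.
  by apply/funext => x; exact: bop_lin.
- split=> //; apply: Acl; first exact: bop_comp.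
  move=> e e0; have [M M0 hM] := bop_bound bT.
  have [S' [bS' AS'] SS'] := h (e / M) (divr_gt0 e0 M0); exists (T \o S') => // x.
  rewrite /= -bopB// (le_trans (hM _))// mulrC -ler_pdivlMr// mulrAC.
  by rewrite (le_trans (SS' x)).
Qed.

Lemma opcomp_closedr H K L (A : set (H -> L)) (S : H -> K) : bounded_op S ->
  opclosed A -> opclosed [set T : K -> L | bounded_op T /\ A (T \o S)].
Proof.
move=> bS [A0 AD Acl]; split=> [|a T T' [bT AT] [bT' AT']|T bT h].
- by split; first exact: bop_0.
- split; first exact: bopP.
  exact: (AD a (T \o S) (T' \o S)).
- split=> //; apply: Acl; first exact: bop_comp.
  move=> e e0; have [M M0 hM] := bop_bound bS.
  have [T' [bT' AT'] TT'] := h (e / M) (divr_gt0 e0 M0); exists (T' \o S) => // x.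
  rewrite /= (le_trans (TT' _))// -mulrA ler_wpM2l ?(ltW e0)//.
  by rewrite ler_pdivrMl.
Qed.

(** The left factor is approximated while the right one is held fixed, and then the right factor
    with a generator standing on the left; separate continuity of composition is enough. *)
Lemma opmul_min H K L (X X0 : set (K -> L)) (Y Y0 : set (H -> K)) (A : set (H -> L)) :
  X `<=` opspan X0 -> Y `<=` opspan Y0 -> (forall T, X0 T -> bounded_op T) ->
  (forall S, Y0 S -> bounded_op S) ->
  opclosed A -> opmul X0 Y0 `<=` A -> opmul X Y `<=` A.
Proof.
move=> XX YY bX bY Acl h _ [T XT [S YS <-]].
have bS := opspan_bounded (YY _ YS).
apply: (opspan_min (opcomp_closedr bS Acl) _ (XX _ XT)).2 => T0 XT0.
split; first exact: bX.
apply: (opspan_min (opcomp_closedl (bX _ XT0) Acl) _ (YY _ YS)).2 => S0 YS0.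
by split; [exact: bY|apply: h; exists T0 => //; exists S0].
Qed.

Section Complete.
Variables (H K : ipSpace R).
Hypotheses (hH : hilbert H) (hK : hilbert K).

(* [P e y]: [y] approximates the sought vector up to [e]. *)
Lemma hlim (P : R -> K -> Prop) :
  (forall e : R, 0 < e -> exists y, P e y) ->
  (forall e d y z, P e y -> P d z -> hnorm (y - z) <= e + d) ->
  exists y, forall e z, P e z -> hnorm (y - z) <= e.
Proof.
move=> ex close.
have /choice[u uP] : forall n : nat, exists y, P n.+1%:R^-1 y.
  by move=> n; exact/ex.
have small (e : R) : 0 < e -> exists N : nat, forall n, (N <= n)%N -> n.+1%:R^-1 < e.
  move=> e0; have : n.+1%:R^-1 @[n --> \oo] --> (0 : R) by exact: cvg_harmonic.
  move=> /cvgrPdist_lt /(_ _ e0)[N _ hN]; exists N => n /hN.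
  by rewrite sub0r normrN ger0_norm.
have [e e0|y yu] := hK (u := u).
  have [N hN] := small _ (divr_gt0 e0 (@ltr0n R 2)); exists N => m n /hN mN /hN nN.
  by rewrite (le_lt_trans (close _ _ _ _ (uP m) (uP n)))// [e]splitr ltrD.
exists y => e z Pz; apply: le_eps => d d0.
have d20 : 0 < d / 2 by rewrite divr_gt0.
have [N1 hN1] := small _ d20.
have /cvgrPdist_lt/(_ _ d20)[N2 _ hN2] := yu.
have := hN2 (maxn N1 N2) (leq_maxr _ _); rewrite sub0r normrN ger0_norm ?hnorm_ge0//.
have /ltW := hN1 (maxn N1 N2) (leq_maxl _ _).
set n := maxn _ _; move: (n.+1%:R^-1) (uP n) => r uPn n1 /ltW n2.
have := close _ _ _ _ uPn Pz.
have := hdistD (u n) y z; rewrite (hdistC y (u n)); lra.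
Qed.

(** [G] is the graph of a densely defined operator. It is a relation so that no map on linear
    combinations has to be shown well defined beforehand: applied to differences, the bound makes
    [G] single valued. *)
Lemma extension (G : H -> K -> Prop) (M : R) : 0 <= M ->
  G 0 0 -> (forall a x y x' y', G x y -> G x' y' -> G (a *: x + x') (a *: y + y')) ->
  (forall x y, G x y -> hnorm y <= M * hnorm x) ->
  (forall h (e : R), 0 < e -> exists x y, G x y /\ hnorm (h - x) <= e) ->
  exists F : H -> K, bounded_op F /\ forall x y, G x y -> F x = y.
Proof.
move=> M0 G0 GD Gle Gd.
have GB x y x' y' : G x y -> G x' y' -> G (x' - x) (y' - y).
  by move=> g g'; rewrite addrC -scaleN1r [y' - y]addrC -[- y]scaleN1r; exact: GD.
(* The value at [h] is the limit of [z] over pairs [(x, z)] of the graph with [x] near [h]; the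
   admissible error of such a [z] is [M * hnorm (h - x)]. *)
have /choice[F FP] : forall h, exists y, forall e z,
    (exists x, G x z /\ M * hnorm (h - x) <= e) -> hnorm (y - z) <= e.
  move=> h; apply: hlim => [e e0|e d y z [x [g xe]] [x' [g' xd]]].
    have M1 : 0 < M + 1 by rewrite ltr_wpDl.
    have [x [y [g xe]]] := Gd h (e / (M + 1)) (divr_gt0 e0 M1).
    exists y, x; split=> //; rewrite (le_trans (ler_wpM2l M0 xe))// mulrCA.
    by rewrite ler_piMr ?(ltW e0)// ler_pdivrMr// mul1r lerDl.
  rewrite (le_trans (Gle _ _ (GB _ _ _ _ g' g)))//.
  rewrite (le_trans (ler_wpM2l M0 (hdistD h _ _)))// mulrDr lerD// hdistC//.
have FG x y : G x y -> F x = y.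
  move=> g; apply/eqP; rewrite -subr_eq0 -hnorm_eq0 eq_le hnorm_ge0 andbT.
  by apply: FP; exists x; rewrite subrr hnorm0 mulr0.
have Fap h (e : R) : 0 < e -> exists x y,
    [/\ G x y, hnorm (h - x) <= e & hnorm (F h - y) <= M * e].
  move=> e0; have [x [y [g xe]]] := Gd h _ e0; exists x, y; split=> //.
  by apply: FP; exists x; rewrite ler_wpM2l.
exists F; split=> //; split.
  move=> a h h'; apply/eqP; rewrite -subr_eq0; apply/eqP/hnorm_le0 => e e0.
  (* Since [t <= e1], the errors in [le3] and [le4] add up to at most [e1 * (3 * M + 1)], which is
     below [e]. *)
  have M1 : 0 < 3 * M + 2 by rewrite ltr_wpDl ?mulr_ge0.
  pose e1 := e / (3 * M + 2); have e10 : 0 < e1 by rewrite divr_gt0.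
  have [d d0 hd] := scale_small a e10.
  have M2 : 0 < M + 1 by rewrite ltr_wpDl.
  pose t := Num.min d e1 / (M + 1).
  have t0 : 0 < t by rewrite divr_gt0// lt_min d0.
  have tM : t * (M + 1) <= Num.min d e1 by rewrite divfK// gt_eqF.
  have [td te] : t * (M + 1) <= d /\ t * (M + 1) <= e1.
    by split; rewrite (le_trans tM)// ge_min lexx ?orbT.
  have [x [y [g xh yF]]] := Fap h _ t0; have [x' [y' [g' xh' yF']]] := Fap h' _ t0.
  have gg := GD a _ _ _ _ g g'.
  have le1 : hnorm (a *: (h - x)) <= e1.
    rewrite -lecR hnormZ; apply: hd; rewrite hnorm_ge0 (le_trans xh)// (le_trans _ td)//.
    by rewrite ler_peMr ?(ltW t0)// lerDr.
  have le2 : hnorm (a *: (F h - y)) <= e1.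
    rewrite -lecR hnormZ; apply: hd; rewrite hnorm_ge0 (le_trans yF)// (le_trans _ td)//.
    by rewrite mulrC ler_wpM2l ?(ltW t0)// lerDl.
  have le3 : hnorm (F (a *: h + h') - (a *: y + y')) <= M * (e1 + t).
    apply: FP; exists (a *: x + x'); split=> //; rewrite ler_wpM2l// opprD addrACA -scalerBr.
    by rewrite (le_trans (hnormD _ _))// lerD.
  have le4 : hnorm ((a *: y + y') - (a *: F h + F h')) <= e1 + M * t.
    by rewrite hdistC opprD addrACA -scalerBr (le_trans (hnormD _ _))// lerD.
  have := hdistD (a *: y + y') (F (a *: h + h')) (a *: F h + F h').
  have : e1 * (3 * M + 2) = e by rewrite divfK// gt_eqF.
  move: le3 le4 te; move: (ltW t0); clear -M0 e10; nra.
exists M => h; apply: le_eps => e e0.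
have M1 : 0 < 2 * M + 1 by rewrite ltr_wpDl ?mulr_ge0.
have [x [y [g xe yF]]] := Fap h _ (divr_gt0 e0 M1).
have := Gle _ _ g; have := hdistD y (F h) 0; rewrite !subr0.
have : hnorm x <= hnorm h + e / (2 * M + 1).
  by have := hdistD h x 0; rewrite !subr0 (hdistC x h); lra.
have : e / (2 * M + 1) * (2 * M + 1) = e by rewrite divfK// gt_eqF.
move: (e / (2 * M + 1)) xe yF => r xe yF re xh Fy yx.
have := ler_wpM2l M0 xh; rewrite mulrDr; have := hnorm_ge0 (h - x). nra.
Qed.

End Complete.

Section Riesz.
Variable H : ipSpace R.
Hypothesis hH : hilbert H.

Lemma parallelogram (x y z : H) :
  hnorm (y - z) ^+ 2 + 4 * hnorm (x - 2^-1 *: (y + z)) ^+ 2 =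
  2 * hnorm (x - y) ^+ 2 + 2 * hnorm (x - z) ^+ 2.
Proof.
pose u := x - y; pose v := x - z.
have -> : y - z = v - u by rewrite /u /v opprB [RHS]addrC subrKA.
have -> : x - 2^-1 *: (y + z) = (2^-1 : R)%:C *: (u + v).
  rewrite /u /v addrACA -opprD scalerBr; congr (_ - _); last first.
    by rewrite rmorphV ?unitfE ?pnatr_eq0//= rmorph_nat.
  rewrite -[x in x + _]scale1r -[x in _ + x]scale1r -scalerDl scalerA.
  by rewrite -[1 + 1](rmorph_nat (real_complex R) 2) -rmorphM /= mulVf ?pnatr_eq0// scale1r.
have n2 (w : H) : hnorm ((2^-1 : R)%:C *: w) ^+ 2 = hnorm w ^+ 2 / 4.
  by rewrite !hnorm_sqr ipZl ipZr; case: (ip w w) => a b /=; field.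
rewrite n2 -/u -/v; clearbody u v; rewrite !hnormD_sqr hnormN ipNr (ipC u v).
by case: (ip v u) => a b /=; field.
Qed.

(** Near-minimizers of the distance are Cauchy by the parallelogram law. Allowing an excess of
    [e ^+ 2 / 2] over the infimum [D] gives a squared distance of at most [e ^+ 2 + d ^+ 2] between
    two of them, hence a distance of at most [e + d], as [hlim] requires. *)
Lemma projection (A : set H) : subsp A -> hclosed A ->
  forall x, exists2 y, A y & forall a, A a -> ip a (x - y) = 0.
Proof.
move=> [A0 AD] Acl x.
pose E := [set r | exists2 a, A a & r = hnorm (x - a) ^+ 2].
have E0 : E !=set0 by exists (hnorm (x - 0) ^+ 2), 0.
have lbE : has_lbound E by exists 0 => _ [a _ ->]; exact: sqr_ge0.
pose D := inf E.
have D0 : 0 <= D by apply: lb_le_inf => // _ [a _ ->]; exact: sqr_ge0.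
have DE a : A a -> D <= hnorm (x - a) ^+ 2 by move=> Aa; apply: ge_inf => //; exists a.
have AZ c a : A a -> A (c *: a) by move=> Aa; rewrite -[_ *: _]addr0; exact: AD.
have [e e0|e d y z [e0 [Ay ye]] [d0 [Az zd]]|y yP] :=
  hlim hH (P := fun e y => 0 <= e /\ A y /\ hnorm (x - y) ^+ 2 <= D + e ^+ 2 / 2).
- have e2 : 0 < e ^+ 2 / 2 by rewrite divr_gt0// exprn_gt0.
  have [_ [a Aa ->] /ltW aD] := inf_adherent e2 (conj E0 lbE).
  by exists a; rewrite ltW.
- rewrite -ler_sqr ?nnegrE ?addr_ge0 ?hnorm_ge0//.
  have := DE _ (AZ 2^-1 _ (AD 1 _ _ Ay Az)); rewrite scale1r.
  by have := parallelogram x y z; nra.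
have [s s0 sD] : exists2 s : R, 0 <= s & s ^+ 2 = D by exists (Num.sqrt D); rewrite ?sqr_sqrtr.
have ap (e : R) : 0 < e -> exists2 z, A z & hnorm (y - z) <= e /\ hnorm (x - z) <= s + e.
  move=> e0; have e2 : 0 < e ^+ 2 / 2 by rewrite divr_gt0// exprn_gt0.
  have [_ [a Aa ->] /ltW aD] := inf_adherent e2 (conj E0 lbE).
  exists a => //; split; first by apply: yP; rewrite (ltW e0).
  rewrite -ler_sqr ?nnegrE ?hnorm_ge0// ?addr_ge0 ?(ltW e0)//.
  by rewrite (le_trans aD)// -/D -sD; move: (mulr_ge0 s0 (ltW e0)) (sqr_ge0 e); nra.
exists y; first by apply: Acl => e /ap[z Az []]; exists z.
have yD : hnorm (x - y) ^+ 2 <= D.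
  rewrite -sD ler_sqr ?nnegrE ?hnorm_ge0//; apply: le_eps => e e0.
  have [z _ [yz xz]] := ap (e / 2) (divr_gt0 e0 (@ltr0n R 2)).
  by have := hdistD z x y; rewrite (hdistC z y); lra.
have Ay : A y by apply: Acl => e /ap[z Az []]; exists z.
move=> a Aa; set w := x - y; set z := ip a w.
(* Minimality is tested at [y + (t z) a]. With r the squared modulus of [z] it gives 0 <= t^2 r N -
   2 t r, and t N < 1 then forces r = 0. The summand 1 in the denominator covers [a = 0]. *)
pose N := hnorm a ^+ 2; pose t := (N + 1)^-1.
have N0 : 0 <= N by exact: sqr_ge0.
have t0 : 0 < t by rewrite invr_gt0 ltr_wpDl.
have tN : t * (N + 1) = 1 by rewrite mulVf// gt_eqF// ltr_wpDl.
have := DE _ (AD (t%:C * z) _ _ Aa Ay).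
rewrite opprD addrCA -/w addrC hnormD_sqr hnormN ipNr ipZr.
have -> : hnorm ((t%:C * z) *: a) ^+ 2 = t ^+ 2 * (complex.Re z ^+ 2 + complex.Im z ^+ 2) * N.
  rewrite /N !hnorm_sqr ipZl ipZr -hnorm2; case: z => p q /=; ring.
have -> : ip w a = conjc z by exact: ipC.
have -> : complex.Re (- (t%:C * z * conjc z)) = - (t * (complex.Re z ^+ 2 + complex.Im z ^+ 2)).
  by case: (z) => p q /=; ring.
have := sqr_ge0 (complex.Re z); have := sqr_ge0 (complex.Im z).
case: (z) => p q /=; set r := p ^+ 2 + q ^+ 2 => q0 p0 h.
have rp : 0 <= r by rewrite /r addr_ge0.
have r0 : r = 0.
  have : t * r <= 0.
    have : 0 <= t * r by rewrite mulr_ge0// ltW.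
    move: yD h; rewrite -/w; have : t ^+ 2 * r * N = (t * (N + 1)) * (t * r) - t * (t * r) by ring.
    rewrite tN mul1r => ->; have := ltW t0; nra.
  by move=> tr; apply/eqP; rewrite eq_le rp andbT -(pmulr_rle0 _ t0).
move/eqP: r0; rewrite paddr_eq0 ?sqr_ge0// !sqrf_eq0 => /andP[/eqP-> /eqP->].
by [].
Qed.

Lemma hspan_orth (Y : set H) : (forall x, (forall y, Y y -> ip y x = 0) -> x = 0) ->
  hspan Y = setT.
Proof.
move=> h; apply/seteqP; split=> // x _.
have [y Yy o] := projection (hspan_subsp Y) (hspan_closed (Y := Y)) x.
suff -> : x = y by [].
by apply/eqP; rewrite -subr_eq0; apply/eqP/h => a Ya; exact/o/hspan_sub.
Qed.

Lemma riesz (phi : H -> C) (M : R) : (forall a x y, phi (a *: x + y) = a * phi x + phi y) ->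
  (forall x, `|phi x| <= (M * hnorm x)%:C) -> exists v, forall x, phi x = ip v x.
Proof.
move=> lin bd.
have p0 : phi 0 = 0 by apply: (addrI (phi 0)); rewrite -[X in X + _]mul1r -lin scaler0 !addr0.
have pB x y : phi (x - y) = phi x - phi y.
  by rewrite addrC -scaleN1r lin mulN1r addrC.
pose A : set H := [set x | phi x = 0].
have sA : subsp A by split=> // a x y; rewrite /A /= lin => -> ->; rewrite mulr0 addr0.
have cA : hclosed A.
  move=> x h; apply/eqP; rewrite /A /= -normr_le0.
  have : complex.Re `|phi x| <= 0.
    apply: le_eps => e e0; rewrite add0r.
    have M1 : 0 < `|M| + 1 by rewrite ltr_wpDl.
    have [y Ay xy] := h _ (divr_gt0 e0 M1).
    rewrite -lecR RRe_real ?normr_real//.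
    have -> : phi x = phi (x - y) by rewrite pB Ay subr0.
    rewrite (le_trans (bd _))// lecR (@le_trans _ _ ((`|M| + 1) * hnorm (x - y)))//.
      by rewrite ler_wpM2r ?hnorm_ge0// (le_trans (ler_norm _))// lerDl.
    by rewrite mulrC -ler_pdivlMr.
  by rewrite -lecR RRe_real ?normr_real.
have [allA|/existsNP[x /eqP px]] := pselect (forall x, A x).
  by exists 0 => x; rewrite ip0l; exact: allA.
have [y Ay o] := projection sA cA x.
pose w := x - y.
have pw : phi w != 0 by rewrite pB Ay subr0.
have w0 : ip w w != 0.
  by rewrite ip_eq0; apply: contra pw => /eqP->; rewrite p0.
exists ((conjc (phi w) / ip w w) *: w) => z.
have : ip w (z - (phi z / phi w) *: w) = 0.
  rewrite ipC o ?rmorph0// /A /= -[LHS]/(phi _) pB.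
  by rewrite -[_ *: w]addr0 lin p0 addr0 divfK// subrr.
move/eqP; rewrite ipBr ipZr subr_eq0 => /eqP e.
rewrite ipZl rmorphM fmorphV /= conjcK -ipC e.
by field; rewrite pw w0.
Qed.

Lemma adjoint_exists K (T : H -> K) : bounded_op T ->
  exists S : K -> H, forall x y, ip (T x) y = ip x (S y).
Proof.
move=> bT; have [M M0 hM] := bop_bound bT.
have /choice[S SP] : forall y, exists v, forall x, ip y (T x) = ip v x.
  move=> y; apply: (@riesz (fun x => ip y (T x)) (hnorm y * M)) => [a u v|u].
    by rewrite bop_lin// ipDZr.
  by rewrite (le_trans (ip_CS _ _))// lecR -mulrA ler_wpM2l ?hnorm_ge0.
by exists S => x y; rewrite ipC SP -ipC.
Qed.

Lemma adjE K (T : H -> K) : bounded_op T -> forall x y, ip (T x) y = ip x (adj T y).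
Proof. by move=> bT; rewrite /adj; case: xgetP => // /(_ _) h; have [S /h] := adjoint_exists bT. Qed.

Lemma adj_uniq K (T : H -> K) (S : K -> H) : bounded_op T ->
  (forall x y, ip (T x) y = ip x (S y)) -> adj T = S.
Proof.
by move=> bT h; apply/funext => y; apply: ipI => z; rewrite -adjE.
Qed.

Lemma adj_bop K (T : H -> K) : bounded_op T -> bounded_op (adj T).
Proof.
move=> bT; split.
  by move=> a x y; apply: ipI => z; rewrite -adjE// ipDZr !adjE// ipDZr.
have [M M0 hM] := bop_bound bT; exists M => y.
have [->|n0] := eqVneq (hnorm (adj T y)) 0; first by rewrite mulr_ge0 ?hnorm_ge0// ltW.
have n1 : 0 < hnorm (adj T y) by rewrite lt_def n0 hnorm_ge0.
rewrite -(ler_pM2l n1) -expr2 hnorm_sqr -adjE// (le_trans (Re_ip_le _ _))//.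
by rewrite mulrA [hnorm _ * M]mulrC ler_wpM2r ?hnorm_ge0.
Qed.

End Riesz.

End Hilbert.

Local Notation tril X := (@tril _ _ _ _ _ _ X).
Local Notation trir X := (@trir _ _ _ _ _ _ X).

(** * Modules over a commutative base, kets, transport and associativity *)

Section Rtp.
Variable R : realType.
Local Notation C := R[i].
Implicit Types H K L : ipSpace R.

Lemma ip_ext H (Y : set H) u v : hspan Y = setT ->
  (forall y, Y y -> ip y u = ip y v) -> u = v.
Proof.
move=> Y1 h; apply: ipI => x; have : hspan Y x by rewrite Y1.
apply: (@hspan_min _ _ _ [set x | ip x u = ip x v]) => //.
  by split=> [|a y z /= yu zu]; rewrite /= ?ip0l// !ipDZl yu zu.
move=> y hy; apply/eqP; rewrite -subr_eq0 -ipBr -normr_le0.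
have : complex.Re `|ip y (u - v)| <= 0; last first.
  by rewrite -lecR RRe_real ?normr_real.
apply: le_eps => e e0; rewrite add0r.
have N1 : 0 < hnorm (u - v) + 1 by rewrite ltr_wpDl ?hnorm_ge0.
have [z zE yz] := hy _ (divr_gt0 e0 N1).
rewrite -lecR RRe_real ?normr_real//.
have -> : ip y (u - v) = ip (y - z) (u - v) by rewrite ipBl [ip z _]ipBr zE subrr subr0.
rewrite (le_trans (ip_CS _ _))// lecR.
rewrite (@le_trans _ _ (hnorm (y - z) * (hnorm (u - v) + 1)))//.
  by rewrite ler_wpM2l ?hnorm_ge0// lerDl.
by rewrite -ler_pdivlMr.
Qed.

Lemma ip_adj H K (T : H -> K) x y : hilbert H -> bounded_op T -> ip (adj T y) x = ip y (T x).
Proof. by move=> hH bT; rewrite ipC -adjE// -ipC. Qed.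

Lemma adj_comp H K L (T : K -> L) (S : H -> K) : hilbert H -> hilbert K ->
  bounded_op T -> bounded_op S -> adj (T \o S) = adj S \o adj T.
Proof.
by move=> hH hK bT bS; apply: adj_uniq => // [|x y]; rewrite /= ?adjE//; exact: bop_comp.
Qed.

Lemma adjK H K (T : H -> K) : hilbert H -> hilbert K -> bounded_op T -> adj (adj T) = T.
Proof.
move=> hH hK bT; apply: adj_uniq => // [|x y]; first exact: adj_bop.
by rewrite ip_adj.
Qed.

(** A combination of the [w i] has squared norm [ip x (P x)] for the same combination [x] of the
    [v i], so the assignment is bounded; [M + 1] serves as bound because [M <= (M + 1) ^+ 2]. Kets
    and associativity maps are obtained in this way. *)
Lemma extension_ip H K (I : Type) (v : I -> H) (w : I -> K) (P : H -> H) :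
  hilbert K -> bounded_op P -> hspan (range v) = setT ->
  (forall i j, ip (w i) (w j) = ip (v i) (P (v j))) ->
  exists F : H -> K, bounded_op F /\ forall i, F (v i) = w i.
Proof.
move=> hK bP tot vw; have [M M0 hM] := bop_bound bP.
pose G x y := lspan (range (fun i => (v i, w i) : (H * K : lmodType C)%type)) (x, y).
have GP x y x' y' : G x y -> G x' y' -> ip y y' = ip x (P x').
  move=> gx gx'.
  apply: (@lspan_min _ _ _ [set p : H * K | ip p.2 y' = ip p.1 (P x')]) gx => /=.
  - by rewrite !ip0l.
  - by move=> a [x1 y1] [x2 y2] /= h1 h2; rewrite !ipDZl h1 h2.
  move=> _ [i _ <-] /=.
  apply: (@lspan_min _ _ _ [set p : H * K | ip (w i) p.2 = ip (v i) (P p.1)]) gx' => /=.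
  - by rewrite bop0// !ip0r.
  - by move=> a [x1 y1] [x2 y2] /= h1 h2; rewrite bop_lin// !ipDZr h1 h2.
  by move=> _ [j _ <-] /=.
have [|||||F [bF FG]] := extension hK (G := G) (M := M + 1).
- by rewrite addr_ge0// ltW.
- exact: lspan0.
- by move=> a x y x' y' g g'; apply: (lspanP a g g').
- move=> x y g; rewrite -ler_sqr ?nnegrE ?hnorm_ge0 ?mulr_ge0 ?hnorm_ge0 ?addr_ge0// ?(ltW M0)//.
  rewrite hnorm_sqr (GP _ _ _ _ g g) (le_trans (Re_ip_le _ _))//.
  have := hM x; have := hnorm_ge0 x; nra.
- move=> h e e0; have : hspan (range v) h by rewrite tot.
  move=> /(_ _ e0)[x vx hx].
  suff [y gxy] : exists y, G x y by exists x, y.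
  apply: (@lspan_min _ _ _ [set x | exists y, G x y]) vx => /=.
  + by exists 0; exact: lspan0.
  + move=> a x1 x2 [y1 g1] [y2 g2]; exists (a *: y1 + y2).
    exact: (lspanP a g1 g2).
  + by move=> _ [i _ <-]; exists (w i); apply: lspan_sub; exists i.
by exists F; split=> // i; apply: FG; apply: lspan_sub; exists i.
Qed.

Variables (K0 : ipSpace R) (hK0 : hilbert K0) (B : set (K0 -> K0)).
Hypothesis clB : opspan B = B.
Hypothesis adjB : forall b, B b -> B (adj b).
Hypothesis comB : forall b c, B b -> B c -> b \o c = c \o b.

Definition rho H (a : set (K0 -> H)) (b : K0 -> K0) : H -> H :=
  xget (fun=> 0) [set r : H -> H | bounded_op r /\ forall xi, a xi -> r \o xi = xi \o b].

(** The working notion of module over a base whose two algebras are one and the same commutative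
    [B]: inner products lie in [B], and [B] is also represented on [H]. Modules over the base and
    over its opposite need not be told apart, which permits flips. *)
Record amod H (a : set (K0 -> H)) : Prop := Amod {
  am_hil : hilbert H;
  am_bop : forall xi, a xi -> bounded_op xi;
  am_tot : hspan (opapp a) = setT;
  am_ip : forall xi xi', a xi -> a xi' -> B (adj xi \o xi');
  am_rho : forall b, B b -> exists r : H -> H,
    bounded_op r /\ forall xi, a xi -> r \o xi = xi \o b }.

Let Bbop b : B b -> bounded_op b.
Proof. by rewrite -clB => /opspan_bounded. Qed.

Lemma amod_ext H L (a : set (K0 -> H)) (T S : H -> L) : amod a ->
  bounded_op T -> bounded_op S -> (forall xi, a xi -> T \o xi = S \o xi) -> T = S.
Proof.
move=> aa bT bS h; apply: (bop_ext_on bT bS (am_tot aa)) => _ [xi axi [z _ <-]].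
exact: (congr1 (@^~ z) (h _ axi)).
Qed.

Lemma rhoP H (a : set (K0 -> H)) b : amod a -> B b ->
  bounded_op (rho a b) /\ forall xi, a xi -> rho a b \o xi = xi \o b.
Proof.
by move=> aa Bb; rewrite /rho; case: xgetP => [r _ []//|/(_ _) h]; have [r /h] := am_rho aa Bb.
Qed.

Lemma rho_bop H (a : set (K0 -> H)) b : amod a -> B b -> bounded_op (rho a b).
Proof. by move=> aa /(rhoP aa)[]. Qed.

Lemma rhoE H (a : set (K0 -> H)) b xi : amod a -> B b -> a xi -> rho a b \o xi = xi \o b.
Proof. by move=> aa Bb; have [_] := rhoP aa Bb; apply. Qed.

Lemma rho_uniq H (a : set (K0 -> H)) b r : amod a -> B b -> bounded_op r ->
  (forall xi, a xi -> r \o xi = xi \o b) -> rho a b = r.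
Proof.
move=> aa Bb br rE; apply: (amod_ext aa) => //; first exact: rho_bop.
by move=> xi axi; rewrite rhoE// rE.
Qed.

Lemma flip_ax H K (be : set (K0 -> H)) (ga : set (K0 -> K)) (X : rtp be ga) :
  amod be -> amod ga -> is_rtp ga be (fun eta z xi => rtp_tens X xi z eta).
Proof.
move=> abe aga; have [hX ipX spX] := rtp_ax X; split=> //.
  move=> eta eta' z z' xi xi' gae gae' bxi bxi'; rewrite ipX//.
  have := comB (am_ip abe bxi bxi') (am_ip aga gae gae').
  by move=> /(congr1 (@^~ z')) /= ->.
rewrite -spX; congr hspan; apply/seteqP; split=> x.
  by move=> [eta [z [xi [? ? ->]]]]; exists xi, z, eta.
by move=> [xi [z [eta [? ? ->]]]]; exists eta, z, xi.
Qed.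

(** [ket1] of [X] is convertible with [ket2] of its flip, and likewise [trir] with [tril], so that
    only the [ket2] side has to be developed. *)
Definition flip H K (be : set (K0 -> H)) (ga : set (K0 -> K)) (X : rtp be ga)
  (abe : amod be) (aga : amod ga) : rtp ga be := Rtp (flip_ax X abe aga).

Section Kets.
Variables (H K : ipSpace R) (be : set (K0 -> H)) (ga : set (K0 -> K)) (X : rtp be ga).
Hypotheses (abe : amod be) (aga : amod ga).

Let hX : hilbert X. Proof. by have [] := rtp_ax X. Qed.

(** The defining inner product of the tensors xi z (x) eta and xi' z' (x) eta equals that of xi z
    with [rho be (adj eta \o eta)] applied to xi' z'; this is the Gram relation that [extension_ip]
    asks for. *)
Lemma ket2P eta : ga eta -> bounded_op (ket2 X eta) /\
  forall xi z, be xi -> ket2 X eta (xi z) = rtp_tens X xi z eta.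
Proof.
move=> ge; rewrite /ket2; case: xgetP => [F _ []//|/(_ _) no].
have [_ ipX _] := rtp_ax X.
pose I := {p : (K0 -> H) * K0 | `[< be p.1 >]}.
have [||||F [bF FE]] := @extension_ip H X I (fun p => (sval p).1 (sval p).2)
  (fun p => rtp_tens X (sval p).1 (sval p).2 eta) (rho be (adj eta \o eta)) => //.
- exact: rho_bop (am_ip aga ge ge).
- apply/seteqP; split=> // x _; have : hspan (opapp be) x by rewrite (am_tot abe).
  apply: hspan_min; [exact: hspan_subsp|exact: hspan_closed|].
  move=> _ [xi bxi [z _ <-]]; apply: hspan_sub.
  by exists (exist _ (xi, z) (asboolT bxi)).
- move=> [[xi z] /= /asboolP bxi] [[xi' z'] /= /asboolP bxi'].
  rewrite ipX// -[rho _ _ (xi' z')]/((rho _ _ \o xi') z') (rhoE abe (am_ip aga ge ge) bxi').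
  by rewrite adjE//; exact: am_bop bxi.
exfalso; apply: (no F); split=> // xi z bxi.
exact: (FE (exist _ (xi, z) (asboolT bxi))).
Qed.

Lemma ket2_bop eta : ga eta -> bounded_op (ket2 X eta).
Proof. by case/ket2P. Qed.

Lemma ket2E eta xi z : ga eta -> be xi -> ket2 X eta (xi z) = rtp_tens X xi z eta.
Proof. by case/ket2P => _; apply. Qed.

Lemma ket2_uniq eta (F : H -> X) : ga eta -> bounded_op F ->
  (forall xi z, be xi -> F (xi z) = rtp_tens X xi z eta) -> ket2 X eta = F.
Proof.
move=> ge bF FE; apply: (amod_ext abe (ket2_bop ge) bF) => xi bxi.
by apply/funext => z /=; rewrite ket2E// FE.
Qed.

Lemma ket2_adj eta eta' : ga eta -> ga eta' ->
  adj (ket2 X eta) \o ket2 X eta' = rho be (adj eta \o eta').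
Proof.
move=> ge ge'; have [_ ipX _] := rtp_ax X; have hH := am_hil abe.
have Bee := am_ip aga ge ge'.
apply: (amod_ext abe).
- by apply: bop_comp; [apply: adj_bop|]; rewrite //; exact: ket2_bop.
- exact: rho_bop.
move=> xi bxi; rewrite rhoE//; apply/funext => z /=.
apply: (ip_ext (am_tot abe)) => _ [xi' bxi' [z' _ <-]].
rewrite -adjE//; last exact: ket2_bop.
by rewrite !ket2E// ipX// adjE//; exact: am_bop bxi'.
Qed.

Lemma ket2_ip eta eta' h h' : ga eta -> ga eta' ->
  ip (ket2 X eta h) (ket2 X eta' h') = ip h (rho be (adj eta \o eta') h').
Proof.
move=> ge ge'; rewrite adjE//; [|exact: am_hil abe|exact: ket2_bop].
by rewrite -[adj _ _]/((adj (ket2 X eta) \o ket2 X eta') h') ket2_adj.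
Qed.

Lemma ket2_tot : hspan (opapp [set ket2 X eta | eta in ga]) = setT.
Proof.
apply/seteqP; split=> // x _; have [_ _] := rtp_ax X => /seteqP[_ /(_ x I)].
apply: hspan_min; [exact: hspan_subsp|exact: hspan_closed|].
move=> _ [xi [z [eta [bxi ge ->]]]]; apply: hspan_sub.
by exists (ket2 X eta); [exists eta|exists (xi z) => //; rewrite ket2E].
Qed.

Lemma ket2_ext L (T S : X -> L) : bounded_op T -> bounded_op S ->
  (forall eta, ga eta -> T \o ket2 X eta = S \o ket2 X eta) -> T = S.
Proof.
move=> bT bS h; apply: (bop_ext_on bT bS ket2_tot) => _ [_ [eta ge <-] [z _ <-]].
exact: (congr1 (@^~ z) (h _ ge)).
Qed.

Section Tril.
Variable de : set (K0 -> H).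
Hypothesis ade : amod de.
Hypothesis stab : forall b d, B b -> de d -> de (rho be b \o d).
Hypothesis rhoX : forall b, B b -> exists r : X -> X, bounded_op r /\
  forall eta, ga eta -> r \o ket2 X eta = ket2 X eta \o rho de b.

Let gen := opmul [set ket2 X eta | eta in ga] de.

Let gen_bop T : gen T -> bounded_op T.
Proof.
by move=> [_ [eta ge <-] [d dd <-]]; apply: bop_comp; [exact: ket2_bop|exact: am_bop dd].
Qed.

(** For two generators the inner product collapses by [ket2_adj] to one inside [de], because [stab]
    keeps [rho be b \o d] in [de]. Closedness of [B] then carries it to the span, one factor at a
    time. The representation on the span is the lift supplied by [rhoX]. *)
Lemma tril_amod : amod (tril X de).
Proof.
have Bcl : opclosed B by rewrite -clB; exact: opspan_opclosed.
have genip T S : gen T -> gen S -> B (adj T \o S).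
  move=> gT [_ [eta' ge' <-] [d' dd' <-]].
  move: gT => [_ [eta ge <-] [d dd <-]].
  have bd := am_bop ade dd.
  rewrite (adj_comp hK0 (am_hil ade) (ket2_bop ge) bd).
  rewrite -compA (compA (adj (ket2 X eta))) ket2_adj//; apply: (am_ip ade dd).
  exact: stab (am_ip aga ge ge') dd'.
have genip2 T S : gen T -> tril X de S -> B (adj T \o S).
  move=> gT; have bT := adj_bop hK0 (gen_bop gT).
  move/(opspan_min (opcomp_closedl bT Bcl)) => h; have [|//] := h _.
  by move=> S' gS'; split; [exact: gen_bop|exact: genip].
split=> //.
- by move=> T [].
- apply/seteqP; split=> // x _; have : hspan (opapp [set ket2 X eta | eta in ga]) x.
    by rewrite ket2_tot.
  apply: hspan_min; [exact: hspan_subsp|exact: hspan_closed|].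
  move=> _ [_ [eta ge <-] [h _ <-]].
  have : hspan (opapp de) h by rewrite (am_tot ade).
  have bk := ket2_bop ge.
  apply: (@hspan_min _ _ _ [set h | hspan (opapp (tril X de)) (ket2 X eta h)]).
  + have [h0 hD] := hspan_subsp (opapp (tril X de)).
    by split=> [|a y z] /=; rewrite ?bop0// bop_lin//; exact: hD.
  + exact: bop_isub_hclosed bk (hspan_closed (Y := _)).
  move=> _ [d dd [z _ <-]]; apply: hspan_sub; exists (ket2 X eta \o d); last by exists z.
  have gd : gen (ket2 X eta \o d) by exists (ket2 X eta); [exists eta|exists d].
  exact: opspan_sub (gen_bop gd) gd.
- move=> T S tT tS; have bS := opspan_bounded tS.
  have bT := opspan_bounded tT.
  (* Passing to the adjoint puts the factor still to be approximated on the right, where composition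
     with the fixed operator [adj S] is closed. *)
  suff : B (adj S \o T) by move/adjB; rewrite adj_comp ?adjK//; exact: adj_bop.
  have : [set T | bounded_op T /\ B (adj S \o T)] T; last by case.
  move: T tT {bT}; apply: opspan_min; first exact: opcomp_closedl (adj_bop hK0 bS) Bcl.
  move=> T gT; split; first exact: gen_bop.
  have := genip2 _ _ gT tS; move/adjB; rewrite adj_comp ?adjK//; first exact: gen_bop.
  exact/adj_bop/gen_bop.
- move=> b Bb; have [r [br rE]] := rhoX Bb; exists r; split=> //.
  have E T : gen T -> r \o T = T \o b.
    move=> [_ [eta ge <-] [d dd <-]].
    by rewrite -[LHS]/((r \o ket2 X eta) \o d) rE// -compA rhoE.
  move=> T [bT hT]; apply/funext => z; apply/eqP; rewrite -subr_eq0; apply/eqP.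
  have [Mr Mr0 hr] := bop_bound br; have [Mb Mb0 hb] := bop_bound (Bbop Bb).
  apply: hnorm_le0 => e e0.
  pose N := Mr * hnorm z + Mb * hnorm z + 1.
  have N0 : 0 < N by rewrite ltr_wpDl// addr_ge0// mulr_ge0 ?hnorm_ge0// ltW.
  have [S gS TS] := hT _ (divr_gt0 e0 N0).
  have SE : r (S z) = S (b z).
    suff : r \o S = S \o b by move/(congr1 (@^~ z)).
    move: S gS {TS}; apply: (@lspan_min _ (K0 -> X : lmodType C) gen
      [set S : K0 -> X | r \o S = S \o b]) => /=.
    - by apply/funext => y /=; rewrite bop0.
    - move=> a S S' /(congr1 (fun f y => f y)) SE /(congr1 (fun f y => f y)) SE'.
      apply/funext => y; rewrite /= -[(_ + _ : K0 -> X) y]/(a *: S y + S' y) bop_lin//.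
      rewrite -[(_ + _ : K0 -> X) (b y)]/(a *: S (b y) + S' (b y)).
      by have /(congr1 (@^~ y)) /= -> := SE; have /(congr1 (@^~ y)) /= -> := SE'.
    - exact: E.
  rewrite /= (le_trans (hdistD (r (S z)) _ _))//.
  have -> : e = e / N * (Mr * hnorm z) + e / N * (Mb * hnorm z) + e / N.
    by rewrite -!mulrDr -[X in _ + X]mulr1 -mulrDr divfK// gt_eqF.
  rewrite (@le_trans _ _ (e / N * (Mr * hnorm z) + e / N * (Mb * hnorm z)))//; last first.
    by rewrite lerDl ltW// divr_gt0.
  have eN : 0 <= e / N by rewrite ltW// divr_gt0.
  rewrite lerD//.
    rewrite -bopB// (le_trans (hr _))// [leRHS]mulrCA ler_wpM2l ?(ltW Mr0)//.
  rewrite SE hdistC (le_trans (TS _))// ler_wpM2l//.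
Qed.

End Tril.

Lemma tril_rho (de : set (K0 -> H)) b eta : amod de -> amod (tril X de) -> B b -> ga eta ->
  rho (tril X de) b \o ket2 X eta = ket2 X eta \o rho de b.
Proof.
move=> ade atr Bb ge; have bk := ket2_bop ge.
apply: (amod_ext ade); try by apply: bop_comp => //; exact: rho_bop.
move=> d dd.
rewrite -[RHS]/(ket2 X eta \o (rho de b \o d)) (rhoE ade Bb dd).
rewrite -[LHS]/(rho (tril X de) b \o (ket2 X eta \o d)).
have bd := am_bop ade dd.
have td : tril X de (ket2 X eta \o d).
  apply: opspan_sub; first exact: bop_comp.
  by exists (ket2 X eta); [exists eta|exists d].
by rewrite (rhoE atr Bb td).
Qed.

End Kets.

Definition uinv H K (V : H -> K) (y : K) : H := xget 0 [set x | V x = y].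

Section Unitary.
Variables (H K : ipSpace R) (V : H -> K).
Hypothesis uV : unitary V.

Lemma unitary_hnorm x : hnorm (V x) = hnorm x.
Proof. by have [_ ipV _] := uV; rewrite /hnorm ipV. Qed.

Lemma unitary_bop : bounded_op V.
Proof.
by have [lV _ _] := uV; split=> //; exists 1 => x; rewrite unitary_hnorm mul1r.
Qed.

Lemma unitary_inj : injective V.
Proof.
move=> x y e; apply/eqP; rewrite -subr_eq0 -hnorm_eq0 -unitary_hnorm.
by rewrite bopB ?e ?subrr ?hnorm0//; exact: unitary_bop.
Qed.

Lemma uinvK y : V (uinv V y) = y.
Proof. by rewrite /uinv; case: xgetP => // h; have [_ _ /(_ y)[x /h]] := uV. Qed.

Lemma Vuinv x : uinv V (V x) = x.
Proof. by apply: unitary_inj; rewrite uinvK. Qed.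

Lemma uinv_ip x y : ip (uinv V x) (uinv V y) = ip x y.
Proof. by have [_ ipV _] := uV; rewrite -ipV !uinvK. Qed.

Lemma uinv_bop : bounded_op (uinv V).
Proof.
split=> [a x y|].
  by apply: unitary_inj; rewrite (bop_lin unitary_bop) !uinvK.
by exists 1 => x; rewrite /hnorm uinv_ip mul1r.
Qed.

Lemma adj_unitary L (S T : L -> H) : hilbert L -> bounded_op S -> bounded_op T ->
  adj (V \o S) \o (V \o T) = adj S \o T.
Proof.
move=> hL bS bT; apply/funext => x; apply: ipI => y /=.
rewrite -adjE//; last exact: bop_comp unitary_bop bS.
by have [_ ipV _] := uV; rewrite /= ipV adjE.
Qed.

End Unitary.

Section Transport.
Variables (H H' L : ipSpace R) (a : set (K0 -> H)) (a' : set (K0 -> H')).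
Variables (ep : set (K0 -> L)) (V : H -> H') (XL : rtp a ep).
Hypotheses (uV : unitary V) (Va : [set V \o T | T in a] = a') (hH' : hilbert H').
Hypotheses (aa : amod a) (aep : amod ep).

Lemma transport_amod : amod a'.
Proof.
rewrite -Va; have bV := unitary_bop uV; split=> //.
- by move=> _ [T aT <-]; apply: bop_comp => //; exact: am_bop aT.
- apply/seteqP; split=> // x _.
  have : hspan (opapp a) (uinv V x) by rewrite (am_tot aa).
  rewrite -[x in _ -> _ x](uinvK uV).
  apply: (@hspan_min _ _ _ [set h | hspan _ (V h)]).
  + have [h0 hD] := hspan_subsp (opapp [set V \o T | T in a]).
    by split=> [|c y z] /=; rewrite ?bop0// bop_lin//; exact: hD.
  + exact: bop_isub_hclosed bV (hspan_closed (Y := _)).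
  move=> _ [T aT [z _ <-]]; apply: hspan_sub.
  by exists (V \o T); [exists T|exists z].
- move=> _ _ [S aS <-] [T aT <-]; rewrite (adj_unitary uV hK0 (am_bop aa aS) (am_bop aa aT)).
  exact: (am_ip aa aS aT).
- move=> b Bb; exists (V \o rho a b \o uinv V); split.
    by apply: bop_comp (uinv_bop uV); apply: bop_comp => //; exact: rho_bop.
  move=> _ [T aT <-]; apply/funext => z /=; rewrite (Vuinv uV).
  by have /(congr1 (@^~ z)) /= -> := rhoE aa Bb aT.
Qed.

Let uS T : a T -> uinv V \o (V \o T) = T.
Proof. by move=> _; apply/funext => z /=; rewrite (Vuinv uV). Qed.

Lemma transport_ax :
  is_rtp a' ep (fun xi z eta => rtp_tens XL (uinv V \o xi) z eta : XL).
Proof.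
rewrite -Va; have [hX ipX spX] := rtp_ax XL; split=> //.
  move=> _ _ z z' eta eta' [S aS <-] [T aT <-] ge ge'; rewrite !uS// ipX//.
  have /(congr1 (fun f => f (adj eta (eta' z')))) /= := adj_unitary uV hK0 (am_bop aa aS) (am_bop aa aT).
  by move=> ->.
rewrite -spX; congr hspan; apply/seteqP; split=> x.
  move=> [_ [z [eta [[T aT <-] ge ->]]]]; rewrite uS//.
  by exists T, z, eta.
move=> [T [z [eta [aT ge ->]]]]; exists (V \o T), z, eta; rewrite uS//.
by split=> //; exists T.
Qed.

(** The underlying space is that of [XL]; only the labels of the first leg are pulled back along
    [V]. In this realization V (x) id is the identity map, which is what [ket2_transport]
    records. *)
Definition transport : rtp a' ep := Rtp transport_ax.

Lemma ket2_transport eta : ep eta -> ket2 transport eta \o V = ket2 XL eta.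
Proof.
move=> ge; have bk := ket2_bop XL aa aep ge.
rewrite (ket2_uniq (X := transport) transport_amod aep ge (F := ket2 XL eta \o uinv V)).
- by apply/funext => x /=; rewrite (Vuinv uV).
- exact: bop_comp bk (uinv_bop uV).
- move=> xi z axi; have [T aT <-] : [set V \o T | T in a] xi by rewrite Va.
  rewrite /= (Vuinv uV).
  by rewrite (ket2E XL aa aep _ ge aT) uS.
Qed.

End Transport.

Section Assoc.
Variables (H K L : ipSpace R) (be : set (K0 -> H)) (ga de : set (K0 -> K)) (ep : set (K0 -> L)).
Variables (X : rtp be ga) (Y : rtp de ep) (XL : rtp (trir X de) ep).
Hypotheses (abe : amod be) (aga : amod ga) (ade : amod de) (aep : amod ep).
Hypotheses (atrir : amod (trir X de)) (atril : amod (tril Y ga)).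
Hypothesis com : forall b c, B b -> B c -> rho ga b \o rho de c = rho de c \o rho ga b.

Let fX := flip X abe aga.
Let hXL : hilbert XL. Proof. by have [] := rtp_ax XL. Qed.
Let hY : hilbert Y. Proof. by have [] := rtp_ax Y. Qed.

Let k1 xi : be xi -> bounded_op (ket1 X xi).
Proof. exact: (ket2_bop fX). Qed.

(** Pushing both inner products down to [K] leaves [rho ga (adj xi \o xi')] and
    [rho de (adj eta \o eta')] acting on [k'], in opposite orders on the two sides; [com] identifies
    them. *)
Let wip xi xi' eta eta' k k' : be xi -> be xi' -> ep eta -> ep eta' ->
  ip (ket2 XL eta (ket1 X xi k)) (ket2 XL eta' (ket1 X xi' k')) =
  ip (ket2 Y eta k) (rho (tril Y ga) (adj xi \o xi') (ket2 Y eta' k')).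
Proof.
move=> bx bx' ee ee'; have Bx := am_ip abe bx bx'; have Be := am_ip aep ee ee'.
rewrite (ket2_ip XL)//.
have /(congr1 (@^~ k')) /= -> := tril_rho (X := fX) aga abe ade atrir Be bx'.
rewrite -[LHS]/(ip (ket2 fX xi k) (ket2 fX xi' _)) (ket2_ip fX)//.
have /(congr1 (@^~ k')) /= -> := tril_rho (X := Y) ade aep aga atril Bx ee'.
rewrite (ket2_ip Y)//.
by have /(congr1 (@^~ k')) /= -> := com Bx Be.
Qed.

Lemma assoc_op xi : be xi -> exists F : Y -> XL, bounded_op F /\
  forall eta, ep eta -> F \o ket2 Y eta = ket2 XL eta \o ket1 X xi.
Proof.
move=> bx; pose I := {p : (K0 -> L) * K | `[< ep p.1 >]}.
have [|||F [bF FE]] := @extension_ip Y XL I (fun p => ket2 Y (sval p).1 (sval p).2)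
  (fun p => ket2 XL (sval p).1 (ket1 X xi (sval p).2)) (rho (tril Y ga) (adj xi \o xi)) hXL.
- exact: rho_bop atril (am_ip abe bx bx).
- rewrite -(ket2_tot Y ade aep); congr hspan; apply/seteqP; split=> x.
    by move=> [[[e k] /= /asboolP ee] _ <-]; exists (ket2 Y e); [exists e|exists k].
  move=> [_ [e ee <-] [k _ <-]].
  by exists (exist _ (e, k) (asboolT ee)).
- by move=> [[e k] /= /asboolP ee] [[e' k'] /= /asboolP ee']; exact: wip.
exists F; split=> // eta ee; apply/funext => k.
exact: (FE (exist _ (eta, k) (asboolT ee))).
Qed.

Definition assocT xi : Y -> XL := xget (fun=> 0) [set F : Y -> XL | bounded_op F /\
  forall eta, ep eta -> F \o ket2 Y eta = ket2 XL eta \o ket1 X xi].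

Let assocTP xi : be xi -> bounded_op (assocT xi) /\
  forall eta, ep eta -> assocT xi \o ket2 Y eta = ket2 XL eta \o ket1 X xi.
Proof.
move=> bx; rewrite /assocT; case: xgetP => [F _ []//|h].
by have [F /h] := assoc_op bx.
Qed.

Let assocT_adj xi xi' : be xi -> be xi' ->
  adj (assocT xi) \o assocT xi' = rho (tril Y ga) (adj xi \o xi').
Proof.
move=> bx bx'; have [b E] := assocTP bx; have [b' E'] := assocTP bx'.
have Bx := am_ip abe bx bx'.
apply: (ket2_ext ade aep).
- exact: bop_comp (adj_bop hY b) b'.
- exact: rho_bop.
move=> eta' ee'; apply/funext => k'.
apply: (ip_ext (ket2_tot Y ade aep)) => _ [_ [eta ee <-] [k _ <-]].
rewrite /= -adjE//.
have /(congr1 (@^~ k)) /= -> := E _ ee; have /(congr1 (@^~ k')) /= -> := E' _ ee'.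
by rewrite wip.
Qed.

Lemma assoc_ax : is_rtp be (tril Y ga) (fun xi z Th => assocT xi (Th z) : XL).
Proof.
split=> //.
  move=> xi xi' z z' Th Th' bx bx' gT gT'; have [b E] := assocTP bx.
  have bT := am_bop atril gT; have bT' := am_bop atril gT'.
  have Bx := am_ip abe bx bx'; have BT := am_ip atril gT gT'.
  rewrite adjE//; have /(congr1 (@^~ (Th' z'))) /= -> := assocT_adj bx bx'.
  have /(congr1 (@^~ z')) /= -> := rhoE atril Bx gT'.
  rewrite adjE//; congr ip.
  by have /(congr1 (@^~ z')) /= -> := comB Bx BT.
apply/seteqP; split=> // x _.
have : hspan (opapp [set ket2 XL eta | eta in ep]) x by rewrite (ket2_tot XL).
apply: hspan_min; [exact: hspan_subsp|exact: hspan_closed|].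
move=> _ [_ [eta ee <-] [h _ <-]]; have bk := ket2_bop XL atrir aep ee.
set S := hspan _; have [S0 SD] : subsp S by exact: hspan_subsp.
have : hspan (opapp [set ket2 fX xi | xi in be]) h by rewrite (ket2_tot fX).
apply: (@hspan_min _ _ _ [set h | S (ket2 XL eta h)]).
- by split=> [|c y z] /=; rewrite ?bop0// bop_lin//; exact: SD.
- exact: bop_isub_hclosed bk (hspan_closed (Y := _)).
move=> _ [_ [xi bx <-] [k _ <-]] /=; have [b E] := assocTP bx.
have /(congr1 (@^~ k)) /= e := E _ ee; rewrite -[ket2 fX xi]/(ket1 X xi) -e.
have bkY := ket2_bop Y ade aep ee.
have bF := bop_comp b bkY.
have : hspan (opapp ga) k by rewrite (am_tot aga).
apply: (@hspan_min _ _ _ [set k | S (assocT xi (ket2 Y eta k))]).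
- split=> [|c y z] /=; first by rewrite (bop0 bkY) (bop0 b).
  by rewrite (bop_lin bkY) (bop_lin b); exact: SD.
- exact: (bop_isub_hclosed bF (hspan_closed (Y := _))).
move=> _ [g gg [z _ <-]] /=; apply: hspan_sub; exists xi, z, (ket2 Y eta \o g); split=> //.
apply: opspan_sub; first exact: bop_comp bkY (am_bop aga gg).
by exists (ket2 Y eta); [exists eta|exists g].
Qed.

(** The product bracketed to the right is realized on the space of the one bracketed to the left,
    with [ket1] acting by [assocT]; the associativity isomorphism is then the identity. *)
Definition assocR : rtp be (tril Y ga) := Rtp assoc_ax.

Lemma ket1_assocR xi eta : be xi -> ep eta ->
  ket1 assocR xi \o ket2 Y eta = ket2 XL eta \o ket1 X xi.
Proof.
move=> bx ee; have [b E] := assocTP bx; rewrite -E//; congr (_ \o _).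
exact: (ket2_uniq (X := flip assocR abe atril) atril abe bx b).
Qed.

End Assoc.

End Rtp.

Section Polarization.
Variable R : realType.
Local Notation C := R[i].

(** Replacing [y] by ['i *: y] separates the two terms that the substitution [x + y] leaves
    together. It upgrades norm formulas for operators to inner product formulas. *)
Lemma polarization (H : ipSpace R) (T : H -> H) : bounded_op T ->
  (forall z, ip z (T z) = 0) -> forall x, T x = 0.
Proof.
move=> bT h; have E x y : ip x (T y) + ip y (T x) = 0.
  by have := h (x + y); rewrite (bopD bT) !(ipDl, ipDr) !h add0r addr0 addrC.
have E2 x y : ip x (T y) = ip y (T x).
  have := E x ('i *: y); rewrite (bopZ bT) ipZr ipZl => /eqP.
  have -> : conjc 'i = - ('i : C) by rewrite /= ; congr (_ +i* _); rewrite oppr0.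
  rewrite mulNr -mulrBr mulf_eq0 => /orP[/eqP[/eqP]|]; first by rewrite oner_eq0.
  by rewrite subr_eq0 => /eqP.
move=> x; apply: ipI => y; rewrite ip0r; have := E y x; rewrite -(E2 y x) -mulr2n.
by move/eqP; rewrite mulrn_eq0 => /eqP.
Qed.

End Polarization.

(** * Weighted composition operators on L2 spaces *)

Section SqNorm.
Variable R : realType.
Local Notation C := R[i].

(** The squared modulus as a real number: weights and integrands of L2 norms are stated with it,
    which keeps square roots and the order of the complex numbers out of the integration theory. *)
Definition sqn (z : C) : R := complex.Re z ^+ 2 + complex.Im z ^+ 2.

Lemma sqn_ge0 z : 0 <= sqn z. Proof. by rewrite addr_ge0 ?sqr_ge0. Qed.
Lemma sqnM z w : sqn (z * w) = sqn z * sqn w.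
Proof. by case: z w => a b [c d]; rewrite /sqn /=; ring. Qed.
Lemma sqnR (a : R) : sqn a%:C = a ^+ 2.
Proof. by rewrite /sqn /= expr0n addr0. Qed.
Lemma sqn0 : sqn 0 = 0. Proof. by rewrite -[0]/(0%:C) sqnR expr0n. Qed.
Lemma sqnD z w : sqn (z + w) <= 2 * (sqn z + sqn w).
Proof.
case: z w => a b [c d]; rewrite /sqn /=.
have := sqr_ge0 (a - c); have := sqr_ge0 (b - d); nra.
Qed.
Lemma sqn_eq0 z : (sqn z == 0) = (z == 0).
Proof. by case: z => a b; rewrite /sqn /= paddr_eq0 ?sqr_ge0// !sqrf_eq0 eq_complex. Qed.
Lemma sqnE z : (sqn z)%:C = z * conjc z.
Proof. by case: z => a b; rewrite /sqn; congr (_ +i* _) => /=; ring. Qed.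
Lemma sqn_conj z : sqn (conjc z) = sqn z.
Proof. by case: z => a b; rewrite /sqn /= sqrrN. Qed.
Lemma normc_sqn z : `|z| = (Num.sqrt (sqn z))%:C.
Proof. by rewrite normc_def. Qed.

End SqNorm.

Section Cmeas.
Context d (T : measurableType d) (R : realType).
Local Notation C := R[i].

Definition cmeas (f : T -> C) : Prop :=
  measurable_fun setT (fun x => complex.Re (f x)) /\
  measurable_fun setT (fun x => complex.Im (f x)).

Lemma cmeasD f g : cmeas f -> cmeas g -> cmeas (fun x => f x + g x).
Proof.
move=> [f1 f2] [g1 g2]; split.
  rewrite (_ : (fun x => _) = (fun x => complex.Re (f x)) \+ (fun x => complex.Re (g x))).
    exact: measurable_funD.
  by apply/funext => x /=; case: (f x) (g x) => ? ? [].
rewrite (_ : (fun x => _) = (fun x => complex.Im (f x)) \+ (fun x => complex.Im (g x))).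
  exact: measurable_funD.
by apply/funext => x /=; case: (f x) (g x) => ? ? [].
Qed.

Lemma cmeasM f g : cmeas f -> cmeas g -> cmeas (fun x => f x * g x).
Proof.
move=> [f1 f2] [g1 g2]; split.
  rewrite (_ : (fun x => _) = (fun x => complex.Re (f x) * complex.Re (g x)) \-
     (fun x => complex.Im (f x) * complex.Im (g x))).
    by apply: measurable_funB; exact: measurable_funM.
  by apply/funext => x /=; case: (f x) (g x) => ? ? [].
rewrite (_ : (fun x => _) = (fun x => complex.Re (f x) * complex.Im (g x)) \+
     (fun x => complex.Im (f x) * complex.Re (g x))).
  by apply: measurable_funD; exact: measurable_funM.
by apply/funext => x /=; case: (f x) (g x) => ? ? [].
Qed.

Lemma cmeas_cst c : cmeas (fun=> c).
Proof. by split; exact: measurable_cst. Qed.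

Lemma cmeas_real (f : T -> R) : measurable_fun setT f -> cmeas (fun x => (f x)%:C).
Proof. by move=> mf; split => //=; exact: measurable_cst. Qed.

Lemma cmeas_sqn f : cmeas f -> measurable_fun setT (fun x => sqn (f x)).
Proof. by move=> [f1 f2]; apply: measurable_funD; exact: measurable_funX. Qed.

Lemma cmeas_esqn f : cmeas f -> measurable_fun setT (fun x => (sqn (f x))%:E).
Proof. by move=> /cmeas_sqn mf; exact/measurable_EFinP. Qed.

Lemma cmeas_comp d' (T' : measurableType d') (p : T' -> T) f : measurable_fun setT p ->
  cmeas f -> [/\ measurable_fun setT (fun x => complex.Re (f (p x))) &
  measurable_fun setT (fun x => complex.Im (f (p x)))].
Proof.
move=> mp [f1 f2]; split.
  exact: (measurableT_comp f1 mp).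
exact: (measurableT_comp f2 mp).
Qed.

End Cmeas.

Section L2Basic.
Context d (T : measurableType d) (R : realType).
Local Notation C := R[i].
Variable mu : {measure set T -> \bar R}.
Local Notation H := (L2space mu).
Local Notation cls := (cls mu).
Local Notation sqint := (sqint mu).

Lemma measurable_EFin (g : T -> R) : measurable_fun setT g ->
  measurable_fun setT (fun x => (g x)%:E).
Proof. by move=> mg; exact/measurable_EFinP. Qed.

Let ge0_sq (f : T -> R) x : (0 <= (f x ^+ 2)%:E)%E. Proof. by rewrite lee_fin sqr_ge0. Qed.

Lemma Lfun2P (f : T -> R) : f \in Lfun mu 2%:E <->
  measurable_fun setT f /\ (\int[mu]_x (f x ^+ 2)%:E < +oo)%E.
Proof.
have E : (Lnorm mu 2%:E (EFin \o f) `^ 2)%E = (\int[mu]_x (f x ^+ 2)%:E)%E.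
  rewrite poweR_Lnorm ?pnatr_eq0//; apply: eq_integral => x _ /=.
  by rewrite powR_mulrn// real_normK// num_real.
split=> [f2|[mf f2]].
  split; first by move: f2; rewrite inE => /andP[]; rewrite inE.
  by have := f2; rewrite inE => /andP[_]; rewrite inE /= /finite_norm => /(poweR_lty 2); rewrite E.
rewrite inE; apply/andP; split; rewrite inE//= /finite_norm.
by apply: (@lty_poweRy _ _ 2); rewrite ?pnatr_eq0// E.
Qed.

Lemma sqintP (f : T -> C) : f \in sqint <->
  cmeas f /\ (\int[mu]_x (sqn (f x))%:E < +oo)%E.
Proof.
have ID : cmeas f -> (\int[mu]_x (sqn (f x))%:E =
    \int[mu]_x (complex.Re (f x) ^+ 2)%:E + \int[mu]_x (complex.Im (f x) ^+ 2)%:E)%E.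
  move=> [f1 f2]; rewrite -ge0_integralD//; try by move=> x _; rewrite lee_fin sqr_ge0.
    exact: (measurable_EFin (measurable_funX 2 f1)).
  exact: (measurable_EFin (measurable_funX 2 f2)).
split=> [/andP[/Lfun2P[m1 i1] /Lfun2P[m2 i2]]|[mf i]].
  by split; [split|rewrite ID//; exact: lte_add_pinfty].
have [m1 m2] := mf.
have i0 (g : T -> R) : (0 <= \int[mu]_x (g x ^+ 2)%:E)%E.
  by apply: integral_ge0 => x _; exact: ge0_sq.
apply/andP; split; apply/Lfun2P; split=> //; apply: le_lt_trans i; rewrite ID//.
  by rewrite leeDl.
by rewrite leeDr.
Qed.

Lemma sqint_meas f : f \in sqint -> cmeas f. Proof. by case/sqintP. Qed.
Lemma sqint_lty f : f \in sqint -> (\int[mu]_x (sqn (f x))%:E < +oo)%E.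
Proof. by case/sqintP. Qed.

Lemma sqintD f g : f \in sqint -> g \in sqint -> (fun x => f x + g x) \in sqint.
Proof. by move=> f2 g2; exact: (rpredD f2 g2). Qed.

Lemma sqintZ (a : C) f : f \in sqint -> (fun x => a * f x) \in sqint.
Proof. by move=> f2; have := @rpredZ _ _ sqint a f f2. Qed.

Lemma sqintB f g : f \in sqint -> g \in sqint -> (fun x => f x - g x) \in sqint.
Proof. by move=> f2 g2; exact: (rpredB f2 g2). Qed.

Lemma sqint0 : (fun=> 0) \in sqint. Proof. exact: rpred0. Qed.

Lemma clsE f (f2 : f \in sqint) : cls f = \pi_(L2 mu)%qT (Sqfun f2).
Proof.
by rewrite /cls; congr (\pi_(L2 mu)%qT _); apply: val_inj; rewrite val_insubd f2.
Qed.

Lemma cls_eqP f g : f \in sqint -> g \in sqint -> cls f = cls g <-> \forall x \ae mu, f x = g x.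
Proof. by move=> f2 g2; rewrite (clsE f2) (clsE g2); exact: L2P. Qed.

Lemma cls_surj (u : H) : exists2 f, f \in sqint & u = cls f.
Proof.
exists (repr u); first exact: (valP (repr u)).
rewrite /cls (_ : insubd _ _ = repr u) ?reprK//; apply: val_inj.
by rewrite val_insubd (valP (repr u)).
Qed.

Lemma clsDZ (a : C) f g : f \in sqint -> g \in sqint ->
  cls (fun x => a * f x + g x) = a *: cls f + cls g.
Proof.
move=> f2 g2; have h : (fun x => a * f x + g x) \in sqint by apply: sqintD => //; exact: sqintZ.
rewrite (clsE h) (clsE f2) (clsE g2) -[a *: _]/(L2scale a _) -pi_scale.
rewrite -(raddfD (\pi_(L2 mu)%qT : {additive _ -> _})).
by congr (\pi_(L2 mu)%qT _); exact: val_inj.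
Qed.

Lemma cls0 : cls (fun=> 0) = 0.
Proof.
rewrite (clsE sqint0) -[RHS](raddf0 (\pi_(L2 mu)%qT : {additive _ -> _})).
by congr (\pi_(L2 mu)%qT _); exact: val_inj.
Qed.

Lemma clsD f g : f \in sqint -> g \in sqint -> cls (fun x => f x + g x) = cls f + cls g.
Proof.
move=> f2 g2; rewrite -[cls f]scale1r -clsDZ//; congr cls.
by apply/funext => x; rewrite mul1r.
Qed.

Lemma clsB f g : f \in sqint -> g \in sqint -> cls (fun x => f x - g x) = cls f - cls g.
Proof.
move=> f2 g2; rewrite addrC -scaleN1r -clsDZ//; congr cls.
by apply/funext => x; rewrite mulN1r addrC.
Qed.

Lemma ip_cls f g : f \in sqint -> g \in sqint ->
  ip (cls f) (cls g) = cint mu setT (fun x => g x * conjc (f x)).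
Proof. by move=> f2 g2; rewrite (clsE f2) (clsE g2); exact: L2formE. Qed.

Lemma hnorm_cls f : f \in sqint ->
  ((hnorm (cls f)) ^+ 2)%:E = (\int[mu]_x (sqn (f x))%:E)%E.
Proof.
move=> f2; rewrite hnorm_sqr ip_cls// /cint /= fineK.
  by apply: eq_integral => x _; rewrite -sqnE.
have -> : (\int[mu]_x (complex.Re (f x * conjc (f x)))%:E = \int[mu]_x (sqn (f x))%:E)%E.
  by apply: eq_integral => x _; rewrite -sqnE.
by rewrite ge0_fin_numE ?sqint_lty// integral_ge0// => x _; rewrite lee_fin sqn_ge0.
Qed.

Lemma hnorm_cls_le f g (c : R) : 0 <= c -> f \in sqint -> g \in sqint ->
  (forall x, sqn (g x) <= c ^+ 2 * sqn (f x)) -> hnorm (cls g) <= c * hnorm (cls f).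
Proof.
move=> c0 f2 g2 h; rewrite -ler_sqr ?nnegrE ?mulr_ge0 ?hnorm_ge0// exprMn.
rewrite -lee_fin [leRHS]EFinM !hnorm_cls// -ge0_integralZl_EFin//; first last.
- exact: sqr_ge0.
- exact/cmeas_esqn/sqint_meas.
- by move=> x _; rewrite lee_fin sqn_ge0.
apply: ge0_le_integral => //.
- by move=> x _; rewrite lee_fin sqn_ge0.
- exact/cmeas_esqn/sqint_meas.
- by apply: measurable_funeM; exact/cmeas_esqn/sqint_meas.
- by move=> x _; rewrite -EFinM lee_fin.
Qed.

End L2Basic.

(** * Relative tensor products from a dense family of kets *)

Section Dense.
Variable R : realType.
Local Notation C := R[i].

Lemma le_small (a c : R) : (forall e : R, 0 < e <= 1 -> a <= c * e) -> a <= 0.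
Proof.
move=> h; rewrite leNgt; apply/negP => a0.
have c1 : 0 < `|c| + a + 1 by have := normr_ge0 c; lra.
have e0 : 0 < a / (2 * (`|c| + a + 1)) by rewrite divr_gt0// mulr_gt0.
have e1 : a / (2 * (`|c| + a + 1)) <= 1.
  by rewrite ler_pdivrMr ?mulr_gt0// mul1r; have := normr_ge0 c; lra.
have := h _ (introT andP (conj e0 e1)).
have eE : a / (2 * (`|c| + a + 1)) * (2 * (`|c| + a + 1)) = a by rewrite divfK// gt_eqF// mulr_gt0.
move: eE e0; set e := a / _ => eE e0.
have := ler_norm c; have := normr_ge0 c; nra.
Qed.

Lemma hnorm_lim0 (H : ipSpace R) (x y : H) (c : R) :
  (forall e : R, 0 < e <= 1 -> exists x', hnorm (x - x') <= c * e /\ hnorm (y - x') <= c * e) -> x = y.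
Proof.
move=> h; apply/eqP; rewrite -subr_eq0 -hnorm_eq0 eq_le hnorm_ge0 andbT.
apply: (@le_small _ (2 * c)) => e /h[x' [h1 h2]].
by have := hdistD x' x y; rewrite (hdistC x' y); lra.
Qed.

Lemma ip_lim (H L : ipSpace R) (x y : H) (u v : L) (c : R) : 0 <= c ->
  (forall e : R, 0 < e <= 1 -> exists x' y' u' v', [/\ ip x' y' = ip u' v',
    hnorm (x - x') <= c * e, hnorm (y - y') <= c * e,
    hnorm (u - u') <= c * e & hnorm (v - v') <= c * e]) -> ip x y = ip u v.
Proof.
move=> c0 h.
have key (M : ipSpace R) (p q p' q' : M) (e : R) : 0 < e <= 1 ->
    hnorm (p - p') <= c * e -> hnorm (q - q') <= c * e ->
    `|ip p q - ip p' q'| <= ((c * (hnorm p + hnorm q + c)) * e)%:C.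
  move=> /andP[e0 e1] hp hq.
  have -> : ip p q - ip p' q' = ip p (q - q') + ip (p - p') (q - (q - q')).
    have -> : q - (q - q') = q' by rewrite opprB addrC subrK.
    by rewrite ipBr ipBl addrA subrK.
  have n1 := hnorm_ge0 p; have n2 := hnorm_ge0 q.
  have h1 := ip_CS p (q - q'); have h2 := ip_CS (p - p') (q - (q - q')).
  apply: (le_trans (ler_normD _ _)); apply: (le_trans (lerD h1 h2)).
  rewrite -rmorphD /= lecR.
  have h3 : hnorm (q - (q - q')) <= hnorm q + c.
    have hn := hnormD q (- (q - q')); rewrite hnormN in hn.
    have ce : c * e <= c by rewrite -[leRHS]mulr1 ler_wpM2l.
    by apply: (le_trans hn); rewrite lerD2l (le_trans hq).
  have := hnorm_ge0 (q - q'); have := hnorm_ge0 (p - p').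
  have := hnorm_ge0 (q - (q - q')) => n3 n4 n5.
  have a1 : hnorm p * hnorm (q - q') <= hnorm p * (c * e) by rewrite ler_wpM2l.
  have a2 : hnorm (p - p') * hnorm (q - (q - q')) <= c * e * (hnorm q + c) by rewrite ler_pM.
  by apply: (le_trans (lerD a1 a2)); lra.
apply/eqP; rewrite -subr_eq0 -normr_eq0 normc_sqn.
set r := Num.sqrt _; have r0 : 0 <= r := sqrtr_ge0 _.
suff : r <= 0 by move=> r1; rewrite (@le_anti _ _ r 0)// r1.
apply: (@le_small _ (c * (hnorm x + hnorm y + c) + c * (hnorm u + hnorm v + c))) => e e01.
have [x' [y' [u' [v' [E hx hy hu hv]]]]] := h e e01.
rewrite -lecR /r -normc_sqn mulrDl rmorphD /=.
have -> : ip x y - ip u v = (ip x y - ip x' y') - (ip u v - ip u' v').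
  by rewrite E opprB addrA subrK.
by apply: (le_trans (ler_normB _ _)); apply: lerD; apply: key.
Qed.

Variables (K0 H K T : ipSpace R) (be : set (K0 -> H)) (ga : set (K0 -> K)).
Variables (I : Type) (J : I -> K0 -> K) (ka : I -> H -> T) (P : I -> I -> H -> H).
Hypotheses (hK0 : hilbert K0) (hH : hilbert H) (hK : hilbert K) (hT : hilbert T).
Hypothesis be_bop : forall xi, be xi -> bounded_op xi.
Hypothesis ga_bop : forall eta, ga eta -> bounded_op eta.
Hypothesis Jga : forall i, ga (J i).
Hypothesis Jdense : forall eta, ga eta -> forall e : R, 0 < e -> exists i, op_close eta (J i) e.
Hypothesis ka_bop : forall i, bounded_op (ka i).
Hypothesis ka_ip : forall i j x y, ip (ka i x) (ka j y) = ip x (P i j y).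
Hypothesis PE : forall i j xi, be xi -> P i j \o xi = xi \o (adj (J i) \o J j).
Hypothesis be_tot : hspan (opapp be) = setT.
Hypothesis ka_tot : hspan [set x | exists i h, x = ka i h] = setT.

Let ipE i j xi xi' z z' : be xi -> be xi' ->
  ip (ka i (xi z)) (ka j (xi' z')) = ip (J i (adj xi' (xi z))) (J j z').
Proof.
move=> bx bx'; rewrite ka_ip -[P i j _]/((P i j \o xi') z') (PE i j bx') /=.
rewrite -(ip_adj _ _ hK0 (be_bop bx')) -(adjE hK0 (ga_bop (Jga i)))//.
Qed.

Let ka_dist i j xi z : be xi ->
  hnorm (ka i (xi z) - ka j (xi z)) ^+ 2 =
  complex.Re (ip (J i (adj xi (xi z)) - J j (adj xi (xi z))) (J i z - J j z)).
Proof. by move=> bx; rewrite hnorm_sqr !(ipBr, ipBl) !ipE. Qed.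

(** By [ka_dist] and the Cauchy-Schwarz inequality the squared distance is at most e^2 a b with a
    and b the two norms in the bound; 1 + a + b dominates the square root of a b. *)
Let ka_dist_le i j xi z (e : R) : 0 <= e -> be xi -> op_close (J i) (J j) e ->
  hnorm (ka i (xi z) - ka j (xi z)) <= e * (1 + hnorm (adj xi (xi z)) + hnorm z).
Proof.
move=> e0 bx ij; set a := hnorm (adj _ _); set b := hnorm z.
have a0 : 0 <= a := hnorm_ge0 _; have b0 : 0 <= b := hnorm_ge0 _.
have : hnorm (ka i (xi z) - ka j (xi z)) ^+ 2 <= (e * a) * (e * b).
  rewrite ka_dist//; apply: le_trans (Re_ip_le _ _) _.
  by apply: ler_pM; rewrite ?hnorm_ge0//; exact: ij.
have := hnorm_ge0 (ka i (xi z) - ka j (xi z)); set n := hnorm _ => n0 nn.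
rewrite -(@ler_sqr _ n) ?nnegrE ?mulr_ge0 ?addr_ge0//; apply: le_trans nn _.
rewrite exprMn mulrACA -expr2 ler_wpM2l ?sqr_ge0//; nra.
Qed.

Let tens0 xi z eta : exists x, be xi -> ga eta -> forall (e : R) i, 0 < e -> op_close eta (J i) e ->
  hnorm (x - ka i (xi z)) <= e * (1 + hnorm (adj xi (xi z)) + hnorm z).
Proof.
set c := 1 + _ + _.
have c0 : 0 < c by rewrite ltr_wpDr ?hnorm_ge0// ltr_wpDr ?hnorm_ge0.
have [bx|nb] := pselect (be xi); last by exists 0.
have [ge|ng] := pselect (ga eta); last by exists 0.
have [||x xP] := @hlim R T hT (fun e y => exists e' i,
  [/\ 0 <= e', op_close eta (J i) e', y = ka i (xi z) & e' * c <= e]).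
- move=> e e0; have [i iP] := Jdense ge (divr_gt0 e0 c0).
  by exists (ka i (xi z)), (e / c), i; split; rewrite ?divfK ?gt_eqF// divr_ge0 ?ltW.
- move=> e d y y' [e' [i [e0 iP -> le]]] [d' [j [d0 jP -> ld]]].
  apply: (@le_trans _ _ ((e' + d') * c)); last by rewrite mulrDl lerD.
  apply: ka_dist_le => //; first exact: addr_ge0.
  exact: op_close_trans (op_close_sym iP) jP.
by exists x => _ _ e i e0 iP; apply: xP; exists e, i; split=> //; exact: ltW.
Qed.

(** The kets are known for the dense family [J i] only. For general [eta] the tensor is the limit of
    [ka i (xi z)] as [J i] approaches [eta]; the inner product formula holds for the approximants by
    [ipE], and all four vectors in it converge. *)
Lemma dense_rtp : exists t, is_rtp be ga t /\
  forall i xi z, be xi -> t xi z (J i) = ka i (xi z) :> T.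
Proof.
have /choice[t tP] : forall p : (K0 -> H) * K0 * (K0 -> K), exists x : T, be p.1.1 -> ga p.2 ->
    forall (e : R) i, 0 < e -> op_close p.2 (J i) e ->
    hnorm (x - ka i (p.1.1 p.1.2)) <= e * (1 + hnorm (adj p.1.1 (p.1.1 p.1.2)) + hnorm p.1.2).
  by move=> [[xi z] eta]; exact: tens0.
have tJ i xi z : be xi -> t (xi, z, J i) = ka i (xi z).
  move=> bx; apply: (@hnorm_lim0 _ _ _ (1 + hnorm (adj xi (xi z)) + hnorm z)) => e /andP[e0 e1].
  exists (ka i (xi z)); rewrite mulrC; split.
    exact: (tP (xi, z, J i) bx (Jga i) e i e0 (op_close_refl _ (ltW e0))).
  by rewrite subrr hnorm0 mulr_ge0 ?(ltW e0)// !addr_ge0 ?hnorm_ge0.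
exists (fun xi z eta => t (xi, z, eta)); split; last by move=> i xi z; exact: tJ.
split=> //.
- move=> xi xi' z z' eta eta' bx bx' ge ge'.
  rewrite -(adjE hK0 (be_bop bx)) -(ip_adj _ _ hK0 (be_bop bx')) -(adjE hK0 (ga_bop ge)).
  set w := adj xi' (xi z).
  pose c := (1 + hnorm (adj xi (xi z)) + hnorm z) + (1 + hnorm (adj xi' (xi' z')) + hnorm z') + hnorm w.
  have nn := (hnorm_ge0 (adj xi (xi z)), hnorm_ge0 z, hnorm_ge0 (adj xi' (xi' z')), hnorm_ge0 z', hnorm_ge0 w).
  move: nn => [[[[n1 n2] n3] n4] n5].
  have c0 : 0 <= c by rewrite /c; lra.
  apply: (@ip_lim _ _ _ _ _ _ c) => // e /andP[e0 e1].
  have [i iP] := Jdense ge e0; have [j jP] := Jdense ge' e0.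
  exists (ka i (xi z)), (ka j (xi' z')), (J i w), (J j z'); split.
  + exact: ipE.
  + apply: (le_trans (tP (xi, z, eta) bx ge e i e0 iP)) => /=; rewrite mulrC ler_wpM2r ?(ltW e0)//.
    by rewrite /c; lra.
  + apply: (le_trans (tP (xi', z', eta') bx' ge' e j e0 jP)) => /=; rewrite mulrC ler_wpM2r ?(ltW e0)//.
    by rewrite /c; lra.
  + by apply: (le_trans (iP w)); rewrite mulrC ler_wpM2r ?(ltW e0)// /c; lra.
  + by apply: (le_trans (jP z')); rewrite mulrC ler_wpM2r ?(ltW e0)// /c; lra.
- apply/seteqP; split=> // x _; have /seteqP[_ /(_ x Logic.I)] := ka_tot.
  apply: hspan_min; [exact: hspan_subsp|exact: hspan_closed|].
  move=> _ [i [h ->]]; have /seteqP[_ /(_ h Logic.I)] := be_tot.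
  set S := hspan [set x | _].
  suff : hspan (opapp be) `<=` ka i @^-1` S by apply.
  apply: hspan_min.
  + have [S0 SD] : subsp S by exact: hspan_subsp.
    split=> [|a u v Su Sv]; first by rewrite /preimage /= bop0.
    by rewrite /preimage /= bop_lin//; exact: SD.
  + exact: (bop_isub_hclosed (ka_bop i) (@hspan_closed _ _ _)).
  + move=> _ [xi bx [z _ <-]]; rewrite /preimage /=; apply: hspan_sub.
    by exists xi, z, (J i); split=> //; rewrite tJ.
Qed.

End Dense.

(** * The pentagon equation reduced to one identity between kets *)

Section PentagonDense.
Variables (R : realType) (bd : baseData R).
Local Notation K0 := (base_space bd).
Local Notation B := (@base_alg R bd).
Local Notation amod := (amod B).

Lemma dense_ext (H : ipSpace R) (a a0 : set (K0 -> H)) (L : ipSpace R) (Q Q' : H -> L) :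
  (forall xi, a xi -> forall e : R, 0 < e -> exists2 xi0, a0 xi0 & op_close xi xi0 e) ->
  bounded_op Q -> bounded_op Q' -> forall z,
  (forall xi0, a0 xi0 -> Q (xi0 z) = Q' (xi0 z)) -> forall xi, a xi -> Q (xi z) = Q' (xi z).
Proof.
move=> d bQ bQ' z h xi ax; have [M M0 hM] := bop_bound bQ; have [M' M'0 hM'] := bop_bound bQ'.
apply: (@hnorm_lim0 _ _ _ _ ((M + M') * hnorm z)) => e /andP[e0 _].
have [xi0 a0x close] := d _ ax _ e0; exists (Q (xi0 z)); split.
  rewrite -bopB//; apply: (le_trans (hM _)).
  rewrite -mulrA [_ * e]mulrC mulrDl; apply: (@le_trans _ _ (M * (e * hnorm z))).
    by rewrite ler_wpM2l ?(ltW M0)//; exact: close.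
  by rewrite lerDl mulr_ge0 ?(ltW M'0)// mulr_ge0 ?hnorm_ge0 ?(ltW e0).
rewrite h// -bopB//; apply: (le_trans (hM' _)).
rewrite -mulrA [_ * e]mulrC mulrDl; apply: (@le_trans _ _ (M' * (e * hnorm z))).
  by rewrite ler_wpM2l ?(ltW M'0)//; exact: close.
by rewrite lerDr mulr_ge0 ?(ltW M0)// mulr_ge0 ?hnorm_ge0 ?(ltW e0).
Qed.

End PentagonDense.

Section Pentagon.
Variables (R : realType) (bd : baseData R).
Local Notation K0 := (base_space bd).
Local Notation B := (@base_alg R bd).
Hypothesis hK0 : hilbert K0.
Hypothesis clB : opspan B = B.
Hypothesis adjB : forall b, B b -> B (adj b).
Hypothesis comB : forall b c, B b -> B c -> b \o c = c \o b.
Local Notation amod := (amod B).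

Variables (H : ipSpace R) (hbe al be : set (K0 -> H)).
Hypotheses (ahbe : amod hbe) (aal : amod al) (abe : amod be).
Hypothesis com_ab : forall b c, B b -> B c -> rho al b \o rho be c = rho be c \o rho al b.
Hypothesis com_ah : forall b c, B b -> B c -> rho al b \o rho hbe c = rho hbe c \o rho al b.
Hypothesis com_bh : forall b c, B b -> B c -> rho be b \o rho hbe c = rho hbe c \o rho be b.
Hypothesis com_aa : forall b c, B b -> B c -> rho al b \o rho al c = rho al c \o rho al b.

Variables (X : rtp hbe al) (Y : rtp al be) (V : X -> Y).
Hypothesis uV : unitary V.
Hypothesis V1 : [set V \o T | T in tril X al] = trir Y al.
Hypothesis V2 : [set V \o T | T in trir X be] = tril Y hbe.
Hypothesis V3 : [set V \o T | T in trir X hbe] = trir Y hbe.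
Hypothesis V4 : [set V \o T | T in tril X be] = tril Y be.
Hypotheses (aX1 : amod (tril X al)) (aX2 : amod (trir X be)).
Hypotheses (aX3 : amod (trir X hbe)) (aX4 : amod (tril X be)).
Variable T1 : rtp (trir X hbe) al.
Variables al0 be0 : set (K0 -> H).
Hypotheses (al0_sub : al0 `<=` al) (be0_sub : be0 `<=` be).
Hypothesis al0_dense : forall xi, al xi -> forall e : R, 0 < e ->
  exists2 xi0, al0 xi0 & op_close xi xi0 e.
Hypothesis be0_dense : forall xi, be xi -> forall e : R, 0 < e ->
  exists2 xi0, be0 xi0 & op_close xi xi0 e.

(* All spaces of the pentagon are realized on the space of [T1], with all
   maps the identity; the only condition left is the one for [a3]. *)
Lemma pentagon_criterion :
  (forall (F1 F5 F7 F2 : (K0 -> H) -> X -> T1),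
    (forall z, hbe z -> bounded_op (F1 z)) ->
    (forall xi, al xi -> bounded_op (F5 xi)) ->
    (forall eta, be eta -> bounded_op (F7 eta)) ->
    (forall eta, al eta -> bounded_op (F2 eta)) ->
    (forall z xi, hbe z -> al xi -> F1 z \o ket2 X xi = ket2 T1 xi \o ket1 X z) ->
    (forall xi z, al xi -> hbe z ->
       F5 xi \o ket1 X z = F1 z \o uinv V \o ket1 Y xi) ->
    (forall eta xi, be eta -> al xi ->
       F7 eta \o ket2 X xi = F5 xi \o uinv V \o ket2 Y eta) ->
    (forall eta xi, al eta -> al xi ->
       F2 eta \o ket2 X xi = ket2 T1 xi \o uinv V \o ket1 Y eta) ->
    forall xi eta, al0 xi -> be0 eta ->
      F7 eta \o uinv V \o ket1 Y xi = F2 xi \o uinv V \o ket2 Y eta) ->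
  pentagon V.
Proof.
move=> crit.
have hY : hilbert Y by have [] := rtp_ax Y.
have bVi := uinv_bop uV.
have aY1 : amod (trir Y al) := transport_amod hK0 uV V1 hY aX1.
have aY2 : amod (tril Y hbe) := transport_amod hK0 uV V2 hY aX2.
have aY3 : amod (trir Y hbe) := transport_amod hK0 uV V3 hY aX3.
have aY4 : amod (tril Y be) := transport_amod hK0 uV V4 hY aX4.
have com_ha b c : B b -> B c -> rho hbe b \o rho al c = rho al c \o rho hbe b.
  by move=> Bb Bc; rewrite com_ah.
pose fX : rtp al hbe := flip comB X ahbe aal.
pose Z : rtp be al := flip comB Y aal abe.
pose T1' : rtp hbe (tril X al) :=
  assocR hK0 comB (X := X) (Y := X) T1 ahbe aal ahbe aal aX3 aX1 com_ah.
pose fT1' : rtp (tril X al) hbe := flip comB T1' ahbe aX1.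
pose fT4 : rtp (trir Y al) hbe := transport hK0 fT1' uV V1 aX1.
pose T4 : rtp hbe (trir Y al) := flip comB fT4 aY1 ahbe.
(* [tril Z al] unfolds to [trir Y al] because [Z] is the flip of [Y]; hence T4 itself serves and id
   (x) sigma becomes the identity. *)
pose T5' : rtp hbe (tril Z al) := T4.
pose fT5 : rtp al (trir X be) :=
  assocR hK0 comB (X := Y) (Y := fX) fT4 aal abe aal ahbe aY1 aX2
    (fun b c Bb Bc => esym (com_ab Bc Bb)).
pose T5 : rtp (trir X be) al := flip comB fT5 aal aX2.
pose T6 : rtp (tril Y hbe) al := transport hK0 T5 uV V2 aX2.
pose fT7 : rtp be (tril X al) :=
  assocR hK0 comB (X := Z) (Y := X) T6 abe aal ahbe aal aY2 aX1 com_ah.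
pose T7 : rtp (tril X al) be := flip comB fT7 abe aX1.
pose T3 : rtp (trir Y al) be := transport hK0 T7 uV V1 aX1.
pose T2 : rtp (trir Y hbe) al := transport hK0 T1 uV V3 aX3.
pose T2' : rtp al (tril X be) :=
  assocR hK0 comB (X := Y) (Y := X) T2 aal abe ahbe aal aY3 aX4 com_bh.
pose fT2' : rtp (tril X be) al := flip comB T2' aal aX4.
pose fT3' : rtp (tril Y be) al := transport hK0 fT2' uV V4 aX4.
pose T3' : rtp al (tril Y be) := flip comB fT3' aY4 aal.
have e1 z xi : hbe z -> al xi -> ket1 T1' z \o ket2 X xi = ket2 T1 xi \o ket1 X z.
  exact: ket1_assocR.
have e4 z : hbe z -> ket1 T4 z \o V = ket1 T1' z.
  exact: (ket2_transport hK0 fT1' uV V1 hY aX1 ahbe).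
have e5 xi z : al xi -> hbe z -> ket2 T5 xi \o ket1 X z = ket1 T4 z \o ket1 Y xi.
  exact: (ket1_assocR hK0 comB (X := Y) (Y := fX) fT4).
have e6 xi : al xi -> ket2 T6 xi \o V = ket2 T5 xi.
  exact: (ket2_transport hK0 T5 uV V2 hY aX2 aal).
have e7 eta xi : be eta -> al xi -> ket2 T7 eta \o ket2 X xi = ket2 T6 xi \o ket2 Y eta.
  exact: (ket1_assocR hK0 comB (X := Z) (Y := X) T6).
have e3 eta : be eta -> ket2 T3 eta \o V = ket2 T7 eta.
  exact: (ket2_transport hK0 T7 uV V1 hY aX1 abe).
have e2 eta : al eta -> ket2 T2 eta \o V = ket2 T1 eta.
  exact: (ket2_transport hK0 T1 uV V3 hY aX3 aal).
have e2' eta xi : al eta -> al xi -> ket1 T2' eta \o ket2 X xi = ket2 T2 xi \o ket1 Y eta.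
  exact: ket1_assocR.
have e3' eta : al eta -> ket1 T3' eta \o V = ket1 T2' eta.
  exact: (ket2_transport hK0 fT2' uV V4 hY aX4 aal).
have Vi L (F : Y -> L) G : F \o V = G -> F = G \o uinv V.
  by move=> <-; apply/funext => y /=; rewrite (uinvK uV).
have uid (W : ipSpace R) : unitary (@id W) by split=> // y; exists y.
have a30 xi eta : al0 xi -> be0 eta ->
    ket2 T3 eta \o ket1 Y xi = ket1 T3' xi \o ket2 Y eta.
  move=> ax0 bet0; have ax := al0_sub ax0; have bet := be0_sub bet0.
  rewrite (Vi _ _ _ (e3 _ bet)) (Vi _ _ _ (e3' _ ax)).
  (* On the common space, [F1], [F5], [F7] and [F2] are the kets of T1', T5, T7 and T2'. Each of
     them is pinned down by the preceding ones through the associativity and flip relations, with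
     every V (x) id replaced by a composition with [uinv V]. *)
  apply: (crit (ket1 T1') (ket2 T5) (ket2 T7) (ket1 T2')) => //.
  - by move=> z hz; exact: (ket2_bop hK0 fT1' aX1 ahbe).
  - by move=> z hz; exact: (ket2_bop hK0 T5 aX2 aal).
  - by move=> z hz; exact: (ket2_bop hK0 T7 aX1 abe).
  - by move=> z hz; exact: (ket2_bop hK0 fT2' aX4 aal).
  - by move=> u z au hz; rewrite e5// (Vi _ _ _ (e4 _ hz)).
  - by move=> u z au hz; rewrite e7// (Vi _ _ _ (e6 _ hz)).
  - by move=> u z au hz; rewrite e2'// (Vi _ _ _ (e2 _ hz)).
have kY1 xi eta z : al xi -> be eta -> ket1 Y xi (eta z) = ket2 Y eta (xi z).
  move=> ax bet; rewrite (ket2E hK0 Y aal abe z bet ax).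
  exact: (ket2E hK0 (flip comB Y aal abe) abe aal z ax bet).
have fT3 : rtp be (trir Y al) := flip comB T3 aY1 abe.
have kY1b xi : al xi -> bounded_op (ket1 Y xi).
  exact: (ket2_bop hK0 (flip comB Y aal abe) abe aal).
have kT3 eta S z : be eta -> trir Y al S -> ket2 T3 eta (S z) = ket1 T3 S (eta z).
  move=> bet tS; rewrite (ket2E hK0 T3 aY1 abe z bet tS).
  by apply/esym; exact: (ket2E hK0 (flip comB T3 aY1 abe) abe aY1 z tS bet).
have kT3' xi S z : al xi -> tril Y be S -> ket1 T3' xi (S z) = ket2 T3' S (xi z).
  move=> ax tS; rewrite (ket2E hK0 T3' aal aY4 z tS ax).
  exact: (ket2E hK0 (flip comB T3' aal aY4) aY4 aal z ax tS).
(* Tested on a vector [eta' z], both sides become a fixed bounded operator applied to [xi z], by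
   exchanging the roles of the two legs; so [xi] may be replaced by its approximants. The next step
   treats [eta] in the same way. *)
have a31 xi eta : al xi -> be0 eta -> ket2 T3 eta \o ket1 Y xi = ket1 T3' xi \o ket2 Y eta.
  move=> ax bet0; have bet := be0_sub bet0; have b3 := ket2_bop hK0 T3 aY1 abe bet.
  have b3' : bounded_op (ket1 T3' xi) := ket2_bop hK0 (flip comB T3' aal aY4) aY4 aal ax.
  apply: (amod_ext abe).
  - by apply: bop_comp => //; exact: kY1b.
  - by apply: bop_comp => //; exact: (ket2_bop hK0 Y aal abe).
  move=> eta' bet'; apply/funext => z /=.
  have bk2 := ket2_bop hK0 Y aal abe.
  have tS : tril Y be (ket2 Y eta \o eta').
    apply: opspan_sub; first by apply: bop_comp (bk2 _ bet) (am_bop abe bet').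
    by exists (ket2 Y eta); [exists eta|exists eta'].
  rewrite kY1// -[RHS]/(ket1 T3' xi ((ket2 Y eta \o eta') z)) kT3'//.
  apply: (dense_ext al0_dense (Q := ket2 T3 eta \o ket2 Y eta') _ _ _ ax).
  - by apply: bop_comp b3 (bk2 _ bet').
  - exact: (ket2_bop hK0 T3' aal aY4).
  move=> xi0 ax0 /=; have ax0' := al0_sub ax0.
  rewrite -kY1// -kT3'//; exact: (congr1 (fun f => f (eta' z)) (a30 _ _ ax0 bet0)).
have a3 xi eta : al xi -> be eta -> ket2 T3 eta \o ket1 Y xi = ket1 T3' xi \o ket2 Y eta.
  move=> ax bet; have b3 := ket2_bop hK0 T3 aY1 abe bet.
  have b3' : bounded_op (ket1 T3' xi) := ket2_bop hK0 (flip comB T3' aal aY4) aY4 aal ax.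
  apply: (amod_ext aal).
  - by apply: bop_comp => //; exact: kY1b.
  - by apply: bop_comp => //; exact: (ket2_bop hK0 Y aal abe).
  move=> eta' aet'; apply/funext => z /=.
  have tS : trir Y al (ket1 Y xi \o eta').
    apply: opspan_sub; first by apply: bop_comp (kY1b _ ax) (am_bop aal aet').
    by exists (ket1 Y xi); [exists xi|exists eta'].
  rewrite -kY1// -[LHS]/(ket2 T3 eta ((ket1 Y xi \o eta') z)) kT3//.
  apply: (dense_ext be0_dense (Q' := ket1 T3' xi \o ket1 Y eta') _ _ _ bet).
  - exact: (ket2_bop hK0 (flip comB T3 aY1 abe) abe aY1).
  - by apply: bop_comp b3' (kY1b _ aet').
  move=> eta0 bet0 /=; have bet0' := be0_sub bet0.
  rewrite kY1// -kT3//; exact: (congr1 (fun f => f (eta' z)) (a31 _ _ ax bet0)).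
exists Z, T1, T1', T2, T2', T3, T3', T4, T5, T5', T6, T7.
exists id, id, id, id, id; split; first split=> //.
- by split=> // xi eta hx ae; rewrite -[LHS]/(ket2 T1 eta \o ket1 X xi) -e1.
- by split=> // xi eta hx ae; rewrite -[LHS]/(ket2 T2 eta \o ket1 Y xi) -e2'.
- by split=> // xi eta hx ae; rewrite -[LHS]/(ket2 T5 eta \o ket1 X xi) e5.
have bid (W : ipSpace R) : bounded_op (@id W) by exact: bop_id.
exists id, id, id, id; split; first split.
- by split=> // eta ae; rewrite e2.
- by split=> // xi ax; rewrite e3'.
- by split=> // xi hx; rewrite e4.
- by split=> // eta be'; rewrite e3.
exists id, id, id, id; split=> //; split.
- by split=> // xi z eta ax bet.
- by split=> // xi hx.
- by split=> // eta ae; rewrite e6.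
- by split=> // xi eta ax ae; rewrite -[LHS]/(ket2 T6 eta \o ket2 Y xi) e7.
Qed.

End Pentagon.

(** * Totality in L2 and weighted composition operators *)

Section Density.
Context d (T : measurableType d) (R : realType).
Local Notation C := R[i].
Variable mu : {measure set T -> \bar R}.

Variables (P : set (set T)) (E : nat -> set T).
Hypothesis mP : measurable = <<s P >>.
Hypothesis PI : setI_closed P.
Hypothesis PE : forall n, P (E n).
Hypothesis Ecover : \bigcup_n E n = setT.
Hypothesis Poo : forall A, P A -> (mu A < +oo)%E.

Let measP A : P A -> measurable A.
Proof. by move=> PA; rewrite mP; exact: sub_sigma_algebra. Qed.

(** The measurable sets whose trace on a fixed [E n] has integral zero form a Dynkin class
    containing the pi-system [P]; so [g] vanishes almost everywhere on each [E n], and countably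
    many of these cover the space. *)
Lemma real_orth0 (g : T -> R) : measurable_fun setT g ->
  (forall n, mu.-integrable (E n) (EFin \o g)) ->
  (forall A, P A -> (\int[mu]_(x in A) (g x)%:E = 0)%E) -> \forall x \ae mu, g x = 0.
Proof.
move=> mg ig g0.
have mE n : measurable (E n) by exact: measP.
have aeE n : ae_eq mu (E n) (EFin \o g) (cst 0%E).
  apply: integral_ae_eq => //.
  move=> S SE mS; rewrite integral_cst// mul0e.
  have -> : S = S `&` E n by apply/esym/setIidl.
  rewrite mP in mS; move: S mS {SE}; apply: (dynkin_induction mP PI).
  - by rewrite setTI; exact: g0.
  - by move=> A PA; apply: g0; exact: PI.
  - move=> S mS S0.
    have e : (\int[mu]_(x in (S `&` E n) `|` (~` S `&` E n)) (EFin \o g) x =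
       \int[mu]_(x in S `&` E n) (EFin \o g) x +
       \int[mu]_(x in ~` S `&` E n) (EFin \o g) x)%E.
      apply: integral_setU.
      + exact: measurableI.
      + by apply: measurableI => //; exact: measurableC.
      + by apply/measurable_EFinP; exact: measurable_funTS.
      + by rewrite disj_set2E; apply/eqP; rewrite setIACA setICr set0I.
    by move: e; rewrite -setIUl setUv setTI S0 add0e => <-; exact: g0.
  - move=> F mF tF F0; rewrite setI_bigcupl integral_bigcup//.
    + by apply: eseries0 => i _ _; exact: F0.
    + exact: trivIset_setIr.
    + by move=> k; exact: measurableI.
    + apply: integrableS (ig n) => //; rewrite -?setI_bigcupl//.
      by apply: measurableI => //; exact: bigcup_measurable.
have : \forall x \ae mu, forall n, E n x -> (g x)%:E = 0%E by exact: ae_foralln.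
apply: filterS => x gx; have : (\bigcup_n E n) x by rewrite Ecover.
by move=> [n _ /gx[]].
Qed.

Lemma cls_orth0 (f : T -> C) : f \in sqint mu ->
  (forall A, P A -> ip (cls mu (fun x => (\1_A x)%:C)) (cls mu f) = 0) -> cls mu f = 0.
Proof.
move=> f2 h; have [mf i2] := (sqintP mu f).1 f2; have [mre mim] := mf.
have ind A : P A -> (fun x => (\1_A x)%:C) \in sqint mu.
  move=> PA; apply/sqintP; split; first by apply: cmeas_real; exact: measurable_indic (measP PA).
  rewrite (eq_integral (fun x => (\1_A x)%:E)) ?integral_indic ?setIT//; try exact: measP.
    exact: Poo.
  by move=> x _; rewrite sqnR indicE; case: (x \in A); rewrite ?expr1n ?expr0n.
have key (g : T -> R) : measurable_fun setT g ->
    (forall x, g x ^+ 2 <= sqn (f x)) ->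
    (forall A, P A -> fine (\int[mu]_x (g x * \1_A x)%:E) = 0) ->
    \forall x \ae mu, g x = 0.
  move=> mg gf gA.
  have ig A : P A -> mu.-integrable A (EFin \o g).
    move=> PA; have mA := measP PA; apply/integrableP; split.
      by apply/measurable_EFinP; exact: measurable_funTS.
    (* On a set of finite measure, |g| <= 1 + |f|^2 makes the square-integrable function
       integrable. *)
    apply: (@le_lt_trans _ _ (\int[mu]_(x in A) ((1 + sqn (f x))%:E))%E).
      apply: ge0_le_integral => //.
      - apply: measurable_funTS; apply/measurable_EFinP.
        exact: (measurableT_comp (@normr_measurable _ setT) mg).
      - apply: measurable_funTS; apply/measurable_EFinP.
        by apply: (@measurable_funD _ _ _ _ (cst 1)) (cmeas_sqn mf); exact: measurable_cst.
      - move=> x _ /=; rewrite lee_fin.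
        by have := gf x; rewrite -[X in X <= _ -> _]real_normK ?num_real//; nra.
    under eq_integral do rewrite EFinD.
    rewrite ge0_integralD//; last 2 first.
    - by move=> x _; rewrite lee_fin sqn_ge0.
    - by apply: measurable_funTS; exact: cmeas_esqn.
    rewrite integral_cst// mul1e lte_add_pinfty//; first exact: Poo.
    apply: le_lt_trans i2; apply: ge0_subset_integral => //.
    - exact: cmeas_esqn.
    - by move=> x _; rewrite lee_fin sqn_ge0.
  apply: real_orth0 => //; first by move=> n; exact: ig.
  move=> A PA; have mA := measP PA; have := gA _ PA.
  have -> : (\int[mu]_x (g x * \1_A x)%:E = \int[mu]_(x in A) (g x)%:E)%E.
    rewrite [RHS]integral_mkcond; apply: eq_integral => x _.
    by rewrite patchE indicE; case: (x \in A); rewrite ?mulr1 ?mulr0.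
  move=> fi; rewrite -[LHS]fineK ?fi//; exact: integrable_fin_num (ig _ PA).
have reim A : P A -> fine (\int[mu]_x (complex.Re (f x) * \1_A x)%:E) = 0 /\
                     fine (\int[mu]_x (complex.Im (f x) * \1_A x)%:E) = 0.
  move=> PA; have := h _ PA; rewrite ip_cls//; last exact: ind.
  rewrite /cint => -[]; set a := (X in fine X = _) => a0; set b := (X in fine X = _) => b0.
  split; [rewrite -[RHS]a0|rewrite -[RHS]b0]; congr fine; apply: eq_integral => x _; congr EFin;
    by case: (f x) => u v /=; rewrite oppr0 !(mulr0, subr0, addr0, add0r).
have r0 : \forall x \ae mu, complex.Re (f x) = 0.
  by apply: key => // [x|A /reim[]//]; rewrite lerDl sqr_ge0.
have m0 : \forall x \ae mu, complex.Im (f x) = 0.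
  by apply: key => // [x|A /reim[]//]; rewrite lerDr sqr_ge0.
rewrite -cls0; apply/cls_eqP => //; first exact: sqint0.
by apply: filterS2 r0 m0 => x /=; case: (f x) => a b /= -> ->.
Qed.

End Density.

Section Wco.
Context d (T : measurableType d) d' (T' : measurableType d') (R : realType).
Local Notation C := R[i].
Variables (m : {measure set T -> \bar R}) (n : {measure set T' -> \bar R}).

(** A representative is chosen so that the operator is total; under [wcb] the result is independent
    of the choice ([wcoE]), because the bound also applies to the difference of two
    representatives. *)
Definition wco (c : T' -> C) (phi : T' -> T) (u : L2space m) : L2space n :=
  cls n (fun y => c y * (generic_quotient.repr u : sqfun m) (phi y)).

(** The last clause says that the image under [phi] of the measure |c|^2 n is at most M m, that is,
    the squared operator norm is at most M. It is tested on nonnegative functions, the only form in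
    which the measures here are known. *)
Definition wcb (c : T' -> C) (phi : T' -> T) (M : R) : Prop :=
  [/\ cmeas c, measurable_fun setT phi, 0 <= M &
    forall F : T -> \bar R, measurable_fun setT F -> (forall x, 0 <= F x)%E ->
    (\int[n]_y ((sqn (c y))%:E * F (phi y)) <= M%:E * \int[m]_x F x)%E].

Variables (c : T' -> C) (phi : T' -> T) (M : R).
Hypothesis cb : wcb c phi M.

Let comp_meas f : cmeas f -> cmeas (fun y => c y * f (phi y)).
Proof.
have [mc mphi _ _] := cb; move=> mf; apply: cmeasM => //.
by have [? ?] := cmeas_comp mphi mf.
Qed.

Let int_le f : cmeas f ->
  (\int[n]_y (sqn (c y * f (phi y)))%:E <= M%:E * \int[m]_x (sqn (f x))%:E)%E.
Proof.
have [mc mphi _ le] := cb; move=> mf.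
under eq_integral do rewrite sqnM EFinM.
apply: (le (fun x => (sqn (f x))%:E)); first exact: cmeas_esqn.
by move=> x; rewrite lee_fin sqn_ge0.
Qed.

Lemma wcb_sqint f : f \in sqint m -> (fun y => c y * f (phi y)) \in sqint n.
Proof.
have [_ _ M0 _] := cb; move=> /sqintP[mf i]; apply/sqintP; split; first exact: comp_meas.
by apply: le_lt_trans (int_le mf) _; rewrite lte_mul_pinfty// lee_fin.
Qed.

Let hnorm_le f : f \in sqint m ->
  hnorm (cls n (fun y => c y * f (phi y))) ^+ 2 <= M * hnorm (cls m f) ^+ 2.
Proof.
move=> f2; rewrite -lee_fin [leRHS]EFinM !hnorm_cls//; last exact: wcb_sqint.
exact: (int_le (sqint_meas f2)).
Qed.

Lemma wcoE f : f \in sqint m -> wco c phi (cls m f) = cls n (fun y => c y * f (phi y)).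
Proof.
move=> f2; rewrite /wco; set g : sqfun m := generic_quotient.repr _.
have g2 : (g : T -> C) \in sqint m by exact: (valP g).
have gE : cls m g = cls m f.
  rewrite /cls (_ : insubd _ _ = g); first exact: generic_quotient.reprK.
  by apply: val_inj; rewrite val_insubd g2.
apply/eqP; rewrite -subr_eq0 -hnorm_eq0 -sqrf_eq0 eq_le sqr_ge0 andbT.
rewrite -clsB; try exact: wcb_sqint.
under eq_fun do rewrite -mulrBr.
apply: le_trans (hnorm_le (sqintB g2 f2)) _.
by rewrite clsB// gE subrr hnorm0 expr0n mulr0.
Qed.

Lemma wco_le u : hnorm (wco c phi u) ^+ 2 <= M * hnorm u ^+ 2.
Proof. by have [f f2 ->] := cls_surj u; rewrite wcoE//; exact: hnorm_le. Qed.

Lemma wco_bop : bounded_op (wco c phi).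
Proof.
split=> [a u v|].
  have [f f2 ->] := cls_surj u; have [g g2 ->] := cls_surj v.
  rewrite -clsDZ// !wcoE//; last by apply: sqintD => //; exact: sqintZ.
  rewrite -clsDZ; try exact: wcb_sqint.
  by congr cls; apply/funext => y; rewrite mulrDr mulrCA.
exists (Num.sqrt M) => u; have [_ _ M0 _] := cb.
rewrite -ler_sqr ?nnegrE ?mulr_ge0 ?hnorm_ge0 ?sqrtr_ge0//.
rewrite exprMn (sqr_sqrtr M0). apply wco_le.
Qed.

Lemma wco_uniq (A : L2space m -> L2space n) :
  (forall f, f \in sqint m -> A (cls m f) = cls n (fun y => c y * f (phi y))) ->
  A = wco c phi.
Proof. by move=> h; apply/funext => u; have [f f2 ->] := cls_surj u; rewrite wcoE// h. Qed.

Lemma wco_norm (h : T -> R) f : f \in sqint m ->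
  (\int[n]_y ((sqn (c y))%:E * (sqn (f (phi y)))%:E) = \int[m]_x (h x * sqn (f x))%:E)%E ->
  ((hnorm (wco c phi (cls m f)) ^+ 2)%:E = \int[m]_x (h x * sqn (f x))%:E)%E.
Proof.
move=> f2 hE; rewrite wcoE// hnorm_cls; last exact: wcb_sqint.
by rewrite -hE; apply: eq_integral => y _; rewrite sqnM EFinM.
Qed.

End Wco.

Section Mult.
Context d (T : measurableType d) (R : realType).
Local Notation C := R[i].
Variable m : {measure set T -> \bar R}.

Lemma wcb_mult (c : T -> C) (M : R) : cmeas c -> 0 <= M ->
  (forall x, sqn (c x) <= M) -> wcb m m c id M.
Proof.
move=> mc M0 cM; split=> // F mF F0.
rewrite -ge0_integralZl_EFin//; apply: ge0_le_integral => //.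
- by move=> x _; rewrite mule_ge0// lee_fin sqn_ge0.
- by apply: emeasurable_funM => //; exact: cmeas_esqn.
- by apply: measurable_funeM.
- by move=> x _; rewrite lee_wpmul2r// lee_fin.
Qed.

End Mult.

(** * Completeness of L2 *)

Section Completeness.
Variable R : realType.
Let q : R := 4^-1.

Let q0 k : 0 < q ^+ k. Proof. by rewrite exprn_gt0// invr_gt0. Qed.

(** For ratio 1/4 the sequences a_k - 2 c q^k and a_k + 2 c q^k are monotone and bracket the limit,
    since 2 c q^k exceeds 2 c q^{k+1} by more than c q^k. This gives the rate together with the
    limit. *)
Lemma geom_limit (a : nat -> R) (c : R) : 0 <= c ->
  (forall k, `|a k.+1 - a k| <= c * q ^+ k) ->
  exists l, a @ \oo --> l /\ forall k, `|l - a k| <= 2 * c * q ^+ k.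
Proof.
move=> c0 h; pose b k := a k - 2 * c * q ^+ k; pose e k := a k + 2 * c * q ^+ k.
have cq k : 0 <= c * q ^+ k by rewrite mulr_ge0// ltW.
have bi : nondecreasing_seq b.
  apply/nondecreasing_seqP => k; rewrite /b exprS /q.
  have := h k; rewrite ler_norml => /andP[h1 _]; have := cq k; rewrite /q; lra.
have ed : nonincreasing_seq e.
  apply/nonincreasing_seqP => k; rewrite /e exprS /q.
  have := h k; rewrite ler_norml => /andP[_ h1]; have := cq k; rewrite /q; lra.
have be j k : b j <= e k.
  apply: le_trans (bi _ _ (leq_maxl j k)) _.
  apply: le_trans _ (ed _ _ (leq_maxr j k)); rewrite /b /e.
  by have := cq (maxn j k); lra.
have bc : cvgn b.
  by apply: nondecreasing_is_cvgn => //; exists (e 0%N) => _ [k _ <-].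
have bl k : b k <= limn b by apply: nondecreasing_cvgn_le.
have el k : limn b <= e k by apply: limr_le => //; apply: nearW => j; exact: be.
exists (limn b); split; last first.
  by move=> k; rewrite ler_norml; have := bl k; have := el k; rewrite /b /e; lra.
have -> : a = b \+ (fun k => geometric (2 * c) q k).
  by apply/funext => k; rewrite /= /b /geometric /= subrK.
rewrite -[X in _ --> X]addr0; apply: cvgD => //; apply: cvg_geometric.
by rewrite ger0_norm ?invr_ge0// invf_lt1// ltr1n.
Qed.

Context d (T : measurableType d) (mu : {measure set T -> \bar R}).
Local Notation C := R[i].

(** Riesz-Fischer: a subsequence with geometrically small increments converges pointwise almost
    everywhere, with an error dominated by one integrable function, and the Cauchy property brings
    the whole sequence along. *)
Lemma hilbert_L2 : hilbert (L2space mu).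
Proof.
move=> u cauchy.
have /choice[N NP] : forall k, exists N, forall i j, (N <= i)%N -> (N <= j)%N ->
    hnorm (u i - u j) < q ^+ k ^+ 2 / 2.
  by move=> k; apply: cauchy; rewrite divr_gt0// exprn_gt0.
pose n k := (\max_(i < k.+1) N i)%N.
have nN k : (N k <= n k)%N by exact: (leq_bigmax (ord_max : 'I_k.+1)).
have nS k : (N k <= n k.+1)%N.
  exact: (@leq_bigmax _ (fun i : 'I_k.+2 => N i) (widen_ord (leqnSn _) (ord_max : 'I_k.+1))).
have /choice[f fP] : forall k, exists g, g \in sqint mu /\ u (n k) = cls mu g.
  by move=> k; have [g ? ->] := cls_surj (u (n k)); exists g.
have f2 k : f k \in sqint mu by have [] := fP k.
have uf k : u (n k) = cls mu (f k) by have [] := fP k.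
pose v k x := f k.+1 x - f k x.
have v2 k : v k \in sqint mu by exact: sqintB.
have vle k : (\int[mu]_x (sqn (v k x))%:E <= (q ^+ k ^+ 2 * (q ^+ k ^+ 2 / 4))%:E)%E.
  rewrite -hnorm_cls// clsB// -!uf lee_fin.
  have := ltW (NP k _ _ (nS k) (nN k)); have := hnorm_ge0 (u (n k.+1) - u (n k)).
  by move: (hnorm _) (q ^+ k ^+ 2) => x y; nra.
(* The factors q^{-2k} make finiteness of [S x] equivalent to more than summability: it bounds
   |v_k(x)|^2 by S(x) q^{2k}, the input of [geom_limit]. The increments were chosen small enough for
   [S] to be integrable all the same. *)
pose S x : \bar R := (\sum_(k <oo) ((q ^+ k ^+ 2)^-1 * sqn (v k x))%:E)%E.
have t0 k x : (0 <= ((q ^+ k ^+ 2)^-1 * sqn (v k x))%:E)%E.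
  by rewrite lee_fin mulr_ge0 ?sqn_ge0// invr_ge0 ltW// exprn_gt0.
have mt k : measurable_fun setT (fun x => ((q ^+ k ^+ 2)^-1 * sqn (v k x))%:E).
  apply/measurable_EFinP; apply: measurable_funM => //.
  exact/cmeas_sqn/sqint_meas.
have mS : measurable_fun setT S by apply: ge0_emeasurable_sum.
have S0 x : (0 <= S x)%E by apply: nneseries_ge0.
have Sfin : (\int[mu]_x S x < +oo)%E.
  rewrite /S integral_nneseries//.
  apply: (@le_lt_trans _ _ (\sum_(k <oo) (1 / (2 ^ (k + 1))%:R)%:E)%E).
    apply: lee_nneseries => k _; first by rewrite integral_ge0.
    under eq_integral do rewrite EFinM.
    have q2 : 0 < q ^+ k ^+ 2 by rewrite exprn_gt0.
    rewrite ge0_integralZl_EFin//; first last.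
    - by rewrite invr_ge0 ltW.
    - exact/cmeas_esqn/sqint_meas.
    - by move=> x _; rewrite lee_fin sqn_ge0.
    apply: (@le_trans _ _ ((q ^+ k ^+ 2)^-1%:E * (q ^+ k ^+ 2 * (q ^+ k ^+ 2 / 4))%:E)%E).
      by apply: lee_wpmul2l; [rewrite lee_fin invr_ge0 ltW|exact: vle].
    rewrite -EFinM mulKf ?gt_eqF// lee_fin addn1 expnS natrM -exprM mulnC exprM div1r invfM.
    rewrite [leRHS]mulrC; apply: ler_pM => //.
    - by rewrite exprn_ge0// exprn_ge0// invr_ge0.
    - rewrite natrX -exprVn; apply: lerXn2r; rewrite ?nnegrE ?exprn_ge0 ?invr_ge0//.
      by rewrite /q expr2; lra.
    - by rewrite lef_pV2 ?posrE// ler_nat.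
  by rewrite (cvg_lim _ (@cvg_geometric_eseries_half R 1 0)) ?ltry.
pose c := fine (\int[mu]_x S x).
have cE : (\int[mu]_x S x = c%:E)%E.
  by rewrite fineK// ge0_fin_numE// integral_ge0.
have c0 : 0 <= c by rewrite fine_ge0// integral_ge0.
pose E := [set x | (S x < +oo)%E].
have mE : measurable E.
  by rewrite /E -[X in measurable X]setTI; apply: emeasurable_fun_infty_o => //.
have vS k x : E x -> sqn (v k x) <= fine (S x) * q ^+ k ^+ 2.
  move=> Ex; have r0 : 0 < q ^+ k ^+ 2 by rewrite exprn_gt0.
  rewrite -[sqn _](mulVKf (lt0r_neq0 r0)) [leRHS]mulrC ler_pM2l//.
  rewrite -lee_fin fineK ?ge0_fin_numE//.
  apply: le_trans _ (nneseries_lim_ge k.+1 _); last by move=> j _ _; exact: t0.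
  by rewrite big_nat_recr//= leeDr// sume_ge0.
have key (pr : C -> R) : (forall z, pr z ^+ 2 <= sqn z) ->
    (forall z w, pr (z - w) = pr z - pr w) ->
    (forall g : T -> C, cmeas g -> measurable_fun setT (fun x => pr (g x))) ->
  exists2 g : T -> R, measurable_fun setT g & forall x, E x ->
    forall k, (g x - pr (f k x)) ^+ 2 <= 4 * fine (S x) * q ^+ k ^+ 2.
  move=> prle prB prm.
  (* Multiplying by [\1_E] makes the sequence converge everywhere, to 0 off [E], so that the limit
     is measurable on the whole space. *)
  have /choice[g gP] : forall x, exists l, [/\
      (fun k => \1_E x * pr (f k x)) @ \oo --> l &
      E x -> forall k, `|l - pr (f k x)| <= 2 * Num.sqrt (fine (S x)) * q ^+ k].
    move=> x; have [Ex|nEx] := pselect (E x); last first.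
      by exists 0; split=> //; rewrite indicE memNset//; under eq_fun do rewrite mul0r; exact: cvg_cst.
    have [||l [la lk]] := @geom_limit (fun k => pr (f k x)) (Num.sqrt (fine (S x))).
    - exact: sqrtr_ge0.
    - move=> k; rewrite -ler_sqr ?nnegrE// ?mulr_ge0 ?sqrtr_ge0 ?(ltW (q0 _))//.
      rewrite exprMn sqr_sqrtr ?fine_ge0// real_normK ?num_real// -prB.
      by apply: le_trans (prle _) _; exact: vS.
    by exists l; split=> //; rewrite indicE mem_set//; under eq_fun do rewrite mul1r.
  exists g => [|x Ex k].
    apply: (@measurable_fun_cvg _ _ _ setT (fun k x => \1_E x * pr (f k x))).
      by move=> k; apply: measurable_funM => //; exact: (prm _ (sqint_meas (f2 k))).
    by move=> x _; have [] := gP x.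
  have [_ /(_ Ex k) h] := gP x.
  rewrite -[leLHS]real_normK ?num_real//.
  have -> : 4 * fine (S x) * q ^+ k ^+ 2 = (2 * Num.sqrt (fine (S x)) * q ^+ k) ^+ 2.
    by rewrite !exprMn sqr_sqrtr ?fine_ge0// -natrX.
  by rewrite ler_sqr// nnegrE !mulr_ge0 ?sqrtr_ge0 ?(ltW (q0 _)).
have [|||g1 mg1 h1] := key (@complex.Re R).
- by move=> z; rewrite lerDl sqr_ge0.
- by move=> [? ?] [? ?].
- by move=> g [].
have [|||g2 mg2 h2] := key (@complex.Im R).
- by move=> z; rewrite lerDr sqr_ge0.
- by move=> [? ?] [? ?].
- by move=> g [].
pose g x : C := g1 x +i* g2 x.
have mg : cmeas g by [].
(* The factor 8 adds 4 for the real and 4 for the imaginary part; where [S] is infinite the bound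
   holds trivially. *)
have gf k x : ((sqn (g x - f k x))%:E <= (8 * q ^+ k ^+ 2)%:E * S x)%E.
  have q2 : 0 < q ^+ k ^+ 2 by rewrite exprn_gt0.
  have [Ex|] := pselect (E x); last first.
    by move/negP; rewrite -leNgt leye_eq => /eqP->; rewrite gt0_muley ?leey// lte_fin mulr_gt0.
  rewrite -[S x]fineK ?ge0_fin_numE// -EFinM lee_fin /sqn.
  have := h1 x Ex k; have := h2 x Ex k; rewrite /g; case: (f k x) => a b /=.
  by move: (q ^+ k ^+ 2) (fine _) => r s; lra.
have q8 k : 0 <= 8 * q ^+ k ^+ 2 by rewrite mulr_ge0// exprn_ge0// ltW.
have iS k : (\int[mu]_x ((8 * q ^+ k ^+ 2)%:E * S x) = (8 * q ^+ k ^+ 2 * c)%:E)%E.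
  by rewrite ge0_integralZl_EFin//; rewrite cE -EFinM.
have gf2 k : (fun x => g x - f k x) \in sqint mu.
  apply/sqintP; split.
    apply: cmeasD => //; have [a b] := sqint_meas (f2 k).
    by split; [rewrite (_ : (fun x => _) = \- (fun x => complex.Re (f k x)))|
      rewrite (_ : (fun x => _) = \- (fun x => complex.Im (f k x)))];
      try exact: measurable_funN; apply/funext => x /=; case: (f k x).
  apply: (@le_lt_trans _ _ (\int[mu]_x ((8 * q ^+ k ^+ 2)%:E * S x))%E).
    apply: ge0_le_integral => //.
    - by move=> x _; rewrite lee_fin sqn_ge0.
    - apply/cmeas_esqn; apply: cmeasD => //; have [a b] := sqint_meas (f2 k).
      by split; [rewrite (_ : (fun x => _) = \- (fun x => complex.Re (f k x)))|
        rewrite (_ : (fun x => _) = \- (fun x => complex.Im (f k x)))];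
        try exact: measurable_funN; apply/funext => x /=; case: (f k x).
    - exact: measurable_funeM.
  by rewrite iS ltry.
have g2' : g \in sqint mu.
  by have := sqintD (gf2 0%N) (f2 0%N); under eq_fun do rewrite subrK.
have le k : hnorm (cls mu g - u (n k)) <= Num.sqrt (8 * c) * q ^+ k.
  rewrite -ler_sqr ?nnegrE ?hnorm_ge0 ?mulr_ge0 ?sqrtr_ge0 ?(ltW (q0 _))//.
  have c8 : 0 <= 8 * c by rewrite mulr_ge0.
  rewrite exprMn (sqr_sqrtr c8).
  rewrite uf -(clsB g2' (f2 k)) -lee_fin (hnorm_cls (gf2 k)).
  apply: (@le_trans _ _ (\int[mu]_x ((8 * q ^+ k ^+ 2)%:E * S x))%E).
    apply: ge0_le_integral => //.
    - by move=> x _; rewrite lee_fin sqn_ge0.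
    - exact/cmeas_esqn/sqint_meas.
    - exact: measurable_funeM.
  rewrite iS lee_fin.
  by rewrite mulrAC.
exists (cls mu g); apply/cvgrPdist_lt => e e0.
have : geometric (Num.sqrt (8 * c) + 1) q @ \oo --> (0 : R).
  by apply: cvg_geometric; rewrite ger0_norm ?invr_ge0// invf_lt1// ltr1n.
move/cvgrPdist_lt/(_ _ e0) => [k _ /(_ k (leqnn _))].
rewrite sub0r normrN ger0_norm ?mulr_ge0 ?addr_ge0 ?sqrtr_ge0 ?(ltW (q0 _))// => ke.
exists (N k) => // i /= ki; rewrite sub0r normrN ger0_norm ?hnorm_ge0//.
apply: le_lt_trans ke; apply: le_trans (hdistD (u (n k)) _ _) _.
have := ltW (NP k _ _ ki (nN k)); have := le k; rewrite (hdistC (cls mu g)).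
have : q ^+ k ^+ 2 <= q ^+ k.
  by rewrite expr2 ler_piMl ?(ltW (q0 _))// exprn_ile1 ?invr_ge0// invf_le1// ler1n.
have := q0 k; rewrite /geometric /=; move: (q ^+ k ^+ 2) (q ^+ k) => x y; lra.
Qed.

End Completeness.

(** * Continuous functions with compact support *)

Section LCH.
Variables (R : realType) (X : ptopologicalType).
Hypothesis lc : locally_compact [set: X].
Hypothesis hd : hausdorff_space X.

Definition supp_in (W : set X) (f : X -> R) : Prop :=
  [/\ continuous f, compact (closure [set x | f x != 0]) &
      [set x | f x != 0] `<=` W].

Lemma compact_nbhd (x : X) : exists2 Q, nbhs x Q & compact Q /\ closed Q.
Proof.
have [Q xQ [cQ clQ]] := @lc x Logic.I; exists Q => //.
by move: xQ; rewrite withinET.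
Qed.

Lemma closure_compact (A Q : set X) : A `<=` Q -> compact Q -> compact (closure A).
Proof.
move=> AQ cQ; apply: (subclosed_compact _ cQ); first exact: closed_closure.
by rewrite (closure_id Q).1; [exact: closure_subset|exact: compact_closed].
Qed.

Lemma point_bump (x : X) (W : set X) : open W -> W x ->
  exists f, supp_in W f /\ (forall y, 0 <= f y <= 1) /\ f x = 1.
Proof.
move=> oW Wx; have [Q xQ [cQ clQ]] := compact_nbhd x.
pose O := W `&` Q^°.
have oO : open O by apply: openI => //; exact: open_interior.
have Ox : O x by split=> //.
have := @locally_compact_completely_regular X R lc hd x (~` O) (open_closedC oO).
move=> /(_ _); have nOx : ~ (~` O) x by apply.
move=> /(_ nOx) /(@uniform_separatorP _ R)[f [cf f01 fx fO]].
exists (fun y => 1 - f y).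
have f1 y : ~ O y -> f y = 1 by move=> nO; apply: fO; exists y.
have sub : [set y | 1 - f y != 0] `<=` O.
  by move=> y /= h; apply: contrapT => /f1 fy; move: h; rewrite fy subrr eqxx.
split; [split|split].
- by move=> y; apply: cvgB; [exact: cvg_cst|exact: cf].
- apply: (@closure_compact _ Q) => //; apply: subset_trans sub _ => y [_].
  exact: interior_subset.
- by apply: subset_trans sub _ => y [].
- move=> y; have : `[0, 1]%classic (f y) by apply: f01; exists y.
  by rewrite /= in_itv /=; lra.
- have -> : f x = 0 by apply: fx; exists x.
  by rewrite subr0.
Qed.

Lemma supp_inD W f g : supp_in W f -> supp_in W g -> supp_in W (fun x => f x + g x).
Proof.
move=> [cf kf fW] [cg kg gW].
have sub : [set x | f x + g x != 0] `<=` [set x | f x != 0] `|` [set x | g x != 0].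
  move=> x /= h; have [fx|] := eqVneq (f x) 0; last by left.
  by right; move: h; rewrite fx add0r.
split=> [x||]; first exact: cvgD (cf x) (cg x).
- apply: (@closure_compact _ (closure [set x | f x != 0] `|` closure [set x | g x != 0])).
    by apply: subset_trans sub _; apply: setUSS; exact: subset_closure.
  exact: compactU.
- by apply: subset_trans sub _ => x [/fW|/gW].
Qed.

Lemma supp_in_comp W f (h : R -> R) : continuous h -> h 0 = 0 -> supp_in W f ->
  supp_in W (h \o f).
Proof.
move=> ch h0 [cf kf fW].
have sub : [set x | (h \o f) x != 0] `<=` [set x | f x != 0].
  by move=> x /=; apply: contraNN => /eqP->; rewrite h0.
split.
- by move=> x; apply: continuous_comp; [exact: cf|exact: ch].
- by apply: closure_compact kf; apply: subset_trans sub (@subset_closure _ _).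
- exact: subset_trans sub fW.
Qed.

Lemma urysohn_bump (K W : set X) : compact K -> open W -> K `<=` W ->
  exists f, supp_in W f /\ (forall y, 0 <= f y <= 1) /\ (forall x, K x -> f x = 1).
Proof.
move=> cK oW KW.
have /choice[g gP] : forall x, exists f, W x ->
    supp_in W f /\ (forall y, 0 <= f y <= 1) /\ f x = 1.
  move=> x; have [Wx|nW] := pselect (W x); last by exists (fun=> 0).
  by have [f h] := point_bump oW Wx; exists f.
have : cover_compact K by rewrite -compact_cover.
move=> /(_ X W (fun x => [set y | W x /\ 2^-1 < g x y])) [].
- move=> x Wx; have [[cg _ _] _] := gP x Wx.
  rewrite (_ : [set y | _] = g x @^-1` [set r | 2^-1 < r]).
    by apply: open_comp => [y _|]; [exact: cg|exact: open_gt].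
  by apply/seteqP; split=> y //= [].
- move=> x Kx; have Wx := KW _ Kx; exists x => //=; split=> //.
  by have [_ [_ ->]] := gP x Wx; rewrite invf_lt1// ltr1n.
move=> D DW Kcov.
have [h [hW h0 hg]] : exists h, [/\ supp_in W h, forall y, 0 <= h y &
    forall x, x \in (finmap.enum_fset D) -> forall y, g x y <= h y].
  have : forall x, x \in (finmap.enum_fset D) -> W x by move=> x /DW /set_mem.
  elim: (finmap.enum_fset D) => [|x s ih] sW.
    exists (fun=> 0); split=> //; split=> //; first by move=> x; exact: cvg_cst.
      by rewrite (_ : [set _ | _] = set0) ?closure0 //; [exact: compact0|];
        apply/seteqP; split=> y //=; rewrite eqxx.
    by move=> y /=; rewrite eqxx.
  have [|h [hW h0 hg]] := ih; first by move=> y ys; apply: sW; rewrite inE ys orbT.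
  have [gW [g01 _]] := gP x (sW _ (mem_head _ _)).
  exists (fun y => g x y + h y); split.
  - exact: supp_inD.
  - by move=> y; rewrite addr_ge0//; have /andP[] := g01 y.
  - move=> z; rewrite inE => /orP[/eqP->|zs] y; first by rewrite lerDl.
    by rewrite (le_trans (hg _ zs y))// lerDr; have /andP[] := g01 y.
(* At each point of [K] one of the summands of [h] exceeds 1/2, so doubling and truncating at 1
   gives the value 1 there. *)
exists (fun y => Num.min 1 (2 * h y)); split; [|split].
- apply: (@supp_in_comp W h (fun r => Num.min 1 (2 * r))) => //.
    move=> r; apply: (@continuous_min _ _ (fun=> 1) (fun r : R => 2 * r)); first exact: cvg_cst.
    by apply: cvgMr; exact: cvg_id.
  by rewrite mulr0; apply/min_idPr.
- by move=> y; rewrite ge_min lexx /= le_min ler01 mulr_ge0.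
- move=> x /Kcov[z zD /= [Wz gz]]; apply/min_idPl.
  by have := hg z zD x; lra.
Qed.

Section SecondCountable.
Hypothesis sc : @second_countable X.

(** A pi-system that generates the Borel sets, covers the space by a sequence, and has finite
    measure for every measure finite on compact sets: the test sets of all Dynkin arguments
    below. *)
Definition precompact_opens : set (set X) := [set A | open A /\ compact (closure A)].

Lemma precompact_opensI : setI_closed precompact_opens.
Proof.
move=> A B [oA cA] [oB cB]; split; first exact: openI.
by apply: (@closure_compact _ (closure A)) => // x [Ax _]; exact: subset_closure.
Qed.

(** The basic open sets with compact closure inside [W] are enumerated through an injection of the
    countable base into the integers; an index that codes no such set yields the empty set. *)
Lemma open_seq (W : set X) : open W -> exists e : nat -> set X,
  W = \bigcup_n e n /\ forall n, [/\ open (e n), compact (closure (e n)) & closure (e n) `<=` W].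
Proof.
move=> oW; have [B cB [Bop Bb]] := sc.
have /countable_injP[f finj] := cB.
pose e n := [set x | exists A, [/\ B A, compact (closure A) /\ closure A `<=` W, f A = n & A x]].
have eA n A : B A -> compact (closure A) -> closure A `<=` W -> f A = n -> e n = A.
  move=> BA kA AW fA; apply/seteqP; split=> x; last by exists A.
  by move=> [A' [BA' _ fA' A'x]]; rewrite (finj A A') ?inE ?fA ?fA'.
have e0 n : e n = set0 \/ exists2 A, B A /\ compact (closure A) & closure A `<=` W /\ f A = n.
  have [->|/set0P[x [A [BA [kA AW] fA _]]]] := eqVneq (e n) set0; first by left.
  by right; exists A.
exists e; split.
  apply/seteqP; split=> x.
    move=> Wx; have [g [[cg kg gW] [g01 gx]]] := point_bump oW Wx.
    pose O := [set y | 2^-1 < g y].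
    have oO : open O.
      by apply: (@open_comp _ _ g [set r | 2^-1 < r]) => [y _|]; [exact: cg|exact: open_gt].
    have Ox : nbhs x O by apply: open_nbhs_nbhs; split=> //; rewrite /O /= gx invf_lt1// ltr1n.
    have [A [BA Ax] AO] := Bb x _ Ox.
    have clO : closure O `<=` [set y | 2^-1 <= g y].
      rewrite (closure_id [set y | 2^-1 <= g y]).1; last first.
        by apply: (@closed_comp _ _ g [set r | 2^-1 <= r]) => [y _|]; [exact: cg|exact: closed_ge].
      by apply: closure_subset => y /= /ltW.
    have AW : closure A `<=` W.
      move=> y /(closure_subset AO) /clO /= gy; apply: gW => /=; apply/eqP => g0.
      by move: gy; rewrite g0 invr_le0 lern0.
    exists (f A) => //; exists A; split=> //; split=> //.
    apply: closure_compact kg => y /AO /= gy; apply: subset_closure => /=.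
    by rewrite gt_eqF// (le_lt_trans _ gy)// invr_ge0.
  by move=> [n _ [A [_ [_ AW] _ Ax]]]; apply: AW; exact: subset_closure.
move=> n; have [->|[A [BA kA] [AW fA]]] := e0 n.
  by rewrite closure0; split=> //; [exact: open0|exact: compact0].
by rewrite (eA n A)//; split=> //; exact: Bop.
Qed.

Lemma precompact_opens_gen : (@measurable _ (borel X)) = <<s precompact_opens >>.
Proof.
apply/seteqP; split; last first.
  by apply: sub_sigma_algebra2 => A [].
apply: smallest_sub; first exact: smallest_sigma_algebra.
move=> W oW; have [e [-> eP]] := open_seq oW.
apply: (@sigma_algebra_bigcup _ _ _ e) => n.
by apply: sub_sigma_algebra; have [? ? _] := eP n.
Qed.

Lemma precompact_cover : exists E : nat -> set X,
  (forall n, precompact_opens (E n)) /\ \bigcup_n E n = setT.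
Proof.
have [e [eT eP]] := open_seq openT; exists e; split=> // n.
by have [] := eP n.
Qed.

Lemma indic_bumps (A : set X) : open A -> exists f : nat -> X -> R,
  [/\ forall n, supp_in A (f n), forall n x, 0 <= f n x <= 1 &
      forall x, A x -> exists N, forall n, (N <= n)%N -> f n x = 1].
Proof.
move=> oA; have [e [Ae eP]] := open_seq oA.
pose K n := \big[setU/set0]_(i < n) closure (e i).
have /choice[f fP] : forall n, exists f, supp_in A f /\ (forall y, 0 <= f y <= 1) /\
    (forall x, K n x -> f x = 1).
  move=> n; apply: urysohn_bump => //.
    by apply: bigsetU_compact => i _; have [] := eP i.
  rewrite /K -(bigcup_mkord n (fun i => closure (e i))); apply: bigcup_sub => i _.
  by have [] := eP i.
exists f; split.
- by move=> n; have [] := fP n.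
- by move=> n x; have [_ []] := fP n.
- rewrite {1}Ae => x [N _ ex]; exists N.+1 => n Nn; have [_ [_]] := fP n; apply.
  by rewrite /K -(bigcup_mkord n (fun i => closure (e i))); exists N => //; exact: subset_closure.
Qed.

End SecondCountable.

End LCH.

Section Ccontinuous.
Variables (R : realType) (X : ptopologicalType).
Local Notation C := R[i].
Implicit Types f g : X -> C.

Lemma ccontD f g : ccontinuous f -> ccontinuous g -> ccontinuous (fun x => f x + g x).
Proof.
move=> [f1 f2] [g1 g2]; split=> x.
  rewrite (_ : (fun x => _) = (fun x => complex.Re (f x) + complex.Re (g x))).
    exact: cvgD (f1 x) (g1 x).
  by apply/funext => y; case: (f y) (g y) => ? ? [].
rewrite (_ : (fun x => _) = (fun x => complex.Im (f x) + complex.Im (g x))).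
  exact: cvgD (f2 x) (g2 x).
by apply/funext => y; case: (f y) (g y) => ? ? [].
Qed.

Lemma ccontM f g : ccontinuous f -> ccontinuous g -> ccontinuous (fun x => f x * g x).
Proof.
move=> [f1 f2] [g1 g2]; split=> x.
  rewrite (_ : (fun x => _) = (fun x => complex.Re (f x) * complex.Re (g x) -
     complex.Im (f x) * complex.Im (g x))).
    exact: cvgB (cvgM (f1 x) (g1 x)) (cvgM (f2 x) (g2 x)).
  by apply/funext => y; case: (f y) (g y) => ? ? [].
rewrite (_ : (fun x => _) = (fun x => complex.Re (f x) * complex.Im (g x) +
     complex.Im (f x) * complex.Re (g x))).
  exact: cvgD (cvgM (f1 x) (g2 x)) (cvgM (f2 x) (g1 x)).
by apply/funext => y; case: (f y) (g y) => ? ? [].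
Qed.

Lemma ccont_real (f : X -> R) : continuous f -> ccontinuous (fun x => (f x)%:C).
Proof. by move=> cf; split=> // x /=; exact: cvg_cst. Qed.

Lemma ccont_cst (c : C) : ccontinuous (fun _ : X => c).
Proof. by split=> x; exact: cvg_cst. Qed.

Lemma ccont_comp (Y : ptopologicalType) (p : X -> Y) (f : Y -> C) :
  continuous p -> ccontinuous f -> ccontinuous (fun x => f (p x)).
Proof.
move=> cp [f1 f2]; split=> x; first exact: (continuous_comp (cp x) (f1 _)).
exact: (continuous_comp (cp x) (f2 _)).
Qed.

Lemma ccont_sqn f : ccontinuous f -> continuous (fun x => sqn (f x)).
Proof.
by move=> [f1 f2] x; apply: cvgD; apply: cvgM; [exact: f1|exact: f1|exact: f2|exact: f2].
Qed.

Lemma ccont_meas f : ccontinuous f -> cmeas (f : borel X -> C).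
Proof.
have m (h : X -> R) : continuous h -> measurable_fun setT (h : borel X -> R).
  move=> ch; apply: (measurability _ (RGenOpens.measurableE R)) => _ [_ [a [b ->] <-]].
  rewrite setTI; apply: sub_sigma_algebra.
  by apply: open_comp => [x _|]; [exact: ch|exact: interval_open].
by move=> [f1 f2]; split; exact: m.
Qed.

Hypothesis hd : hausdorff_space X.

Lemma Cc_sub f g : Cc f -> ccontinuous g -> (forall x, f x = 0 -> g x = 0) -> Cc g.
Proof.
move=> [cf kf] cg fg; split=> //; apply: (@closure_compact _ hd _ _ _ kf) => x /= gx.
by apply: subset_closure => /=; apply: contraNN gx => /eqP/fg->.
Qed.

Lemma CcMr f g : Cc f -> ccontinuous g -> Cc (fun x => f x * g x).
Proof.
move=> fc cg; apply: (Cc_sub fc); first by apply: ccontM => //; case: fc.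
by move=> x ->; rewrite mul0r.
Qed.

Lemma CcZ a f : Cc f -> Cc (fun x => a * f x).
Proof.
move=> fc; apply: (Cc_sub fc); first by apply: ccontM; [exact: ccont_cst|case: fc].
by move=> x ->; rewrite mulr0.
Qed.

Lemma CcD f g : Cc f -> Cc g -> Cc (fun x => f x + g x).
Proof.
move=> [cf kf] [cg kg]; split; first exact: ccontD.
apply: (@closure_compact _ hd _ (closure [set x | f x != 0] `|` closure [set x | g x != 0])).
  move=> x /= h; have [fx|fx] := eqVneq (f x) 0; last by left; exact: subset_closure.
  by right; apply: subset_closure => /=; move: h; rewrite fx add0r.
exact: compactU.
Qed.

Lemma Cc0 : Cc (fun _ : X => 0 : C).
Proof.
split; first exact: ccont_cst.
rewrite (_ : [set _ | _] = set0) ?closure0; first exact: compact0.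
by apply/seteqP; split=> y //=; rewrite eqxx.
Qed.

Lemma CcB f g : Cc f -> Cc g -> Cc (fun x => f x - g x).
Proof.
move=> fc gc; rewrite (_ : (fun x => _) = (fun x => f x + -1 * g x)).
  by apply: CcD => //; exact: CcZ.
by apply/funext => x; rewrite mulN1r.
Qed.

Lemma supp_in_Cc W (f : X -> R) : supp_in W f -> Cc (fun x => (f x)%:C).
Proof.
move=> [cf kf _]; split; first exact: ccont_real.
rewrite (_ : [set x | (f x)%:C != 0] = [set x | f x != 0])//.
by apply/seteqP; split=> x /=; rewrite eq_complex /= eqxx andbT.
Qed.

Lemma Cc_bounded f : Cc f -> exists2 M, 0 < M & forall x, sqn (f x) <= M.
Proof.
move=> [cf kf]; have cs := ccont_sqn cf.
have : compact ((fun x => sqn (f x) : R^o) @` closure [set x | f x != 0]).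
  by apply: continuous_compact => //; apply: continuous_subspaceT; exact: cs.
move=> /compact_bounded[M [_ hM]]; exists (Num.max 1 (M + 1)); first by rewrite lt_max ltr01.
move=> x; have [->|fx] := eqVneq (f x) 0; first by rewrite sqn0 le_max ler01.
rewrite le_max; apply/orP; right; rewrite -[sqn _]ger0_norm ?sqn_ge0//.
apply: (hM (M + 1)); first by rewrite ltrDl.
by exists x => //; exact: subset_closure.
Qed.

Lemma Cc_bump f : locally_compact [set: X] -> Cc f -> exists a : X -> R,
  [/\ supp_in setT a, forall y, 0 <= a y <= 1 & forall x, f x != 0 -> a x = 1].
Proof.
move=> lc [cf kf]; have [a [sa [a01 a1]]] := urysohn_bump R lc hd kf (@openT X) (@subsetT _ _).
by exists a; split=> // x fx; apply: a1; exact: subset_closure.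
Qed.

End Ccontinuous.

Section Glue.
Variables (R : realType) (X : ptopologicalType).
Hypothesis lc : locally_compact [set: X].
Hypothesis hd : hausdorff_space X.

(* Local approximants [good] near each point of a compact set are glued along
   [h t' + (1 - h) t] for bump functions [h]. *)
Lemma glue (T : Type) (valid : T -> Prop) (good : T -> X -> Prop)
    (comb : (X -> R) -> T -> T -> T) (t0 : T) (K : set X) : valid t0 ->
  (forall h t' t, continuous h -> valid t' -> valid t -> valid (comb h t' t)) ->
  (forall h t' t x, 0 <= h x <= 1 -> (h x != 0 -> good t' x) ->
     (h x != 1 -> good t x) -> good (comb h t' t) x) ->
  compact K ->
  (forall x, K x -> exists U t, [/\ open U, U x, valid t & forall y, U y -> good t y]) ->
  exists t, valid t /\ forall x, K x -> good t x.
Proof.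
move=> v0 combV combP cK loc.
have /choice[Ut UP] : forall x, exists Ut : set X * T, K x ->
    [/\ open Ut.1, Ut.1 x, valid Ut.2 & forall y, Ut.1 y -> good Ut.2 y].
  move=> x; have [/loc[U [t h]]|nK] := pselect (K x); first by exists (U, t).
  by exists (set0, t0).
have : cover_compact K by rewrite -compact_cover.
move=> /(_ X K (fun x => (Ut x).1)) [].
- by move=> x /UP[].
- by move=> x Kx; exists x => //; have [] := UP _ Kx.
move=> D DK Kcov.
have DK' : forall x, x \in finmap.enum_fset D -> K x by move=> x /DK /set_mem.
have {}Kcov : forall x, K x -> exists2 z, z \in finmap.enum_fset D & (Ut z).1 x.
  by move=> x /Kcov[z zD Uz]; exists z.
have {}UP z (zD : z \in finmap.enum_fset D) := UP z (DK' z zD).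
elim: (finmap.enum_fset D) K cK Kcov UP {loc DK DK'} => [|z s ih] K cK Kcov UP.
  by exists t0; split=> // x /Kcov[].
have [oU _ vt gt] := UP z (mem_head _ _).
pose V := \bigcup_(w in [set w | w \in s]) (Ut w).1.
have UPs w : w \in s -> [/\ open (Ut w).1, (Ut w).1 w, valid (Ut w).2 &
    forall y, (Ut w).1 y -> good (Ut w).2 y].
  by move=> ws; apply: UP; rewrite inE ws orbT.
have oV : open V by apply: bigcup_open => w /= /UPs[].
have cK2 : compact (K `&` ~` (Ut z).1) by apply: compact_closedI => //; exact: open_closedC.
have K2V : K `&` ~` (Ut z).1 `<=` V.
  move=> x [/Kcov[w +] Uw nU]; rewrite inE => /orP[/eqP wz|ws].
    by exfalso; apply: nU; rewrite -wz.
  by exists w.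
have [h [[ch kh hV] [h01 h1]]] := urysohn_bump R lc hd cK2 oV K2V.
(* On the part of [K] outside the first neighbourhood [h] is 1, hence so is [h2] below. Where [h2]
   is nonzero, [h] exceeds 1/2, and [K3] is a compact set to which the induction hypothesis
   applies. *)
pose K3 := [set x | 2^-1 <= h x].
have h0 x : K3 x -> h x != 0.
  by rewrite /K3 /= => hx; rewrite gt_eqF// (lt_le_trans _ hx)// invr_gt0.
have cK3 : compact K3.
  apply: (subclosed_compact _ kh); last by move=> x /h0 hx; exact: subset_closure.
  by apply: (@closed_comp _ _ h [set r | 2^-1 <= r]) => [y _|]; [exact: ch|exact: closed_ge].
have [|t' [vt' gt']] := ih K3 cK3 _ UPs.
  by move=> x /h0 /hV[w ws Uw]; exists w.
pose h2 x := Num.max 0 (2 * h x - 1).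
exists (comb h2 t' (Ut z).2); split.
  apply: combV => // x; apply: (@continuous_max _ _ (fun=> 0) (fun y => 2 * h y - 1)).
    exact: cvg_cst.
  by apply: cvgB; [apply: cvgMr; exact: ch|exact: cvg_cst].
move=> x Kx; apply: combP.
- by rewrite le_max lexx /= ge_max ler01 /=; have := h01 x; lra.
- move=> h2x; apply: gt'; rewrite /K3 /= leNgt; apply/negP => hx; move: h2x.
  by rewrite /h2 (_ : Num.max _ _ = 0) ?eqxx//; apply/max_idPl; lra.
- move=> h2x; apply: gt; apply: contrapT => nU; move: h2x.
  rewrite /h2 h1//; rewrite (_ : Num.max _ _ = 1) ?eqxx//.
  by rewrite mulr1 (_ : 2 - 1 = 1 :> R); [apply/max_idPr|lra].
Qed.

End Glue.

(** * Approximation by sums of products of functions of one variable *)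

Section StoneWeierstrass.
Variables (R : realType) (X Y : ptopologicalType).
Local Notation C := R[i].
Hypotheses (lcX : locally_compact [set: X]) (hdX : hausdorff_space X).
Hypotheses (lcY : locally_compact [set: Y]) (hdY : hausdorff_space Y).

Inductive tsum (P : (X -> C) -> Prop) (Q : (Y -> C) -> Prop) : (X -> Y -> C) -> Prop :=
| tsum0 : tsum P Q (fun _ _ => 0)
| tsumA f g s : P f -> Q g -> tsum P Q s -> tsum P Q (fun x y => f x * g y + s x y).

Lemma tsumD P Q s t : tsum P Q s -> tsum P Q t -> tsum P Q (fun x y => s x y + t x y).
Proof.
elim=> [|f g u Pf Qg _ ih] ht.
  by rewrite (_ : (fun x y => _) = t)//; apply/funext => x; apply/funext => y; rewrite add0r.
rewrite (_ : (fun x y => _) = (fun x y => f x * g y + (u x y + t x y))).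
  by apply: tsumA => //; exact: ih.
by apply/funext => x; apply/funext => y; rewrite addrA.
Qed.

Lemma tsumM (P P' : (X -> C) -> Prop) (Q Q' : (Y -> C) -> Prop) a b s :
  (forall f, P f -> P' (fun x => a x * f x)) -> (forall g, Q g -> Q' (fun y => b y * g y)) ->
  tsum P Q s -> tsum P' Q' (fun x y => a x * b y * s x y).
Proof.
move=> aP bQ; elim=> [|f g u Pf Qg _ ih].
  rewrite (_ : (fun x y => _) = (fun _ _ => 0)); first exact: tsum0.
  by apply/funext => x; apply/funext => y; rewrite mulr0.
rewrite (_ : (fun x y => _) = (fun x y => (a x * f x) * (b y * g y) + a x * b y * u x y)).
  by apply: tsumA => //; [exact: aP|exact: bQ].
by apply/funext => x; apply/funext => y; rewrite mulrDr mulrACA.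
Qed.

Lemma sqn_convex (h : R) (z w : C) (e : R) : 0 <= h <= 1 ->
  (h != 0 -> sqn z <= e) -> (h != 1 -> sqn w <= e) -> sqn (h%:C * z + (1 - h)%:C * w) <= e.
Proof.
move=> h01; have [->|h0] := eqVneq h 0.
  by rewrite subr0 mul0r add0r mul1r => _; apply; rewrite eq_sym oner_eq0.
have [->|h1] := eqVneq h 1.
  by rewrite subrr mul0r addr0 mul1r => + _; apply.
move=> /(_ isT) + /(_ isT); case: z w => a b [c d]; rewrite /sqn /= => ze we.
have -> : (h * a - 0 * b + ((1 - h) * c - 0 * d)) ^+ 2 +
    (h * b + 0 * a + ((1 - h) * d + 0 * c)) ^+ 2 =
  h * (a ^+ 2 + b ^+ 2) + (1 - h) * (c ^+ 2 + d ^+ 2) -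
    h * (1 - h) * ((a - c) ^+ 2 + (b - d) ^+ 2) by ring.
have /andP[hp h1'] := h01; have h1p : 0 <= 1 - h by rewrite subr_ge0.
have : 0 <= h * (1 - h) * ((a - c) ^+ 2 + (b - d) ^+ 2).
  by rewrite !mulr_ge0// addr_ge0// sqr_ge0.
have := ler_wpM2l hp ze; have := ler_wpM2l h1p we; lra.
Qed.

Variables (T : ptopologicalType) (v : T -> X * Y).
Hypothesis vc : continuous v.
Hypothesis vcl : closed (range v).
Hypothesis vinit : forall p W, nbhs p W -> exists2 O, nbhs (v p) O & v @^-1` O `<=` W.

Let cc (Z : ptopologicalType) : (Z -> C) -> Prop := @ccontinuous R Z.

Let tsum_comb (h : X -> R) (k : Y -> R) s t : continuous h -> continuous k ->
  tsum (cc (Z:=X)) (cc (Z:=Y)) s -> tsum (cc (Z:=X)) (cc (Z:=Y)) t ->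
  tsum (cc (Z:=X)) (cc (Z:=Y)) (fun x y => (h x)%:C * (k y)%:C * s x y).
Proof.
move=> ch ck hs ht; apply: (tsumM (a := fun x => (h x)%:C) (b := fun y => (k y)%:C) _ _ hs).
  by move=> f cf; apply: ccontM => //; exact: ccont_real.
by move=> f cf; apply: ccontM => //; exact: ccont_real.
Qed.

(** Gluing is applied twice: over y near a fixed x, keeping track of an open set on which the
    approximation holds, and then over x. The local approximants are constants: the value of [w]
    near a point of the range of [v], and 0 near any other point, where closedness of the range
    leaves nothing to approximate. *)
Lemma tsum_approx (w : T -> C) (K1 : set X) (K2 : set Y) (e : R) : 0 < e ->
  ccontinuous w -> compact K1 -> compact K2 ->
  exists s, tsum (cc (Z:=X)) (cc (Z:=Y)) s /\
    forall p, K1 (v p).1 -> K2 (v p).2 -> sqn (w p - s (v p).1 (v p).2) <= e.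
Proof.
move=> e0 cw cK1 cK2.
have c1 (Z : ptopologicalType) : continuous (fun _ : Z => 1 : R) by move=> x; exact: cvg_cst.
have c1B (Z : ptopologicalType) (h : Z -> R) : continuous h -> continuous (fun x => 1 - h x).
  by move=> ch x; apply: cvgB; [exact: cvg_cst|exact: ch].
have [||||x Kx|s [vs gs]] := @glue R X lcX hdX (X -> Y -> C) (tsum (cc (Z:=X)) (cc (Z:=Y)))
  (fun s x => forall p, (v p).1 = x -> K2 (v p).2 -> sqn (w p - s x (v p).2) <= e)
  (fun h t' t x y => (h x)%:C * 1%:C * t' x y + (1 - h x)%:C * 1%:C * t x y) (fun _ _ => 0) K1.
- exact: tsum0.
- move=> h t' t ch vt' vt; apply: tsumD.
    exact: (@tsum_comb h (fun=> 1) t' t).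
  by apply: (@tsum_comb (fun x => 1 - h x) (fun=> 1) t t) => //; exact: c1B.
- move=> h t' t x h01 g' g p px Kp.
  rewrite !mulr1 (_ : w p - _ = (h x)%:C * (w p - t' x (v p).2) +
     (1 - h x)%:C * (w p - t x (v p).2)).
    by apply: sqn_convex => // [/g'|/g]; apply.
  by rewrite rmorphB /=; ring.
- exact: cK1.
- have [||||y Ky|[U s] [[oU Ux vs] gs]] := @glue R Y lcY hdY (set X * (X -> Y -> C))
    (fun t => [/\ open t.1, t.1 x & tsum (cc (Z:=X)) (cc (Z:=Y)) t.2])
    (fun t y => forall p, t.1 (v p).1 -> (v p).2 = y -> sqn (w p - t.2 (v p).1 y) <= e)
    (fun h t' t => (t'.1 `&` t.1, fun x y => 1%:C * (h y)%:C * t'.2 x y + 1%:C * (1 - h y)%:C * t.2 x y))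
    (setT, fun _ _ => 0) K2.
  + by split; [exact: openT| |exact: tsum0].
  + move=> h [U' t'] [U t] ch [oU' Ux' vt'] [oU Ux vt]; split=> /=; first exact: openI.
      by [].
    apply: tsumD; first exact: (@tsum_comb (fun=> 1) h t' t).
    by apply: (@tsum_comb (fun=> 1) (fun x => 1 - h x) t t) => //; exact: c1B.
  + move=> h [U' t'] [U t] y h01 g' g p [/= U'p Up] py.
    rewrite !mul1r (_ : w p - _ = (h y)%:C * (w p - t' (v p).1 y) +
       (1 - h y)%:C * (w p - t (v p).1 y)).
      by apply: sqn_convex => // [/g'|/g]; apply.
    by rewrite rmorphB /=; ring.
  + exact: cK2.
  + have [[p0 _ vp0]|nv] := pselect (range v (x, y)).
      have : nbhs p0 [set p | sqn (w p - w p0) < e].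
        have cs : continuous (fun p => sqn (w p - w p0)).
          apply: ccont_sqn; apply: ccontD => //.
          by have [] := ccont_cst T (- w p0); split.
        have /cvgr_lt := cs p0; rewrite subrr sqn0; exact.
      move=> nW; have [N0 nN0 OW] := vinit nW.
      move: nN0; rewrite vp0 => -[[A B] /= [nA nB] AB].
      exists B^°, (A^°, fun _ _ => w p0); split=> /=.
      * exact: open_interior.
      * exact: nB.
      * split; [exact: open_interior|exact: nA|].
        rewrite (_ : (fun _ _ => _) = (fun x y => (fun=> w p0) x * (fun=> 1) y + 0)).
          by apply: tsumA; [exact: ccont_cst|exact: ccont_cst|exact: tsum0].
        by apply/funext => ?; apply/funext => ?; rewrite mulr1 addr0.
      * move=> y' By' p Ap py'; apply/ltW; apply: OW; apply: AB; split=> /=.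
          exact: interior_subset.
        by rewrite py'; exact: interior_subset.
    have : nbhs (x, y) (~` range v) by apply: open_nbhs_nbhs; split=> //; exact: closed_openC.
    move=> [[A B] /= [nA nB] AB].
    exists B^°, (A^°, fun _ _ => 0); split=> /=.
    * exact: open_interior.
    * exact: nB.
    * by split; [exact: open_interior|exact: nA|exact: tsum0].
    * move=> y' By' p Ap py'; exfalso; apply: (AB (v p)); last by exists p.
      by split=> /=; [exact: interior_subset|rewrite py'; exact: interior_subset].
  exists U, s; split=> //= x' Ux' p px' Kp.
  by rewrite -px'; apply: (gs _ Kp p) => //=; rewrite px'.
by exists s; split=> // p K1p K2p; exact: gs.
Qed.

(** The majorant (a b)^2 does not depend on the tolerance. A pointwise error of this form is an
    error in operator norm once products of bumps are known to define bounded operators. *)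
Lemma Cc_tsum (w : T -> C) : Cc w -> exists (a : X -> R) (b : Y -> R),
  [/\ supp_in setT a, supp_in setT b &
   forall e, 0 < e -> exists s, tsum (@Cc R X) (@Cc R Y) s /\
     forall p, sqn (w p - s (v p).1 (v p).2) <= e * (a (v p).1 * b (v p).2) ^+ 2].
Proof.
move=> [cw kw]; set S := closure _ in kw.
have cS1 : compact ((fst \o v) @` S).
  apply: continuous_compact => //; apply: continuous_subspaceT => p.
  by apply: continuous_comp; [exact: vc|exact: cvg_fst].
have cS2 : compact ((snd \o v) @` S).
  apply: continuous_compact => //; apply: continuous_subspaceT => p.
  by apply: continuous_comp; [exact: vc|exact: cvg_snd].
have [a1 [[ca1 ka1 _] [a101 a11]]] := urysohn_bump R lcX hdX cS1 openT (@subsetT _ _).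
have [b1 [[cb1 kb1 _] [b101 b11]]] := urysohn_bump R lcY hdY cS2 openT (@subsetT _ _).
have [a [sa [a01 aK]]] := urysohn_bump R lcX hdX ka1 openT (@subsetT _ _).
have [b [sb [b01 bK]]] := urysohn_bump R lcY hdY kb1 openT (@subsetT _ _).
exists a, b; split=> // e e0.
have [s [hs sP]] := tsum_approx e0 cw ka1 kb1.
(* The cut-offs [a1] and [b1] leave [w] unchanged and give the sum compact support; [a] and [b]
   equal 1 on their supports, so the error carries the factor a b. *)
exists (fun x y => (a1 x)%:C * (b1 y)%:C * s x y); split.
  have Cca : Cc (fun x => (a1 x)%:C) by apply: (supp_in_Cc (W := setT)); split.
  have Ccb : Cc (fun x => (b1 x)%:C) by apply: (supp_in_Cc (W := setT)); split.
  apply: (tsumM (a := fun x => (a1 x)%:C) (b := fun y => (b1 y)%:C) _ _ hs).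
    by move=> f cf; exact: CcMr.
  by move=> f cf; exact: CcMr.
move=> p; have wS : w p != 0 -> S p by move=> wp; exact: subset_closure.
have w1 : w p = (a1 (v p).1)%:C * (b1 (v p).2)%:C * w p.
  have [->|/wS Sp] := eqVneq (w p) 0; first by rewrite mulr0.
  by rewrite a11 ?b11 ?mul1r//; exists p.
rewrite [X in sqn (X - _)]w1 -mulrBr sqnM -rmorphM sqnR.
have [A1|] := eqVneq (a1 (v p).1) 0.
  by rewrite A1 mul0r expr0n mul0r mulr_ge0 ?sqr_ge0// ltW.
have [B1 _|B1 A1] := eqVneq (b1 (v p).2) 0.
  by rewrite B1 mulr0 expr0n mul0r mulr_ge0 ?sqr_ge0// ltW.
have Kp1 := @subset_closure _ [set x | a1 x != 0] _ A1.
have Kp2 := @subset_closure _ [set x | b1 x != 0] _ B1.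
rewrite aK// bK// mulr1 expr1n mulr1 (le_trans _ (sP p Kp1 Kp2))// ler_piMl ?sqn_ge0//.
rewrite exprn_ile1//; first by rewrite mulr_ge0//; [have /andP[] := a101 (v p).1|have /andP[] := b101 (v p).2].
by rewrite mulr_ile1//; [have /andP[] := a101 (v p).1|have /andP[] := b101 (v p).2|have /andP[] := a101 (v p).1|have /andP[] := b101 (v p).2].
Qed.

End StoneWeierstrass.

Section General.

Lemma cont_comp (X Y Z : topologicalType) (f : X -> Y) (g : Y -> Z) :
  continuous f -> continuous g -> continuous (fun x => g (f x)).
Proof. by move=> cf cg x; apply: continuous_comp; [exact: cf|exact: cg]. Qed.

Lemma cont_pair (X Y Z : topologicalType) (f : X -> Y) (g : X -> Z) :
  continuous f -> continuous g -> continuous (fun x => (f x, g x)).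
Proof. by move=> cf cg x; apply: cvg_pair; [exact: cf|exact: cg]. Qed.

Lemma closed_eqfun (Z U : topologicalType) (f g : Z -> U) : hausdorff_space U ->
  continuous f -> continuous g -> closed [set z | f z = g z].
Proof.
move=> hU cf cg; rewrite -[X in closed X]setCK; apply: open_closedC.
rewrite openE => z /= fg; move: hU; rewrite open_hausdorff => /(_ (f z) (g z)).
case; first by apply/eqP.
move=> [A B] /= [/set_mem Af /set_mem Bg] [oA oB AB0].
have nA : nbhs z (f @^-1` A) by apply: cf; exact: open_nbhs_nbhs.
have nB : nbhs z (g @^-1` B) by apply: cg; exact: open_nbhs_nbhs.
apply: filterS2 nA nB => y /= Ay By e; have : (A `&` B) (f y) by split=> //; rewrite e.
by rewrite (eqP AB0).
Qed.

Lemma hausdorff_inj (Z U : topologicalType) (f : Z -> U) : hausdorff_space U ->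
  continuous f -> injective f -> hausdorff_space Z.
Proof.
rewrite !open_hausdorff => hU cf fi x y /eqP xy.
have /hU[[A B] /= [/set_mem Ax /set_mem By] [oA oB /eqP AB0]] : f x != f y.
  by apply/eqP => /fi.
exists (f @^-1` A, f @^-1` B) => /=; first by split; apply/mem_set.
split; [by apply: open_comp => // ? _; exact: cf..|].
by apply/eqP; rewrite -preimage_setI AB0 preimage_set0.
Qed.

Lemma hausdorff_prod (U V : topologicalType) : hausdorff_space U -> hausdorff_space V ->
  hausdorff_space (U * V)%type.
Proof.
rewrite !open_hausdorff => hU hV [x x'] [y y'] /= xy.
have [e|] := eqVneq x y.
  have /hV[[A B] /= [/set_mem Ax /set_mem By] [oA oB /eqP AB0]] : x' != y'.
    by apply: contra xy => /eqP->; rewrite e.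
  exists (snd @^-1` A, snd @^-1` B) => /=; first by split; apply/mem_set.
  split; [by apply: open_comp => // ? _; exact: cvg_snd..|].
  by apply/eqP; rewrite -preimage_setI AB0 preimage_set0.
move=> /hU[[A B] /= [/set_mem Ax /set_mem By] [oA oB /eqP AB0]].
exists (fst @^-1` A, fst @^-1` B) => /=; first by split; apply/mem_set.
split; [by apply: open_comp => // ? _; exact: cvg_fst..|].
by apply/eqP; rewrite -preimage_setI AB0 preimage_set0.
Qed.

Lemma continuous_borel (X Y : ptopologicalType) (f : X -> Y) : continuous f ->
  measurable_fun setT (f : borel X -> borel Y).
Proof.
move=> cf; apply: (@measurability _ _ (borel X) (borel Y) setT f (@open Y)) => //.
move=> _ [A oA <-]; rewrite setTI; apply: sub_sigma_algebra.
by apply: open_comp => // x _; exact: cf.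
Qed.

Lemma open_borel (X : ptopologicalType) (A : set X) : open A -> measurable (A : set (borel X)).
Proof. by move=> oA; exact: sub_sigma_algebra. Qed.

Lemma closed_borel (X : ptopologicalType) (A : set X) : closed A -> measurable (A : set (borel X)).
Proof.
move=> cA; rewrite -[A]setCK; apply: measurableC; apply: open_borel; exact: closed_openC.
Qed.

End General.

(** * Borel sets of products of second countable spaces *)

Lemma bigcupXl T1 T2 (D : nat -> set T1) (B : set T2) :
  (\bigcup_k D k) `*` B = \bigcup_k (D k `*` B).
Proof.
by apply/seteqP; split=> -[x y] /= => [[[k _ ?] ?]|[k _ [? ?]]]; [exists k|split=> //; exists k].
Qed.

Lemma bigcupXr T1 T2 (D : nat -> set T2) (B : set T1) :
  B `*` (\bigcup_k D k) = \bigcup_k (B `*` D k).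
Proof.
by apply/seteqP; split=> -[x y] /= => [[? [k _ ?]]|[k _ [? ?]]]; [exists k|split=> //; exists k].
Qed.

Section Product.
Variables (R : realType) (X Y : ptopologicalType).
Hypotheses (lcX : locally_compact [set: X]) (hdX : hausdorff_space X).
Hypothesis scX : @second_countable X.
Hypotheses (lcY : locally_compact [set: Y]) (hdY : hausdorff_space Y).
Hypothesis scY : @second_countable Y.

Lemma open_prod_seq (W : set (X * Y)) : open W -> exists (e : nat -> set X) (f : nat -> set Y),
  [/\ forall n, precompact_opens (e n), forall n, precompact_opens (f n) &
   W = \bigcup_n (e n `*` f n)].
Proof.
move=> oW; have [BX cBX [BXop BXb]] := scX; have [BY cBY [BYop BYb]] := scY.
have cB := countableX cBX cBY.
have /countable_injP[h hinj] := cB.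
pose good (A : set X) (B : set Y) := [/\ compact (closure A), compact (closure B) & A `*` B `<=` W].
pose e n := [set x | exists A B, [/\ (BX `*` BY) (A, B), good A B, h (A, B) = n & A x]].
pose f n := [set y | exists A B, [/\ (BX `*` BY) (A, B), good A B, h (A, B) = n & B y]].
have eE n A B : (BX `*` BY) (A, B) -> good A B -> h (A, B) = n -> e n = A /\ f n = B.
  move=> BA gAB hA; split; apply/seteqP; split=> x; try by exists A, B.
    move=> [A' [B' [BA' _ hA' A'x]]].
    by have [-> _] : (A, B) = (A', B') by apply: hinj; rewrite ?inE ?hA ?hA'.
  move=> [A' [B' [BA' _ hA' A'x]]].
  by have [_ ->] : (A, B) = (A', B') by apply: hinj; rewrite ?inE ?hA ?hA'.
have e0 n : (e n = set0 /\ f n = set0) \/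
    exists A B, [/\ (BX `*` BY) (A, B), good A B & h (A, B) = n].
  have [h1|h1] := pselect (exists A B, [/\ (BX `*` BY) (A, B), good A B & h (A, B) = n]).
    by right.
  left; split; apply/seteqP; split=> // x [A [B [? ? ? _]]]; exfalso; apply: h1;
    by exists A, B.
have ePO n : precompact_opens (e n) /\ precompact_opens (f n).
  have [[-> ->]|[A [B [BAB gAB hA]]]] := e0 n.
    by split; split; rewrite ?closure0; [exact: open0|exact: compact0|exact: open0|exact: compact0].
  have [-> ->] := eE _ _ _ BAB gAB hA; have [cA cB' _] := gAB; have [BA BB] := BAB.
  by split; split=> //; [exact: BXop|exact: BYop].
exists e, f; split=> [n|n|]; try by have [] := ePO n.
apply/seteqP; split=> [[x y] Wxy|].
  have : nbhs (x, y) W by apply: open_nbhs_nbhs.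
  move=> [[A B] /= [nA nB] AB].
  have [Q xQ [cQ clQ]] := compact_nbhd lcX x; have [Q' yQ' [cQ' clQ']] := compact_nbhd lcY y.
  have [A' [BA' A'x] A'A] := BXb x _ (filterI nA xQ).
  have [B' [BB' B'y] B'B] := BYb y _ (filterI nB yQ').
  have gAB : good A' B'.
    split; first by apply: (closure_compact hdX _ cQ) => z /A'A[].
      by apply: (closure_compact hdY _ cQ') => z /B'B[].
    by move=> [z z'] /= [/A'A[Az _] /B'B[Bz _]]; apply: AB.
  exists (h (A', B')) => //; have [|-> ->] := eE (h (A', B')) A' B' _ gAB erefl; by split.
move=> [x y] [n _ [/= [A [B [BAB gAB hA Ax]]]]].
have [_ ->] := eE _ _ _ BAB gAB hA => By; have [_ _ AB] := gAB; exact: AB.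
Qed.

Lemma precompact_rect_gen : (@measurable _ (borel X * borel Y)%type) =
  <<s [set A `*` B | A in @precompact_opens X & B in @precompact_opens Y] >>.
Proof.
apply/seteqP; split; last first.
  apply: smallest_sub; first exact: sigma_algebra_measurable.
  by move=> _ [A [oA _] [B [oB _] <-]]; apply: measurableX; exact: open_borel.
rewrite measurable_prod_measurableType.
apply: smallest_sub; first exact: smallest_sigma_algebra.
move=> _ [A mA [B mB <-]].
set S := <<s _ >>.
have [E [PE Ecov]] := precompact_cover R lcX hdX scX.
have [F [PF Fcov]] := precompact_cover R lcY hdY scY.
have SX (A' : set (borel X)) : measurable A' -> S (A' `*` setT).
  rewrite [measurable]precompact_opens_gen//.
  suff : <<s @precompact_opens X >> `<=` [set A' | S (A' `*` setT)] by apply.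
  apply: smallest_sub.
    split.
    - by rewrite /= set0X; exact: sigma_algebra0.
    - move=> D /= SD; rewrite setTD.
      have -> : (~` D) `*` [set: Y] = ~` (D `*` setT).
        by apply/seteqP; split=> -[x y] /=; [move=> [nD _] [/nD]|move=> nD; split=> // Dx; exact: nD].
      by rewrite -setTD; exact: sigma_algebraCD.
    - move=> D SD /=; rewrite bigcupXl.
      exact: sigma_algebra_bigcup.
  move=> D PD /=; rewrite -Fcov bigcupXr.
  by apply: sigma_algebra_bigcup => n; apply: sub_sigma_algebra; exists D => //; exists (F n).
have SY (B' : set (borel Y)) : measurable B' -> S (setT `*` B').
  rewrite [measurable]precompact_opens_gen//.
  suff : <<s @precompact_opens Y >> `<=` [set A' | S (setT `*` A')] by apply.
  apply: smallest_sub.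
    split.
    - by rewrite /= setX0; exact: sigma_algebra0.
    - move=> D /= SD; rewrite setTD.
      have -> : [set: X] `*` (~` D) = ~` (setT `*` D).
        by apply/seteqP; split=> -[x y] /=; [move=> [_ nD] [_ /nD]|move=> nD; split=> // Dx; exact: nD].
      by rewrite -setTD; exact: sigma_algebraCD.
    - move=> D SD /=; rewrite bigcupXr.
      exact: sigma_algebra_bigcup.
  move=> D PD /=; rewrite -Ecov bigcupXl.
  by apply: sigma_algebra_bigcup => n; apply: sub_sigma_algebra; exists (E n) => //; exists D.
have -> : A `*` B = (A `*` setT) `&` (setT `*` B).
  by apply/seteqP; split=> -[x y] /=; [move=> []|move=> [[? _] []]].
by apply: (@measurableI _ (g_sigma_algebraType
  [set A `*` B | A in @precompact_opens X & B in @precompact_opens Y])); [exact: SX|exact: SY].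
Qed.

(** Every open set of the product is a countable union of open rectangles by second countability.
    This links the measures on fibre products, given on Borel sets of the product space, with Fubini
    arguments, which use the product sigma-algebra. *)
Lemma borel_prod : (@measurable _ (borel (X * Y)%type)) = (@measurable _ (borel X * borel Y)%type).
Proof.
apply/seteqP; split.
  apply: smallest_sub; first exact: sigma_algebra_measurable.
  move=> W oW; have [e [f [eP fP ->]]] := open_prod_seq oW.
  apply: bigcupT_measurable => n; apply: measurableX; apply: open_borel.
    by have [] := eP n.
  by have [] := fP n.
rewrite precompact_rect_gen; apply: smallest_sub; first exact: smallest_sigma_algebra.
move=> _ [A [oA _] [B [oB _] <-]]; apply: sub_sigma_algebra.
have -> : A `*` B = fst @^-1` A `&` snd @^-1` B by [].
by apply: openI; apply: open_comp => // z _; [exact: cvg_fst|exact: cvg_snd].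
Qed.

End Product.

(** * The unit space, the fibre products and the shear *)

Section Units.
Variables (R : realType) (G : topGroupoid).
Hypotheses (lc : locally_compact [set: G]) (hd : hausdorff_space G).
Hypothesis sc : @second_countable G.

Lemma gid_inj : injective (@gid G).
Proof. by move=> u v /(congr1 (@gr G)); rewrite !gr_id. Qed.

Lemma units_hausdorff : hausdorff_space (gunits G).
Proof. exact: (hausdorff_inj hd (@gid_cont G) gid_inj). Qed.

Lemma units_sc : @second_countable (gunits G).
Proof.
have [B cB [Bop Bb]] := sc; exists [set @gid G @^-1` A | A in B].
  exact: (card_le_trans (card_image_le _ _) cB).
split=> [_ [A BA <-]|u W nW].
  by apply: open_comp => [? _|]; [exact: gid_cont|exact: Bop].
have nW' : nbhs (gid u) (@gr G @^-1` W) by apply: gr_cont; rewrite gr_id.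
have [A [BA Au] AW] := Bb _ _ nW'.
exists (@gid G @^-1` A); first by split=> //; exists A.
by move=> v /AW /=; rewrite gr_id.
Qed.

Lemma units_lc : locally_compact [set: gunits G].
Proof.
move=> u _; have [Q xQ [cQ clQ]] := compact_nbhd lc (gid u).
have cK : compact (@gr G @` Q).
  by apply: continuous_compact => //; apply: continuous_subspaceT; exact: gr_cont.
exists (@gr G @` Q).
  rewrite withinET; have : nbhs u (@gid G @^-1` Q) by exact: gid_cont.
  by apply: filterS => v Qv; exists (gid v) => //; rewrite gr_id.
by split=> //; exact: (compact_closed units_hausdorff).
Qed.

End Units.

Section FibreProduct.
Variables (R : realType) (G : topGroupoid).
Hypotheses (lc : locally_compact [set: G]) (hd : hausdorff_space G).
Hypothesis sc : @second_countable G.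

Lemma fib_sr_range : range (val : fib_sr G -> G * G) = [set p | gs p.1 = gr p.2].
Proof.
apply/seteqP; split=> [_ [p _ <-]|p h]; first by have := valP p; rewrite inE.
by exists (exist (fun q : G * G => q \in _) p (mem_set h)).
Qed.

Lemma fib_rr_range : range (val : fib_rr G -> G * G) = [set p | gr p.1 = gr p.2].
Proof.
apply/seteqP; split=> [_ [p _ <-]|p h]; first by have := valP p; rewrite inE.
by exists (exist (fun q : G * G => q \in _) p (mem_set h)).
Qed.

Lemma fib_sr_closed : closed [set p : G * G | gs p.1 = gr p.2].
Proof.
apply: closed_eqfun; first exact: units_hausdorff.
  by move=> p; apply: continuous_comp; [exact: cvg_fst|exact: gs_cont].
by move=> p; apply: continuous_comp; [exact: cvg_snd|exact: gr_cont].
Qed.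

Lemma fib_rr_closed : closed [set p : G * G | gr p.1 = gr p.2].
Proof.
apply: closed_eqfun; first exact: units_hausdorff.
  by move=> p; apply: continuous_comp; [exact: cvg_fst|exact: gr_cont].
by move=> p; apply: continuous_comp; [exact: cvg_snd|exact: gr_cont].
Qed.

Lemma val_sr_cont : continuous (val : fib_sr G -> G * G).
Proof. exact: initial_continuous. Qed.
Lemma val_rr_cont : continuous (val : fib_rr G -> G * G).
Proof. exact: initial_continuous. Qed.

Lemma val_sr_nbhs (p : fib_sr G) W : nbhs p W ->
  exists2 V, nbhs (val p) V & (val : fib_sr G -> G * G) @^-1` V `<=` W.
Proof.
rewrite nbhsE => nW; case: nW => P0 [[V oV VO] Op] OW; exists V; last by rewrite VO.
by apply: open_nbhs_nbhs; split=> //; move: Op; rewrite -VO.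
Qed.

Lemma val_rr_nbhs (p : fib_rr G) W : nbhs p W ->
  exists2 V, nbhs (val p) V & (val : fib_rr G -> G * G) @^-1` V `<=` W.
Proof.
rewrite nbhsE => nW; case: nW => P0 [[V oV VO] Op] OW; exists V; last by rewrite VO.
by apply: open_nbhs_nbhs; split=> //; move: Op; rewrite -VO.
Qed.

Lemma fib_sr_hausdorff : hausdorff_space (fib_sr G).
Proof.
apply: (hausdorff_inj (hausdorff_prod hd hd) val_sr_cont); exact: val_inj.
Qed.

Lemma fib_rr_hausdorff : hausdorff_space (fib_rr G).
Proof.
apply: (hausdorff_inj (hausdorff_prod hd hd) val_rr_cont); exact: val_inj.
Qed.

(** The inverse (x, y) |-> (x, xy) of the shear. The default branch never occurs, since x and xy
    have equal range whenever x and y are composable. *)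
Definition unshear (p : fib_sr G) : fib_rr G :=
  match pselect (gr (val p).1 = gr (gmul (val p).1 (val p).2)) with
  | left h => exist (fun q : G * G => q \in _) ((val p).1, gmul (val p).1 (val p).2) (mem_set h)
  | right _ => point
  end.

Lemma sr_eq (p : fib_sr G) : gs (val p).1 = gr (val p).2.
Proof. by have := valP p; rewrite inE. Qed.
Lemma rr_eq (p : fib_rr G) : gr (val p).1 = gr (val p).2.
Proof. by have := valP p; rewrite inE. Qed.

Lemma val_unshear p : val (unshear p) = ((val p).1, gmul (val p).1 (val p).2).
Proof. by rewrite /unshear; case: pselect => //= []; rewrite gr_mul// sr_eq. Qed.

Lemma shearK : cancel (@shear G) unshear.
Proof.
move=> p; apply: val_inj; rewrite val_unshear /=; have := rr_eq p.
move=> e; rewrite gmulA ?gs_inv ?gr_inv// gmulVr e gmul1l; exact/esym/surjective_pairing.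
Qed.

Lemma unshearK : cancel unshear (@shear G).
Proof.
move=> p; apply: val_inj => /=; rewrite val_unshear /=; have := sr_eq p.
move=> e; rewrite gmulA ?gs_inv ?gr_inv// gmulVl e gmul1l; exact/esym/surjective_pairing.
Qed.

Lemma cont_to_sr (Z : topologicalType) (f : Z -> fib_sr G) :
  continuous (val \o f) -> continuous f.
Proof.
move=> cf z W /val_sr_nbhs[V nV VW]; have h := cf z V nV; exact: (filterS (fun y (k : ((val \o f) @^-1` V) y) => VW (f y) k) h).
Qed.

Lemma cont_to_rr (Z : topologicalType) (f : Z -> fib_rr G) :
  continuous (val \o f) -> continuous f.
Proof.
move=> cf z W /val_rr_nbhs[V nV VW]; have h := cf z V nV; exact: (filterS (fun y (k : ((val \o f) @^-1` V) y) => VW (f y) k) h).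
Qed.

Lemma gmul_sr_cont : continuous (fun p : fib_sr G => gmul (val p).1 (val p).2).
Proof.
have /subspace_sigL_continuousP := @gmul_cont G; exact.
Qed.

Lemma val1_sr_cont : continuous (fun p : fib_sr G => (val p).1).
Proof. exact: (cont_comp val_sr_cont (fun=> cvg_fst)). Qed.
Lemma val2_sr_cont : continuous (fun p : fib_sr G => (val p).2).
Proof. exact: (cont_comp val_sr_cont (fun=> cvg_snd)). Qed.
Lemma val1_rr_cont : continuous (fun p : fib_rr G => (val p).1).
Proof. exact: (cont_comp val_rr_cont (fun=> cvg_fst)). Qed.
Lemma val2_rr_cont : continuous (fun p : fib_rr G => (val p).2).
Proof. exact: (cont_comp val_rr_cont (fun=> cvg_snd)). Qed.

(** Multiplication is continuous on composable pairs only, so the second coordinate is factored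
    through the map (x, y) |-> (x^{-1}, y) into [fib_sr]. *)
Lemma shear_cont : continuous (@shear G).
Proof.
apply: cont_to_sr.
pose q (p : fib_rr G) : fib_sr G := exist (fun q : G * G => q \in _)
  (ginv (val p).1, (val p).2) (mem_set (etrans (gs_inv _) (rr_eq p))).
have cq : continuous q.
  apply: cont_to_sr; apply: (cont_pair _ val2_rr_cont).
  exact: (cont_comp val1_rr_cont (@ginv_cont G)).
exact: (cont_pair val1_rr_cont (cont_comp cq gmul_sr_cont)).
Qed.

Lemma unshear_cont : continuous unshear.
Proof.
apply: cont_to_rr.
rewrite (_ : val \o unshear = fun p => ((val p).1, gmul (val p).1 (val p).2)); last first.
  by apply/funext => z; exact: val_unshear.
exact: (cont_pair val1_sr_cont gmul_sr_cont).
Qed.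

Lemma Cc_homeo (X Y : ptopologicalType) (f : X -> Y) (g : Y -> X) (w : Y -> R[i]) :
  hausdorff_space X -> continuous f -> continuous g -> cancel f g -> Cc w -> Cc (w \o f).
Proof.
move=> hX cf cg fK [cw kw]; split; first exact: ccont_comp.
apply: (@closure_compact _ hX _ (g @` closure [set x | w x != 0])).
  by move=> x /= wx; exists (f x); [exact: subset_closure|exact: fK].
by apply: continuous_compact => //; apply: continuous_subspaceT.
Qed.

End FibreProduct.

Lemma measure_bigcupT d (T : measurableType d) (R : realType)
    (m : {measure set T -> \bar R}) (F : nat -> set T) :
  (forall n, measurable (F n)) -> trivIset setT F ->
  m (\bigcup_n F n) = (\sum_(n <oo) m (F n))%E.
Proof.
by move=> mF tF; rewrite measure_bigcup//; apply: eq_eseriesl => i; rewrite in_setT.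
Qed.

(** * Haar systems as kernels *)

Section KernelMeasurability.
Context d d' (T : measurableType d) (Y : measurableType d') (R : realType).
Variables (k : T -> {measure set Y -> \bar R}) (P : set (set Y)) (E : nat -> set Y).
Hypotheses (mP : @measurable _ Y = <<s P >>) (PI : setI_closed P).
Hypotheses (PE : forall n, P (E n)) (Ecover : \bigcup_n E n = setT).
Hypothesis Poo : forall t A, P A -> (k t A < +oo)%E.
Hypothesis Pmeas : forall A, P A -> measurable_fun setT (k ^~ A).

Let measP A : P A -> measurable A.
Proof. by move=> PA; rewrite mP; exact: sub_sigma_algebra. Qed.

(** A Dynkin argument works inside each [E n], where finiteness allows the measure of a complement
    to be written as a difference. A general set is then cut along the disjoint pieces
    [seqDU E n]. *)
Lemma kernel_meas_gen (A : set Y) : measurable A -> measurable_fun setT (k ^~ A).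
Proof.
move=> mA.
have mE n : measurable (E n) by exact: measP.
have key n S : measurable S -> measurable_fun setT (fun t => k t (S `&` E n)).
  rewrite mP; move: S; apply: (dynkin_induction mP PI).
  - by rewrite setTI; exact: Pmeas.
  - by move=> S PS; apply: Pmeas; exact: PI.
  - move=> S mS h.
    rewrite (_ : (fun t => _) = fun t => (k t (E n) - k t (S `&` E n))%E).
      by apply: emeasurable_funB => //; exact: Pmeas.
    apply/funext => t; rewrite (_ : ~` S `&` E n = E n `\` (S `&` E n)); last first.
      by apply/seteqP; split=> x /=; [move=> [? ?]; split=> // -[]|
        move=> [Ex nS]; split=> // Sx; apply: nS].
    rewrite [LHS]measureD//; [|exact: measurableI|exact: Poo].
    by congr (_ - k t _)%E; rewrite setIA [E n `&` S]setIC -setIA setIid.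
  - move=> F mF tF h.
    rewrite (_ : (fun t => _) = fun t => (\sum_(i <oo) k t (F i `&` E n))%E).
      by apply: ge0_emeasurable_sum => // i t _ _; exact: measure_ge0.
    apply/funext => t; rewrite setI_bigcupl.
    rewrite measure_bigcupT//; last exact: trivIset_setIr.
    by move=> i; exact: measurableI.
rewrite (_ : k ^~ A = fun t => (\sum_(n <oo) k t ((A `&` seqDU E n) `&` E n))%E).
  apply: ge0_emeasurable_sum => [n t _ _|n _]; first exact: measure_ge0.
  by apply: key; apply: measurableI => //; apply: measurableD => //;
    apply: bigsetU_measurable.
apply/funext => t; rewrite (eq_eseriesr (g := fun n => k t (A `&` seqDU E n))); last first.
  by move=> n _; congr (k t _); rewrite -setIA; congr setI; apply/setIidl => x [].
have mD n : measurable (A `&` seqDU E n).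
  by apply: measurableI => //; apply: measurableD => //; apply: bigsetU_measurable.
rewrite -measure_bigcupT//; last by apply: trivIset_setIl; exact: trivIset_seqDU.
by rewrite -setI_bigcupr -seqDU_bigcup_eq Ecover setIT.
Qed.

End KernelMeasurability.

Section KernelSection.
Context d d' (T : measurableType d) (Y : measurableType d') (R : realType).
Variables (k : T -> {measure set Y -> \bar R}) (E : nat -> set Y).
Hypotheses (mE : forall n, measurable (E n)) (Ecover : \bigcup_n E n = setT).
Hypothesis Eoo : forall t n, (k t (E n) < +oo)%E.
Hypothesis kmeas : forall A, measurable A -> measurable_fun setT (k ^~ A).

(** This is delta_t (x) k_t. Integrating F against it gives the integral of F(t, .) over k_t, so
    measurability in t of such an integral becomes measurability of a kernel. *)
Definition ksec (t : T) : {measure set (T * Y)%type -> \bar R} :=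
  measure_function_pushforward__canonical__measure_function_Measure
    (k t) (pair1_measurable t).

Lemma ksecE t (A : set (T * Y)%type) : ksec t A = k t (xsection A t).
Proof. by rewrite /ksec /pushforward; congr (k t _); rewrite /xsection; apply/seteqP; split=> y /=; rewrite ?inE. Qed.

Lemma ksec_meas (A : set (T * Y)%type) : measurable A -> measurable_fun setT (ksec ^~ A).
Proof.
pose P := [set A `*` B | A in @measurable _ T & B in [set B | measurable B /\
   forall t, (k t B < +oo)%E]].
pose F n := [set: T] `*` E n.
apply: (@kernel_meas_gen _ _ _ _ _ ksec P F).
- rewrite measurable_prod_measurableType; apply/seteqP; split; last first.
    by apply: sub_sigma_algebra2 => _ [A' mA [B [mB _] <-]]; exists A' => //; exists B.
  apply: smallest_sub; first exact: smallest_sigma_algebra.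
  move=> _ [A' mA [B mB <-]].
  have -> : A' `*` B = \bigcup_n (A' `*` (B `&` E n)).
    apply/seteqP; split=> -[x y] /=; last by move=> [n _ [? []]].
    move=> [Ax By]; have : (\bigcup_n E n) y by rewrite Ecover.
    by move=> [n _ Ey]; exists n.
  apply: sigma_algebra_bigcup => n; apply: sub_sigma_algebra.
  exists A' => //; exists (B `&` E n) => //; split; first exact: measurableI.
  move=> t; apply: le_lt_trans (Eoo t n); apply: le_measure; rewrite ?inE//.
  exact: measurableI.
- move=> _ _ [A' mA [B [mB Boo] <-]] [C' mC [D [mD Doo] <-]].
  exists (A' `&` C'); first exact: measurableI.
  exists (B `&` D); last by rewrite setXI.
  split; first exact: measurableI.
  move=> t; apply: le_lt_trans (Boo t); apply: le_measure; rewrite ?inE//.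
  exact: measurableI.
- by move=> n; exists setT => //; exists (E n).
- apply/seteqP; split=> // -[x y] _; have : (\bigcup_n E n) y by rewrite Ecover.
  by move=> [n _ Ey]; exists n.
- move=> t _ [A' mA [B [mB Boo] <-]]; rewrite ksecE; apply: le_lt_trans (Boo t).
  apply: le_measure; rewrite ?inE//.
    by apply: measurable_xsection; exact: measurableX.
  by move=> y; rewrite /xsection /= inE => -[].
- move=> _ [A' mA [B [mB Boo] <-]].
  rewrite (_ : (ksec ^~ _) = fun t => ((\1_A' t)%:E * k t B)%E).
    apply: emeasurable_funM; last exact: kmeas.
    by apply/measurable_EFinP; exact: measurable_indic.
  apply/funext => t; rewrite ksecE indicE; have [tA|tA] := boolP (t \in A').
    by rewrite mul1e in_xsectionX.
  by rewrite mul0e notin_xsectionX// measure0.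
Qed.

Lemma ksec_int t (F : T * Y -> \bar R) : measurable_fun setT F -> (forall p, 0 <= F p)%E ->
  (\int[ksec t]_p F p = \int[k t]_y F (t, y))%E.
Proof. by move=> mF F0; exact: (ge0_integral_pushforward (pair1_measurable t)). Qed.

Lemma kint_meas (F : T * Y -> \bar R) : measurable_fun setT F -> (forall p, 0 <= F p)%E ->
  measurable_fun setT (fun t => \int[k t]_y F (t, y))%E.
Proof.
move=> mF F0; rewrite (_ : (fun t => _) = fun t => (\int[ksec t]_p F p)%E).
  by apply: measurable_fun_integral_kernel => //; exact: ksec_meas.
by apply/funext => t; rewrite ksec_int.
Qed.

End KernelSection.

Section SFinite.
Context d d' (T : measurableType d) (Y : measurableType d') (R : realType).

(** The restrictions to the disjointified [E n] are kernels with a bound uniform in t and add up to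
    [k]; the s-finite structure gives access to composition of kernels and to Fubini. *)
Lemma sfkernel_ex (k : T -> {measure set Y -> \bar R}) (E : nat -> set Y) :
  (forall n, measurable (E n)) -> \bigcup_n E n = setT ->
  (forall n, exists r : R, forall t, (k t (E n) < r%:E)%E) ->
  (forall A, measurable A -> measurable_fun setT (k ^~ A)) ->
  exists l : R.-sfker T ~> Y, forall t, l t = k t.
Proof.
move=> mE Ecover bE km.
have mD n : measurable (seqDU E n).
  by apply: measurableD => //; apply: bigsetU_measurable.
pose piece n t : {measure set Y -> \bar R} := mrestr (k t) (mD n).
have pm n A : measurable A -> measurable_fun setT (piece n ^~ A).
  by move=> mA; apply: km; exact: measurableI.
pose pk n : R.-ker T ~> Y := HB.pack (piece n) (isKernel.Build _ _ _ _ _ (piece n) (pm n)).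
have pu n : measure_fam_uub (pk n).
  have [r rP] := bE n; exists r => t; apply: le_lt_trans (rP t).
  rewrite /pk /= /piece /mrestr setTI; apply: le_measure; rewrite ?inE//.
  by move=> y [].
pose fk n : R.-fker T ~> Y := HB.pack (piece n) (isKernel.Build _ _ _ _ _ (piece n) (pm n))
  (Kernel_isFinite.Build _ _ _ _ _ (pk n) (pu n)).
pose kk : R.-ker T ~> Y := HB.pack k (isKernel.Build _ _ _ _ _ k km).
have sf : exists s : (R.-fker T ~> Y)^nat, forall x U, measurable U -> kk x U = kseries s x U.
  exists fk => t U mU; rewrite /kseries /=.
  rewrite -[RHS]/(\sum_(0 <= i <oo) k t (U `&` seqDU E i))%E.
  rewrite -measure_bigcupT//; last 2 first.
  - by move=> n; exact: measurableI.
  - by apply: trivIset_setIl; exact: trivIset_seqDU.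
  by rewrite -setI_bigcupr -seqDU_bigcup_eq Ecover setIT.
pose sk : R.-sfker T ~> Y := HB.pack k (isKernel.Build _ _ _ _ _ k km) (Kernel_isSFinite.Build _ _ _ _ _ kk sf).
by exists sk.
Qed.

End SFinite.

Section KernelProduct.
Context d d' (T : measurableType d) (Y : measurableType d') (R : realType).
Variables (m : {measure set T -> \bar R}) (k : T -> {measure set Y -> \bar R}).
Variables (A : nat -> set T) (E : nat -> set Y).
Hypotheses (mA : forall n, measurable (A n)) (Acover : \bigcup_n A n = setT).
Hypothesis Aoo : forall n, (m (A n) < +oo)%E.
Hypotheses (mE : forall n, measurable (E n)) (Ecover : \bigcup_n E n = setT).
Hypothesis Ebd : forall n, exists r : R, forall t, (k t (E n) < r%:E)%E.
Hypothesis kmeas : forall B, measurable B -> measurable_fun setT (k ^~ B).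

(** The constant kernel [m] is composed with the kernel t |-> delta_t (x) k_t; both are s-finite,
    and the formula is the integral against a composed kernel. *)
Lemma kprod_ex : exists n : {measure set (T * Y)%type -> \bar R},
  forall F : T * Y -> \bar R, measurable_fun setT F -> (forall p, 0 <= F p)%E ->
  (\int[n]_p F p = \int[m]_t \int[k t]_y F (t, y))%E.
Proof.
have Eoo t n : (k t (E n) < +oo)%E.
  by have [r rP] := Ebd n; exact: lt_trans (rP t) (ltry r).
have [l lE] : exists l : R.-sfker unit ~> T, forall t, l t = m.
  apply: (@sfkernel_ex _ _ _ _ _ (fun=> m) A) => // n.
  exists (fine (m (A n)) + 1) => _; rewrite EFinD fineK ?ge0_fin_numE//.
  by rewrite lteDl ?lte01// ge0_fin_numE.
have [q qE] : exists q : R.-sfker (unit * T)%type ~> (T * Y)%type,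
    forall p, q p = ksec k p.2.
  apply: (@sfkernel_ex _ _ _ _ _ (fun p => ksec k p.2) (fun n => [set: T] `*` E n)) => //.
  - by move=> n; exact: measurableX.
  - apply/seteqP; split=> // -[x y] _; have : (\bigcup_n E n) y by rewrite Ecover.
    by move=> [n _ Ey]; exists n.
  - move=> n; have [r rP] := Ebd n; exists r => p; apply: le_lt_trans (rP p.2).
    by rewrite ksecE in_xsectionX ?inE.
  - move=> B mB; apply: (measurableT_comp (ksec_meas mE Ecover Eoo kmeas mB)).
    exact: measurable_snd.
exists (mkcomp l q tt) => F mF F0.
rewrite [LHS]integral_kcomp// lE; apply: eq_integral => t _.
by rewrite qE ksec_int.
Qed.

End KernelProduct.

Lemma cint_real d (T : measurableType d) (R : realType) (m : {measure set T -> \bar R}) A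
    (f : T -> R) :
  cint m A (fun x => (f x)%:C) = (fine (\int[m]_(x in A) (f x)%:E)%E)%:C.
Proof. by rewrite /cint /=; congr (_ +i* _); rewrite (integral0 m A). Qed.

Lemma int_indic_le d (T : measurableType d) (R : realType) (m : {measure set T -> \bar R})
    (K : set T) (M : R) (F : T -> \bar R) : measurable K -> measurable_fun setT F ->
  (forall x, 0 <= F x <= M%:E)%E -> (forall x, ~ K x -> F x = 0%E) ->
  (\int[m]_x F x <= M%:E * m K)%E.
Proof.
move=> mK mF FM F0; have [M0|M0] := leP 0 M; last first.
  rewrite integral0_eq ?mule0; last first.
    move=> x _; have /andP[h1 h2] := FM x; have := le_trans h1 h2.
    by rewrite lee_fin leNgt M0.
  have [K0|/set0P[x _]] := eqVneq K set0; first by rewrite K0 measure0 mule0.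
  by have /andP[h1 h2] := FM x; have := le_trans h1 h2; rewrite lee_fin leNgt M0.
rewrite -[m K]/(m K) -(setIT K) -integral_indic// -ge0_integralZl//; last first.
  by apply/measurable_EFinP; exact: measurable_indic.
apply: ge0_le_integral => //.
- by move=> x _; have /andP[] := FM x.
- by apply: measurable_funeM; apply/measurable_EFinP; exact: measurable_indic.
- move=> x _; rewrite indicE; have [xK|xK] := boolP (x \in K).
    by rewrite mule1; have /andP[] := FM x.
  by rewrite mule0 F0//; move/negP: xK => xK Kx; apply: xK; rewrite inE.
Qed.

Section Bumps.
Variables (R : realType) (X : ptopologicalType).
Hypotheses (lc : locally_compact [set: X]) (hd : hausdorff_space X).
Hypothesis sc : @second_countable X.
Implicit Types m : {measure set (borel X) -> \bar R}.

Lemma cont_meas (f : X -> R) : continuous f -> measurable_fun setT (f : borel X -> R).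
Proof.
move=> cf; have [h _] := ccont_meas (ccont_real cf); exact: h.
Qed.

(** The bumps are eventually 1 at each point of [A] but need not increase, so the estimate from
    below comes from Fatou's lemma instead of monotone convergence. *)
Lemma bump_sup m (A : set X) (f : nat -> X -> R) : open A ->
  (forall n, supp_in A (f n)) -> (forall n x, 0 <= f n x <= 1) ->
  (forall x, A x -> exists N, forall n, (N <= n)%N -> f n x = 1) ->
  m A = esups (fun n => \int[m]_x (f n x)%:E)%E 0%N.
Proof.
move=> oA fA f01 f1.
have mA : measurable (A : set (borel X)) by exact: open_borel.
have mf n : measurable_fun setT (fun x : borel X => (f n x)%:E).
  by apply/measurable_EFinP; apply: cont_meas; case: (fA n).
have f0 n x : ~ A x -> f n x = 0.
  move=> nA; apply/eqP; apply: contrapT => /negP fx; apply: nA; have [_ _] := fA n; exact.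
apply/eqP; rewrite eq_le; apply/andP; split; last first.
  apply: ge_ereal_sup => _ [n _ <-]; rewrite -(setIT A) -integral_indic//.
  apply: ge0_le_integral => //.
  - by move=> x _; rewrite lee_fin; have /andP[] := f01 n x.
  - by apply/measurable_EFinP; exact: measurable_indic.
  - move=> x _; rewrite lee_fin indicE; have [xA|xA] := boolP (x \in A).
      by have /andP[] := f01 n x.
    by rewrite f0//; move/negP: xA => xA Ax; apply: xA; rewrite inE.
rewrite -(setIT A) -integral_indic//.
rewrite (eq_integral (fun x : borel X => limn_einf (fun n => (f n x)%:E))); last first.
  move=> x _; rewrite indicE.
  suff /cvg_limn_einf_sup[-> _] : (fun n => (f n x)%:E) @ \oo --> (x \in A)%:R%:E by [].
  have [/set_mem Ax|xA] := boolP (x \in A).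
    have [N fN] := f1 _ Ax; apply: cvg_near_cst; exists N => // n /= Nn.
    by rewrite fN.
  apply: cvg_near_cst; apply: nearW => n; rewrite f0//.
  by move/negP: xA => xA Ax; apply: xA; rewrite inE.
apply: (le_trans (fatou _ _ _ _)) => //.
  by move=> n x _; rewrite lee_fin; have /andP[] := f01 n x.
apply: (le_trans (limn_einf_sup _)); rewrite limn_esup_lim.
apply: lime_le; first exact: is_cvg_esups.
by apply: nearW => n; exact: (@nonincreasing_esups R).
Qed.

Lemma bump_measure_eq m1 m2 :
  (forall A, precompact_opens A -> (m1 A < +oo)%E) ->
  (forall f : X -> R, supp_in setT f -> (forall x, 0 <= f x <= 1) ->
    (\int[m1]_x (f x)%:E = \int[m2]_x (f x)%:E)%E) ->
  forall A : set (borel X), measurable A -> m1 A = m2 A.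
Proof.
move=> m1oo m12 A mA.
have e B : precompact_opens B -> m1 B = m2 B.
  move=> [oB _]; have [f [fB f01 f1]] := indic_bumps R lc hd sc oB.
  rewrite (bump_sup m1 oB fB f01 f1) (bump_sup m2 oB fB f01 f1); congr (esups _ _).
  by apply/funext => n; apply: m12 => //; have [cf kf _] := fB n.
have [E [PE Ecov]] := precompact_cover R lc hd sc.
apply: (@g_sigma_algebra_measure_unique _ _ (borel X) (@precompact_opens X) _ E) => //.
- by move=> B [oB _]; exact: open_borel.
- exact: (precompact_opensI hd).
- by move=> n; exact: m1oo.
- by rewrite -(precompact_opens_gen R lc hd sc).
Qed.

End Bumps.

Section Haar.
Variables (R : realType) (G : topGroupoid).
Hypotheses (lc : locally_compact [set: G]) (hd : hausdorff_space G).
Hypothesis sc : @second_countable G.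
Local Notation U := (gunits G).
Local Notation Gb := (borel G).
Local Notation Ub := (borel U).
Variable lam : U -> {measure set Gb -> \bar R}.
Hypothesis lamH : is_Haar_system lam.

Let lcU : locally_compact [set: U] := units_lc lc hd.
Let hdU : hausdorff_space U := units_hausdorff hd.
Let scU : @second_countable U := units_sc sc.

Lemma gr_meas : measurable_fun setT (@gr G : Gb -> Ub).
Proof. exact: continuous_borel (@gr_cont G). Qed.
Lemma gs_meas : measurable_fun setT (@gs G : Gb -> Ub).
Proof. exact: continuous_borel (@gs_cont G). Qed.
Lemma ginv_meas : measurable_fun setT (@ginv G : Gb -> Gb).
Proof. exact: continuous_borel (@ginv_cont G). Qed.

Lemma fibre_closed u : closed [set x : G | gr x = u].
Proof.
apply: (@closed_eqfun _ _ (@gr G) (fun=> u) hdU); first exact: gr_cont.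
by move=> x; exact: cvg_cst.
Qed.

Lemma lam_compl u : lam u (~` [set x : G | gr x = u]) = 0%E.
Proof.
have [_ h _ _] := lamH; have [<- _] := h u; congr (lam u _).
by apply/seteqP; split=> x /=; [move/eqP|move=> /eqP].
Qed.

Lemma lam_ae u : {ae lam u, forall x : Gb, gr x = u}.
Proof.
exists (~` [set x : G | gr x = u]); split=> //; last exact: lam_compl.
by apply: measurableC; apply: closed_borel; exact: fibre_closed.
Qed.

Lemma lam_eq u (F F' : Gb -> \bar R) : measurable_fun setT F -> measurable_fun setT F' ->
  (forall x, 0 <= F x)%E -> (forall x, 0 <= F' x)%E ->
  (forall x : G, gr x = u -> F x = F' x) -> (\int[lam u]_x F x = \int[lam u]_x F' x)%E.
Proof.
move=> mF mF' F0 F0' e; apply: ge0_ae_eq_integral => //.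
by apply: filterS (lam_ae u) => x /e.
Qed.

Lemma lam_fin u (K : set G) : compact K -> (lam u K < +oo)%E.
Proof. by move=> cK; have [r _ _ _] := lamH; have [h _ _] := r u; exact: h. Qed.

Lemma lam_precompact u (A : set G) : precompact_opens A -> (lam u A < +oo)%E.
Proof.
move=> [oA cA]; apply: le_lt_trans (lam_fin u cA); apply: le_measure; rewrite ?inE.
- exact: open_borel.
- by apply: closed_borel; exact: closed_closure.
- exact: subset_closure.
Qed.

Lemma lam_Cc (f : G -> R[i]) : Cc f -> Cc (fun u => cint (lam u) setT f).
Proof.
move=> fc; split; first by have [_ _ h _] := lamH; exact: h.
have [cf kf] := fc; have [mf1 mf2] := ccont_meas cf.
apply: (@closure_compact _ hdU _ (@gr G @` closure [set x | f x != 0])); last first.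
  by apply: continuous_compact => //; apply: continuous_subspaceT; exact: gr_cont.
move=> u /=; apply: contraNP => nu; apply/eqP.
have f0 (x : G) : gr x = u -> f x = 0.
  move=> xu; apply/eqP; apply: contrapT => /negP fx; apply: nu; exists x => //.
  exact: subset_closure.
have e (h : Gb -> R) : measurable_fun setT h -> (forall x : G, gr x = u -> h x = 0) ->
    (\int[lam u]_x (h x)%:E)%E = 0%E.
  move=> mh h0; rewrite (ae_eq_integral (cst 0%E)) ?integral0//.
    exact/measurable_EFinP.
  by apply: filterS (lam_ae u) => x xu _ /=; rewrite h0.
by rewrite /cint !e//= => x /f0->.
Qed.

Lemma lam_int_bump u (f : G -> R) : supp_in setT f -> (forall x, 0 <= f x <= 1) ->
  (\int[lam u]_x (f x)%:E)%E = (complex.Re (cint (lam u) setT (fun x => (f x)%:C)))%:E.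
Proof.
move=> sf f01; have [cf kf _] := sf; rewrite cint_real /= fineK//.
rewrite ge0_fin_numE; last by apply: integral_ge0 => x _; rewrite lee_fin; have /andP[] := f01 x.
apply: (@le_lt_trans _ _ (1%:E * lam u (closure [set x | f x != 0%R]))%E).
  apply: int_indic_le.
  - by apply: closed_borel; exact: closed_closure.
  - by apply/measurable_EFinP; exact: cont_meas.
  - by move=> x; rewrite !lee_fin.
  - move=> x nx; congr EFin; apply/eqP; apply: contrapT => /negP fx; apply: nx.
    exact: subset_closure.
by rewrite mul1e; exact: lam_fin.
Qed.

Lemma lam_bound (A : set G) : precompact_opens A ->
  exists r : R, forall u, (lam u A < r%:E)%E.
Proof.
move=> PA; have [oA cA] := PA.
have [f [sf [f01 f1]]] := urysohn_bump R lc hd cA (@openT G) (@subsetT _ _).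
have [M M0 MP] := Cc_bounded (lam_Cc (supp_in_Cc sf)).
(* [M] bounds the square of the integral of the bump, uniformly in [u], because this integral is a
   function in C_c; moreover t <= t^2 + 1 for every real t. *)
exists (M + 2) => u; apply: (@le_lt_trans _ _ (\int[lam u]_x (f x)%:E)%E).
  have mA : measurable (A : set Gb) by exact: open_borel.
  rewrite -[X in (X <= _)%E]mul1e -[X in (1 * lam u X)%E](setIT A) -integral_indic//.
  rewrite mul1e; apply: ge0_le_integral => //.
  - by apply/measurable_EFinP; exact: measurable_indic.
  - by apply/measurable_EFinP; apply: cont_meas; case: sf.
  - move=> x _; rewrite lee_fin indicE; have [/set_mem xA|xA] := boolP (x \in A).
      by rewrite f1//; exact: subset_closure.
    by have /andP[] := f01 x.
rewrite lam_int_bump// lte_fin; have := MP u; rewrite /sqn.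
set c := cint _ _ _; have := sqr_ge0 (complex.Im c); rewrite !expr2; nra.
Qed.

(** Continuity of the Haar system concerns functions in C_c. The measure of a precompact open set is
    a countable supremum of integrals of bumps, hence measurable in the unit, and [kernel_meas_gen]
    extends this to Borel sets. *)
Lemma lam_meas (A : set Gb) : measurable A -> measurable_fun setT (fun u : Ub => lam u A).
Proof.
have [E [PE Ecov]] := precompact_cover R lc hd sc.
apply: (@kernel_meas_gen _ _ Ub Gb R lam (@precompact_opens G) E) => //.
- exact: precompact_opens_gen.
- exact: precompact_opensI.
- by move=> u B; exact: lam_precompact.
- move=> B [oB _]; have [f [fB f01 f1]] := indic_bumps R lc hd sc oB.
  rewrite (_ : (fun x => _) = fun u => esups (fun n => \int[lam u]_x (f n x)%:E)%E 0%N); last first.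
    by apply/funext => u; exact: bump_sup.
  apply: measurable_fun_esups => n.
  have sf : supp_in setT (f n) by have [] := fB n.
  rewrite (_ : (fun u => _) =
    fun u => (complex.Re (cint (lam u) setT (fun x => (f n x)%:C)))%:E); last first.
    by apply/funext => u; exact: lam_int_bump.
  apply/measurable_EFinP; have [h _] := ccont_meas (lam_Cc (supp_in_Cc sf)).1.
  exact: h.
Qed.

(* The Borel extension of the multiplication to all pairs. *)
Definition gm (p : G * G) : G :=
  match pselect (gs p.1 = gr p.2) with left _ => gmul p.1 p.2 | right _ => p.2 end.

Lemma gmE x y : gs x = gr y -> gm (x, y) = gmul x y.
Proof. by move=> e; rewrite /gm; case: pselect. Qed.

Lemma gm_meas : measurable_fun setT (gm : Gb * Gb -> Gb).
Proof.
apply: (@measurability _ _ (Gb * Gb)%type Gb setT _ (@open G)) => //.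
move=> _ [W oW <-]; rewrite setTI -(borel_prod R lc hd sc lc hd sc).
pose D := [set p : G * G | gs p.1 = gr p.2].
have mD : measurable (D : set (borel (G * G)%type)).
  rewrite -[D]setCK; apply: measurableC; apply: sub_sigma_algebra.
  by apply: closed_openC; exact: (fib_sr_closed hd).
have [V oV VE] : exists2 V : set (G * G), open V & V `&` D = [set p | gmul p.1 p.2 \in W] `&` D.
  have oF : open ((fun p : fib_sr G => gmul (val p).1 (val p).2) @^-1` W).
    by apply: open_comp => // p _; exact: gmul_sr_cont.
  have [V oV VF] := oF; exists V => //; apply/seteqP.
  split=> p [Vp Dp]; split=> //; pose q : fib_sr G :=
    exist (fun q : G * G => q \in _) p (mem_set (Dp : D p)).
  - by rewrite /= inE; have : (val @^-1` V) q by []; rewrite VF.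
  - by have : (val @^-1` V) q by rewrite VF /=; move: Vp; rewrite /= inE.
have -> : gm @^-1` W = (V `&` D) `|` ((snd @^-1` W) `\` D).
  apply/seteqP; split=> p /=; rewrite /gm.
    case: pselect => h Wp; last by right; split.
    by left; have : (V `&` D) p by rewrite VE; split=> //; rewrite /= inE.
  case: pselect => h.
    move=> [VDp|[_ nD]]; last by case: nD.
    by have : (V `&` D) p by []; rewrite VE => -[] /=; rewrite inE.
  by move=> [[_ /h]|[]].
apply: measurableU; first by apply: measurableI => //; exact: sub_sigma_algebra.
apply: measurableD => //; apply: sub_sigma_algebra; apply: open_comp => // p _; exact: cvg_snd.
Qed.

Lemma gm_meas1 x : measurable_fun setT (fun y : Gb => gm (x, y) : Gb).
Proof.
exact: (measurableT_comp gm_meas (pair1_measurable (x : Gb))).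
Qed.

Lemma translate_compact x (K : set G) : compact K ->
  compact ((fun z => gmul (ginv x) z) @` (K `&` [set z | gr z = gr x])).
Proof.
move=> cK; apply: continuous_compact; last first.
  by apply: (subclosed_compact _ cK); [apply: closedI; [exact: compact_closed|exact: fibre_closed]|move=> ? []].
apply/subspace_continuousP => z [_ zx] W nW.
have /subspace_continuousP/(_ (ginv x, z) _ W nW) := @gmul_cont G.
move=> /(_ (etrans (gs_inv x) (esym zx))) h.
have cp : continuous (fun y : G => (ginv x, y)).
  by apply: cont_pair => y; [exact: cvg_cst|exact: cvg_id].
have hh : nbhs z (fun y => gs (ginv x) = gr y -> W (gmul (ginv x) y)) := cp z _ h.
suff : nbhs z (fun y => (K `&` [set z | gr z = gr x]) y ->
  W (gmul (ginv x) y)) by [].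
by apply: filterS hh => y hy [_ yx]; apply: hy; rewrite gs_inv yx.
Qed.

(** Invariance is assumed for C_c functions on the fibres. It says that the image of [lam (gs x)]
    under translation by x and [lam (gr x)] agree on bumps, so they agree as measures by
    [bump_measure_eq]. *)
Lemma lam_inv x (F : Gb -> \bar R) : measurable_fun setT F -> (forall y, 0 <= F y)%E ->
  (\int[lam (gs x)]_y F (gm (x, y)) = \int[lam (gr x)]_y F y)%E.
Proof.
move=> mF F0.
pose m2 : {measure set Gb -> \bar R} :=
  measure_function_pushforward__canonical__measure_function_Measure (lam (gs x)) (gm_meas1 x).
have -> : (\int[lam (gs x)]_y F (gm (x, y)) = \int[m2]_y F y)%E.
  by apply/esym; apply: (ge0_integral_pushforward (gm_meas1 x)).
apply/esym; apply: eq_measure_integral => B mB _.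
apply: (bump_measure_eq lc hd sc) mB; first by move=> C; exact: lam_precompact.
move=> f sf f01; have cf : Cc (fun x => (f x)%:C : R[i]) by exact: supp_in_Cc sf.
have mf : measurable_fun setT (fun y : Gb => (f y)%:E).
  by apply/measurable_EFinP; apply: cont_meas; case: sf.
have f0 y : (0 <= (f y)%:E)%E by rewrite lee_fin; have /andP[] := f01 y.
have mS u : measurable ([set y : G | gr y = u] : set Gb).
  by apply: closed_borel; exact: fibre_closed.
have D u (h : Gb -> \bar R) : measurable_fun setT h -> (forall y, 0 <= h y)%E ->
    (\int[lam u]_(y in [set y : G | gr y = u]) h y = \int[lam u]_y h y)%E.
  move=> mh h0; rewrite integral_mkcond; apply: lam_eq => //.
  - exact/(measurable_restrictT _ (mS u))/measurable_funTS.
  - by move=> y; rewrite patchE; case: ifP.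
  - by move=> y yu; rewrite patchE mem_set.
have [_ _ _ inv] := lamH; have := inv _ x cf.
have e1 : (\int[m2]_y (f y)%:E = \int[lam (gs x)]_y (f (gm (x, y)))%:E)%E.
  exact: (ge0_integral_pushforward (gm_meas1 x)).
have e2 : (\int[lam (gs x)]_y (f (gm (x, y)))%:E =
   \int[lam (gs x)]_(y in [set y : G | gr y = gs x]) (f (gmul x y))%:E)%E.
  rewrite -D//; last exact: (measurableT_comp mf (gm_meas1 x)).
  by apply: eq_integral => y; rewrite inE /= => yx; rewrite gmE.
(* Finiteness allows [fine] to be dropped in the invariance assumption. On the fibre, the translated
   bump vanishes outside the translate of a compact set. *)
have fin : (\int[lam (gs x)]_y (f (gm (x, y)))%:E < +oo)%E.
  have [_ kf _] := sf; have cT := @translate_compact x _ kf.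
  apply: le_lt_trans (lam_fin (gs x) cT); rewrite -[leRHS]mul1e.
  have mK : measurable (((fun z => gmul (ginv x) z) @`
      (closure [set y | f y != 0] `&` [set z | gr z = gr x])) : set Gb).
    by apply: closed_borel; exact: compact_closed.
  have mfg := measurableT_comp mf (gm_meas1 x).
  rewrite -D//= integral_mkcond; apply: int_indic_le => //.
  - exact/(measurable_restrictT _ (mS _))/measurable_funTS.
  - move=> y; rewrite patchE; case: ifP => _; rewrite ?lexx ?lee01//=.
    by rewrite !lee_fin; have := f01 (gm (x, y)).
  - move=> y nK; rewrite patchE; case: ifPn => // /set_mem /= yx; congr EFin.
    apply/eqP; apply: contrapT => /negP; rewrite gmE// => fxy; apply: nK.
    exists (gmul x y); first by split; [exact: subset_closure|exact: gr_mul].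
    by rewrite gmulA ?gs_inv ?gr_inv// gmulVl -yx gmul1l.
rewrite e1; have := inv _ x cf.
rewrite !cint_real => -[]; rewrite -e2 D//.
have fin2 : (\int[lam (gr x)]_y (f y)%:E < +oo)%E by rewrite lam_int_bump// ltry.
move=> e _; rewrite -[LHS]fineK ?ge0_fin_numE ?integral_ge0//.
by rewrite -e fineK// ge0_fin_numE// integral_ge0.
Qed.

End Haar.

Lemma int_indicT d (T : measurableType d) (R : realType) (m : {measure set T -> \bar R})
  (A : set T) : measurable A -> (\int[m]_x (\1_A x : R)%:E)%E = m A.
Proof. by move=> mA; rewrite integral_indic// setIT. Qed.

Lemma ginvK (G : topGroupoid) : involutive (@ginv G).
Proof.
move=> x; have : gmul (ginv (ginv x)) (gmul (ginv x) x) = x.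
  by rewrite gmulA ?gs_inv ?gr_inv// gmulVl gs_inv gmul1l.
by rewrite gmulVl -(gr_inv x) -(gs_inv (ginv x)) gmul1r.
Qed.

Lemma mul_invMl (G : topGroupoid) (x y : G) : gs x = gr y ->
  gmul (ginv (gmul x y)) x = ginv y.
Proof.
move=> xy; set a := ginv _; have ax : gs a = gr x by rewrite gs_inv gr_mul.
have e : gmul (gmul a x) y = gid (gs y) by rewrite -gmulA// gmulVl gs_mul.
have -> : gmul a x = gmul (gmul a x) (gmul y (ginv y)).
  by rewrite gmulVr -xy -(gs_mul ax) gmul1r.
by rewrite gmulA ?gs_mul ?gr_inv// e -gr_inv gmul1l.
Qed.

Lemma mul_invMr (G : topGroupoid) (x y : G) : gs x = gr y ->
  gmul y (ginv (gmul x y)) = ginv x.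
Proof.
move=> xy; set a := ginv _; have ya : gs y = gr a by rewrite gr_inv gs_mul.
have e : gmul x (gmul y a) = gid (gr x) by rewrite gmulA// gmulVr gr_mul.
have -> : gmul y a = gmul (gmul (ginv x) x) (gmul y a).
  by rewrite gmulVl xy -(gr_mul ya) gmul1l.
by rewrite -gmulA ?gs_inv ?gr_mul// e -gs_inv gmul1r.
Qed.

(** * Quasi-invariance and the multiplicativity of the density *)

Section Quasi.
Variables (R : realType) (G : topGroupoid).
Hypotheses (lc : locally_compact [set: G]) (hd : hausdorff_space G).
Hypothesis sc : @second_countable G.
Local Notation U := (gunits G).
Local Notation Gb := (borel G).
Local Notation Ub := (borel U).
Variable lam : U -> {measure set Gb -> \bar R}.
Hypothesis lamH : is_Haar_system lam.
Variable mu : {measure set Ub -> \bar R}.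
Hypothesis mu_radon : radon mu.
Variables nu nui : {measure set Gb -> \bar R}.
Hypotheses (nuE : is_nu mu lam nu) (nuiE : is_nu mu (haar_inv lam) nui).
Hypotheses (nui_ac : nui `<< nu) (D : G -> R) (DE : is_density nu nui D).

Lemma lam_kint d (T : measurableType d) (q : T -> Ub) (F : T * Gb -> \bar R) :
  measurable_fun setT q -> measurable_fun setT F -> (forall p, 0 <= F p)%E ->
  measurable_fun setT (fun t => \int[lam (q t)]_y F (t, y))%E.
Proof.
move=> mq mF F0; have [E [PE Ecov]] := precompact_cover R lc hd sc.
apply: (@kint_meas _ _ T Gb R (fun t => lam (q t)) E) => //.
- by move=> n; apply: open_borel; case: (PE n).
- by move=> t n; exact: (lam_precompact lamH).
- by move=> B mB; exact: (measurableT_comp (lam_meas lc hd sc lamH mB) mq).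
Qed.

Lemma nui_int (F : Gb -> \bar R) : measurable_fun setT F -> (forall x, 0 <= F x)%E ->
  (\int[nui]_x F x = \int[nu]_x F (ginv x))%E.
Proof.
move=> mF F0; have mFi := measurableT_comp mF (@ginv_meas G).
have F0i x : (0 <= (F \o @ginv G) x)%E by exact: F0.
rewrite (nuiE mF F0) (nuE mFi F0i).
by apply: eq_integral => u _; apply: (ge0_integral_pushforward (@ginv_meas G)).
Qed.

Lemma nu_precompact (A : set G) : precompact_opens A -> (nu A < +oo)%E.
Proof.
move=> PA; have [oA cA] := PA; have mA : measurable (A : set Gb) by exact: open_borel.
have m1 : measurable_fun setT (fun x : Gb => (\1_A x : R)%:E).
  by apply/measurable_EFinP; exact: measurable_indic.
have [r rP] := lam_bound lc hd lamH PA.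
rewrite -(setIT A) -integral_indic// nuE//.
pose K := @gr G @` closure A.
have cK : compact K.
  by apply: continuous_compact => //; apply: continuous_subspaceT; exact: gr_cont.
have mK : measurable (K : set Ub).
  by apply: closed_borel; apply: compact_closed => //; exact: units_hausdorff.
apply: (@le_lt_trans _ _ (r%:E * mu K)%E); last first.
  have [h _ _] := mu_radon; rewrite lte_mul_pinfty ?h// lee_fin.
  by have := rP point; move=> /ltW/(le_trans (measure_ge0 _ _)); rewrite lee_fin.
apply: int_indic_le => //.
- by under eq_fun do rewrite integral_indic// setIT; exact: (lam_meas lc hd sc lamH).
- by move=> u; rewrite integral_indic// setIT measure_ge0 ltW.
- move=> u nK; rewrite (lam_eq hd lamH (F' := cst 0%E)) ?integral0//=.
  move=> x xu; rewrite indicE; have [/set_mem Ax|//] := boolP (x \in A).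
  by exfalso; apply: nK; exists x => //; exact: subset_closure.
Qed.

Lemma borel_prod_meas d (S : measurableType d) (F : Gb * Gb -> S) : measurable_fun setT F ->
  measurable_fun setT (F : borel (G * G)%type -> S).
Proof.
move=> mF mT B mB; have := mF measurableT B mB.
by rewrite -(borel_prod R lc hd sc lc hd sc).
Qed.

Section Fib.
Variables (nu2sr : {measure set (borel (fib_sr G)) -> \bar R}).
Variables (nu2rr : {measure set (borel (fib_rr G)) -> \bar R}).
Hypotheses (srE : is_nu2_sr mu lam nu2sr) (rrE : is_nu2_rr mu lam nu2rr).

Lemma sr_int (F : Gb * Gb -> \bar R) : measurable_fun setT F -> (forall p, 0 <= F p)%E ->
  (\int[nu2sr]_p F (val (p : fib_sr G)) = \int[nu]_x \int[lam (gs x)]_y F (x, y))%E.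
Proof.
move=> mF F0; have m1 := lam_kint (@gs_meas G) mF F0.
have p1 x : (0 <= \int[lam (gs x)]_y F (x, y))%E by exact: integral_ge0.
by rewrite (srE (borel_prod_meas mF) F0) (nuE m1 p1).
Qed.

Lemma rr_int (F : Gb * Gb -> \bar R) : measurable_fun setT F -> (forall p, 0 <= F p)%E ->
  (\int[nu2rr]_p F (val (p : fib_rr G)) = \int[nu]_x \int[lam (gr x)]_y F (x, y))%E.
Proof.
move=> mF F0; have m1 : measurable_fun setT (fun x : Gb => \int[lam (gr x)]_y F (x, y))%E.
  exact: (lam_kint (@gr_meas G)).
have p1 x : (0 <= \int[lam (gr x)]_y F (x, y))%E by exact: integral_ge0.
rewrite (rrE (borel_prod_meas mF) F0) (nuE m1 p1).
apply: eq_integral => u _; apply: (lam_eq hd lamH _ m1 _ p1).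
- exact: (@lam_kint _ Gb (fun=> u) F (measurable_cst _) mF F0).
- by move=> x; exact: integral_ge0.
- by move=> x ->.
Qed.

End Fib.

(** [is_density] speaks of sets. The measure with density D is realized as the composite of [nui]
    with the kernel x |-> D(x) delta_x, which is s-finite along the sets where D is at most n; the
    formula for functions is that of a composed kernel. *)
Lemma dens_int (F : Gb -> \bar R) : measurable_fun setT F -> (forall x, 0 <= F x)%E ->
  (\int[nu]_x F x = \int[nui]_x ((D x)%:E * F x))%E.
Proof.
move=> mF F0; have [mD D0 DA] := DE.
have [E [PE Ecov]] := precompact_cover R lc hd sc.
have [l lE] : exists l : R.-sfker unit ~> Gb, forall t, l t = nui.
  apply: (@sfkernel_ex _ _ _ _ _ (fun=> nui) (fun n => @ginv G @^-1` (E n))).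
  - move=> n; rewrite -[X in measurable X]setTI; apply: (@ginv_meas G) => //.
    by apply: open_borel; case: (PE n).
  - by rewrite -preimage_bigcup Ecov.
  - move=> n; have mEn : measurable (E n : set Gb) by apply: open_borel; case: (PE n).
    have mIn : measurable ((@ginv G @^-1` (E n)) : set Gb).
      by rewrite -[X in measurable X]setTI; exact: (@ginv_meas G).
    have e : nui (@ginv G @^-1` E n) = nu (E n).
      rewrite -(int_indicT _ mIn) -(int_indicT _ mEn) nui_int//; last first.
        by apply/measurable_EFinP; exact: measurable_indic.
      by apply: eq_integral => x _; rewrite -[RHS]/((\1_(E n) x)%:E) -{2}[x]ginvK.
    exists (fine (nu (E n)) + 1) => _; rewrite e EFinD fineK ?ge0_fin_numE//; last exact: nu_precompact.
    by rewrite lteDl ?lte01// ge0_fin_numE//; exact: nu_precompact.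
  - by [].
have mscE0 (p : unit * Gb) (B : set Gb) :
    mscale (NngNum (D0 p.2)) (dirac p.2) B = (D p.2 * \1_B p.2)%:E.
  by rewrite /mscale /= diracE indicE EFinM.
have mscE (p : unit * Gb) (B : set Gb) :
    (mscale (NngNum (D0 p.2)) (dirac p.2) : {measure set Gb -> \bar R}) B =
    (D p.2 * \1_B p.2)%:E.
  exact: mscE0.
have mk B : measurable B -> measurable_fun setT (fun p : unit * Gb => mscale (NngNum (D0 p.2)) (dirac p.2) B).
  move=> mB; rewrite (_ : (fun p => _) = fun p : unit * Gb => (D p.2 * \1_B p.2)%:E).
    apply/measurable_EFinP; apply: measurable_funM.
      exact: (measurableT_comp mD).
    exact: (measurableT_comp (measurable_indic mB)).
  by apply/funext => p; rewrite /mscale /= diracE indicE EFinM.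
have [k kE] : exists k : R.-sfker (unit * Gb)%type ~> Gb,
    forall p, k p = mscale (NngNum (D0 p.2)) (dirac p.2).
  apply: (@sfkernel_ex _ _ (unit * Gb)%type Gb R
    (fun p => (mscale (NngNum (D0 p.2)) (dirac p.2) : {measure set Gb -> \bar R}))
    (fun n => [set x | D x <= n%:R])) => //.
  - move=> n; rewrite (_ : [set _ | _] = setT `&` (D : Gb -> R) @^-1` `]-oo, n%:R]%classic).
      exact: mD.
    by rewrite setTI; apply/seteqP; split=> x /=; rewrite in_itv.
  - apply/seteqP; split=> // x _; exists (Num.trunc (D x)).+1 => //=.
    by rewrite ltW// truncnS_gt.
  - move=> n; exists (n%:R + 1) => p; rewrite mscE lte_fin indicE.
    have [/set_mem /= h|_] := boolP (_ \in _); first by rewrite mulr1 ltr_pwDr.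
    by rewrite mulr0 ltr_wpDl.
have e A : measurable A -> setT `&` A = A -> nu A = mkcomp l k tt A.
  move=> mA _; rewrite DA// /mkcomp /= /kcomp lE [LHS]integral_mkcond.
  apply: eq_integral => x _; rewrite kE [RHS](mscE (tt, x)) patchE indicE.
  by case: (x \in A); rewrite ?mulr1 ?mulr0.
rewrite (eq_measure_integral (mkcomp l k tt)); last by move=> A mA _; apply: e; rewrite ?setTI.
rewrite [LHS]integral_kcomp// lE; apply: eq_integral => x _.
by rewrite kE ge0_integral_mscale// integral_dirac// diracT mul1e.
Qed.

(** The zero set of D is null for [nu] by the density formula, hence null for [nui] by absolute
    continuity. *)
Lemma D_pos_nui : {ae nui, forall x : Gb, 0 < D x}.
Proof.
have [mD D0 DA] := DE.
have m0 : measurable ([set x | D x = 0] : set Gb).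
  rewrite (_ : [set _ | _] = setT `&` (D : Gb -> R) @^-1` [set 0]); first exact: mD.
  by rewrite setTI.
exists [set x | D x = 0]; split=> //.
  apply/(measure0_null_setP nui m0)/nui_ac/(measure0_null_setP nu m0).
  apply: (etrans (DA _ m0)); rewrite (eq_integral (cst 0%E)) ?integral0//.
  by move=> x; rewrite inE /= => ->.
by move=> x /= /negP; rewrite -leNgt => h; apply/eqP; rewrite eq_le h D0.
Qed.

Lemma Dm12_meas : cmeas (Dm12 D : Gb -> R[i]).
Proof.
have [mD _ _] := DE; apply: cmeas_real.
exact: (measurableT_comp (measurable_powR _) mD).
Qed.

Lemma sqn_Dm12 x : 0 < D x -> sqn (Dm12 D x) = (D x)^-1.
Proof.
move=> h; rewrite /Dm12 sqnR -powR_mulrn ?powR_ge0// -powRrM.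
by rewrite mulNr mulVf ?pnatr_eq0// powR_inv1// ltW.
Qed.

Lemma Dm12_int (F : Gb -> \bar R) : measurable_fun setT F -> (forall x, 0 <= F x)%E ->
  (\int[nu]_x (F x * (sqn (Dm12 D x))%:E) = \int[nui]_x F x)%E.
Proof.
move=> mF F0; have [mD D0 DA] := DE.
have m1 : measurable_fun setT (fun x : Gb => (F x * (sqn (Dm12 D x))%:E)%E).
  by apply: emeasurable_funM => //; exact: cmeas_esqn Dm12_meas.
rewrite dens_int//; last by move=> x; rewrite mule_ge0// lee_fin sqn_ge0.
apply: ge0_ae_eq_integral => //.
- by apply: emeasurable_funM => //; apply/measurable_EFinP.
- by move=> x _; rewrite !mule_ge0// lee_fin ?sqn_ge0.
- apply: filterS D_pos_nui => x xp _; rewrite sqn_Dm12// muleCA -EFinM.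
  by rewrite divff ?gt_eqF// mule1.
Qed.

Definition iter_int (F : Gb * Gb -> \bar R) : \bar R :=
  (\int[nu]_x \int[lam (gs x)]_y F (x, y))%E.

Definition posmeas (F : Gb * Gb -> \bar R) : Prop :=
  measurable_fun setT F /\ forall p, (0 <= F p)%E.

Lemma iter_meas F : posmeas F -> measurable_fun setT (fun x : Gb => \int[lam (gs x)]_y F (x, y))%E.
Proof. by move=> [mF F0]; exact: (lam_kint (@gs_meas G)). Qed.

Lemma sec_meas F x : posmeas F -> measurable_fun setT (fun y : Gb => F (x, y)).
Proof. by move=> [mF F0]; exact: (measurableT_comp mF (pair1_measurable (x : Gb))). Qed.

Lemma iter_int_eq F F' : posmeas F -> posmeas F' ->
  (forall x y : G, gs x = gr y -> F (x, y) = F' (x, y)) -> iter_int F = iter_int F'.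
Proof.
move=> pF pF' e; have [_ F0] := pF; have [_ F0'] := pF'.
apply: eq_integral => x _; apply: (lam_eq hd lamH (sec_meas x pF) (sec_meas x pF')) => //.
by move=> y yx; rewrite e.
Qed.

(** View a composable pair (x, y) as a chain of three points with x joining the first to the second
    and y the second to the third. Then [theta] exchanges the first two points and [tau] the last
    two; they satisfy the braid relation of transpositions. *)
Definition theta (p : Gb * Gb) : Gb * Gb := (ginv p.1, gm p).
Definition tau (p : Gb * Gb) : Gb * Gb := (gm p, ginv p.2).

Lemma theta_meas : measurable_fun setT theta.
Proof.
apply: measurable_fun_pair; last exact: (gm_meas R lc hd sc).
exact: (measurableT_comp (@ginv_meas G) measurable_fst).
Qed.

Lemma tau_meas : measurable_fun setT tau.
Proof.
apply: measurable_fun_pair; first exact: (gm_meas R lc hd sc).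
exact: (measurableT_comp (@ginv_meas G) measurable_snd).
Qed.

Lemma posmeas_comp F (h : Gb * Gb -> Gb * Gb) : measurable_fun setT h -> posmeas F ->
  posmeas (F \o h).
Proof. by move=> mh [mF F0]; split=> [|p]; [exact: measurableT_comp|exact: F0]. Qed.

Definition wD (x : Gb) : \bar R := (sqn (Dm12 D x))%:E.
Lemma wD_meas : measurable_fun setT wD. Proof. exact: cmeas_esqn Dm12_meas. Qed.
Lemma wD_ge0 x : (0 <= wD x)%E. Proof. by rewrite lee_fin sqn_ge0. Qed.

Lemma posmeasM F (h : Gb * Gb -> Gb) : measurable_fun setT h -> posmeas F ->
  posmeas (fun p => (F p * wD (h p))%E).
Proof.
move=> mh [mF F0]; split=> [|p]; last by rewrite mule_ge0// wD_ge0.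
by apply: emeasurable_funM => //; exact: (measurableT_comp wD_meas).
Qed.

(** Left invariance absorbs x in the second variable. The inversion remaining in the first variable
    carries [nu] to [nui], whence the factor [wD p.1]. *)
Lemma iter_theta F : posmeas F -> iter_int (F \o theta) = iter_int (fun p => (F p * wD p.1)%E).
Proof.
move=> pF; have [mF F0] := pF.
have mI := iter_meas pF.
have I0 x : (0 <= \int[lam (gs x)]_y F (x, y))%E by exact: integral_ge0.
transitivity (\int[nu]_x \int[lam (gs (ginv x))]_y F (ginv x, y))%E.
  apply: eq_integral => x _; rewrite gs_inv.
  exact: (lam_inv lc hd sc lamH x (sec_meas (ginv x) pF)).
rewrite -(nui_int mI I0) -(Dm12_int mI I0); apply: eq_integral => x _.
by rewrite muleC -ge0_integralZl ?wD_ge0//; [under eq_integral do rewrite muleC|exact: sec_meas].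
Qed.

Lemma lam_swap u (F : Gb * Gb -> \bar R) : posmeas F ->
  (\int[lam u]_x \int[lam u]_y F (x, y) = \int[lam u]_y \int[lam u]_x F (x, y))%E.
Proof.
move=> [mF F0]; have [E [PE Ecov]] := precompact_cover R lc hd sc.
have [l lE] : exists l : R.-sfker Ub ~> Gb, forall t, l t = lam t.
  apply: (@sfkernel_ex _ _ Ub Gb R lam E) => //.
  - by move=> n; apply: open_borel; case: (PE n).
  - by move=> n; exact: (lam_bound lc hd lamH).
  - by move=> A; exact: (lam_meas lc hd sc lamH).
have sf : sfinite_measure (lam u) by rewrite -lE; exact: sfinite_kernel_measure.
pose m := HB.pack_for (SFiniteMeasure.type Gb R) (Measure.sort (lam u))
  (isSFinite.Build _ _ _ _ sf).
have -> : lam u = m by exact: eq_measure.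
exact: (@sfinite_Fubini _ _ _ _ _ m m F F0 mF).
Qed.

(** The substitution z = xy turns the integrand into F(z, z^{-1} x) over pairs of equal range. There
    x and z may be exchanged by [lam_swap], and left invariance removes z^{-1}; no inversion of a
    single variable against [nu] occurs, so no density appears. *)
Lemma iter_tau F : posmeas F -> iter_int (F \o tau) = iter_int F.
Proof.
move=> pF; have [mF F0] := pF.
pose F1 (p : Gb * Gb) := F (p.2, gm (ginv p.2, p.1)).
have mh : measurable_fun setT (fun p : Gb * Gb => (p.2, gm (ginv p.2, p.1)) : Gb * Gb).
  apply: measurable_fun_pair => //; apply: (measurableT_comp (gm_meas R lc hd sc)).
  by apply: measurable_fun_pair => //; exact: (measurableT_comp (@ginv_meas G) measurable_snd).
have p1 : posmeas F1 by exact: (posmeas_comp mh pF).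
have [mF1 F10] := p1.
have swp : posmeas (fun p : Gb * Gb => F1 (p.2, p.1)).
  by apply: (posmeas_comp _ p1); apply: measurable_fun_pair.
transitivity (\int[nu]_x \int[lam (gr x)]_z F1 (x, z))%E.
  apply: eq_integral => x _; rewrite -(lam_inv lc hd sc lamH x (sec_meas x p1))//.
  apply: (lam_eq hd lamH) => //.
  - exact: (sec_meas x (posmeas_comp tau_meas pF)).
  - exact: (measurableT_comp (sec_meas x p1) (gm_meas1 R lc hd sc x)).
  - by move=> y; exact: F0.
  - move=> y yx; rewrite /F1 /tau /= (gmE (esym yx)).
    rewrite gmE ?gs_inv ?gr_mul//; congr (F (_, _)).
    by rewrite mul_invMl.
have mI (F2 : Gb * Gb -> \bar R) : posmeas F2 ->
    (\int[nu]_x \int[lam (gr x)]_z F2 (x, z) = \int[mu]_u \int[lam u]_x \int[lam u]_z F2 (x, z))%E.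
  move=> [mF2 F20]; have m2 := lam_kint (@gr_meas G) mF2 F20.
  have p2 x : (0 <= \int[lam (gr x)]_z F2 (x, z))%E by exact: integral_ge0.
  rewrite (nuE m2 p2); apply: eq_integral => u _; apply: (lam_eq hd lamH m2 _ p2).
  - exact: (@lam_kint _ Gb (fun=> u) F2 (measurable_cst _) mF2 F20).
  - by move=> x; exact: integral_ge0.
  - by move=> x ->.
rewrite (mI _ p1).
under eq_integral do rewrite (lam_swap _ p1).
rewrite -(mI _ swp); apply: eq_integral => z _.
have := lam_inv lc hd sc lamH (ginv z) (sec_meas z pF) (fun y => F0 (z, y)).
by rewrite gs_inv gr_inv => <-.
Qed.

(** The integral of F composed with theta tau theta = tau theta tau is computed in both ways. Each
    use of [theta] costs a density: two uses leave the factors at x and at y, while the single use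
    in the other word leaves the factor at xy. *)
Lemma iter_cocycle F : posmeas F ->
  iter_int (fun p => (F p * wD p.1 * wD p.2)%E) = iter_int (fun p => (F p * wD (gm p))%E).
Proof.
move=> pF; have mgm := gm_meas R lc hd sc; have mt := theta_meas; have mu' := tau_meas.
have m1 := @measurable_fst _ _ Gb Gb; have m2 := @measurable_snd _ _ Gb Gb.
have p1 : posmeas (fun p => (F p * wD p.2)%E) by exact: (posmeasM m2 pF).
transitivity (iter_int (F \o theta \o tau \o theta)).
  rewrite (iter_theta (posmeas_comp mu' (posmeas_comp mt pF))).
  pose F2 p := (F (theta p) * wD (gm p))%E.
  have p2 : posmeas F2 by exact: (posmeasM mgm (posmeas_comp mt pF)).
  transitivity (iter_int (F2 \o tau)); last first.
    apply: iter_int_eq.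
    - exact: (posmeas_comp mu' p2).
    - exact: (posmeasM m1 (posmeas_comp mu' (posmeas_comp mt pF))).
    - move=> x y xy; rewrite /F2 /=; congr (_ * wD _)%E; rewrite /tau /= (gmE xy).
      by rewrite gmE ?gs_mul ?gr_inv// -gmulA ?gr_inv// gmulVr -xy gmul1r.
  rewrite (iter_tau p2) -[RHS]/(iter_int ((fun p => (F p * wD p.2)%E) \o theta)).
  rewrite (iter_theta p1); congr iter_int; apply/funext => p.
  by rewrite -!muleA [(wD p.1 * _)%E]muleC.
transitivity (iter_int (F \o tau \o theta \o tau)).
  apply: iter_int_eq; first exact: (posmeas_comp mt (posmeas_comp mu' (posmeas_comp mt pF))).
    exact: (posmeas_comp mu' (posmeas_comp mt (posmeas_comp mu' pF))).
  move=> x y xy; rewrite /=; congr F; rewrite /theta /tau /= (gmE xy).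
  have g1 : gm (ginv x, gmul x y) = y.
    by rewrite gmE ?gs_inv ?gr_mul// gmulA ?gs_inv ?gr_inv// gmulVl xy gmul1l.
  have g2 : gm (gmul x y, ginv y) = x.
    by rewrite gmE ?gs_mul ?gr_inv// -gmulA ?gr_inv// gmulVr -xy gmul1r.
  rewrite !g1 !g2.
  have gy : gm (y, ginv (gmul x y)) = ginv x.
    by rewrite gmE ?gr_inv ?gs_mul// mul_invMr.
  have gx : gm (ginv (gmul x y), x) = ginv y.
    by rewrite gmE ?gs_inv ?gr_mul// mul_invMl.
  by rewrite gy gx.
have p4 : posmeas (fun p => (F p * wD (gm p))%E) by exact: (posmeasM mgm pF).
rewrite (iter_tau (posmeas_comp mt (posmeas_comp mu' pF))) (iter_theta (posmeas_comp mu' pF)).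
rewrite -[RHS](iter_tau p4); apply: iter_int_eq.
- exact: (posmeasM m1 (posmeas_comp mu' pF)).
- exact: (posmeas_comp mu' p4).
- move=> x y xy /=; congr (_ * wD _)%E; rewrite /tau /= (gmE xy).
  by rewrite gmE ?gs_mul ?gr_inv// -gmulA ?gr_inv// gmulVr -xy gmul1r.
Qed.

End Quasi.

(** * Multiplication operators and operators attached to a disintegration *)

Section Mult.
Context d (T : measurableType d) (R : realType).
Local Notation C := R[i].
Variable m : {measure set T -> \bar R}.

Definition bmeas (g : T -> C) : Prop := cmeas g /\ exists2 M : R, 0 <= M & forall x, sqn (g x) <= M.

Definition mulop (g : T -> C) : L2space m -> L2space m := wco m g id.

Lemma bmeas_wcb g : bmeas g -> exists M, wcb m m g id M.
Proof. by move=> [mg [M M0 gM]]; exists M; exact: wcb_mult. Qed.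

Lemma mulop_bop g : bmeas g -> bounded_op (mulop g).
Proof. by move=> /bmeas_wcb[M h]; exact: wco_bop h. Qed.

Lemma bmeas_sqint g f : bmeas g -> f \in sqint m -> (fun x => g x * f x) \in sqint m.
Proof. by move=> /bmeas_wcb[M h] f2; exact: (wcb_sqint h f2). Qed.

Lemma mulopE g f : bmeas g -> f \in sqint m -> mulop g (cls m f) = cls m (fun x => g x * f x).
Proof. by move=> /bmeas_wcb[M h] f2; exact: (wcoE h f2). Qed.

Lemma bmeasDZ a g h : bmeas g -> bmeas h -> bmeas (fun x => a * g x + h x).
Proof.
move=> [mg [M M0 gM]] [mh [N N0 hN]]; split.
  by apply: cmeasD => //; apply: cmeasM => //; exact: cmeas_cst.
exists (2 * (sqn a * M + N)) => [|x].
  by rewrite mulr_ge0// addr_ge0// mulr_ge0// sqn_ge0.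
apply: (le_trans (sqnD _ _)); rewrite ler_pM2l// sqnM lerD//.
by rewrite ler_wpM2l ?sqn_ge0.
Qed.

Lemma mulopDZ a g h x : bmeas g -> bmeas h ->
  mulop (fun t => a * g t + h t) x = a *: mulop g x + mulop h x.
Proof.
move=> bg bh; have [f f2 ->] := cls_surj x; rewrite !mulopE//; last exact: bmeasDZ.
rewrite -clsDZ; try exact: bmeas_sqint.
by congr cls; apply/funext => t; rewrite mulrDl mulrA.
Qed.

Lemma ip_mulop g f f' : bmeas g -> f \in sqint m -> f' \in sqint m ->
  ip (cls m f) (mulop g (cls m f')) = cint m setT (fun x => g x * f' x * conjc (f x)).
Proof. by move=> bg f2 f2'; rewrite mulopE// ip_cls//; exact: bmeas_sqint. Qed.

Lemma bmeas_conj g : bmeas g -> bmeas (fun x => conjc (g x)).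
Proof.
move=> [mg [M M0 gM]]; split; last by exists M => // x; rewrite sqn_conj.
have [m1 m2] := mg; split; first by move: m1; congr measurable_fun; apply/funext => x /=; case: (g x).
rewrite (_ : (fun x => _) = (fun x => - complex.Im (g x))); last by apply/funext => x /=; case: (g x).
exact: measurable_funN.
Qed.

Lemma mulop_adj g : bmeas g -> adj (mulop g) = mulop (fun x => conjc (g x)).
Proof.
move=> bg; apply: adj_uniq; [exact: hilbert_L2|exact: mulop_bop|].
move=> x y; have [f f2 ->] := cls_surj x; have [f' f2' ->] := cls_surj y.
have bc := bmeas_conj bg.
rewrite !mulopE// !ip_cls//; try exact: bmeas_sqint.
by congr cint; apply/funext => t; rewrite rmorphM /=; ring.
Qed.

Lemma bmeasM g h : bmeas g -> bmeas h -> bmeas (fun x => g x * h x).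
Proof.
move=> [mg [M M0 gM]] [mh [N N0 hN]]; split; first exact: cmeasM.
by exists (M * N) => [|x]; rewrite ?mulr_ge0// sqnM ler_pM ?sqn_ge0.
Qed.

Lemma mulop_comp g h : bmeas g -> bmeas h -> mulop g \o mulop h = mulop (fun x => g x * h x).
Proof.
move=> bg bh; apply/funext => x /=; have [f f2 ->] := cls_surj x.
rewrite !mulopE//; [|exact: bmeasM|exact: bmeas_sqint].
by congr cls; apply/funext => t; rewrite mulrA.
Qed.

End Mult.
Arguments mulop {d T R} m g _.

Lemma sesqui0 (R : realType) (d12 d21 : R[i]) :
  d12 + d21 = 0 -> 'i * d12 + conjc 'i * d21 = 0 -> d12 = 0.
Proof.
have -> : conjc 'i = - ('i : R[i]) by rewrite /=; congr (_ +i* _); rewrite oppr0.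
move=> /eqP; rewrite addr_eq0 => /eqP->; rewrite mulrN -mulNr -mulrDl => /eqP.
rewrite mulf_eq0 => /orP[|/eqP->]; last by rewrite oppr0.
by rewrite -opprD oppr_eq0 -mulr2n mulrn_eq0 /= => /eqP[/eqP]; rewrite oner_eq0.
Qed.

Lemma Cc_sqint_gen (R : realType) (X : ptopologicalType)
    (m : {measure set (borel X) -> \bar R}) (xi : X -> R[i]) :
  (forall K : set X, compact K -> (m K < +oo)%E) -> Cc xi -> (xi : borel X -> R[i]) \in sqint m.
Proof.
move=> mfin xc; have [M M0 xM] := Cc_bounded xc; have [cx kx] := xc; apply/sqintP; split.
  exact: ccont_meas.
apply: (@le_lt_trans _ _ (M%:E * m (closure [set x | xi x != 0%R]))%E).
  apply: int_indic_le.
  - by apply: closed_borel; exact: closed_closure.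
  - exact: cmeas_esqn (ccont_meas cx).
  - by move=> x; rewrite !lee_fin sqn_ge0 /=; exact: xM.
  - move=> x nx; congr EFin; apply/eqP; rewrite sqn_eq0; apply: contrapT => /negP fx.
    by apply: nx; exact: subset_closure.
by rewrite lte_mul_pinfty ?mfin// lee_fin ltW.
Qed.

Section Fib.
Context d (T : measurableType d) d' (N : measurableType d') (R : realType).
Local Notation C := R[i].
Variables (X U : ptopologicalType).
Hypothesis hdX : hausdorff_space X.
Local Notation Xb := (borel X).
Local Notation Ub := (borel U).
Variable ka : U -> {measure set Xb -> \bar R}.

Record kern : Prop := Kern {
  ker_Cc : forall f : X -> C, Cc f -> Cc (fun u => cint (ka u) setT f);
  ker_fin : forall u (K : set X), compact K -> (ka u K < +oo)%E }.

Hypothesis kk : kern.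
Let kaCc := ker_Cc kk.
Let kafin := ker_fin kk.

Definition kip (xi xi' : X -> C) (u : U) : C := cint (ka u) setT (fun x => conjc (xi x) * xi' x).

Lemma ccont_conj (Z : ptopologicalType) (f : Z -> C) : ccontinuous f -> ccontinuous (fun x => conjc (f x)).
Proof.
move=> [f1 f2]; split=> x.
  by rewrite (_ : (fun x => _) = (fun x => complex.Re (f x)))//; apply/funext => y; case: (f y).
rewrite (_ : (fun x => _) = (fun x => - complex.Im (f x))); last by apply/funext => y; case: (f y).
exact: (continuousN (f2 x)).
Qed.

Lemma Cc_conj (Z : ptopologicalType) (f : Z -> C) : hausdorff_space Z -> Cc f ->
  Cc (fun x => conjc (f x)).
Proof.
move=> hZ fc; apply: (Cc_sub hZ fc); first by apply: ccont_conj; case: fc.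
by move=> x ->; rewrite conjc0.
Qed.

Lemma kip_Cc xi xi' : Cc xi -> Cc xi' -> Cc (kip xi xi').
Proof.
by move=> c c'; apply: kaCc; apply: CcMr => //; [exact: Cc_conj|case: c'].
Qed.

Lemma Cc_sqint u xi : Cc xi -> (xi : Xb -> C) \in sqint (ka u).
Proof. by apply: Cc_sqint_gen => K; exact: kafin. Qed.

Lemma kipE u xi xi' : Cc xi -> Cc xi' -> kip xi xi' u = ip (cls (ka u) xi) (cls (ka u) xi').
Proof.
move=> c c'; rewrite ip_cls; try exact: Cc_sqint.
by congr cint; apply/funext => x; rewrite mulrC.
Qed.

Lemma kip_sqn u xi : Cc xi -> kip xi xi u = (fine (\int[ka u]_x (sqn (xi x))%:E)%E)%:C.
Proof. by move=> c; rewrite kipE// -hnorm2 -hnorm_cls//; exact: Cc_sqint. Qed.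

Lemma kasqn_fin u xi : Cc xi -> (\int[ka u]_x (sqn (xi x))%:E)%E \is a fin_num.
Proof.
move=> c; rewrite ge0_fin_numE; first by have /sqint_lty := Cc_sqint u c.
by apply: integral_ge0 => x _; rewrite lee_fin sqn_ge0.
Qed.

Lemma ka_sqnE u xi : Cc xi ->
  (\int[ka u]_x (sqn (xi x))%:E)%E = (complex.Re (kip xi xi u))%:E.
Proof. by move=> c; rewrite kip_sqn//= fineK// kasqn_fin. Qed.

Lemma Re_kip_ge0 u xi : Cc xi -> 0 <= complex.Re (kip xi xi u).
Proof. by move=> c; rewrite -lee_fin -ka_sqnE// integral_ge0// => x _; rewrite lee_fin sqn_ge0. Qed.

Lemma kip_bound xi : Cc xi -> exists2 M : R, 0 <= M & forall u, complex.Re (kip xi xi u) <= M.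
Proof.
move=> c; have [M M0 hM] := Cc_bounded (kip_Cc c c); exists (M + 1); first by rewrite addr_ge0// ltW.
move=> u; have := hM u; rewrite /sqn; set k := kip _ _ _.
by have := sqr_ge0 (complex.Im k); rewrite !expr2; nra.
Qed.

Variables (m : {measure set T -> \bar R}) (n : {measure set N -> \bar R}).
Variables (a : N -> T) (b : N -> Xb) (w : N -> C) (q : T -> Ub).

(* [n] disintegrates, with weight [sqn w], along [a] over [m] with fibre measures
   [ka (q t)] seen through [b]. *)
Record fibd : Prop := Fibd {
  fib_a : measurable_fun setT a;
  fib_b : measurable_fun setT b;
  fib_w : cmeas w;
  fib_q : measurable_fun setT q;
  fib_int : forall (psi : Xb -> \bar R) (F : T -> \bar R),
    measurable_fun setT psi -> measurable_fun setT F ->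
    (forall x, 0 <= psi x)%E -> (forall t, 0 <= F t)%E ->
    (\int[n]_p ((sqn (w p))%:E * psi (b p) * F (a p)) =
     \int[m]_t (F t * \int[ka (q t)]_x psi x))%E }.

Hypothesis fd : fibd.
Let ma := fib_a fd.
Let mb := fib_b fd.
Let mw := fib_w fd.
Let mq := fib_q fd.
Let fibE := fib_int fd.

(** One pattern for all basic operators: with [b] the identity it gives j and j-hat (weights 1 and
    D^{-1/2}, [a] being the range or the source map); with [a] and [b] the coordinates of a fibre
    product it gives the kets. *)
Definition fop (xi : X -> C) : L2space m -> L2space n := wco n (fun p => xi (b p) * w p) a.

Let cmb f : cmeas f -> cmeas (fun p => f (b p) : C).
Proof. by move=> mf; have [? ?] := cmeas_comp mb mf. Qed.

Lemma fop_int xi (F : T -> \bar R) : Cc xi -> measurable_fun setT F -> (forall t, 0 <= F t)%E ->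
  (\int[n]_p ((sqn (xi (b p) * w p))%:E * F (a p)) =
   \int[m]_t (F t * (complex.Re (kip xi xi (q t)))%:E))%E.
Proof.
move=> c mF F0; have mx := ccont_meas c.1.
under eq_integral do rewrite sqnM mulrC EFinM.
rewrite (fibE (psi := fun x => (sqn (xi x))%:E))//; first 1 last.
- exact: cmeas_esqn.
- by move=> x; rewrite lee_fin sqn_ge0.
by apply: eq_integral => t _; rewrite ka_sqnE.
Qed.

Lemma fop_wcb xi : Cc xi -> exists M, wcb m n (fun p => xi (b p) * w p) a M.
Proof.
move=> c; have [M M0 hM] := kip_bound c; have mx := ccont_meas c.1; exists M; split=> //.
  by apply: cmeasM => //; exact: cmb.
move=> F mF F0; rewrite fop_int// -ge0_integralZl_EFin//; apply: ge0_le_integral => //.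
- by move=> t _; rewrite mule_ge0// lee_fin Re_kip_ge0.
- apply: emeasurable_funM => //; apply/measurable_EFinP.
  have [mk _] := ccont_meas (kip_Cc c c).1.
  exact: (measurableT_comp mk mq).
- exact: measurable_funeM.
- by move=> t _; rewrite muleC lee_wpmul2r// lee_fin.
Qed.

Lemma fop_bop xi : Cc xi -> bounded_op (fop xi).
Proof. by move=> /fop_wcb[M h]; exact: wco_bop h. Qed.

Lemma fopE xi f : Cc xi -> f \in sqint m ->
  fop xi (cls m f) = cls n (fun p => xi (b p) * w p * f (a p)).
Proof. by move=> /fop_wcb[M h] f2; exact: (wcoE h f2). Qed.

Lemma fop_sqint xi f : Cc xi -> f \in sqint m -> (fun p => xi (b p) * w p * f (a p)) \in sqint n.
Proof. by move=> /fop_wcb[M h] f2; exact: (wcb_sqint h f2). Qed.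

Lemma fopDZ c xi xi' x : Cc xi -> Cc xi' ->
  fop (fun y => c * xi y + xi' y) x = c *: fop xi x + fop xi' x.
Proof.
move=> cx cx'; have [f f2 ->] := cls_surj x.
rewrite !fopE//; last by apply: CcD => //; exact: CcZ.
rewrite -clsDZ; try exact: fop_sqint.
by congr cls; apply/funext => p; ring.
Qed.

Lemma Cc_bmeas (g : U -> C) : Cc g -> bmeas (fun t => g (q t)).
Proof.
move=> c; split; last by have [M /ltW M0 hM] := Cc_bounded c; exists M.
by have [? ?] := cmeas_comp mq (ccont_meas c.1).
Qed.

Lemma fop_norm xi x : Cc xi ->
  ip (fop xi x) (fop xi x) = ip x (mulop m (fun t => kip xi xi (q t)) x).
Proof.
move=> c; have [f f2 ->] := cls_surj x; have bk := Cc_bmeas (kip_Cc c c).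
rewrite -hnorm2; have mf := sqint_meas f2.
have h0 t : 0 <= complex.Re (kip xi xi (q t)) by exact: Re_kip_ge0.
have mk : measurable_fun setT (fun t => complex.Re (kip xi xi (q t))).
  by have [[h _] _] := bk.
have e : ((hnorm (fop xi (cls m f))) ^+ 2)%:E =
    (\int[m]_t (complex.Re (kip xi xi (q t)) * sqn (f t))%:E)%E.
  have [M hM] := fop_wcb c; apply: (wco_norm hM f2).
  rewrite (fop_int (F := fun t => (sqn (f t))%:E))//.
  - by apply: eq_integral => t _; rewrite -EFinM mulrC.
  - exact: cmeas_esqn.
  - by move=> t; rewrite lee_fin sqn_ge0.
rewrite ip_mulop// (_ : (fun t => _) = fun t => (complex.Re (kip xi xi (q t)) * sqn (f t))%:C).
  by rewrite cint_real -e.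
apply/funext => t; rewrite [RHS](_ : _ = (complex.Re (kip xi xi (q t)))%:C * (sqn (f t))%:C).
  by rewrite sqnE -mulrA; congr (_ * _); rewrite kip_sqn.
by rewrite -rmorphM.
Qed.

Lemma fop_ip_diag xi x y : Cc xi ->
  ip (fop xi x) (fop xi y) = ip x (mulop m (fun t => kip xi xi (q t)) y).
Proof.
move=> c; set g := fun t => _; have bf := fop_bop c; have bg : bounded_op (mulop m g).
  by apply: mulop_bop; exact: Cc_bmeas (kip_Cc c c).
have hm : hilbert (L2space m) by exact: hilbert_L2.
rewrite (adjE hm bf).
have bA : bounded_op (adj (fop xi) \o fop xi) by apply: bop_comp => //; exact: adj_bop.
have bT : bounded_op (-1 *: mulop m g + (adj (fop xi) \o fop xi) : L2space m -> L2space m).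
  by apply: bopP.
have : (-1 *: mulop m g + (adj (fop xi) \o fop xi) : L2space m -> L2space m) y = 0.
  apply: polarization => // z; rewrite -[(_ + _ : L2space m -> L2space m) z]/(-1 *: mulop m g z + adj (fop xi) (fop xi z)).
  by rewrite ipDr ipZr -adjE// fop_norm// mulN1r addNr.
rewrite -[(_ + _ : L2space m -> L2space m) y]/(-1 *: mulop m g y + adj (fop xi) (fop xi y)) => /eqP.
by rewrite scaleN1r addrC subr_eq0 => /eqP->.
Qed.

Lemma kipDZ c xi xi' eta eta' u : Cc xi -> Cc xi' -> Cc eta -> Cc eta' ->
  kip (fun y => c * xi y + xi' y) (fun y => c * eta y + eta' y) u =
  (conjc c * (c * kip xi eta u) + conjc c * kip xi eta' u) + (c * kip xi' eta u + kip xi' eta' u).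
Proof.
move=> c1 c2 c3 c4; rewrite !kipE//; try by apply: CcD => //; exact: CcZ.
rewrite !clsDZ; try exact: Cc_sqint.
by rewrite !ipDZl !ipDZr; ring.
Qed.

(** [fib_int] concerns nonnegative functions, so it yields only the norm of [fop xi x]. A first
    polarization, in the vectors, gives [fop_ip_diag]; the second one, here, is in the functions
    [xi] and [xi']. *)
Lemma fop_ip xi xi' x y : Cc xi -> Cc xi' ->
  ip (fop xi x) (fop xi' y) = ip x (mulop m (fun t => kip xi xi' (q t)) y).
Proof.
move=> c c'; have bk e e' (ce : Cc e) (ce' : Cc e') := Cc_bmeas (kip_Cc ce ce').
have [Q QE] : exists Q : (X -> C) -> (X -> C) -> C, forall e e', Q e e' = ip (fop e x) (fop e' y).
  by exists (fun e e' => ip (fop e x) (fop e' y)).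
have [S SE] : exists S : (X -> C) -> (X -> C) -> C,
    forall e e', S e e' = ip x (mulop m (fun t => kip e e' (q t)) y).
  by exists (fun e e' => ip x (mulop m (fun t => kip e e' (q t)) y)).
have QS e : Cc e -> Q e e = S e e by move=> ce; rewrite QE SE fop_ip_diag.
have Qz z : Q (fun t => z * xi t + xi' t) (fun t => z * xi t + xi' t) =
    conjc z * z * Q xi xi + (conjc z * Q xi xi' + (z * Q xi' xi + Q xi' xi')).
  rewrite !QE !fopDZ// ipDZl !ipDZr -!QE.
  by move: (Q xi xi) (Q xi xi') (Q xi' xi) (Q xi' xi') => u1 u2 u3 u4; ring.
have Sz z : S (fun t => z * xi t + xi' t) (fun t => z * xi t + xi' t) =
    conjc z * z * S xi xi + (conjc z * S xi xi' + (z * S xi' xi + S xi' xi')).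
  rewrite !SE.
  rewrite (_ : (fun t => kip _ _ (q t)) = fun t => (conjc z * z) * kip xi xi (q t) +
    (conjc z * kip xi xi' (q t) + (z * kip xi' xi (q t) + kip xi' xi' (q t)))); last first.
    by apply/funext => t; rewrite kipDZ//; ring.
  have b1 := bk _ _ c' c'; have b2 := bmeasDZ z (bk _ _ c' c) b1.
  have b3 := bmeasDZ (conjc z) (bk _ _ c c') b2.
  rewrite (mulopDZ _ _ (bk _ _ c c) b3) (mulopDZ _ _ (bk _ _ c c') b2) (mulopDZ _ _ (bk _ _ c' c) b1).
  by rewrite !ipDZr.
have key z : conjc z * (Q xi xi' - S xi xi') + z * (Q xi' xi - S xi' xi) = 0.
  have cz : Cc (fun t => z * xi t + xi' t) by apply: CcD => //; exact: CcZ.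
  have := QS _ cz; rewrite Qz Sz (QS _ c) (QS _ c') => /addrI.
  move=> /eqP; rewrite !addrA (inj_eq (addIr _)) -subr_eq0 => /eqP h; rewrite -[RHS]h.
  by move: (Q xi xi') (S xi xi') (Q xi' xi) (S xi' xi) => u1 u2 u3 u4; ring.
apply/eqP; rewrite -subr_eq0; apply/eqP; rewrite -QE -SE.
apply: (@sesqui0 _ _ (Q xi' xi - S xi' xi)).
  by have := key 1; rewrite conjc1 !mul1r.
by have := key (conjc 'i); rewrite conjcK.
Qed.

End Fib.

(** * The modules of a groupoid *)

Section LCSpace.
Variables (R : realType) (U : ptopologicalType).
Hypotheses (lc : locally_compact [set: U]) (hd : hausdorff_space U).
Hypothesis sc : @second_countable U.
Local Notation C := R[i].
Local Notation Ub := (borel U).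
Variable mu : {measure set Ub -> \bar R}.
Hypothesis mufin : forall K, compact K -> (mu K < +oo)%E.

Lemma precompact_meas (A : set U) : precompact_opens A -> measurable (A : set Ub).
Proof. by move=> [oA _]; exact: open_borel. Qed.

Lemma precompact_fin (A : set U) : precompact_opens A -> (mu A < +oo)%E.
Proof.
move=> PA; have mA := precompact_meas PA; have [oA cA] := PA.
apply: le_lt_trans (mufin cA); apply: le_measure; rewrite ?inE//.
  by apply: closed_borel; exact: closed_closure.
exact: subset_closure.
Qed.

Lemma ind_sqint d (T : measurableType d) (m : {measure set T -> \bar R}) (A : set T) :
  measurable A -> (m A < +oo)%E -> (fun x => (\1_A x)%:C) \in sqint m.
Proof.
move=> mA Aoo; apply/sqintP; split; first by apply: cmeas_real; exact: measurable_indic.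
rewrite (eq_integral (fun x => (\1_A x)%:E)) ?integral_indic ?setIT//.
by move=> x _; rewrite sqnR indicE; case: (x \in A); rewrite ?expr1n ?expr0n.
Qed.

Lemma hnorm_ind d (T : measurableType d) (m : {measure set T -> \bar R}) (A : set T) :
  measurable A -> (m A < +oo)%E -> ((hnorm (cls m (fun x => (\1_A x)%:C)) ^+ 2)%:E = m A)%E.
Proof.
move=> mA Aoo; rewrite hnorm_cls; last exact: ind_sqint.
rewrite (eq_integral (fun x => (\1_A x)%:E)) ?integral_indic ?setIT//.
by move=> x _; rewrite sqnR indicE; case: (x \in A); rewrite ?expr1n ?expr0n.
Qed.

Lemma Cc_sqint_m z : Cc z -> (z : Ub -> C) \in sqint mu.
Proof. by apply: Cc_sqint_gen => K; exact: mufin. Qed.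

(** Bumps supported in [A] lie between 0 and the indicator, so the squared difference is at most the
    difference, whose integral is small by [bump_sup]. *)
Lemma bump_approx (m : {measure set Ub -> \bar R}) (A : set U) (e : R) : precompact_opens A ->
  (m A < +oo)%E -> 0 < e -> exists f : U -> R, [/\ supp_in A f, forall x, 0 <= f x <= 1 &
    (\int[m]_x (sqn ((\1_A x)%:C - (f x)%:C))%:E <= e%:E)%E].
Proof.
move=> PA Aoo e0; have mA := precompact_meas PA; have [oA cA] := PA.
have [f [fA f01 f1]] := indic_bumps R lc hd sc oA.
have sup := bump_sup m oA fA f01 f1.
have mf k : measurable_fun setT (fun x : Ub => (f k x)%:E).
  by apply/measurable_EFinP; apply: cont_meas; case: (fA k).
have fle k x : f k x <= \1_A x.
  rewrite indicE; have [xA|xA] := boolP (x \in A); first by have /andP[] := f01 k x.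
  have [_ _ s] := fA k; rewrite leNgt; apply/negP => h; move/negP: xA; apply.
  by rewrite inE; apply: s; rewrite /= gt_eqF.
have ilt k : (\int[m]_x (f k x)%:E <= m A)%E.
  rewrite -(setIT A) -integral_indic//; apply: ge0_le_integral => //.
  - by move=> x _; rewrite lee_fin; have /andP[] := f01 k x.
  - by apply/measurable_EFinP; exact: measurable_indic.
  - by move=> x _; rewrite lee_fin.
have i0 k : (0 <= \int[m]_x (f k x)%:E)%E.
  by apply: integral_ge0 => x _; rewrite lee_fin; have /andP[] := f01 k x.
have fA' : m A \is a fin_num by rewrite ge0_fin_numE.
have [k kP] : exists k, (m A - e%:E < \int[m]_x (f k x)%:E)%E.
  apply/not_existsP => h.
  have : (m A <= m A - e%:E)%E.
    rewrite {1}sup; apply: ge_ereal_sup => _ [k _ <-]; rewrite leNgt; apply/negP; exact: h.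
  by rewrite leeBrDr// -(fineK fA') -EFinD lee_fin gerDl leNgt e0.
exists (f k); split=> //.
apply: (@le_trans _ _ (\int[m]_x ((\1_A x)%:E - (f k x)%:E))%E).
  apply: ge0_le_integral => //.
  - by move=> x _; rewrite lee_fin sqn_ge0.
  - apply: cmeas_esqn; rewrite (_ : (fun x => _) = fun x : Ub => (\1_A x - f k x)%:C); last first.
      by apply/funext => x; rewrite rmorphB.
    apply: cmeas_real; apply: measurable_funB; first exact: measurable_indic.
    by apply: cont_meas; case: (fA k).
  - apply: emeasurable_funB => //; apply/measurable_EFinP; exact: measurable_indic.
  - move=> x _; rewrite -rmorphB sqnR -EFinB lee_fin.
    have h1 := fle k x; have /andP[h2 _] := f01 k x.
    have : (\1_A x : R) <= 1 by rewrite indicE; case: (_ \in _).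
    by rewrite expr2; nra.
rewrite integralB_EFin//; last 2 first.
- apply/integrableP; split; first by apply/measurable_EFinP; exact: measurable_indic.
  under eq_integral do rewrite gee0_abs ?lee_fin//.
  by rewrite integral_indic// setIT.
- apply/integrableP; split; first exact: mf.
  rewrite (eq_integral (fun x : Ub => (f k x)%:E)); first exact: le_lt_trans (ilt k) Aoo.
  by move=> x _; rewrite /= ger0_norm//; have /andP[] := f01 k x.
rewrite integral_indic// setIT leeBlDr; last by rewrite ge0_fin_numE//; exact: le_lt_trans (ilt k) Aoo.
by rewrite addeC -leeBlDr// ltW.
Qed.

Lemma Cc_total : hspan [set cls mu z | z in @Cc R U] = setT.
Proof.
have [E [PE Ecov]] := precompact_cover R lc hd sc.
apply: hspan_orth; first exact: hilbert_L2.
move=> x h; have [f f2 xE] := cls_surj x; rewrite xE.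
apply: (cls_orth0 (precompact_opens_gen R lc hd sc) (precompact_opensI hd) PE Ecov) => //.
  by move=> A; exact: precompact_fin.
move=> A PA; have mA := precompact_meas PA; have Aoo := precompact_fin PA.
rewrite -xE; apply/eqP; rewrite -normr_eq0 normc_sqn.
set r := Num.sqrt _; have r0 : 0 <= r := sqrtr_ge0 _.
have n0 := hnorm_ge0 x.
suff : r <= 0 by move=> r1; rewrite (@le_anti _ _ r 0)// r1.
apply: le_eps => e e0; rewrite add0r.
have d0 : 0 < e / (hnorm x + 1) by rewrite divr_gt0// ltr_wpDl.
have [z [sz z01 zle]] := bump_approx PA Aoo (exprn_gt0 2 d0).
have zc := supp_in_Cc sz; have zh := h _ (ex_intro2 _ _ _ zc erefl).
rewrite -lecR /r -normc_sqn; have i2 := ind_sqint mA Aoo.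
have -> : ip (cls mu (fun y => (\1_A y)%:C)) x = ip (cls mu (fun y => (\1_A y)%:C - (z y)%:C)) x.
  by rewrite clsB//; [rewrite ipBl zh subr0|exact: Cc_sqint_m].
apply: (le_trans (ip_CS _ _)); rewrite lecR.
have h1 : hnorm (cls mu (fun y => (\1_A y)%:C - (z y)%:C)) <= e / (hnorm x + 1).
  rewrite -ler_sqr ?nnegrE ?hnorm_ge0 ?(ltW d0)// -lee_fin hnorm_cls//.
  by apply: sqintB => //; exact: Cc_sqint_m.
apply: (le_trans (ler_wpM2r n0 h1)); rewrite -mulrA ler_piMr ?(ltW e0)//.
by rewrite mulrC ler_pdivrMr ?ltr_wpDl// mul1r lerDl.
Qed.

Section FullSupport.
Hypothesis full : full_support mu.

(** If h exceeded M somewhere, it would exceed the midpoint c on a precompact open set, which has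
    positive finite measure by full support; the averaged inequality fails on that set. *)
Lemma full_le (h : U -> R) (M : R) : continuous h -> (forall u, 0 <= h u) ->
  (forall A : set U, precompact_opens A -> (\int[mu]_(x in A) (h x)%:E <= M%:E * mu A)%E) ->
  forall u, h u <= M.
Proof.
move=> ch h0 hA u; rewrite leNgt; apply/negP => Mu.
have M0 : 0 <= M \/ M < 0 by have [|] := leP 0 M; [left|right].
have [Q uQ [cQ clQ]] := compact_nbhd lc u.
pose c := (M + h u) / 2; have Mc : M < c /\ c < h u by rewrite /c; lra.
pose W := Q^° `&` [set v | c < h v].
have oW : open W.
  apply: openI; first exact: open_interior.
  by apply: (open_comp (f := h) (D := [set r | c < r])) => // v _; exact: ch.
have Wu : W u by split=> //=; case: Mc.
have PW : precompact_opens W.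
  split=> //; apply: (@closure_compact _ hd _ Q) => // v [Qv _]; exact: interior_subset Qv.
have mW := precompact_meas PW; have Woo := precompact_fin PW.
have W0 : (0 < mu W)%E by apply: full => //; exists u.
have := hA _ PW; apply/negP; rewrite -ltNge.
apply: (@lt_le_trans _ _ (c%:E * mu W)%E).
  rewrite lte_pmul2r// ?lte_fin ?ge0_fin_numE//; by case: Mc.
have c0 : 0 <= c \/ c < 0 by have [|] := leP 0 c; [left|right].
rewrite -integral_cst//; case: c0 => c0.
  apply: ge0_le_integral => //.
  - by apply/measurable_EFinP; apply: measurable_funTS; exact: cont_meas.
  - by move=> x [_ /= /ltW hx]; rewrite lee_fin.
rewrite integral_cst//; apply: (@le_trans _ _ 0%E).
  by rewrite mule_le0_ge0// lee_fin ltW.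
by apply: integral_ge0 => x _; rewrite lee_fin.
Qed.

(** Tested on indicators of precompact open sets, the operator estimate is an integral inequality
    for |f - g|^2, which [full_le] makes pointwise. *)
Lemma mulop_close_le (f g : U -> C) (e : R) : ccontinuous f -> ccontinuous g ->
  bmeas (f : Ub -> C) -> bmeas (g : Ub -> C) -> 0 <= e -> op_close (mulop mu f) (mulop mu g) e ->
  forall u, sqn (f u - g u) <= e ^+ 2.
Proof.
move=> cf cg bf bg e0 fg; apply: full_le.
- apply: ccont_sqn; have [f1 f2] := cf; have [g1 g2] := cg.
  split=> u.
    rewrite (_ : (fun x => _) = fun x => complex.Re (f x) - complex.Re (g x)).
      by apply: cvgB; [exact: f1|exact: g1].
    by apply/funext => x; case: (f x) (g x) => ? ? [].
  rewrite (_ : (fun x => _) = fun x => complex.Im (f x) - complex.Im (g x)).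
    by apply: cvgB; [exact: f2|exact: g2].
  by apply/funext => x; case: (f x) (g x) => ? ? [].
- by move=> u; exact: sqn_ge0.
- move=> A PA; have mA := precompact_meas PA; have Aoo := precompact_fin PA.
  have i2 := ind_sqint mA Aoo; have := fg (cls mu (fun x => (\1_A x)%:C)).
  rewrite !mulopE// -clsB; try exact: bmeas_sqint.
  set v := cls mu _; set v1 := cls mu _ => h.
  have h2 : hnorm v ^+ 2 <= e ^+ 2 * hnorm v1 ^+ 2.
    by rewrite -exprMn ler_sqr ?nnegrE ?mulr_ge0 ?hnorm_ge0.
  rewrite -(hnorm_ind mA Aoo) -EFinM -/v1.
  suff -> : (\int[mu]_(x in A) (sqn (f x - g x))%:E = (hnorm v ^+ 2)%:E)%E by rewrite lee_fin.
  rewrite hnorm_cls; last by apply: sqintB; exact: bmeas_sqint.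
  rewrite [LHS]integral_mkcond; apply: eq_integral => x _.
  rewrite patchE indicE; case: (x \in A); first by rewrite !mulr1.
  by rewrite !mulr0 subr0 sqn0.
Qed.

End FullSupport.

Lemma C0_bounded (f : U -> C) : C0 f -> exists2 M : R, 0 <= M & forall u, sqn (f u) <= M.
Proof.
move=> [cf kf]; have k1 := kf 1 ltr01; have cs := ccont_sqn cf.
have : compact ((fun x => sqn (f x) : R^o) @` [set x | (1 : R)%:C <= `|f x|]).
  by apply: continuous_compact => //; apply: continuous_subspaceT; exact: cs.
move=> /compact_bounded[M [_ hM]]; exists (Num.max 1 (M + 1)); first by rewrite le_max ler01.
move=> x; have [h|h] := boolP ((1 : R)%:C <= `|f x|).
  have := hM (M + 1); rewrite ltrDl => /(_ ltr01) /(_ (sqn (f x))).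
  move=> /(_ (ex_intro2 _ _ x h erefl)) /=; rewrite ger0_norm ?sqn_ge0// => h'.
  by rewrite le_max h' orbT.
move: h; rewrite normc_sqn lecR -ltNge => h; rewrite le_max; apply/orP; left.
rewrite -(sqr_sqrtr (sqn_ge0 (f x))) expr_le1 ?sqrtr_ge0//; exact: ltW.
Qed.

Lemma C0_bmeas (f : U -> C) : C0 f -> bmeas (f : Ub -> C).
Proof. by move=> f0; split; [apply: ccont_meas; case: f0|exact: C0_bounded]. Qed.

Lemma normc_le (e : R) (z : C) : 0 <= e -> (e%:C <= `|z|) = (e ^+ 2 <= sqn z).
Proof.
by move=> e0; rewrite normc_sqn lecR -ler_sqr ?nnegrE ?sqrtr_ge0// sqr_sqrtr// sqn_ge0.
Qed.

Lemma Cc_C0 (f : U -> C) : Cc f -> C0 f.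
Proof.
move=> [cf kf]; split=> // e e0; apply: (subclosed_compact _ kf).
  rewrite (_ : [set x | _] = (fun x => sqn (f x)) @^-1` [set r | e ^+ 2 <= r]).
    apply: closed_comp; last exact: closed_ge.
    by move=> x _; exact: (ccont_sqn cf).
  by apply/seteqP; split=> x /=; rewrite normc_le ?(ltW e0).
move=> x /= h; apply: subset_closure => /=; apply: contraTneq h => ->.
by rewrite normr0 lecR -ltNge.
Qed.

Lemma mulC0P (M : L2space mu -> L2space mu) : mulC0 mu M <-> exists2 f, C0 f & M = mulop mu f.
Proof.
split=> [[f f0 h]|[f f0 ->]]; exists f => //.
  by have [M' hM] := bmeas_wcb mu (C0_bmeas f0); exact: (wco_uniq hM h).
by move=> g g2; rewrite mulopE//; exact: C0_bmeas.
Qed.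

Lemma C0_conj f : C0 f -> C0 (fun u : U => conjc (f u) : C).
Proof.
move=> [cf kf]; split; first exact: ccont_conj.
move=> e e0; have := kf e e0; congr compact; apply/seteqP; split=> x /=;
  by rewrite !normc_sqn sqn_conj.
Qed.

Lemma C0M f g : C0 f -> C0 g -> C0 (fun u : U => f u * g u : C).
Proof.
move=> cf cg; have [M M0 hM] := C0_bounded cg; have [cf1 kf] := cf; have [cg1 kg] := cg.
split; first exact: ccontM.
move=> e e0; have d0 : 0 < e / (Num.sqrt M + 1) by rewrite divr_gt0// ltr_wpDl// sqrtr_ge0.
apply: (subclosed_compact _ (kf _ d0)).
  rewrite (_ : [set x | _] = (fun x => sqn (f x * g x)) @^-1` [set r | e ^+ 2 <= r]).
    apply: closed_comp; last exact: closed_ge.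
    by move=> x _; exact: (ccont_sqn (ccontM cf1 cg1)).
  by apply/seteqP; split=> x /=; rewrite normc_le ?(ltW e0).
move=> x /=; rewrite !normc_le ?(ltW e0) ?(ltW d0)// sqnM => h.
rewrite expr_div_n ler_pdivrMr ?exprn_gt0 ?ltr_wpDl ?sqrtr_ge0//; apply: (le_trans h).
rewrite ler_wpM2l ?sqn_ge0//; apply: (le_trans (hM x)).
by have := sqrtr_ge0 M; have := sqr_sqrtr M0; rewrite !expr2; nra.
Qed.

Lemma C0DZ a f g : C0 f -> C0 g -> C0 (fun u : U => a * f u + g u : C).
Proof.
move=> [cf kf] [cg kg].
have cD : ccontinuous (fun u : U => a * f u + g u : C).
  by apply: ccontD => //; apply: ccontM => //; exact: ccont_cst.
split=> // e e0.
pose A := Num.sqrt (sqn a) + 1; have A0 : 0 < A by rewrite ltr_wpDl// sqrtr_ge0.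
have d0 : 0 < e / (2 * A) by rewrite divr_gt0// mulr_gt0.
have e20 : 0 < e / 2 by rewrite divr_gt0.
apply: (@subclosed_compact _ _ ([set x | (e / (2 * A))%:C <= `|f x|] `|` [set x | (e / 2)%:C <= `|g x|])).
- rewrite (_ : [set x | _] = (fun x => sqn (a * f x + g x)) @^-1` [set r | e ^+ 2 <= r]).
    apply: closed_comp; last exact: closed_ge.
    by move=> x _; exact: (ccont_sqn cD).
  by apply/seteqP; split=> x /=; rewrite normc_le ?(ltW e0).
- by apply: compactU; [exact: kf|exact: kg].
move=> x /= h; apply: contrapT => /not_orP[]; rewrite !normc_sqn !lecR => /negP; rewrite -ltNge => h1.
move=> /negP; rewrite -ltNge => h2; have := le_trans h (ler_normD (a * f x) (g x)).
rewrite normrM !normc_sqn -rmorphM -rmorphD lecR leNgt => /negP; apply.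
have h3 : Num.sqrt (sqn a) * Num.sqrt (sqn (f x)) <= A * Num.sqrt (sqn (f x)).
  by rewrite ler_wpM2r ?sqrtr_ge0// lerDl.
have : A * Num.sqrt (sqn (f x)) < e / 2.
  rewrite -(ltr_pdivlMl _ _ A0); apply: (lt_le_trans h1).
  by suff -> : e / (2 * A) = A^-1 * (e / 2) by []; field; rewrite gt_eqF.
by move: h3; rewrite /= ; lra.
Qed.

(** Real and imaginary parts are within 2 c q^k of their limits, so the squared modulus of the error
    is at most 8 c^2 q^{2k}, hence at most (4 c q^k)^2. Uniformity then passes continuity and
    vanishing at infinity to the limit. *)
Lemma C0_limit (f : nat -> U -> C) (c : R) : 0 <= c -> (forall k, C0 (f k)) ->
  (forall k u, sqn (f k.+1 u - f k u) <= (c * 4^-1 ^+ k) ^+ 2) ->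
  exists2 g, C0 g & forall k u, sqn (g u - f k u) <= (4 * c * 4^-1 ^+ k) ^+ 2.
Proof.
move=> c0 f0 h; have q0 k : 0 <= (4^-1 : R) ^+ k by rewrite exprn_ge0// invr_ge0.
have sqr_le (x y : R) : 0 <= y -> x ^+ 2 <= y ^+ 2 -> `|x| <= y.
  by move=> y0; rewrite -[x ^+ 2]real_normK ?num_real// ler_sqr ?nnegrE.
have reP u : exists l : R, (fun k => complex.Re (f k u)) @ \oo --> l /\
    forall k, `|l - complex.Re (f k u)| <= 2 * c * 4^-1 ^+ k.
  apply: geom_limit => // k; apply: sqr_le; first by rewrite mulr_ge0.
  apply: le_trans (h k u); rewrite /sqn; case: (f k.+1 u) (f k u) => x y [x' y'] /=.
  by rewrite lerDl sqr_ge0.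
have imP u : exists l : R, (fun k => complex.Im (f k u)) @ \oo --> l /\
    forall k, `|l - complex.Im (f k u)| <= 2 * c * 4^-1 ^+ k.
  apply: geom_limit => // k; apply: sqr_le; first by rewrite mulr_ge0.
  apply: le_trans (h k u); rewrite /sqn; case: (f k.+1 u) (f k u) => x y [x' y'] /=.
  by rewrite lerDr sqr_ge0.
have /choice[r rP] := reP; have /choice[i iP] := imP.
pose g u : C := r u +i* i u.
have gle k u : sqn (g u - f k u) <= (4 * c * 4^-1 ^+ k) ^+ 2.
  have [_ /(_ k) h1] := rP u; have [_ /(_ k) h2] := iP u; have := q0 k.
  rewrite /sqn /g; case: (f k u) h1 h2 => x y /=; set s := 4^-1 ^+ k => h1 h2 s0.
  have e1 : (r u - x) ^+ 2 <= (2 * c * s) ^+ 2.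
    by rewrite -[_ ^+ 2 in X in X <= _]real_normK ?num_real// ler_sqr ?nnegrE// !mulr_ge0.
  have e2 : (i u - y) ^+ 2 <= (2 * c * s) ^+ 2.
    by rewrite -[_ ^+ 2 in X in X <= _]real_normK ?num_real// ler_sqr ?nnegrE// !mulr_ge0.
  apply: (le_trans (lerD e1 e2)); have := sqr_ge0 (c * s); rewrite !expr2; nra.
have small (e : R) : 0 < e -> exists k, 2 * c * 4^-1 ^+ k < e.
  move=> e0; have := @cvg_geometric R (2 * c) 4^-1 _; rewrite ger0_norm ?invr_ge0// invf_lt1// ltr1n.
  move=> /(_ isT) /cvgrPdist_lt/(_ _ e0)[k _ /(_ k (leqnn k))]; rewrite /geometric /= sub0r normrN => hk.
  by exists k; rewrite (le_lt_trans _ hk)// ler_norm.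
have cts (a : nat -> U -> R) (l : U -> R) : (forall k, continuous (a k)) ->
    (forall u k, `|l u - a k u| <= 2 * c * 4^-1 ^+ k) -> continuous l.
  move=> ca la u; apply/cvgrPdist_lt => e e0.
  have e3 : 0 < e / 3 by rewrite divr_gt0.
  have [k hk] := small _ e3; have cak : a k @ u --> a k u by exact: ca.
  have /cvgrPdist_lt hc := cak; move: (hc _ e3).
  apply: filterS => v av; have h1 := la u k; have h2 := la v k.
  rewrite (_ : l u - l v = (l u - a k u) + (a k u - a k v) + (a k v - l v)); last by ring.
  apply: (le_lt_trans (ler_normD _ _)); apply: (@le_lt_trans _ _ (`|l u - a k u| + `|a k u - a k v| + `|a k v - l v|)).
    by rewrite lerD2r ler_normD.
  by rewrite [`|a k v - _|]distrC; lra.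
have cg : ccontinuous g.
  split; [apply: (cts (fun k u => complex.Re (f k u)))|apply: (cts (fun k u => complex.Im (f k u)))].
  - by move=> k; have [[? _] _] := f0 k.
  - by move=> u k; have [_] := rP u.
  - by move=> k; have [[_ ?] _] := f0 k.
  - by move=> u k; have [_] := iP u.
exists g => //; split=> // e e0.
have e4 : 0 < e / 4 by rewrite divr_gt0.
have [k hk] := small _ e4; have [_ kf] := f0 k; have kc := kf _ e4.
apply: (subclosed_compact _ kc).
  rewrite (_ : [set x | _] = (fun x => sqn (g x)) @^-1` [set r | e ^+ 2 <= r]).
    by apply: closed_comp; [move=> x _; exact: (ccont_sqn cg)|exact: closed_ge].
  by apply/seteqP; split=> x /=; rewrite normc_le ?(ltW e0).
move=> x /=; rewrite !normc_sqn !lecR => gx.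
have hd2 : Num.sqrt (sqn (g x - f k x)) <= e / 2.
  rewrite -[e / 2]gtr0_norm ?divr_gt0// -sqrtr_sqr ler_wsqrtr//; apply: (le_trans (gle k x)).
  rewrite ler_sqr ?nnegrE ?divr_ge0 ?(ltW e0)// ?mulr_ge0//; lra.
have := ler_normD (g x - f k x) (f k x); rewrite subrK !normc_sqn -rmorphD lecR /=; lra.
Qed.

End LCSpace.

(** * The base C_0(G^0) and the modules generated by C_c functions *)

Section Base.
Variables (R : realType) (U : ptopologicalType).
Hypotheses (lc : locally_compact [set: U]) (hd : hausdorff_space U).
Hypothesis sc : @second_countable U.
Local Notation C := R[i].
Local Notation Ub := (borel U).
Variable mu : {measure set Ub -> \bar R}.
Hypothesis mufin : forall K, compact K -> (mu K < +oo)%E.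
Hypothesis full : full_support mu.
Local Notation K := (L2space mu).

Lemma mulop_close (f g : U -> C) (e : R) : bmeas (f : Ub -> C) -> bmeas (g : Ub -> C) -> 0 <= e ->
  (forall u, sqn (f u - g u) <= e ^+ 2) -> op_close (mulop mu f) (mulop mu g) e.
Proof.
move=> bf bg e0 h x; have [z z2 ->] := cls_surj x.
rewrite !mulopE// -clsB; try exact: bmeas_sqint.
apply: hnorm_cls_le => //; first by apply: sqintB; exact: bmeas_sqint.
by move=> u; rewrite -mulrBl sqnM ler_wpM2r ?sqn_ge0.
Qed.

(** By full support, multipliers that are Cauchy in operator norm are uniformly Cauchy; their limit
    lies in C_0 and multiplies as the limit operator does. *)
Lemma mulC0_opclosed : opclosed (mulC0 mu).
Proof.
split.
- apply/mulC0P; exists (fun=> 0); first by apply: Cc_C0; exact: Cc0.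
  apply/funext => x; have [z z2 ->] := cls_surj x.
  rewrite mulopE//; last by apply: C0_bmeas; apply: Cc_C0; exact: Cc0.
  by rewrite (_ : (fun x => _) = fun=> 0) ?cls0//; apply/funext => u; rewrite mul0r.
- move=> a _ _ /mulC0P[f f0 ->] /mulC0P[g g0 ->]; apply/mulC0P.
  exists (fun u => a * f u + g u); first exact: C0DZ.
  by apply/funext => x; rewrite mulopDZ//; exact: C0_bmeas.
- move=> T bT h.
  have /choice[f fP] : forall k : nat, exists f, C0 f /\ op_close T (mulop mu f) (4^-1 ^+ k).
    move=> k; have [|S /mulC0P[f f0 ->] c] := h (4^-1 ^+ k); first by rewrite exprn_gt0.
    by exists f.
  have q0 k : 0 <= (4^-1 : R) ^+ k by rewrite exprn_ge0// invr_ge0.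
  have fb k : bmeas (f k : Ub -> C) by apply: C0_bmeas; case: (fP k).
  (* The constant 2 bounds the error 4^-(k+1) + 4^-k of consecutive terms by 2 * 4^-k. *)
  have [|||g g0 gf] := @C0_limit R U f 2; first by [].
  + by move=> k; case: (fP k).
  + move=> k; apply: (mulop_close_le lc hd mufin full) => //.
    * by have [[]] := fP k.+1.
    * by have [[]] := fP k.
    have [_ c1] := fP k.+1; have [_ c2] := fP k.
    have := op_close_trans (op_close_sym c1) c2.
    move=> c3 x; apply: (le_trans (c3 x)); rewrite ler_wpM2r ?hnorm_ge0//.
    by rewrite exprS; have := q0 k; lra.
  apply/mulC0P; exists g => //; apply/funext => x.
  have gb := C0_bmeas g0.
  apply/eqP; rewrite -subr_eq0; apply/eqP; apply: hnorm_le0 => e e0.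
  have n0 := hnorm_ge0 x; have d0 : 0 < e / (9 * (hnorm x + 1)).
    by rewrite divr_gt0// mulr_gt0// ltr_wpDl.
  have [k hk] : exists k, (4^-1 : R) ^+ k < e / (9 * (hnorm x + 1)).
    have /cvgrPdist_lt hc := @cvg_geometric R 1 4^-1 ltac:(by rewrite ger0_norm ?invr_ge0// invf_lt1// ltr1n).
    have [k _ /(_ k (leqnn k))] := hc _ d0; rewrite /geometric /= sub0r normrN mul1r ger0_norm// => hk.
    by exists k.
  have [_ c1] := fP k; have c2 : op_close (mulop mu g) (mulop mu (f k)) (8 * 4^-1 ^+ k).
    apply: mulop_close => //.
    by move=> u; rewrite (_ : 8 = 4 * 2 :> R) ?gf// -natrM.
  have := op_close_trans c1 (op_close_sym c2) x => h2; apply: (le_trans h2).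
  rewrite (_ : 4^-1 ^+ k + 8 * 4^-1 ^+ k = 9 * 4^-1 ^+ k); last by ring.
  have : 9 * 4^-1 ^+ k * (hnorm x + 1) <= e.
    rewrite -ler_pdivlMr ?ltr_wpDl// -ler_pdivlMl//; apply: (le_trans (ltW hk)).
    by rewrite invfM mulrCA mulrC.
  by have := q0 k; lra.
Qed.

Lemma mulC0_bop T : mulC0 mu T -> bounded_op T.
Proof. by move=> /mulC0P[f f0 ->]; apply: mulop_bop; exact: C0_bmeas. Qed.

Lemma opspan_id (H L : ipSpace R) (A : set (H -> L)) : opclosed A -> (forall T, A T -> bounded_op T) ->
  opspan A = A.
Proof.
move=> cA bA; apply/seteqP; split; first exact: opspan_min.
by move=> T AT; apply: opspan_sub => //; exact: bA.
Qed.

Lemma mulC0_span : opspan (mulC0 mu) = mulC0 mu.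
Proof. by apply: opspan_id; [exact: mulC0_opclosed|exact: mulC0_bop]. Qed.

Lemma mulC0_adj T : mulC0 mu T -> mulC0 mu (adj T).
Proof.
move=> /mulC0P[f f0 ->]; rewrite mulop_adj; last exact: C0_bmeas.
by apply/mulC0P; eexists; [exact: C0_conj f0|].
Qed.

Lemma mulC0_com T S : mulC0 mu T -> mulC0 mu S -> T \o S = S \o T.
Proof.
move=> /mulC0P[f f0 ->] /mulC0P[g g0 ->].
rewrite !mulop_comp; try exact: C0_bmeas.
by congr mulop; apply/funext => u; rewrite mulrC.
Qed.

Lemma mulC0_nondeg : is_nondegenerate_Calgebra (mulC0 mu).
Proof.
split.
- exact: mulC0_span.
- move=> _ [_ /mulC0P[f f0 ->] [_ /mulC0P[g g0 ->] <-]].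
  rewrite mulop_comp; try exact: C0_bmeas.
  by apply/mulC0P; eexists; [exact: C0M f0 g0|].
- by move=> _ [T /mulC0_adj h <-].
- apply/seteqP; split=> // x _; have /seteqP[_ /(_ x Logic.I)] := Cc_total lc hd sc mufin.
  apply: hspan_min; [exact: hspan_subsp|exact: hspan_closed|].
  move=> _ [z zc <-]; have [b [sb b01 b1]] := Cc_bump hd lc zc.
  have b0 : C0 (fun u => (b u)%:C : C) by apply: Cc_C0; exact: supp_in_Cc sb.
  apply: hspan_sub; exists (mulop mu (fun u => (b u)%:C)); first by apply/mulC0P; exists (fun u => (b u)%:C).
  exists (cls mu z) => //; rewrite mulopE; [|exact: C0_bmeas|exact: Cc_sqint_m].
  congr cls; apply/funext => u; have [->|zu] := eqVneq (z u) 0; first by rewrite mulr0.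
  by rewrite b1// mul1r.
Qed.

Lemma L2_Cbase : is_Cbase (BaseData (mulC0 mu) (mulC0 mu)).
Proof. by split; [exact: hilbert_L2|exact: mulC0_nondeg|exact: mulC0_nondeg|exact: mulC0_com]. Qed.

Section Module.
Variable G : ptopologicalType.
Hypotheses (lcG : locally_compact [set: G]) (hdG : hausdorff_space G).
Local Notation Gb := (borel G).
Variables (ka : U -> {measure set Gb -> \bar R}) (kk : kern ka).
Variables (nu : {measure set Gb -> \bar R}) (p : G -> U) (w : G -> C).
Hypothesis cp : continuous p.
Hypothesis fd : fibd ka mu nu (p : Gb -> Ub) id w id.
Local Notation H := (L2space nu).
Local Notation J xi := (fop (m := mu) nu (p : Gb -> Ub) id w xi : K -> H).

(** The operator-norm closure of the operators of C_c functions. It is easier to handle than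
    [completed_image], with which [completed_cmod] identifies it. *)
Definition cmod : set (K -> H) := [set T | bounded_op T /\
  forall e : R, 0 < e -> exists2 xi, Cc xi & op_close T (J xi) e].

Let Jb xi : Cc xi -> bounded_op (J xi). Proof. by move=> c; exact: (fop_bop hdG kk fd c). Qed.

Lemma cmod_J xi : Cc xi -> cmod (J xi).
Proof.
move=> c; split; first exact: Jb.
by move=> e e0; exists xi => //; apply: op_close_refl; exact: ltW.
Qed.

Lemma cmod_bop T : cmod T -> bounded_op T. Proof. by case. Qed.

Lemma cmod_opclosed : opclosed cmod.
Proof.
have C00 := @Cc0 R G.
split.
- rewrite (_ : 0 = J (fun=> 0)); first exact: cmod_J.
  apply/funext => x; have [z z2 ->] := cls_surj x; rewrite (fopE hdG kk fd)//.
  rewrite (_ : (fun p => _) = fun=> 0) ?cls0//; apply/funext => y; by rewrite !mul0r.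
- move=> a T S [bT hT] [bS hS]; split; first exact: bopP.
  move=> e e0; have e20 : 0 < e / 2 by rewrite divr_gt0.
  have [d d0 dP] := @scale_small R a (e / 2) e20.
  have [xi c xiT] := hT d d0; have [eta c' etaS] := hS _ e20.
  exists (fun y => a * xi y + eta y); first by apply: CcD => //; exact: CcZ.
  have -> : J (fun y => a * xi y + eta y) = a *: J xi + J eta :> (K -> H).
    by apply/funext => x; rewrite (fopDZ hdG kk fd).
  exact: (op_closeP e0 d0 dP).
- move=> T bT h; split=> // e e0; have e20 : 0 < e / 2 by rewrite divr_gt0.
  have [S [bS hS] TS] := h _ e20; have [xi c xiS] := hS _ e20; exists xi => //.
  by have := op_close_trans TS xiS; rewrite -splitr.
Qed.

Lemma cmod_span : opspan cmod = cmod.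
Proof. by apply: opspan_id; [exact: cmod_opclosed|exact: cmod_bop]. Qed.

Lemma cmod_min (A : set (K -> H)) : opclosed A -> (forall xi, Cc xi -> A (J xi)) ->
  cmod `<=` A.
Proof.
move=> [_ _ cA] h T [bT hT]; apply: cA => // e /hT[xi c xiT]; exists (J xi) => //; exact: h.
Qed.

(** The estimate on indicators is averaged over precompact open sets and made pointwise by
    [full_le]. This is the half of the isometry of j and j-hat that recovers the norm of the Hilbert
    module from the operator norm. *)
Lemma J_le xi (e : R) : Cc xi -> 0 <= e -> (forall x, hnorm (J xi x) <= e * hnorm x) ->
  forall u, complex.Re (kip ka xi xi u) <= e ^+ 2.
Proof.
move=> c e0 h; apply: (full_le lc hd mufin full).
- by have [[] ] := kip_Cc hdG kk c c.
- by move=> u; exact: Re_kip_ge0.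
- move=> A PA; have mA := precompact_meas PA; have Aoo := precompact_fin mufin PA.
  have i2 := ind_sqint mA Aoo; have := h (cls mu (fun x => (\1_A x)%:C)).
  set v1 := cls mu _ => h1.
  have h2 : hnorm (J xi v1) ^+ 2 <= e ^+ 2 * hnorm v1 ^+ 2.
    by rewrite -exprMn ler_sqr ?nnegrE ?mulr_ge0 ?hnorm_ge0.
  rewrite -(hnorm_ind mA Aoo) -EFinM -/v1.
  suff -> : (\int[mu]_(x in A) (complex.Re (kip ka xi xi x))%:E = (hnorm (J xi v1) ^+ 2)%:E)%E by rewrite lee_fin.
  rewrite (fopE hdG kk fd)//; have s2 := fop_sqint hdG kk fd c i2; rewrite hnorm_cls//.
  have := fop_int kk fd (F := fun u => (\1_A u)%:E) c _ _ => /= hi.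
  rewrite [LHS]integral_mkcond; transitivity (\int[mu]_t ((\1_A t)%:E * (complex.Re (kip ka xi xi t))%:E))%E.
    by apply: eq_integral => x _; rewrite patchE indicE; case: (x \in A); rewrite ?mul1e ?mul0e.
  rewrite -hi; last 2 first.
  - by apply/measurable_EFinP; exact: measurable_indic.
  - by move=> u; rewrite lee_fin.
  apply: eq_integral => x _; rewrite [in RHS]sqnM EFinM; congr (_ * _)%E; rewrite sqnR indicE.
  by case: (_ \in A); rewrite ?expr1n ?expr0n.
Qed.

End Module.

End Base.

Lemma pos_part_div_cont (R : realType) (U : ptopologicalType) (f : U -> R[i]) (h : U -> R) (m : R) :
  0 < m -> ccontinuous f -> continuous h ->
  ccontinuous (fun u => f u * ((Num.max (h u) m)^-1)%:C).
Proof.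
move=> m0 cf ch; apply: ccontM => //; apply: ccont_real => u.
apply: cvgV; first by rewrite gt_eqF// lt_max m0 orbT.
exact: (continuous_max (ch u) (cvg_cst _)).
Qed.

Section Base.
Variables (R : realType) (U : ptopologicalType).
Hypotheses (lc : locally_compact [set: U]) (hd : hausdorff_space U).
Hypothesis sc : @second_countable U.
Local Notation C := R[i].
Local Notation Ub := (borel U).
Variable mu : {measure set Ub -> \bar R}.
Hypothesis mufin : forall K, compact K -> (mu K < +oo)%E.
Hypothesis full : full_support mu.
Local Notation K := (L2space mu).
Let hK : hilbert K := @hilbert_L2 _ _ _ mu.

Lemma C0_approx (f : U -> C) (e : R) : C0 f -> 0 < e ->
  exists2 g, Cc g & forall u, sqn (f u - g u) <= e ^+ 2.
Proof.
move=> [cf kf] e0; have [a [sa [a01 a1]]] := urysohn_bump R lc hd (kf e e0) (@openT U) (@subsetT _ _).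
have ca := supp_in_Cc sa.
exists (fun u => (a u)%:C * f u); first by apply: CcMr.
move=> u; have [h|h] := boolP (e%:C <= `|f u|); first by rewrite a1// mul1r subrr /sqn expr0n /= addr0 sqr_ge0.
rewrite -{1}[f u]mul1r -mulrBl sqnM -[1 - _](_ : (1 - a u)%:C = _); last by rewrite rmorphB.
rewrite sqnR; have /andP[a0 a1'] := a01 u.
have {}h : sqn (f u) < e ^+ 2 by rewrite ltNge -normc_le// ltW.
apply: (le_trans _ (ltW h)); rewrite -[leRHS]mul1r ler_wpM2r ?sqn_ge0// expr_le1 ?subr_ge0//.
by rewrite gerBl.
Qed.

Lemma mulC0_min (A : set (K -> K)) : opclosed A -> (forall f, Cc f -> A (mulop mu f)) -> mulC0 mu `<=` A.
Proof.
move=> [_ _ cA] h _ /mulC0P[f f0 ->]; apply: cA; first by apply: mulop_bop; exact: C0_bmeas.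
move=> e e0; have [g gc fg] := C0_approx f0 e0; exists (mulop mu g); first exact: h.
by apply: mulop_close => //; [exact: C0_bmeas|apply: C0_bmeas; exact: Cc_C0|exact: ltW].
Qed.

Section Module.
Variable G : ptopologicalType.
Hypotheses (lcG : locally_compact [set: G]) (hdG : hausdorff_space G).
Local Notation Gb := (borel G).
Variables (ka : U -> {measure set Gb -> \bar R}) (kk : kern ka).
Variables (nu : {measure set Gb -> \bar R}) (p : G -> U) (w : G -> C).
Hypothesis cp : continuous p.
Hypothesis fd : fibd ka mu nu (p : Gb -> Ub) id w id.
Local Notation H := (L2space nu).
Local Notation J xi := (fop (m := mu) nu (p : Gb -> Ub) id w xi : K -> H).
Local Notation cmod := (@cmod R U mu G nu p w).
Let hH : hilbert H := @hilbert_L2 _ _ _ nu.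

Let Jb xi : Cc xi -> bounded_op (J xi). Proof. by move=> c; exact: (fop_bop hdG kk fd c). Qed.
Let JE xi z : Cc xi -> z \in sqint mu -> J xi (cls mu z) = cls nu (fun y => xi y * w y * z (p y)).
Proof. by move=> c z2; rewrite (fopE hdG kk fd). Qed.
Let cJ xi : Cc xi -> cmod (J xi). Proof. exact: (cmod_J hdG kk fd). Qed.

Lemma base_bump (xi : G -> C) (q : G -> U) : continuous q -> Cc xi -> exists2 a : U -> R,
  supp_in setT a & forall y, xi y * (a (q y))%:C = xi y.
Proof.
move=> cq [_ kf]; have cK : compact (q @` closure [set x | xi x != 0]).
  by apply: continuous_compact => //; exact: continuous_subspaceT.
have [a [sa [_ a1]]] := urysohn_bump R lc hd cK (@openT U) (@subsetT _ _).
exists a => // y; have [->|x0] := eqVneq (xi y) 0; first by rewrite mul0r.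
by rewrite a1 ?mulr1//; exists y => //; exact: subset_closure.
Qed.

Lemma CcMcomp xi (f : U -> C) (q : G -> U) : Cc xi -> C0 f -> continuous q ->
  Cc (fun y : G => xi y * f (q y)).
Proof. by move=> c [cf _] cq; apply: CcMr => //; exact: ccont_comp. Qed.

Lemma C0_bmeas_comp (f : U -> C) (q : G -> U) : C0 f -> continuous q -> bmeas (fun y : Gb => f (q y) : C).
Proof.
move=> f0 cq; split; first by apply: ccont_meas; apply: ccont_comp => //; case: f0.
by have [M M0 h] := C0_bounded f0; exists M.
Qed.

Lemma J_mulop xi f : Cc xi -> C0 f -> J xi \o mulop mu f = J (fun y => xi y * f (p y)).
Proof.
move=> c f0; apply/funext => x; have [z z2 ->] := cls_surj x.
have fb := C0_bmeas f0; have c' := CcMcomp c f0 cp.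
rewrite /= mulopE// !JE//; last exact: bmeas_sqint.
by congr cls; apply/funext => y; ring.
Qed.

Lemma mulop_J xi (f : U -> C) (q : G -> U) : Cc xi -> C0 f -> continuous q ->
  mulop nu (fun y : Gb => f (q y)) \o J xi = J (fun y => xi y * f (q y)).
Proof.
move=> c f0 cq; apply/funext => x; have [z z2 ->] := cls_surj x.
have fb := C0_bmeas_comp f0 cq; have c' := CcMcomp c f0 cq.
rewrite /= !JE// mulopE//; last exact: (fop_sqint hdG kk fd c z2).
by congr cls; apply/funext => y; ring.
Qed.

Lemma mulop_cmod f T : C0 f -> cmod T -> mulop nu (fun y : Gb => f (p y)) \o T = T \o mulop mu f.
Proof.
move=> f0 [bT hT]; have fb := C0_bmeas_comp f0 cp; have b1 := mulop_bop nu fb.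
have [M M0 hM] := bop_bound b1; apply/funext => z /=.
apply: (@hnorm_lim0 R H _ _ (M * hnorm z + hnorm (mulop mu f z))) => e /andP[e0 _].
have [xi c xiT] := hT e e0; exists (J (fun y => xi y * f (p y)) z).
have n1 := hnorm_ge0 z; have n2 := hnorm_ge0 (mulop mu f z).
split.
  rewrite -(mulop_J c f0 cp) /= -(bopB b1); apply: (le_trans (hM _)).
  apply: (@le_trans _ _ (M * (e * hnorm z))); first by rewrite ler_pM2l//; exact: xiT.
  by rewrite mulrDl mulrAC -mulrA mulrA lerDl mulr_ge0// ltW.
rewrite -(J_mulop c f0) /=; apply: (le_trans (xiT _)).
by rewrite mulrC ler_pM2r// lerDr mulr_ge0// ltW.
Qed.

Lemma cmod_genJ : cmod `<=` opspan [set S | exists2 xi, Cc xi & S = J xi].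
Proof.
apply: cmod_min; first exact: opspan_opclosed.
by move=> xi c; apply: opspan_sub; [exact: Jb|exists xi].
Qed.

Lemma cmod_mulB : opspan (opmul cmod (mulC0 mu)) = cmod.
Proof.
apply/seteqP; split.
  apply: opspan_min; first exact: (cmod_opclosed hdG kk fd).
  apply: (opmul_min cmod_genJ (Y0 := mulC0 mu)).
  - by rewrite mulC0_span.
  - by move=> _ [xi c ->]; exact: Jb.
  - by move=> S; exact: mulC0_bop.
  - exact: (cmod_opclosed hdG kk fd).
  move=> _ [_ [xi c ->] [_ /mulC0P[f f0 ->] <-]]; rewrite J_mulop//; apply: cJ.
  exact: CcMcomp.
apply: cmod_min; first exact: opspan_opclosed.
move=> xi c; apply: opspan_sub; first exact: Jb.
have [a sa aE] := base_bump cp c; have a0 : C0 (fun u => (a u)%:C : C) by apply: Cc_C0; exact: supp_in_Cc sa.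
exists (J xi); first exact: cJ.
exists (mulop mu (fun u => (a u)%:C)); first by apply/mulC0P; exists (fun u => (a u)%:C).
by rewrite J_mulop//; congr fop; apply/funext => y; rewrite aE.
Qed.

Lemma adjJ xi xi' : Cc xi -> Cc xi' -> adj (J xi) \o J xi' = mulop mu (kip ka xi xi').
Proof.
move=> c c'; apply/funext => y; apply: (@ip_ext _ _ setT).
  by apply/seteqP; split=> // x _; exact: hspan_sub.
move=> x _; rewrite /= -(adjE hK (Jb c)); exact: (fop_ip hdG kk fd).
Qed.

Lemma cmod_ip T S : cmod T -> cmod S -> mulC0 mu (adj T \o S).
Proof.
have step xi : Cc xi -> forall S, cmod S -> mulC0 mu (adj (J xi) \o S).
  move=> c S0 cS; have bA := adj_bop hK (Jb c).
  apply: (cmod_min (opcomp_closedl bA (mulC0_opclosed lc hd mufin full)) _ cS).2 => eta c'.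
  split; first exact: Jb.
  by rewrite adjJ//; apply/mulC0P; eexists; [apply: Cc_C0; exact: (kip_Cc hdG kk c c')|].
move=> cT; have bT := cmod_bop cT; have bA := adj_bop hK bT.
move=> cS; apply: (cmod_min (opcomp_closedl bA (mulC0_opclosed lc hd mufin full)) _ cS).2 => eta c'.
split; first exact: Jb.
have := mulC0_adj (step _ c' _ cT).
by rewrite (adj_comp hK hH (adj_bop hK (Jb c')) bT) (adjK hK hH (Jb c')).
Qed.

Hypothesis Jtot : hspan [set cls nu (fun y => xi y * w y) | xi in @Cc R G] = setT.

Lemma cmod_tot : hspan (opapp cmod) = setT.
Proof.
apply/seteqP; split=> // x _; have /seteqP[_ /(_ x Logic.I)] := Jtot.
apply: hspan_min; [exact: hspan_subsp|exact: hspan_closed|].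
move=> _ [xi c <-]; have [a sa aE] := base_bump cp c.
apply: hspan_sub; exists (J xi); first exact: cJ.
exists (cls mu (fun u => (a u)%:C)) => //; rewrite JE//.
  by congr cls; apply/funext => y; rewrite mulrAC aE.
by apply: Cc_sqint_m => //; exact: supp_in_Cc sa.
Qed.

Lemma cmod_amod : amod (mulC0 mu) cmod.
Proof.
split; [exact: hH|by move=> xi; exact: cmod_bop|exact: cmod_tot|exact: cmod_ip|].
move=> _ /mulC0P[f f0 ->]; exists (mulop nu (fun y : Gb => f (p y))).
by split; [apply: mulop_bop; exact: C0_bmeas_comp|move=> xi; exact: mulop_cmod].
Qed.

Lemma cmod_rho f : C0 f -> rho cmod (mulop mu f) = mulop nu (fun y : Gb => f (p y)).
Proof.
move=> f0; apply: (rho_uniq cmod_amod).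
- by apply/mulC0P; exists f.
- by apply: mulop_bop; exact: C0_bmeas_comp.
- by move=> xi; exact: mulop_cmod.
Qed.

Lemma cmod_rho_image : rho_image (b := BaseData (mulC0 mu) (mulC0 mu)) cmod =
  [set mulop nu (fun y : Gb => f (p y)) | f in @C0 R U].
Proof.
apply/seteqP; split=> T /=.
  move=> [bT [_ /mulC0P[f f0 ->] h]]; exists f => //.
  by rewrite -(cmod_rho f0); apply: (rho_uniq cmod_amod) => //; apply/mulC0P; exists f.
move=> [f f0 <-]; split; first by apply: mulop_bop; exact: C0_bmeas_comp.
by exists (mulop mu f); [apply/mulC0P; exists f|move=> xi; exact: mulop_cmod].
Qed.

Lemma cmod_mulq (q : G -> U) : continuous q ->
  opspan (opmul [set mulop nu (fun y : Gb => f (q y)) | f in @C0 R U] cmod) = cmod.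
Proof.
move=> cq; apply/seteqP; split.
  apply: opspan_min; first exact: (cmod_opclosed hdG kk fd).
  apply: (opmul_min (X0 := [set mulop nu (fun y : Gb => f (q y)) | f in @C0 R U]) _ cmod_genJ).
  - move=> _ [f f0 <-]; apply: opspan_sub; last by exists f.
    by apply: mulop_bop; exact: C0_bmeas_comp.
  - by move=> _ [f f0 <-]; apply: mulop_bop; exact: C0_bmeas_comp.
  - by move=> _ [xi c ->]; exact: Jb.
  - exact: (cmod_opclosed hdG kk fd).
  move=> _ [_ [f f0 <-] [_ [xi c ->] <-]]; rewrite mulop_J//; apply: cJ.
  exact: CcMcomp.
apply: cmod_min; first exact: opspan_opclosed.
move=> xi c; apply: opspan_sub; first exact: Jb.
have [a sa aE] := base_bump cq c; have a0 : C0 (fun u => (a u)%:C : C) by apply: Cc_C0; exact: supp_in_Cc sa.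
exists (mulop nu (fun y : Gb => (a (q y))%:C)); first by exists (fun u => (a u)%:C).
exists (J xi); first exact: cJ.
by rewrite (mulop_J c a0 cq); congr fop; apply/funext => y; rewrite aE.
Qed.

Variable sg : U -> G.
Hypotheses (csg : continuous sg) (psg : forall u, p (sg u) = u).
Hypothesis pos : forall u (W : set G), open W -> W (sg u) -> (0 < ka u W)%E.

Lemma kip_pos (a : G -> R) u : supp_in setT a -> a (sg u) = 1 ->
  0 < complex.Re (kip ka (fun y => (a y)%:C) (fun y => (a y)%:C) u).
Proof.
move=> sa a1; have ca := supp_in_Cc sa; have [cta _ _] := sa.
have oW : open [set y | 2^-1 < a y].
  by apply: (@open_comp _ _ a [set r | 2^-1 < r]); [move=> y _; exact: cta|exact: open_gt].
have W0 := pos oW (u := u); rewrite -lte_fin -(ka_sqnE kk)//.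
apply: (@lt_le_trans _ _ ((2^-1 ^+ 2)%:E * ka u [set y | (2^-1 < a y)%R])%E).
  by rewrite mule_gt0 ?lte_fin ?exprn_gt0 ?invr_gt0//; apply: W0; rewrite /= a1 invf_lt1 ?ltr1n.
rewrite -(setIT [set y | _]) -integral_indic//; last exact: open_borel.
rewrite -ge0_integralZl_EFin//; [|by apply/measurable_EFinP; apply: measurable_indic; exact: open_borel].
apply: ge0_le_integral => //.
- apply: emeasurable_funM => //; apply/measurable_EFinP; apply: measurable_indic; exact: open_borel.
- exact: cmeas_esqn (ccont_meas (proj1 ca)).
move=> x _; rewrite -EFinM lee_fin sqnR indicE; have [|] := boolP (x \in _); rewrite ?mulr0 ?sqr_ge0//.
rewrite inE /= mulr1 => h; rewrite ler_sqr ?nnegrE ?invr_ge0//; first exact: ltW.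
by apply: le_trans (ltW h); rewrite invr_ge0.
Qed.

(** For the inclusion from right to left, a multiplier f in C_c is factored as <xi|xi> g, with xi a
    bump that is 1 on the units over the support of f. Then <xi|xi> is positive there because the
    fibre measure charges neighbourhoods of the unit. *)
Lemma cmod_full : opspan (opmul [set adj xi | xi in cmod] cmod) = mulC0 mu.
Proof.
apply/seteqP; split.
  apply: opspan_min; first exact: (mulC0_opclosed lc hd mufin full).
  by move=> _ [_ [T cT <-] [S cS <-]]; exact: cmod_ip.
apply: mulC0_min; first exact: opspan_opclosed.
move=> f fc; have [cf kf] := fc.
have cK : compact (sg @` closure [set u | f u != 0]).
  by apply: continuous_compact => //; exact: continuous_subspaceT.
have [a [sa [_ a1]]] := urysohn_bump R lcG hdG cK (@openT G) (@subsetT _ _).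
have ca := supp_in_Cc sa; set xi : G -> C := fun y => (a y)%:C.
pose h u := complex.Re (kip ka xi xi u).
have ch : continuous h by have [[]] := kip_Cc hdG kk ca ca.
have hE u : kip ka xi xi u = (h u)%:C by rewrite /h (kip_sqn kk).
have [m m0 hm] : exists2 m : R, 0 < m & forall u, f u != 0 -> m <= h u.
  have [e|ne] := pselect (exists u, f u != 0); last first.
    by exists 1 => // u fu; case: ne; exists u.
  have [||u0 ku0 hu0] := @compact_EVT_min U R h (closure [set u | f u != 0]) _ kf.
  - by have [u fu] := e; exists u; exact: subset_closure.
  - exact: continuous_subspaceT.
  exists (h u0); last by move=> u fu; apply: hu0; rewrite inE; exact: subset_closure.
  by apply: kip_pos => //; apply: a1; exists u0 => //; rewrite inE in ku0.
(* On the set where f is nonzero, h is at least m, so the maximum changes nothing there; elsewhere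
   it keeps the quotient continuous. *)
pose g u := f u * ((Num.max (h u) m)^-1)%:C.
have gc : Cc g.
  apply: (Cc_sub hd fc); first exact: pos_part_div_cont.
  by move=> u fu; rewrite /g fu mul0r.
have g0 := Cc_C0 gc.
have -> : mulop mu f = adj (J xi) \o (J xi \o mulop mu g).
  rewrite compA adjJ// mulop_comp; [|by apply: C0_bmeas; apply: Cc_C0 => //; exact: (kip_Cc hdG kk)|exact: C0_bmeas].
  congr mulop; apply/funext => u; rewrite hE /g.
  have [->|fu] := eqVneq (f u) 0; first by rewrite mul0r mulr0.
  rewrite (max_idPl (hm _ fu)) mulrCA -rmorphM mulfV ?mulr1// gt_eqF//.
  exact: lt_le_trans (hm _ fu).
rewrite J_mulop//; have c' := CcMcomp ca g0 cp.
apply: opspan_sub; first by apply: bop_comp; [exact: adj_bop (Jb ca)|exact: Jb].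
by exists (adj (J xi)); [exists (J xi) => //; exact: cJ|exists (J (fun y => xi y * g (p y))) => //; exact: cJ].
Qed.

Lemma cmod_Cmodule : is_Cmodule (b := BaseData (mulC0 mu) (mulC0 mu)) cmod.
Proof.
split; [exact: hH|exact: (cmod_span hdG kk fd)|exact: cmod_tot|exact: cmod_mulB|exact: cmod_full].
Qed.

End Module.

End Base.

Lemma compact_in_precompact_open (R : realType) (X : ptopologicalType) (K : set X) :
  locally_compact [set: X] -> hausdorff_space X -> compact K -> exists2 A, precompact_opens A & K `<=` A.
Proof.
move=> lc hd cK; have [a [[ca ka _] [_ a1]]] := urysohn_bump R lc hd cK (@openT X) (@subsetT _ _).
exists [set x | a x != 0]; last by move=> x /a1 /= ->; exact: oner_neq0.
split=> //; apply: (@open_comp _ _ a [set r | r != 0]); first by move=> y _; exact: ca.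
exact: open_neq.
Qed.

Lemma multimodule3 (R : realType) (b : baseData R) (H : ipSpace R) (h a c : set (base_space b -> H)) :
  is_Cmodule (b := base_op b) h -> is_Cmodule (b := b) a -> is_Cmodule (b := base_op b) c ->
  opspan (opmul (rho_image (b := base_op b) h) a) = a ->
  opspan (opmul (rho_image (b := base_op b) h) c) = c ->
  opspan (opmul (rho_image (b := b) a) h) = h ->
  opspan (opmul (rho_image (b := b) a) c) = c ->
  opspan (opmul (rho_image (b := base_op b) c) h) = h ->
  opspan (opmul (rho_image (b := base_op b) c) a) = a ->
  is_Cmultimodule (fun i : 'I_3 => match val i with
  | 0 => OpSet (h : set (base_space (base_op b) -> H))
  | 1 => OpSet (a : set (base_space b -> H))
  | _ => OpSet (c : set (base_space (base_op b) -> H)) end).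
Proof.
move=> *; split=> [[[|[|[|//]]] i]|[[|[|[|//]]] i] [[|[|[|//]]] j]] //.
Qed.

(** * The modules alpha and hat-beta of the groupoid *)

Section Gpd.
Variables (R : realType) (G : topGroupoid).
Hypotheses (lc : locally_compact [set: G]) (hd : hausdorff_space G).
Hypothesis sc : @second_countable G.
Local Notation C := R[i].
Local Notation U := (gunits G).
Local Notation Gb := (borel G).
Local Notation Ub := (borel U).
Variable lam : U -> {measure set Gb -> \bar R}.
Hypothesis lamH : is_Haar_system lam.
Variable mu : {measure set Ub -> \bar R}.
Hypothesis mu_radon : radon mu.
Hypothesis full : full_support mu.
Variables nu nui : {measure set Gb -> \bar R}.
Hypotheses (nuE : is_nu mu lam nu) (nuiE : is_nu mu (haar_inv lam) nui).
Hypotheses (nu_ac : nu `<< nui) (nui_ac : nui `<< nu).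
Variables (D : G -> R) (DE : is_density nu nui D).
Local Notation K := (L2space mu).
Local Notation H := (L2space nu).

Lemma gpd_lcU : locally_compact [set: U]. Proof. exact: units_lc. Qed.
Lemma gpd_hdU : hausdorff_space U. Proof. exact: units_hausdorff hd. Qed.
Lemma gpd_scU : @second_countable U. Proof. exact: units_sc sc. Qed.
Lemma gpd_mufin (A : set U) : compact A -> (mu A < +oo)%E.
Proof. by have [h _ _] := mu_radon; exact: h. Qed.
Local Notation lcU := gpd_lcU.
Local Notation hdU := gpd_hdU.
Local Notation scU := gpd_scU.
Local Notation mufin := gpd_mufin.

Definition lami (u : U) : {measure set Gb -> \bar R} :=
  measure_function_pushforward__canonical__measure_function_Measure (lam u) (@ginv_meas G).

Lemma lami_int u (F : Gb -> \bar R) : measurable_fun setT F -> (forall x, 0 <= F x)%E ->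
  (\int[lami u]_x F x = \int[lam u]_x F (ginv x))%E.
Proof. by move=> mF F0; exact: (ge0_integral_pushforward (@ginv_meas G)). Qed.

Lemma Cc_ginv (f : G -> C) : Cc f -> Cc (fun x => f (ginv x)).
Proof. by apply: Cc_homeo => //; [exact: ginv_cont|exact: ginv_cont|exact: ginvK]. Qed.

Lemma lam_kern : kern lam.
Proof. by split; [exact: (lam_Cc hd lamH)|exact: (lam_fin lamH)]. Qed.

Lemma cint_sqint_ginv u (f : G -> C) : Cc f ->
  cint (lami u) setT f = cint (lam u) setT (fun x => f (ginv x)).
Proof.
move=> fc; have fic := Cc_ginv fc.
have [mre mim] := ccont_meas (proj1 fc).
have pos (g : G -> R) : measurable_fun setT (g : Gb -> R) ->
  (\int[lami u]_x (g x)%:E = \int[lam u]_x (g (ginv x))%:E)%E.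
  move=> mg; have mG := mg; rewrite integralE [RHS]integralE; congr (_ - _)%E.
    rewrite lami_int//; first by apply: eq_integral => x _; rewrite !funeposE.
    by apply: measurable_funepos; exact/measurable_EFinP.
  rewrite lami_int//; first by apply: eq_integral => x _; rewrite !funenegE.
  by apply: measurable_funeneg; exact/measurable_EFinP.
by rewrite /cint !pos.
Qed.

Lemma lami_kern : kern lami.
Proof.
split=> [f fc|u A cA].
  rewrite (_ : (fun u => _) = fun u => cint (lam u) setT (fun x => f (ginv x))).
    exact: (lam_Cc hd lamH (Cc_ginv fc)).
  by apply/funext => u; rewrite cint_sqint_ginv.
have -> : lami u A = lam u (@ginv G @` A).
  rewrite /= /pushforward; congr (lam u _); apply/seteqP; split=> x /=.
    by move=> h; exists (ginv x) => //; rewrite ginvK.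
  by move=> [y Ay <-]; rewrite ginvK.
apply: (lam_fin lamH); apply: continuous_compact => //.
by apply: continuous_subspaceT; exact: ginv_cont.
Qed.

Lemma nu_fib (psi : Gb -> \bar R) (F : Ub -> \bar R) : measurable_fun setT psi -> measurable_fun setT F ->
  (forall x, 0 <= psi x)%E -> (forall t, 0 <= F t)%E ->
  (\int[nu]_x (psi x * F (gr x)) = \int[mu]_u (F u * \int[lam u]_x psi x))%E.
Proof.
move=> mp mF p0 F0; have mFr := measurableT_comp mF (@gr_meas G).
rewrite nuE; first last.
- by move=> x; rewrite mule_ge0.
- exact: emeasurable_funM.
apply: eq_integral => u _; rewrite -ge0_integralZl//.
apply: (lam_eq hd lamH).
- exact: emeasurable_funM.
- exact: measurable_funeM.
- by move=> x; rewrite mule_ge0.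
- by move=> x; rewrite mule_ge0.
by move=> x ->; rewrite muleC.
Qed.

Lemma fibd_alpha : fibd lam mu nu (@gr G : Gb -> Ub) id (fun=> 1) id.
Proof.
split=> //; first exact: gr_meas.
move=> psi F mp mF p0 F0; rewrite -nu_fib//; apply: eq_integral => x _.
by rewrite (sqnR (1 : R)) expr1n mul1e.
Qed.

(** The weight |D^{-1/2}|^2 turns [nu] into [nui], the image of [nu] under inversion; after
    inverting, the source map becomes the range map and [nu_fib] applies. *)
Lemma fibd_hbeta : fibd lami mu nu (@gs G : Gb -> Ub) id (Dm12 D) id.
Proof.
split=> //; [exact: gs_meas|exact: (Dm12_meas DE)|].
move=> psi F mp mF p0 F0; have mFs := measurableT_comp mF (@gs_meas G).
have mpF : measurable_fun setT (fun x : Gb => psi x * F (gs x))%E by exact: emeasurable_funM.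
transitivity (\int[nu]_x (psi x * F (gs x) * (sqn (Dm12 D x))%:E))%E.
  by apply: eq_integral => x _; rewrite [RHS]muleC muleA.
have pF0 x : (0 <= psi x * F (gs x))%E by rewrite mule_ge0.
rewrite (Dm12_int lc hd sc lamH mu_radon nuE nuiE nui_ac DE mpF pF0) (nui_int nuE nuiE mpF pF0).
have mpi : measurable_fun setT (fun x : Gb => psi (ginv x)) := measurableT_comp mp (@ginv_meas G).
transitivity (\int[nu]_x (psi (ginv x) * F (gr x)))%E.
  by apply: eq_integral => x _; rewrite gs_inv.
rewrite (nu_fib mpi mF (fun x => p0 (ginv x)) F0).
by apply: eq_integral => u _; rewrite (lami_int u mp p0).
Qed.

Definition cal : set (K -> H) := @cmod R U mu G nu (@gr G) (fun=> 1).
Definition chb : set (K -> H) := @cmod R U mu G nu (@gs G) (Dm12 D).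
Definition jA xi : K -> H := fop (m := mu) nu (@gr G : Gb -> Ub) id (fun=> 1) xi.
Definition jB xi : K -> H := fop (m := mu) nu (@gs G : Gb -> Ub) id (Dm12 D) xi.

Lemma compact_fin (m : {measure set Gb -> \bar R}) : (forall A, precompact_opens A -> (m A < +oo)%E) ->
  forall A : set G, compact A -> (m A < +oo)%E.
Proof.
move=> h A cA; have [B PB AB] := compact_in_precompact_open R lc hd cA.
apply: (le_lt_trans _ (h _ PB)); apply: le_measure => //; rewrite inE.
  by apply: closed_borel; exact: compact_closed.
by apply: open_borel; case: PB.
Qed.

Lemma nu_fin (A : set G) : compact A -> (nu A < +oo)%E.
Proof. by apply: compact_fin => B; exact: (nu_precompact lc hd sc lamH mu_radon nuE). Qed.

Lemma nui_fin (A : set G) : compact A -> (nui A < +oo)%E.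
Proof.
move=> cA; have mA : measurable (A : set Gb) by apply: closed_borel; exact: compact_closed.
have -> : nui A = nu (@ginv G @` A).
  have -> : @ginv G @` A = @ginv G @^-1` A.
    by apply/seteqP; split=> x /=; [move=> [y Ay <-]; rewrite ginvK|exists (ginv x) => //; rewrite ginvK].
  have m1 : measurable_fun setT (fun x : Gb => (\1_A x : R)%:E) by apply/measurable_EFinP; exact: measurable_indic.
  rewrite -int_indicT// (nui_int nuE nuiE)// -int_indicT//.
  by rewrite -[X in measurable X]setTI; exact: (@ginv_meas G).
apply: nu_fin; apply: continuous_compact => //; apply: continuous_subspaceT; exact: ginv_cont.
Qed.

Lemma tot_alpha : hspan [set cls nu (fun y => xi y * 1) | xi in @Cc R G] = setT.
Proof.
rewrite -(Cc_total lc hd sc nu_fin); congr hspan; apply/seteqP.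
by split=> _ [xi c <-]; exists xi => //; congr cls; apply/funext => y; rewrite mulr1.
Qed.

Lemma Dm12_neq0 : {ae nu, forall x : Gb, Dm12 D x != 0}.
Proof.
have [N [mN N0 h]] := D_pos_nui nui_ac DE; exists N; split=> //.
  by apply/(measure0_null_setP nu mN)/nu_ac/(measure0_null_setP nui mN).
apply: subset_trans h; apply: subsetC => x /= Dx.
by rewrite /Dm12 eq_complex /= eqxx andbT gt_eqF// powR_gt0.
Qed.

Lemma wcb_Dm12 : wcb nui nu (Dm12 D : Gb -> C) id 1.
Proof.
split=> //; first exact: (Dm12_meas DE).
move=> F mF F0; rewrite mul1e -(Dm12_int lc hd sc lamH mu_radon nuE nuiE nui_ac DE mF F0).
by under eq_integral do rewrite muleC.
Qed.

(** Multiplication by D^{-1/2} is bounded from L2 of [nui] to L2 of [nu], and every g is the image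
    of g D^{1/2}, as D^{-1/2} is nonzero almost everywhere. It therefore carries the total set C_c
    to a total set. *)
Lemma tot_hbeta : hspan [set cls nu (fun y => xi y * Dm12 D y) | xi in @Cc R G] = setT.
Proof.
apply/seteqP; split=> // x _; have [g g2 ->] := cls_surj x.
have mD := Dm12_meas DE; have [mg _] := (sqintP nu g).1 g2.
pose g' (y : Gb) : C := g y * (D y `^ 2^-1)%:C.
have mg' : cmeas g'.
  apply: cmeasM => //; apply: cmeas_real; have [m1 _ _] := DE.
  exact: (measurableT_comp (measurable_powR _) m1).
have le1 y : sqn (g' y) * sqn (Dm12 D y) <= sqn (g y).
  rewrite /g' /Dm12 sqnM !sqnR powRN -mulrA -exprMn ler_piMr ?sqn_ge0//.
  by rewrite exprn_ile1//; [rewrite mulr_ge0 ?invr_ge0 ?powR_ge0|have [->|d0] := eqVneq (D y `^ 2^-1) 0; rewrite ?mul0r ?divff].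
have g'2 : g' \in sqint nui.
  apply/sqintP; split=> //.
  rewrite -(Dm12_int lc hd sc lamH mu_radon nuE nuiE nui_ac DE (cmeas_esqn mg')); last first.
    by move=> y; rewrite lee_fin sqn_ge0.
  apply: (le_lt_trans _ (sqint_lty g2)); apply: ge0_le_integral => //.
  - by move=> y _; rewrite -EFinM lee_fin mulr_ge0 ?sqn_ge0.
  - by apply: emeasurable_funM; exact: cmeas_esqn.
  - exact: cmeas_esqn.
  - by move=> y _; rewrite -EFinM lee_fin.
have gE : cls nu g = wco nu (Dm12 D : Gb -> C) id (cls nui g').
  rewrite (wcoE wcb_Dm12)//; apply/cls_eqP => //.
    exact: (wcb_sqint wcb_Dm12).
  apply: filterS Dm12_neq0 => y Dy; rewrite /g' mulrCA -rmorphM powRN mulVf ?mulr1//.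
  by move: Dy; rewrite /Dm12 eq_complex /= eqxx andbT powRN invr_eq0.
have bW := wco_bop wcb_Dm12; rewrite gE; set S := hspan _.
have /seteqP[_ /(_ (cls nui g') Logic.I)] := Cc_total lc hd sc nui_fin.
suff : hspan [set cls nui z | z in @Cc R G] `<=` wco nu (Dm12 D : Gb -> C) id @^-1` S by apply.
have [s0 sP] := @hspan_subsp _ _ [set cls nu (fun y => xi y * Dm12 D y) | xi in @Cc R G].
apply: hspan_min.
- split; first by rewrite /= (bop0 bW).
  move=> a u v hu hv; rewrite -[_ (_ + _)]/(S (wco nu (Dm12 D : Gb -> C) id (a *: u + v))) (bop_lin bW).
  exact: (sP a _ _ hu hv).
- by apply: (bop_isub_hclosed bW); exact: hspan_closed.
move=> _ [z zc <-] /=; rewrite (wcoE wcb_Dm12); last exact: (Cc_sqint_m nui_fin).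
by apply: hspan_sub; exists z => //; congr cls; apply/funext => y; rewrite mulrC.
Qed.

Lemma lam_pos u (W : set G) : open W -> W (gid u) -> (0 < lam u W)%E.
Proof.
move=> oW Wu; have [_ h _ _] := lamH; have [_ h2] := h u; apply: h2 => //.
by exists (gid u) => //; exact: gr_id.
Qed.

Lemma ginv_id u : ginv (gid u) = gid u :> G.
Proof.
have := gmul1r (ginv (gid u) : G); rewrite gs_inv gr_id => <-.
by rewrite gmulVl gs_id.
Qed.

Lemma lami_pos u (W : set G) : open W -> W (gid u) -> (0 < lami u W)%E.
Proof.
move=> oW Wu; apply: (@lam_pos u (@ginv G @^-1` W)); last by rewrite /= ginv_id.
by apply: open_comp => // y _; exact: ginv_cont.
Qed.

Section Image.
Variables (ka : U -> {measure set Gb -> \bar R}) (k : U -> set Gb -> \bar R) (kk : kern ka).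
Hypothesis kE : forall u, k u = ka u.
Variables (p : G -> U) (w : G -> C).
Hypothesis fd : fibd ka mu nu (p : Gb -> Ub) id w id.
Local Notation J xi := (fop (m := mu) nu (p : Gb -> Ub) id w xi : K -> H).

Lemma J_unique xi (T : K -> H) : Cc xi ->
  (bounded_op T /\ forall z, Cc z -> T (cls mu z) = cls nu (fun x => xi x * w x * z (p x))) <-> T = J xi.
Proof.
move=> c; have bJ := fop_bop hd kk fd c.
have E z : Cc z -> J xi (cls mu z) = cls nu (fun x => xi x * w x * z (p x)).
  by move=> zc; rewrite (fopE hd kk fd c)//; exact: (Cc_sqint_m mufin).
split=> [[bT TE]|->]; last by split.
by apply: (bop_ext_on bT bJ (Cc_total lcU hdU scU mufin)) => _ [z zc <-]; rewrite TE// E.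
Qed.

(** Choosing approximants within 1/(n+1) in operator norm gives a sequence in C_c that is Cauchy for
    the norm of the Hilbert module, by [J_le]; this is the sequence that [completed_image] asks
    for. *)
Lemma completed_cmod (JR : (G -> C) -> (K -> H) -> Prop) :
  (forall xi T, Cc xi -> JR xi T <-> T = J xi) -> completed_image k JR = @cmod R U mu G nu p w.
Proof.
move=> JE; apply/seteqP; split=> T [bT].
  move=> [xi [S [h _ cv]]]; split=> // e e0; have [N hN] := cv e e0.
  have [c /(JE _ _ c) SE] := h N; exists (xi N) => //; rewrite -SE; apply: op_close_sym; exact: hN.
move=> hT; split=> //.
have n0 n : (0 : R) < n.+1%:R^-1 by rewrite invr_gt0.
have /choice[xi xiP] : forall n : nat, exists xi, Cc xi /\ op_close T (J xi) n.+1%:R^-1.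
  by move=> n; have [xi c h] := hT _ (n0 n); exists xi.
have lim (e : R) : 0 < e -> exists N : nat, forall n, (N <= n)%N -> n.+1%:R^-1 <= e.
  move=> e0; exists (Num.truncn e^-1) => n Nn; rewrite -[leRHS]invrK lef_pV2 ?posrE ?invr_gt0//.
  by apply: ltW; apply: (lt_le_trans (truncnS_gt _)); rewrite ler_nat.
exists xi, (fun n => J (xi n)); split.
- by move=> n; have [c _] := xiP n; split=> //; exact/JE.
- move=> e e0; have e20 : 0 < e / 2 by rewrite divr_gt0.
  have [N hN] := lim _ e20; exists N => m n Nm Nn u.
  have [cm hm] := xiP m; have [cn hn] := xiP n; have cmn := CcB hd cm cn.
  rewrite /mod_ip kE; apply: (J_le lcU hdU mufin full hd kk fd cmn) (ltW e0) _ u.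
  move=> x; have -> : J (fun y => xi m y - xi n y) x = J (xi m) x - J (xi n) x.
    have := fopDZ hd kk fd (-1) x cn cm; rewrite scaleN1r addrC => <-.
    by congr (fop _ _ _ _ _ _); apply/funext => y; rewrite mulN1r addrC.
  have := op_close_trans (op_close_sym hm) hn x => /le_trans; apply.
  by rewrite ler_wpM2r ?hnorm_ge0// [leRHS]splitr lerD// hN.
- move=> e e0; have [N hN] := lim _ e0; exists N => n Nn x; have [_ hn] := xiP n.
  apply: (le_trans (op_close_sym hn x)); rewrite ler_wpM2r ?hnorm_ge0//; exact: hN.
Qed.

End Image.

Lemma is_jE xi T : Cc xi -> is_j xi T <-> T = jA xi.
Proof.
move=> c; rewrite /jA -(J_unique lam_kern fibd_alpha)//.
by split=> -[bT h]; split=> // z zc; rewrite h//; congr cls; apply/funext => x; rewrite mulr1.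
Qed.

Lemma is_jhatE xi T : Cc xi -> is_jhat D xi T <-> T = jB xi.
Proof. by move=> c; rewrite /jB -(J_unique lami_kern fibd_hbeta). Qed.

Lemma gpd_alphaE : gpd_alpha mu nu lam = cal.
Proof. by apply: (completed_cmod lam_kern _ fibd_alpha) => //; exact: is_jE. Qed.

Lemma gpd_hbetaE : gpd_hbeta mu nu D lam = chb.
Proof. by apply: (completed_cmod lami_kern _ fibd_hbeta) => //; exact: is_jhatE. Qed.

Lemma cal_Cmodule : is_Cmodule (b := gpd_base mu) cal.
Proof.
exact: (cmod_Cmodule lcU hdU mufin full lc hd lam_kern (@gr_cont G) fibd_alpha tot_alpha
  (@gid_cont G) lam_pos).
Qed.

Lemma chb_Cmodule : is_Cmodule (b := gpd_base mu) chb.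
Proof.
exact: (cmod_Cmodule lcU hdU mufin full lc hd lami_kern (@gs_cont G) fibd_hbeta tot_hbeta
  (@gid_cont G) lami_pos).
Qed.

Lemma cal_amod : amod (mulC0 mu) cal.
Proof. exact: (cmod_amod lcU hdU mufin full hd lam_kern (@gr_cont G) fibd_alpha tot_alpha). Qed.

Lemma chb_amod : amod (mulC0 mu) chb.
Proof. exact: (cmod_amod lcU hdU mufin full hd lami_kern (@gs_cont G) fibd_hbeta tot_hbeta). Qed.

Lemma cal_rho f : C0 f -> rho cal (mulop mu f) = mulop nu (fun y : Gb => f (gr y)).
Proof. exact: (cmod_rho lcU hdU mufin full hd lam_kern (@gr_cont G) fibd_alpha tot_alpha). Qed.

Lemma chb_rho f : C0 f -> rho chb (mulop mu f) = mulop nu (fun y : Gb => f (gs y)).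
Proof. exact: (cmod_rho lcU hdU mufin full hd lami_kern (@gs_cont G) fibd_hbeta tot_hbeta). Qed.

Lemma gpd_multimodule : is_Cmultimodule (fun i : 'I_3 => match val i with
  | 0 => OpSet (chb : set (base_space (base_op (gpd_base mu)) -> H))
  | 1 => OpSet (cal : set (base_space (gpd_base mu) -> H))
  | _ => OpSet (cal : set (base_space (base_op (gpd_base mu)) -> H)) end).
Proof.
have imA : rho_image (b := gpd_base mu) cal = [set mulop nu (fun y : Gb => f (gr y)) | f in @C0 R U].
  exact: (cmod_rho_image lcU hdU mufin full hd lam_kern (@gr_cont G) fibd_alpha tot_alpha).
have imB : rho_image (b := gpd_base mu) chb = [set mulop nu (fun y : Gb => f (gs y)) | f in @C0 R U].
  exact: (cmod_rho_image lcU hdU mufin full hd lami_kern (@gs_cont G) fibd_hbeta tot_hbeta).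
have mqA q : continuous q -> opspan (opmul [set mulop nu (fun y : Gb => f (q y)) | f in @C0 R U] cal) = cal.
  by move=> cq; exact: (cmod_mulq lcU hdU hd lam_kern fibd_alpha).
have mqB q : continuous q -> opspan (opmul [set mulop nu (fun y : Gb => f (q y)) | f in @C0 R U] chb) = chb.
  by move=> cq; exact: (cmod_mulq lcU hdU hd lami_kern fibd_hbeta).
have hAA : opspan (opmul (rho_image (b := gpd_base mu) cal) cal) = cal.
  by rewrite imA; apply: mqA; exact: gr_cont.
have hAB : opspan (opmul (rho_image (b := gpd_base mu) cal) chb) = chb.
  by rewrite imA; apply: mqB; exact: gr_cont.
have hBA : opspan (opmul (rho_image (b := gpd_base mu) chb) cal) = cal.
  by rewrite imB; apply: mqA; exact: gs_cont.
exact: (multimodule3 (b := gpd_base mu) chb_Cmodule cal_Cmodule cal_Cmodule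
  hBA hBA hAB hAA hAB hAA).
Qed.

End Gpd.

(** * Relative tensor products as L2 spaces *)

Section RectGen.
Context d1 (T : measurableType d1) d2 (Y : measurableType d2) d3 (N : measurableType d3).
Variables (P1 : set (set T)) (P2 : set (set Y)) (a : N -> T) (b : N -> Y).
Hypotheses (g1 : @measurable _ T = <<s P1 >>) (g2 : @measurable _ Y = <<s P2 >>).
Variables (E1 : nat -> set T) (E2 : nat -> set Y).
Hypotheses (PE1 : forall n, P1 (E1 n)) (PE2 : forall n, P2 (E2 n)).
Hypotheses (c1 : \bigcup_n E1 n = setT) (c2 : \bigcup_n E2 n = setT).
Hypotheses (ma : measurable_fun setT a) (mb : measurable_fun setT b).

Definition rects : set (set N) := [set a @^-1` A `&` b @^-1` B | A in P1 & B in P2].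

Hypothesis gN : forall S : set (set N), sigma_algebra setT S ->
  (forall A, measurable A -> S (a @^-1` A)) -> (forall B, measurable B -> S (b @^-1` B)) ->
  measurable `<=` S.

(** [gN] says that the coordinates [a] and [b] generate the measurable sets; a preimage under a
    single coordinate is a countable union of rectangles because the other coordinate is covered by
    test sets. *)
Lemma rect_gen : @measurable _ N = <<s rects >>.
Proof.
apply/seteqP; split; last first.
  apply: smallest_sub; first exact: sigma_algebra_measurable.
  move=> _ [A PA [B PB <-]]; apply: measurableI; rewrite -[X in measurable X]setTI.
    by apply: ma => //; rewrite g1; exact: sub_sigma_algebra.
  by apply: mb => //; rewrite g2; exact: sub_sigma_algebra.
apply: gN; first exact: smallest_sigma_algebra.
- move=> A mA.
  have m : measurable_fun [set: g_sigma_algebraType rects] (a : g_sigma_algebraType rects -> T).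
    apply: (measurability P1) => // _ [B PB <-]; rewrite setTI.
    have -> : a @^-1` B = \bigcup_n (a @^-1` B `&` b @^-1` (E2 n)).
      by rewrite -setI_bigcupr -preimage_bigcup c2 preimage_setT setIT.
    by apply: bigcup_measurable => n _; apply: sub_sigma_algebra; exists B => //; exists (E2 n).
  by have := m measurableT _ mA; rewrite setTI.
- move=> A mA.
  have m : measurable_fun [set: g_sigma_algebraType rects] (b : g_sigma_algebraType rects -> Y).
    apply: (measurability P2) => // _ [B PB <-]; rewrite setTI.
    have -> : b @^-1` B = \bigcup_n (a @^-1` (E1 n) `&` b @^-1` B).
      by rewrite -setI_bigcupl -preimage_bigcup c1 preimage_setT setTI.
    by apply: bigcup_measurable => n _; apply: sub_sigma_algebra; exists (E1 n) => //; exists B.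
  by have := m measurableT _ mA; rewrite setTI.
Qed.

Hypotheses (i1 : setI_closed P1) (i2 : setI_closed P2).

Lemma rectsI : setI_closed rects.
Proof.
move=> _ _ [A PA [B PB <-]] [A' PA' [B' PB' <-]].
exists (A `&` A'); first exact: i1.
by exists (B `&` B'); [exact: i2|rewrite !preimage_setI setIACA].
Qed.

Lemma rects_cover : exists E : nat -> set N, (forall n, rects (E n)) /\ \bigcup_n E n = setT.
Proof.
exists (fun n => let k := (pickle_inv n : option (nat * nat)) in
  let k := odflt (0%N, 0%N) k in a @^-1` (E1 k.1) `&` b @^-1` (E2 k.2)); split.
  move=> n /=; set k := odflt _ _; exists (E1 k.1); first exact: PE1.
  by exists (E2 k.2); first exact: PE2.
apply/seteqP; split=> // x _.
have : (\bigcup_n E1 n) (a x) by rewrite c1.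
have : (\bigcup_n E2 n) (b x) by rewrite c2.
move=> [k _ hk] [l _ hl]; exists (pickle (l, k)) => //=.
by rewrite pickleK_inv.
Qed.

End RectGen.

Section FibTot.
Context d (T : measurableType d) d' (N : measurableType d') (R : realType).
Local Notation C := R[i].
Variables (X U : ptopologicalType).
Hypotheses (lcX : locally_compact [set: X]) (hdX : hausdorff_space X).
Hypothesis scX : @second_countable X.
Local Notation Xb := (borel X).
Local Notation Ub := (borel U).
Variable ka : U -> {measure set Xb -> \bar R}.
Hypothesis kk : kern ka.
Variables (m : {measure set T -> \bar R}) (n : {measure set N -> \bar R}).
Variables (a : N -> T) (b : N -> Xb) (q : T -> Ub).
Hypothesis fd : fibd ka m n a b (fun=> 1) q.
Variables (P1 : set (set T)) (E1 : nat -> set T).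
Hypotheses (g1 : @measurable _ T = <<s P1 >>) (i1 : setI_closed P1).
Hypotheses (PE1 : forall k, P1 (E1 k)) (c1 : \bigcup_k E1 k = setT).
Hypothesis m1 : forall A, P1 A -> (m A < +oo)%E.
Hypothesis gN : forall S : set (set N), sigma_algebra setT S ->
  (forall A, measurable A -> S (a @^-1` A)) -> (forall B, measurable B -> S (b @^-1` B)) ->
  measurable `<=` S.
Local Notation J xi := (fop (m := m) n a b (fun=> 1) xi : L2space m -> L2space n).

Let mP1 A : P1 A -> measurable A. Proof. by move=> PA; rewrite g1; exact: sub_sigma_algebra. Qed.
Let ma : measurable_fun setT a := fib_a fd.
Let mb : measurable_fun setT b := fib_b fd.

Let mI (A : set T) (B : set Xb) : measurable A -> measurable B -> measurable (a @^-1` A `&` b @^-1` B).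
Proof. by move=> mA mB; apply: measurableI; rewrite -[X in measurable X]setTI; [exact: ma|exact: mb]. Qed.

Let ind_m (A : set T) : P1 A -> (fun x => (\1_A x)%:C) \in sqint m.
Proof.
move=> PA; have mA := mP1 PA; apply/sqintP; split; first by apply: cmeas_real; exact: measurable_indic.
rewrite (eq_integral (fun x => (\1_A x)%:E)); first by rewrite (int_indicT m mA) m1.
by move=> x _; rewrite sqnR indicE; case: (_ \in _); rewrite ?expr1n ?expr0n.
Qed.

Lemma rect_fin (A : set T) (B : set X) : P1 A -> precompact_opens B ->
  (n (a @^-1` A `&` b @^-1` B) < +oo)%E.
Proof.
move=> PA PB; have mA := mP1 PA; have mB := precompact_meas PB; have [oB cB] := PB.
have [f [sf [f01 f1]]] := urysohn_bump R lcX hdX cB (@openT X) (@subsetT _ _).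
have mAB := mI mA mB.
have s2 := fop_sqint hdX kk fd (supp_in_Cc sf) (ind_m PA).
apply: (le_lt_trans _ (sqint_lty s2)); rewrite -(int_indicT n mAB).
apply: ge0_le_integral => //.
- by apply/measurable_EFinP; exact: measurable_indic.
- by apply: cmeas_esqn; have [] := (sqintP n _).1 s2.
move=> p _; rewrite lee_fin indicE; have [|_] := boolP (p \in _); last exact: sqn_ge0.
rewrite inE => -[/= Aa Bb]; rewrite f1; last exact: subset_closure.
by rewrite indicE mem_set// !mulr1 (sqnR (1 : R)) expr1n.
Qed.

(** A vector orthogonal to these operators is orthogonal to z(b) times the indicator of a^{-1}(A)
    for every bump z, hence to indicators of rectangles in the limit; these form a generating
    pi-system, so [cls_orth0] applies. *)
Lemma fop_tot : hspan [set x | exists xi h, Cc xi /\ x = J xi h] = setT.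
Proof.
apply: hspan_orth; first exact: hilbert_L2.
move=> x h; have [f f2 xE] := cls_surj x; rewrite xE.
have [E2 [PE2 c2]] := precompact_cover R lcX hdX scX.
have [E [PE c]] := rects_cover a b PE1 PE2 c1 c2.
have gX := precompact_opens_gen R lcX hdX scX.
have gR := rect_gen g1 gX PE1 PE2 c1 c2 ma mb gN.
have iR := rectsI i1 (precompact_opensI hdX) (a := a) (b := b).
have fR A : rects P1 (@precompact_opens X : set (set Xb)) a b A -> (n A < +oo)%E.
  by move=> [A' PA [B PB <-]]; exact: rect_fin.
apply: (cls_orth0 gR iR PE c fR f2).
move=> _ [A PA [B PB <-]]; have mA := mP1 PA; have mB := precompact_meas PB.
have mAB := mI mA mB; have rf := rect_fin PA PB; have i2m := ind_m PA.
rewrite -xE; apply/eqP; rewrite -normr_eq0 normc_sqn.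
set r := Num.sqrt _; have r0 : 0 <= r := sqrtr_ge0 _.
have n0 := hnorm_ge0 x.
suff : r <= 0 by move=> r1; rewrite (@le_anti _ _ r 0)// r1.
apply: le_eps => e e0; rewrite add0r.
have d0 : 0 < e / (hnorm x + 1) by rewrite divr_gt0// ltr_wpDl.
have mpA : measurable (a @^-1` A) by rewrite -[X in measurable X]setTI; exact: ma.
(* This is B |-> n(a^{-1}(A) and b^{-1}(B)). Approximating the indicator of B by a bump in L2 of
   this measure is approximating the rectangle in L2 of n. *)
pose nA := measure_function_pushforward__canonical__measure_function_Measure
  (mrestr n mpA : {measure set N -> \bar R}) mb.
have nAB : (nA B < +oo)%E by rewrite /= /pushforward /mrestr setIC.
have [z [sz z01 zle]] := bump_approx lcX hdX scX PB nAB (exprn_gt0 2 d0).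
have zc := supp_in_Cc sz.
have zh := h _ (ex_intro _ _ (ex_intro _ _ (conj zc erefl))).
have s2 := fop_sqint hdX kk fd zc i2m.
have i2 : (fun p => (\1_(a @^-1` A `&` b @^-1` B) p)%:C) \in sqint n.
  apply/sqintP; split; first by apply: cmeas_real; exact: measurable_indic.
  rewrite (eq_integral (fun x => (\1_(a @^-1` A `&` b @^-1` B) x)%:E)); first by rewrite (int_indicT n mAB).
  by move=> y _; rewrite sqnR indicE; case: (_ \in _); rewrite ?expr1n ?expr0n.
rewrite -lecR /r -normc_sqn.
have -> : ip (cls n (fun p => (\1_(a @^-1` A `&` b @^-1` B) p)%:C)) x =
   ip (cls n (fun p => (\1_(a @^-1` A `&` b @^-1` B) p)%:C - (z (b p))%:C * 1 * (\1_A (a p))%:C)) x.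
  by rewrite clsB// ipBl; move: (zh (cls m (fun t => (\1_A t)%:C))); rewrite (fopE hdX kk fd zc i2m) => ->; rewrite subr0.
apply: (le_trans (ip_CS _ _)); rewrite lecR.
set g := fun p => _ - _; have g2 : g \in sqint n by exact: sqintB.
have h1 : hnorm (cls n g) <= e / (hnorm x + 1).
  rewrite -ler_sqr ?nnegrE ?hnorm_ge0 ?(ltW d0)// -lee_fin hnorm_cls//; apply: le_trans zle.
  pose psi (x : Xb) : \bar R := (sqn ((\1_B x)%:C - (z x)%:C))%:E.
  have mpsi : measurable_fun setT psi.
    apply: cmeas_esqn; rewrite (_ : (fun x => _) = fun x : Xb => (\1_B x - z x)%:C); last first.
      by apply/funext => y; rewrite rmorphB.
    apply: cmeas_real; apply: measurable_funB; first exact: measurable_indic.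
    by apply: cont_meas; case: sz.
  have psi0 y : (0 <= psi y)%E by rewrite lee_fin sqn_ge0.
  have gE p : (sqn (g p))%:E = ((\1_(a @^-1` A) p : R)%:E * psi (b p))%E.
    have aE : (p \in a @^-1` A) = (a p \in A) by apply/idP/idP => /set_mem; rewrite inE.
    have bE : (p \in b @^-1` B) = (b p \in B) by apply/idP/idP => /set_mem; rewrite inE.
    rewrite /g /psi !indicE in_setI aE bE.
    case: (a p \in A) => /=; first by rewrite !mulr1 mul1e.
    by rewrite mulr0 subr0 mul0e (sqnR (0 : R)) expr0n.
  have mpb : measurable_fun setT (fun p => psi (b p)) := measurableT_comp mpsi mb.
  rewrite (eq_integral ((fun p => psi (b p)) \_ (a @^-1` A))); last first.
    by move=> p _; rewrite gE patchE indicE; case: (p \in _); rewrite ?mul1e ?mul0e.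
  rewrite -integral_mkcond.
  rewrite (@eq_measure_integral _ _ _ _ (mrestr n mpA : {measure set N -> \bar R})); last first.
    by move=> S mS SA; rewrite /= /mrestr setIidl.
  rewrite (@ge0_integral_pushforward _ _ _ _ R _ mb (mrestr n mpA : {measure set N -> \bar R}) setT psi)//.
  by rewrite preimage_setT; apply: ge0_subset_integral.
apply: (le_trans (ler_wpM2r n0 h1)); rewrite -mulrA ler_piMr ?(ltW e0)//.
by rewrite mulrC ler_pdivrMr ?ltr_wpDl// mul1r lerDl.
Qed.

End FibTot.

Section WcoComp.
Context d0 (T0 : measurableType d0) d1 (T1 : measurableType d1) d2 (T2 : measurableType d2) (R : realType).
Local Notation C := R[i].
Variables (m0 : {measure set T0 -> \bar R}) (m1 : {measure set T1 -> \bar R}) (m2 : {measure set T2 -> \bar R}).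
Variables (c : T2 -> C) (phi : T2 -> T1) (c' : T1 -> C) (phi' : T1 -> T0) (M M' : R).
Hypotheses (h : wcb m1 m2 c phi M) (h' : wcb m0 m1 c' phi' M').

Lemma wcb_comp : wcb m0 m2 (fun p => c p * c' (phi p)) (fun p => phi' (phi p)) (M * M').
Proof.
have [mc mp M0 b] := h; have [mc' mp' M0' b'] := h'; split.
- by apply: cmeasM => //; have [? ?] := cmeas_comp mp mc'.
- exact: measurableT_comp.
- exact: mulr_ge0.
move=> F mF F0; have mF' : measurable_fun setT (fun x => (sqn (c' x))%:E * F (phi' x))%E.
  by apply: emeasurable_funM; [exact: cmeas_esqn|exact: measurableT_comp].
have F0' x : (0 <= (sqn (c' x))%:E * F (phi' x))%E by rewrite mule_ge0// lee_fin sqn_ge0.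
rewrite (eq_integral (fun p => (sqn (c p))%:E * ((sqn (c' (phi p)))%:E * F (phi' (phi p))))%E); last first.
  by move=> p _; rewrite sqnM EFinM muleA.
apply: (le_trans (b _ mF' F0')); rewrite EFinM -muleA lee_wpmul2l ?lee_fin//; exact: b'.
Qed.

Lemma wco_comp : wco m2 c phi \o wco m1 c' phi' = wco m2 (fun p => c p * c' (phi p)) (fun p => phi' (phi p)) :> (L2space m0 -> _).
Proof.
apply/funext => x; have [f f2 ->] := cls_surj x.
rewrite /= (wcoE h') // (wcoE h) ?(wcoE wcb_comp)//; last exact: (wcb_sqint h').
by congr cls; apply/funext => p; rewrite mulrA.
Qed.

End WcoComp.

Lemma wco_ext d (T : measurableType d) d' (N : measurableType d') (R : realType)
    (m : {measure set T -> \bar R}) (n : {measure set N -> \bar R}) (c c' : N -> R[i]) (phi phi' : N -> T) M M' :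
  wcb m n c phi M -> wcb m n c' phi' M' -> (forall p, phi p = phi' p) ->
  {ae n, forall p, c p = c' p} -> wco (m := m) n c phi = wco n c' phi'.
Proof.
move=> h h' e ae; apply/funext => x; have [f f2 ->] := cls_surj x.
rewrite (wcoE h)// (wcoE h')//; apply/cls_eqP; [exact: (wcb_sqint h)|exact: (wcb_sqint h')|].
by apply: filterS ae => p ->; rewrite e.
Qed.

Lemma op_close_adj_mul (R : realType) (K H : ipSpace R) (T : K -> H) (e : R) : hilbert K -> bounded_op T ->
  0 <= e -> (forall x, hnorm (T x) <= e * hnorm x) -> forall x, hnorm (adj T (T x)) <= e ^+ 2 * hnorm x.
Proof.
move=> hK bT e0 h x; set y := T x; have h1 : hnorm (adj T y) <= e * hnorm y.
  have := hnorm_ge0 (adj T y); rewrite le_eqVlt => /predU1P[<-|p]; first by rewrite mulr_ge0 ?hnorm_ge0.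
  rewrite -(ler_pM2r p) -expr2 -lecR hnorm2 -(adjE hK bT).
  apply: (@le_trans _ _ `|ip (T (adj T y)) y|).
    by rewrite (adjE hK bT) -hnorm2 ger0_norm// lecR sqr_ge0.
  apply: (le_trans (ip_CS _ _)); rewrite lecR mulrAC.
  by rewrite ler_wpM2r ?hnorm_ge0.
by apply: (le_trans h1); rewrite expr2 -mulrA; apply: ler_wpM2l => //; exact: h.
Qed.

(** * Norms of kets and generators of the module structures *)

Section Leg.
Variables (R : realType) (U : ptopologicalType).
Hypotheses (lc : locally_compact [set: U]) (hd : hausdorff_space U).
Hypothesis sc : @second_countable U.
Local Notation C := R[i].
Local Notation Ub := (borel U).
Variable mu : {measure set Ub -> \bar R}.
Hypothesis mufin : forall K, compact K -> (mu K < +oo)%E.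
Hypothesis full : full_support mu.
Local Notation K := (L2space mu).
Let hK : hilbert K := @hilbert_L2 _ _ _ mu.
Local Notation amod := (amod (mulC0 mu)).
Let comB := @mulC0_com R U mu.

Context d (T : measurableType d).
Variables (m : {measure set T -> \bar R}) (q : T -> Ub) (L : ipSpace R).
Hypothesis mq : measurable_fun setT q.
Variables (be : set (K -> L2space m)) (ga : set (K -> L)).
Hypotheses (abe : amod be) (aga : amod ga) (cga : opclosed ga).
Hypothesis be_rho : forall f, C0 f -> rho be (mulop mu f) = mulop m (fun t => f (q t)).
Variable X : rtp be ga.

Lemma ketB eta eta' h : ga eta -> ga eta' ->
  ket2 X ((-1 : C) *: eta' + eta : K -> L) h = ket2 X eta h - ket2 X eta' h.
Proof.
move=> ge ge'; have [_ cP _] := cga; have gd := cP (-1) _ _ ge' ge.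
have b1 := ket2_bop hK X abe aga ge; have b2 := ket2_bop hK X abe aga ge'.
rewrite (ket2_uniq hK (X := X) abe aga (F := (-1 : C) *: ket2 X eta' + ket2 X eta) gd).
- by rewrite -[LHS]/(-1 *: ket2 X eta' h + ket2 X eta h) scaleN1r addrC.
- exact: bopP.
move=> xi z bx; have fE e : ga e -> rtp_tens X xi z e = ket2 (flip comB X abe aga) xi (e z).
  by move=> g; apply/esym; exact: (ket2E hK (flip comB X abe aga) aga abe z bx g).
rewrite -[LHS]/(-1 *: ket2 X eta' (xi z) + ket2 X eta (xi z)).
rewrite !(ket2E hK X abe aga)// !fE// -(bop_lin (ket2_bop hK (flip comB X abe aga) aga abe bx)).
by [].
Qed.

(** The inner product of [eta] with itself is multiplication by some f in C_0, and f is at most e^2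
    in modulus everywhere by full support. So its pullback along [q], which computes the squared
    norm of the ket, has operator norm at most e^2. *)
Lemma ket2_norm eta (e : R) : ga eta -> 0 <= e -> (forall z, hnorm (eta z) <= e * hnorm z) ->
  forall h, hnorm (ket2 X eta h) <= e * hnorm h.
Proof.
move=> ge e0 le h; have bT := am_bop aga ge.
have /mulC0P[f f0 fE] := am_ip aga ge ge; have fb := C0_bmeas f0.
have c0 : C0 (fun _ : U => 0 : C) by apply: Cc_C0; exact: Cc0.
have e20 : 0 <= e ^+ 2 := sqr_ge0 e.
have m0 x : mulop mu (fun=> 0) x = 0.
  have [z z2 ->] := cls_surj x; rewrite mulopE//; last exact: C0_bmeas c0.
  by rewrite (_ : (fun x => _) = fun=> 0) ?cls0//; apply/funext => u; rewrite mul0r.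
have fle u : sqn (f u) <= (e ^+ 2) ^+ 2.
  have cl : op_close (mulop mu f) (mulop mu (fun=> 0)) (e ^+ 2).
    by move=> x; rewrite m0 subr0 -fE; exact: (op_close_adj_mul hK bT e0 le).
  by rewrite -[f u]subr0; exact: (mulop_close_le lc hd mufin full f0.1 c0.1 fb (C0_bmeas c0) e20 cl u).
have h2 : hnorm (mulop m (fun t => f (q t)) h) <= e ^+ 2 * hnorm h.
  have fqb : bmeas (fun t => f (q t)).
    split; first by have [? ?] := cmeas_comp mq fb.1.
    by exists ((e ^+ 2) ^+ 2); [exact: sqr_ge0|move=> t; exact: fle].
  have [g g2 ->] := cls_surj h; rewrite mulopE//; apply: hnorm_cls_le => //.
    exact: bmeas_sqint.
  by move=> t; rewrite sqnM ler_wpM2r ?sqn_ge0.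
rewrite -ler_sqr ?nnegrE ?mulr_ge0 ?hnorm_ge0// exprMn -lecR hnorm2 (ket2_ip hK X abe aga _ _ ge ge) fE be_rho//.
have : `|ip h (mulop m (fun t => f (q t)) h)| <= (e ^+ 2 * hnorm h ^+ 2)%:C.
  apply: (le_trans (ip_CS _ _)); rewrite lecR expr2 [leRHS]mulrA [leRHS]mulrC.
  by rewrite ler_wpM2l ?hnorm_ge0.
apply: le_trans; have -> : ip h (mulop m (fun t => f (q t)) h) = (hnorm (ket2 X eta h) ^+ 2)%:C.
  by rewrite hnorm2 (ket2_ip hK X abe aga _ _ ge ge) fE be_rho.
by rewrite ger0_norm// lecR sqr_ge0.
Qed.

Lemma ket2_close eta eta' e : ga eta -> ga eta' -> 0 <= e -> op_close eta eta' e ->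
  op_close (ket2 X eta) (ket2 X eta') e.
Proof.
move=> ge ge' e0 h x; rewrite -ketB//; apply: ket2_norm => //.
  by have [_ cP _] := cga; exact: cP.
by move=> z; rewrite -[X in hnorm X]/(-1 *: eta' z + eta z) scaleN1r addrC.
Qed.

Variables (ga0 : set (K -> L)) (de de0 : set (K -> L2space m)).
Hypotheses (ga0s : ga0 `<=` ga) (de0s : de0 `<=` de).
Hypothesis ga0d : forall eta, ga eta -> forall e : R, 0 < e -> exists2 eta0, ga0 eta0 & op_close eta eta0 e.
Hypothesis de0d : forall xi, de xi -> forall e : R, 0 < e -> exists2 xi0, de0 xi0 & op_close xi xi0 e.
Hypothesis bde : forall xi, de xi -> bounded_op xi.

(** By [ket2_close], approximation in [ga] gives approximation of kets; so the module structures on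
    the fibre products are spanned by operators of C_c functions, for which explicit formulas
    exist. *)
Lemma tril_gen : tril X de = opspan (opmul [set ket2 X eta | eta in ga0] de0).
Proof.
have bk eta : ga eta -> bounded_op (ket2 X eta) by move=> ge; exact: (ket2_bop hK X abe aga ge).
apply/seteqP; split; apply: opspan_min.
- exact: opspan_opclosed.
- apply: (opmul_min (X0 := [set ket2 X eta | eta in ga0]) (Y0 := de0)).
  + move=> _ [eta ge <-]; split; first exact: bk.
    move=> e e0; have [eta0 g0 c] := ga0d ge e0; exists (ket2 X eta0).
      by apply: lspan_sub; exists eta0.
    by apply: ket2_close => //; [exact: ga0s|exact: ltW].
  + move=> xi dx; split; first exact: bde.
    by move=> e e0; have [xi0 g0 c] := de0d dx e0; exists xi0 => //; exact: lspan_sub.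
  + by move=> _ [eta /ga0s ge <-]; exact: bk.
  + by move=> xi /de0s; exact: bde.
  + exact: opspan_opclosed.
  move=> _ [_ [eta g <-] [xi x <-]]; apply: opspan_sub.
    by apply: bop_comp; [exact: bk (ga0s g)|exact: bde (de0s x)].
  by exists (ket2 X eta); [exists eta|exists xi].
- exact: opspan_opclosed.
move=> _ [_ [eta g <-] [xi x <-]]; apply: opspan_sub.
  by apply: bop_comp; [exact: bk (ga0s g)|exact: bde (de0s x)].
exists (ket2 X eta); first by exists eta => //; exact: ga0s.
by exists xi => //; exact: de0s.
Qed.

End Leg.

(** * From products xi(x) eta(y) to all C_c functions on a fibre product *)

Section TensOps.
Variables (R : realType) (U G N : ptopologicalType).
Hypotheses (lc : locally_compact [set: G]) (hd : hausdorff_space G).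
Local Notation C := R[i].
Local Notation Ub := (borel U).
Local Notation Nb := (borel N).
Variables (mu : {measure set Ub -> \bar R}) (n : {measure set Nb -> \bar R}).
Variables (v : N -> G * G).
Hypothesis vc : continuous v.
Hypothesis vcl : closed (range v).
Hypothesis vinit : forall p W, nbhs p W -> exists2 O, nbhs (v p) O & v @^-1` O `<=` W.
Variables (W : Nb -> C) (Q : Nb -> Ub).
Hypotheses (mW : cmeas W) (mQ : measurable_fun setT Q).
Hypothesis bd : forall xi eta : G -> C, Cc xi -> Cc eta ->
  exists M, wcb mu n (fun p => W p * (xi (v p).1 * eta (v p).2)) Q M.

Definition tens_ops : set (L2space mu -> L2space n) :=
  [set T | exists xi eta : G -> C, [/\ Cc xi, Cc eta &
    T = wco n (fun p => W p * (xi (v p).1 * eta (v p).2)) Q]].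

(** A weight dominated by a product of bumps inherits its bound. With small [e] this turns the
    pointwise estimate of [Cc_tsum] into one for the operator norm. *)
Lemma wcb_le (a b : G -> R) (w : Nb -> C) (e M : R) : cmeas w -> 0 <= e ->
  wcb mu n (fun p => W p * ((a (v p).1)%:C * (b (v p).2)%:C)) Q M ->
  (forall p, sqn (w p) <= e * (a (v p).1 * b (v p).2) ^+ 2) ->
  wcb mu n (fun p => W p * w p) Q (e * M).
Proof.
move=> mw e0 [mc _ M0 h] le; split=> //; [exact: cmeasM|exact: mulr_ge0|].
move=> F mF F0; have mFQ : measurable_fun setT (fun p => F (Q p)) by exact: measurableT_comp.
rewrite EFinM -muleA; apply: (@le_trans _ _ (e%:E * \int[n]_p ((sqn (W p * ((a (v p).1)%:C * (b (v p).2)%:C)))%:E * F (Q p)))%E).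
  have mm : measurable_fun setT (fun p => (sqn (W p * ((a (v p).1)%:C * (b (v p).2)%:C)))%:E * F (Q p))%E.
    by apply: emeasurable_funM => //; exact: cmeas_esqn.
  rewrite -ge0_integralZl_EFin//; last by move=> p _; rewrite mule_ge0// lee_fin sqn_ge0.
  apply: ge0_le_integral => //.
  - by move=> p _; rewrite mule_ge0// lee_fin sqn_ge0.
  - by apply: emeasurable_funM => //; apply: cmeas_esqn; exact: cmeasM.
  - exact: measurable_funeM.
  move=> p _; rewrite muleA lee_wpmul2r// -EFinM lee_fin !sqnM mulrCA ler_wpM2l ?sqn_ge0//.
  by apply: (le_trans (le p)); rewrite !sqnR exprMn.
by rewrite lee_wpmul2l ?lee_fin//; exact: h.
Qed.

Lemma tsum_op s : tsum (@Cc R G) (@Cc R G) s ->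
  lspan (tens_ops : set (L2space mu -> L2space n : lmodType C))
    (wco n (fun p => W p * s (v p).1 (v p).2) Q) /\
  (exists M, wcb mu n (fun p => W p * s (v p).1 (v p).2) Q M).
Proof.
elim=> [|f g {}s fc gc _ [ih [M' h']]].
  have h : wcb mu n (fun p => W p * 0) Q 0.
    split=> //; first by apply: cmeasM => //; exact: cmeas_cst.
    move=> F mF F0; rewrite mul0e (eq_integral (cst 0%E)) ?integral0// => p _.
    by rewrite mulr0 (sqnR (0 : R)) expr0n mul0e.
  split; last by exists 0.
  rewrite (_ : wco _ _ _ = 0); first exact: lspan0.
  apply/funext => x; have [z z2 ->] := cls_surj x; rewrite (wcoE h)//.
  by rewrite (_ : (fun y => _) = fun=> 0) ?cls0//; apply/funext => y; rewrite mulr0 mul0r.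
have [M h] := bd fc gc.
have [m1 _ M0 l] := h; have [m2 _ M0' l'] := h'.
have hD : wcb mu n (fun p => W p * (f (v p).1 * g (v p).2 + s (v p).1 (v p).2)) Q (2 * (M + M')).
  split=> //.
  - rewrite (_ : (fun p => _) = fun p => W p * (f (v p).1 * g (v p).2) + W p * s (v p).1 (v p).2); first exact: cmeasD.
    by apply/funext => p; rewrite mulrDr.
  - by rewrite mulr_ge0// addr_ge0.
  move=> F mF F0; have mFQ : measurable_fun setT (fun p => F (Q p)) by exact: measurableT_comp.
  pose u p := ((sqn (W p * (f (v p).1 * g (v p).2)))%:E * F (Q p))%E.
  pose u' p := ((sqn (W p * s (v p).1 (v p).2))%:E * F (Q p))%E.
  have mu1 : measurable_fun setT u by apply: emeasurable_funM => //; exact: cmeas_esqn.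
  have mu2 : measurable_fun setT u' by apply: emeasurable_funM => //; exact: cmeas_esqn.
  have u0 p : (0 <= u p)%E by rewrite mule_ge0// lee_fin sqn_ge0.
  have u0' p : (0 <= u' p)%E by rewrite mule_ge0// lee_fin sqn_ge0.
  apply: (@le_trans _ _ (2%:E * (\int[n]_p u p + \int[n]_p u' p))%E); last first.
    rewrite EFinM -muleA lee_wpmul2l ?lee_fin// EFinD ge0_muleDl ?lee_fin//.
    by apply: leeD; [exact: l|exact: l'].
  rewrite -ge0_integralD// -ge0_integralZl_EFin//; [|by move=> p _; rewrite adde_ge0|exact: emeasurable_funD].
  apply: ge0_le_integral => //.
  - by move=> p _; rewrite mule_ge0// lee_fin sqn_ge0.
  - apply: emeasurable_funM => //; apply: cmeas_esqn.
    rewrite (_ : (fun p => _) = fun p => W p * (f (v p).1 * g (v p).2) + W p * s (v p).1 (v p).2); first exact: cmeasD.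
    by apply/funext => p; rewrite mulrDr.
  - by apply: measurable_funeM; exact: emeasurable_funD.
  move=> p _; rewrite /u /u' -ge0_muleDl ?lee_fin ?sqn_ge0// muleA lee_wpmul2r// -EFinD -EFinM lee_fin mulrDr.
  exact: sqnD.
split; last by exists (2 * (M + M')).
rewrite (_ : wco _ _ _ = (1 : C) *: (wco n (fun p => W p * (f (v p).1 * g (v p).2)) Q : L2space mu -> L2space n) + wco n (fun p => W p * s (v p).1 (v p).2) Q).
  by apply: lspanP => //; apply: lspan_sub; exists f, g.
apply/funext => x; have [z z2 ->] := cls_surj x.
rewrite -[RHS]/(1 *: wco n _ Q (cls mu z) + wco n _ Q (cls mu z)) scale1r.
rewrite (wcoE hD)// (wcoE h)// (wcoE h')// -clsD; [|exact: (wcb_sqint h)|exact: (wcb_sqint h')].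
by congr cls; apply/funext => p; rewrite mulrDr mulrDl.
Qed.

Lemma tsum_meas s : tsum (@Cc R G) (@Cc R G) s -> cmeas (fun p : Nb => s (v p).1 (v p).2).
Proof.
have cv1 : continuous (fun p => (v p).1) by move=> p; apply: continuous_comp; [exact: vc|exact: cvg_fst].
have cv2 : continuous (fun p => (v p).2) by move=> p; apply: continuous_comp; [exact: vc|exact: cvg_snd].
elim=> [|f g {}s fc gc _ ih]; first exact: cmeas_cst.
apply: cmeasD => //; apply: cmeasM; apply: ccont_meas.
  exact: (ccont_comp cv1 fc.1).
exact: (ccont_comp cv2 gc.1).
Qed.

Lemma Cc_tens_wcb (w : N -> C) : Cc w -> exists M, wcb mu n (fun p => W p * w p) Q M.
Proof.
move=> wc; have [M M0 hM] := Cc_bounded wc; have [_ kw] := wc.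
have ck (i : G * G -> G) : continuous i -> exists a : G -> R, supp_in setT a /\ forall p, w p != 0 -> a (i (v p)) = 1.
  move=> ci; have cK : compact ((i \o v) @` closure [set p | w p != 0]).
    apply: continuous_compact => //; apply: continuous_subspaceT => p.
    by apply: continuous_comp; [exact: vc|exact: ci].
  have [a [sa [_ a1]]] := urysohn_bump R lc hd cK (@openT G) (@subsetT _ _).
  by exists a; split=> // p wp; apply: a1; exists p => //; exact: subset_closure.
have [a [sa a1]] := ck fst (fun p => cvg_fst); have [b [sb b1]] := ck snd (fun p => cvg_snd).
have [M' hM'] := bd (supp_in_Cc sa) (supp_in_Cc sb).
exists (M * M'); apply: (wcb_le _ (ltW M0) hM'); first exact: ccont_meas wc.1.
move=> p; have [->|wp] := eqVneq (w p) 0; first by rewrite (sqnR (0 : R)) expr0n mulr_ge0 ?sqr_ge0// ltW.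
by rewrite a1// b1// mul1r expr1n mulr1; exact: hM.
Qed.

(** This makes the closed span insensitive to the coordinates: composing a product with the shear
    gives a function in C_c that is no longer a product, and it still lies in the span. *)
Lemma Cc_tens_op (w : N -> C) : Cc w -> opspan tens_ops (wco n (fun p => W p * w p) Q).
Proof.
move=> wc; have [a [b [sa sb ap]]] := Cc_tsum lc hd lc hd vc vcl vinit wc.
have [M hM] := bd (supp_in_Cc sa) (supp_in_Cc sb).
have [_ _ M0 _] := hM; have mw : cmeas (w : Nb -> C) by exact: ccont_meas wc.1.
have [M' hw'] := Cc_tens_wcb wc; split; first exact: (wco_bop hw').
(* The squared norm of the difference is at most this tolerance times M, hence at most e^2. *)
move=> e e0; have e1 : 0 < e ^+ 2 / (M + 1) by rewrite divr_gt0 ?exprn_gt0// ltr_wpDl.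
have [s [ts les]] := ap _ e1; have [ls [Ms hs]] := tsum_op ts.
have ms : cmeas (fun p : Nb => w p - s (v p).1 (v p).2).
  rewrite (_ : (fun p => _) = fun p => w p + (-1) * s (v p).1 (v p).2); last first.
    by apply/funext => p; rewrite mulN1r.
  by apply: cmeasD => //; apply: cmeasM; [exact: cmeas_cst|exact: tsum_meas].
have hd' := wcb_le ms (ltW e1) hM les.
exists (wco n (fun p => W p * s (v p).1 (v p).2) Q) => //.
move=> x; have [z z2 ->] := cls_surj x.
rewrite (wcoE hw')// (wcoE hs)// -clsB; [|exact: (wcb_sqint hw')|exact: (wcb_sqint hs)].
rewrite (_ : (fun p => _) = fun p => W p * (w p - s (v p).1 (v p).2) * z (Q p)); last first.
  by apply/funext => p; rewrite mulrBr mulrBl.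
have g2 := wcb_sqint hd' z2.
rewrite -ler_sqr ?nnegrE ?mulr_ge0 ?hnorm_ge0// ?(ltW e0)// exprMn -lee_fin [leRHS]EFinM hnorm_cls// hnorm_cls//.
have [_ _ _ le] := hd'; have [mz _] := (sqintP mu z).1 z2.
have z0 x0 : (0 <= (sqn (z x0))%:E)%E by rewrite lee_fin sqn_ge0.
rewrite (eq_integral (fun p => (sqn (W p * (w p - s (v p).1 (v p).2)))%:E * (sqn (z (Q p)))%:E)%E); last first.
  by move=> p _; rewrite sqnM EFinM.
apply: (le_trans (le _ (cmeas_esqn mz) z0)); rewrite lee_wpmul2r ?integral_ge0//.
rewrite lee_fin -mulrA ler_piMr ?sqr_ge0//.
by rewrite mulrC ler_pdivrMr ?ltr_wpDl// mul1r lerDl.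
Qed.

End TensOps.

(** * The relative tensor products on the two fibre products *)

Section Gpd.
Variables (R : realType) (G : topGroupoid).
Hypotheses (lc : locally_compact [set: G]) (hd : hausdorff_space G).
Hypothesis sc : @second_countable G.
Local Notation C := R[i].
Local Notation U := (gunits G).
Local Notation Gb := (borel G).
Local Notation Ub := (borel U).
Variable lam : U -> {measure set Gb -> \bar R}.
Hypothesis lamH : is_Haar_system lam.
Variable mu : {measure set Ub -> \bar R}.
Hypothesis mu_radon : radon mu.
Hypothesis full : full_support mu.
Variables nu nui : {measure set Gb -> \bar R}.
Hypotheses (nuE : is_nu mu lam nu) (nuiE : is_nu mu (haar_inv lam) nui).
Hypotheses (nu_ac : nu `<< nui) (nui_ac : nui `<< nu).
Variables (D : G -> R) (DE : is_density nu nui D).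
Local Notation K := (L2space mu).
Local Notation H := (L2space nu).
Local Notation lcU := (gpd_lcU lc hd).
Local Notation hdU := (gpd_hdU hd).
Local Notation scU := (gpd_scU sc).
Local Notation mufin := (gpd_mufin mu_radon).
Local Notation cal := (@cal R G mu nu).
Local Notation chb := (@chb R G mu nu D).
Local Notation jA := (@jA R G mu nu).
Local Notation jB := (@jB R G mu nu D).
Let lamk := lam_kern hd lamH.
Let lamik := lami_kern hd lamH.
Let fdA := fibd_alpha hd lamH nuE.
Let fdB := fibd_hbeta lc hd sc lamH mu_radon nuE nuiE nui_ac DE.
Let aA : amod (mulC0 mu) cal := cal_amod lc hd sc lamH mu_radon full nuE.
Let aB : amod (mulC0 mu) chb := chb_amod lc hd sc lamH mu_radon full nuE nuiE nu_ac nui_ac DE.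
Let hK : hilbert K := @hilbert_L2 _ _ _ mu.

(** Open sets of N are preimages of open sets of G x G, which are countable unions of rectangles by
    second countability. *)
Lemma gN_borel (N : ptopologicalType) (v : N -> G * G) : continuous v ->
  (forall p W, nbhs p W -> exists2 O, nbhs (v p) O & v @^-1` O `<=` W) ->
  forall S : set (set (borel N)), sigma_algebra setT S ->
  (forall A : set Gb, measurable A -> S ((fun p => (v p).1) @^-1` A)) ->
  (forall B : set Gb, measurable B -> S ((fun p => (v p).2) @^-1` B)) -> measurable `<=` S.
Proof.
move=> vc vinit S sS h1 h2; rewrite -(sigma_algebra_id sS).
have g1 A : measurable (A : set Gb) -> (@measurable _ (g_sigma_algebraType S)) ((fun p => (v p).1) @^-1` A).
  by move=> mA; apply: sub_sigma_algebra; exact: h1.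
have g2 A : measurable (A : set Gb) -> (@measurable _ (g_sigma_algebraType S)) ((fun p => (v p).2) @^-1` A).
  by move=> mA; apply: sub_sigma_algebra; exact: h2.
apply: smallest_sub; first exact: smallest_sigma_algebra.
move=> W oW; pose V := \bigcup_(O in [set O : set (G * G) | open O /\ v @^-1` O `<=` W]) O.
have oV : open V by apply: bigcup_open => O [].
have WV : W = v @^-1` V.
  apply/seteqP; split=> p; last by case=> O1 [_ h] Op; exact: h.
  move=> Wp; have nW : nbhs p W by apply: open_nbhs_nbhs.
  have [W1 nO OW] := vinit p W nW; exists W1^°; last exact: nO.
  by split; [exact: open_interior|move=> x /= /interior_subset; exact: OW].
have [e [f [Pe Pf VE]]] := open_prod_seq lc hd sc lc hd sc oV.
rewrite WV VE.
have -> : v @^-1` (\bigcup_k (e k `*` f k)) =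
  \bigcup_k (((fun p => (v p).1) @^-1` (e k)) `&` ((fun p => (v p).2) @^-1` (f k))) by rewrite preimage_bigcup.
apply: (@bigcup_measurable _ (g_sigma_algebraType S)) => k _.
by apply: (@measurableI _ (g_sigma_algebraType S)); [exact: g1 (precompact_meas (Pe k))|exact: g2 (precompact_meas (Pf k))].
Qed.

Lemma jA_tot : hspan [set x | exists xi z, Cc xi /\ x = jA xi z] = setT.
Proof.
apply/seteqP; split=> // x _; have /seteqP[_ /(_ x Logic.I)] := am_tot aA.
apply: hspan_min; [exact: hspan_subsp|exact: hspan_closed|].
move=> _ [T [bT hT] [z _ <-]]; apply: hspan_closed => e e0.
have d0 : 0 < e / (hnorm z + 1) by rewrite divr_gt0// ltr_wpDl// hnorm_ge0.
have [xi c xiT] := hT _ d0; exists (jA xi z); first by apply: hspan_sub; exists xi, z.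
apply: (le_trans (xiT z)); rewrite -mulrA ler_piMr ?(ltW e0)//.
by rewrite mulrC ler_pdivrMr ?ltr_wpDl ?hnorm_ge0// mul1r lerDl.
Qed.

Lemma jB_tot : hspan [set x | exists xi z, Cc xi /\ x = jB xi z] = setT.
Proof.
apply/seteqP; split=> // x _; have /seteqP[_ /(_ x Logic.I)] := am_tot aB.
apply: hspan_min; [exact: hspan_subsp|exact: hspan_closed|].
move=> _ [T [bT hT] [z _ <-]]; apply: hspan_closed => e e0.
have d0 : 0 < e / (hnorm z + 1) by rewrite divr_gt0// ltr_wpDl// hnorm_ge0.
have [xi c xiT] := hT _ d0; exists (jB xi z); first by apply: hspan_sub; exists xi, z.
apply: (le_trans (xiT z)); rewrite -mulrA ler_piMr ?(ltW e0)//.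
by rewrite mulrC ler_pdivrMr ?ltr_wpDl ?hnorm_ge0// mul1r lerDl.
Qed.

Lemma cal_jA xi : Cc xi -> cal (jA xi). Proof. exact: (cmod_J hd lamk fdA). Qed.
Lemma chb_jB xi : Cc xi -> chb (jB xi). Proof. exact: (cmod_J hd lamik fdB). Qed.

(** [dense_rtp] is applied to the family of C_c functions, with [fop] in the role of the kets;
    [fop_ip] is their Gram relation, and the multiplication operators in it realize [rho] by the
    commutation hypothesis. *)
Lemma rtp_fop d (T : measurableType d) (m : {measure set T -> \bar R}) d' (N : measurableType d')
    (n : {measure set N -> \bar R}) (a : N -> T) (b : N -> Gb) (q : T -> Ub) (be : set (K -> L2space m)) :
  fibd lam m n a b (fun=> 1) q ->
  hspan [set x | exists xi h, Cc xi /\ x = fop (m := m) n a b (fun=> 1) xi h] = setT ->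
  (forall xi, be xi -> bounded_op xi) -> hspan (opapp be) = setT ->
  (forall f xi, C0 f -> be xi -> mulop m (fun t => f (q t)) \o xi = xi \o mulop mu f) ->
  exists t : (K -> L2space m) -> K -> (K -> H) -> L2space n, is_rtp be cal t /\
    forall xi z eta, Cc eta -> be xi -> t xi z (jA eta) = fop n a b (fun=> 1) eta (xi z).
Proof.
move=> fd tot bb bt bc.
pose I := {xi : G -> C | `[< Cc xi >]}.
have ci (i : I) : Cc (sval i) by apply/asboolP; exact: (svalP i).
have [||||||||t [tr tE]] := @dense_rtp R K (L2space m) H (L2space n) be cal I (fun i => jA (sval i))
  (fun i => fop n a b (fun=> 1) (sval i)) (fun i j => mulop m (fun t => kip lam (sval i) (sval j) (q t)))
  hK (@hilbert_L2 _ _ _ n) bb.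
- by move=> eta; exact: cmod_bop.
- by move=> i; exact: cal_jA.
- move=> eta [_ h] e e0; have [xi c xiT] := h e e0.
  by exists (exist (fun xi => is_true `[< Cc xi >]) xi (introT (asboolP _) c)).
- by move=> i; exact: (fop_bop hd lamk fd (ci i)).
- by move=> i j x y; exact: (fop_ip hd lamk fd).
- move=> i j xi bx; have k0 : C0 (kip lam (sval i) (sval j)) by apply: Cc_C0; exact: (kip_Cc hd lamk).
  by rewrite bc//; congr (xi \o _); rewrite (adjJ hd lamk fdA).
- exact: bt.
- rewrite -tot; congr hspan; apply/seteqP; split=> x.
    by move=> [i [h ->]]; exists (sval i), h.
  by move=> [xi [h [c ->]]]; exists (exist (fun xi => is_true `[< Cc xi >]) xi (introT (asboolP _) c)), h.
exists t; split=> // xi z eta c bx.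
exact: (tE (exist (fun xi => is_true `[< Cc xi >]) eta (introT (asboolP _) c)) xi z bx).
Qed.

Variable nu2sr : {measure set (borel (fib_sr G)) -> \bar R}.
Variable nu2rr : {measure set (borel (fib_rr G)) -> \bar R}.
Hypotheses (srE : is_nu2_sr mu lam nu2sr) (rrE : is_nu2_rr mu lam nu2rr).
Local Notation SR := (borel (fib_sr G)).
Local Notation RR := (borel (fib_rr G)).
Definition sx (p : SR) : Gb := (val (p : fib_sr G)).1.
Definition sy (p : SR) : Gb := (val (p : fib_sr G)).2.
Definition rx (p : RR) : Gb := (val (p : fib_rr G)).1.
Definition ry (p : RR) : Gb := (val (p : fib_rr G)).2.
Lemma sx_meas : measurable_fun setT sx. Proof. exact: (continuous_borel (@val1_sr_cont G)). Qed.
Lemma sy_meas : measurable_fun setT sy. Proof. exact: (continuous_borel (@val2_sr_cont G)). Qed.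
Lemma rx_meas : measurable_fun setT rx. Proof. exact: (continuous_borel (@val1_rr_cont G)). Qed.
Lemma ry_meas : measurable_fun setT ry. Proof. exact: (continuous_borel (@val2_rr_cont G)). Qed.

Let sqn1 : sqn (1 : C) = 1. Proof. by rewrite (sqnR (1 : R)) expr1n. Qed.
Let mM (psi F : Gb -> \bar R) : measurable_fun setT psi -> measurable_fun setT F ->
  measurable_fun setT (fun p : Gb * Gb => psi p.1 * F p.2)%E.
Proof.
by move=> m1 m2; apply: emeasurable_funM; [exact: measurableT_comp m1 measurable_fst|exact: measurableT_comp m2 measurable_snd].
Qed.
Let lam0 (psi : Gb -> \bar R) u : (forall x, 0 <= psi x)%E -> (0 <= \int[lam u]_x psi x)%E.
Proof. by move=> h; exact: integral_ge0. Qed.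
Let lam_int_meas (psi : Gb -> \bar R) : measurable_fun setT psi -> (forall x, 0 <= psi x)%E ->
  measurable_fun setT (fun u : Ub => \int[lam u]_x psi x)%E.
Proof.
move=> mp p0; apply: (lam_kint lc hd sc lamH (T := Ub) (q := id) (F := fun p => psi p.2)) => //.
exact: measurableT_comp mp measurable_snd.
Qed.

Lemma fibd_sr2 : fibd lam nu nu2sr sx sy (fun=> 1) (@gs G : Gb -> Ub).
Proof.
split=> //; [exact: sx_meas|exact: sy_meas|exact: gs_meas|].
move=> psi F mp mF p0 F0.
have := sr_int lc hd sc lamH nuE srE (mM mF mp) (fun p => mule_ge0 (F0 p.1) (p0 p.2)) => /= e.
rewrite (eq_integral (fun p : SR => F (sx p) * psi (sy p))%E); last by move=> p _; rewrite sqn1 mul1e muleC.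
by rewrite e; apply: eq_integral => x _; rewrite ge0_integralZl.
Qed.

Lemma fibd_rr2 : fibd lam nu nu2rr rx ry (fun=> 1) (@gr G : Gb -> Ub).
Proof.
split=> //; [exact: rx_meas|exact: ry_meas|exact: gr_meas|].
move=> psi F mp mF p0 F0.
have := rr_int lc hd sc lamH nuE rrE (mM mF mp) (fun p => mule_ge0 (F0 p.1) (p0 p.2)) => /= e.
rewrite (eq_integral (fun p : RR => F (rx p) * psi (ry p))%E); last by move=> p _; rewrite sqn1 mul1e muleC.
by rewrite e; apply: eq_integral => x _; rewrite ge0_integralZl.
Qed.

Lemma nu_swap (psi F : Gb -> \bar R) : measurable_fun setT psi -> measurable_fun setT F ->
  (forall x, 0 <= psi x)%E -> (forall x, 0 <= F x)%E ->
  (\int[nu]_x (psi x * \int[lam (gr x)]_y F y) = \int[nu]_y (F y * \int[lam (gr y)]_x psi x))%E.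
Proof.
move=> mp mF p0 F0.
rewrite (nu_fib hd lamH nuE mp (lam_int_meas mF F0) p0 (fun u => lam0 u F0)).
rewrite (nu_fib hd lamH nuE mF (lam_int_meas mp p0) F0 (fun u => lam0 u p0)).
by apply: eq_integral => u _; rewrite muleC.
Qed.

Lemma fibd_rr1 : fibd lam nu nu2rr ry rx (fun=> 1) (@gr G : Gb -> Ub).
Proof.
split=> //; [exact: ry_meas|exact: rx_meas|exact: gr_meas|].
move=> psi F mp mF p0 F0.
have := rr_int lc hd sc lamH nuE rrE (mM mp mF) (fun p => mule_ge0 (p0 p.1) (F0 p.2)) => /= e.
rewrite (eq_integral (fun p : RR => psi (rx p) * F (ry p))%E); last by move=> p _; rewrite sqn1 mul1e.
rewrite e -nu_swap//; apply: eq_integral => x _; rewrite ge0_integralZl//.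
Qed.

(** For fixed y the variable x runs over arrows with source r(y), measured by the inverse Haar
    system. Exchanging the order of integration uses [iter_theta], which accounts exactly for the
    weight D^{-1/2}(x), and then [nu_swap]. *)
Lemma fibd_sr1 : fibd (lami lam) nu nu2sr sy sx (fun p => Dm12 D (sx p)) (@gr G : Gb -> Ub).
Proof.
have mD := Dm12_meas DE.
split=> //; [exact: sy_meas|exact: sx_meas|by have [? ?] := cmeas_comp sx_meas mD|exact: gr_meas|].
move=> psi F mp mF p0 F0.
have mpsi : measurable_fun setT (fun x : Gb => psi (ginv x)) := measurableT_comp mp (@ginv_meas G).
have pm : posmeas (fun p : Gb * Gb => psi p.1 * F p.2)%E.
  by split; [exact: mM|move=> p; exact: mule_ge0].
have w0 x : (0 <= (sqn (Dm12 D x))%:E)%E by rewrite lee_fin sqn_ge0.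
have mw := cmeas_esqn mD.
have e := sr_int lc hd sc lamH nuE srE (F := fun p => (psi p.1 * F p.2 * (sqn (Dm12 D p.1))%:E)%E).
rewrite (eq_integral (fun p : SR => psi (sx p) * F (sy p) * (sqn (Dm12 D (sx p)))%:E)%E); last first.
  by move=> p _; rewrite [RHS]muleC muleA.
rewrite e; first last.
- by move=> p; rewrite mule_ge0// mule_ge0.
- by apply: emeasurable_funM; [exact: mM|exact: measurableT_comp mw measurable_fst].
have := iter_theta lc hd sc lamH mu_radon nuE nuiE nui_ac DE pm.
rewrite /iter_int /wD /= => <-; rewrite /theta /=.
transitivity (\int[nu]_x (psi (ginv x) * \int[lam (gr x)]_y F y))%E.
  apply: eq_integral => x _; rewrite ge0_integralZl//; first by rewrite (lam_inv lc hd sc lamH).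
  exact: (measurableT_comp mF (gm_meas1 R lc hd sc x)).
rewrite nu_swap//; apply: eq_integral => y _; congr (_ * _)%E.
exact/esym/(lami_int lam _ mp p0).
Qed.

End Gpd.

Lemma compact_initial (N Z : topologicalType) (v : N -> Z) (A : set Z) : closed (range v) ->
  (forall p W, nbhs p W -> exists2 V, nbhs (v p) V & v @^-1` V `<=` W) ->
  compact A -> compact (v @^-1` A).
Proof.
move=> vcl vinit cA F FF FA.
have FA' : (v @ F) A by exact: FA.
have [z [Az cz]] := cA _ _ FA'.
have : closure (range v) z.
  move=> B nB; have FT : F (v @^-1` range v) by apply: filterS filterT => p _; exists p.
  have [y [[p _ <-] By]] := cz (range v) B FT nB; exists (v p); split=> //; by exists p.
move=> /vcl[p _ pz]; exists p; split; first by rewrite /preimage /= pz.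
move=> B W FB /vinit[V nV VW].
have FB' : F (v @^-1` (v @` B)) by apply: filterS FB => x Bx; exists x.
rewrite pz in nV; have [y [[x Bx <-] Vx]] := cz (v @` B) V FB' nV.
by exists x; split=> //; exact: VW.
Qed.

Lemma Cc_tens (R : realType) (X N : ptopologicalType) (v : N -> X * X) (xi eta : X -> R[i]) :
  hausdorff_space X -> hausdorff_space N -> continuous v -> closed (range v) ->
  (forall p W, nbhs p W -> exists2 V, nbhs (v p) V & v @^-1` V `<=` W) ->
  Cc xi -> Cc eta -> Cc (fun p => xi (v p).1 * eta (v p).2).
Proof.
move=> hX hN vc vcl vinit [c1 k1] [c2 k2]; split.
  apply: ccontM; apply: ccont_comp => // p; apply: continuous_comp; try exact: vc.
    exact: cvg_fst.
  exact: cvg_snd.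
apply: (@closure_compact _ hN _ (v @^-1` (closure [set x | xi x != 0] `*` closure [set x | eta x != 0]))).
  move=> p /=; rewrite mulf_eq0 negb_or => /andP[h1 h2].
  by split; apply: subset_closure.
by apply: compact_initial => //; exact: compact_setX.
Qed.

Lemma cmeas_conj d (T : measurableType d) (R : realType) (f : T -> R[i]) :
  cmeas f -> cmeas (fun x => conjc (f x)).
Proof.
move=> [a b]; split.
  by rewrite (_ : (fun x => _) = fun x => complex.Re (f x))//; apply/funext => x; case: (f x).
rewrite (_ : (fun x => _) = fun x => - complex.Im (f x)); first exact: measurableT_comp.
by apply/funext => x; case: (f x).
Qed.

(** * Composition with the shear, and operators on composable triples *)

Section Push.
Context d1 (N1 : measurableType d1) d2 (N2 : measurableType d2) (R : realType).
Local Notation C := R[i].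
Variables (n1 : {measure set N1 -> \bar R}) (n2 : {measure set N2 -> \bar R}) (h : N2 -> N1).
Hypothesis mh : measurable_fun setT h.
Hypothesis hE : forall F : N1 -> \bar R, measurable_fun setT F -> (forall x, 0 <= F x)%E ->
  (\int[n2]_p F (h p) = \int[n1]_p F p)%E.

Lemma push_wcb : wcb n1 n2 (fun=> 1 : C) h 1.
Proof.
split=> //.
move=> F mF F0; rewrite mul1e -hE//; rewrite (eq_integral (fun p => F (h p)))// => p _.
by rewrite (sqnR (1 : R)) expr1n mul1e.
Qed.

Lemma cint_push (f : N1 -> C) : cmeas f -> cint n2 setT (fun p => f (h p)) = cint n1 setT f.
Proof.
move=> [m1 m2].
have pos (g : N1 -> R) : measurable_fun setT g -> (\int[n2]_p (g (h p))%:E = \int[n1]_p (g p)%:E)%E.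
  move=> mg; rewrite integralE [RHS]integralE; congr (_ - _)%E.
    rewrite -hE//; last by apply: measurable_funepos; exact/measurable_EFinP.
    by apply: eq_integral => x _; rewrite !funeposE.
  rewrite -hE//; last by apply: measurable_funeneg; exact/measurable_EFinP.
  by apply: eq_integral => x _; rewrite !funenegE.
by rewrite /cint (pos _ m1) (pos _ m2).
Qed.

Lemma push_ip x y : ip (wco (m := n1) n2 (fun=> 1) h x) (wco n2 (fun=> 1) h y) = ip x y.
Proof.
have [f f2 ->] := cls_surj x; have [g g2 ->] := cls_surj y.
have w := push_wcb; rewrite !(wcoE w)//.
have e (k : N1 -> C) : (fun p : N2 => 1 * k (h p)) = fun p => k (h p) by apply/funext => p; rewrite mul1r.
have f3 := wcb_sqint w f2; have g3 := wcb_sqint w g2; rewrite !e in f3 g3 *.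
rewrite !ip_cls//; have [mf _] := (sqintP _ _).1 f2; have [mg _] := (sqintP _ _).1 g2.
by apply: (cint_push (f := fun p => g p * conjc (f p))); apply: cmeasM => //; exact: cmeas_conj.
Qed.

Lemma push_unitary g : cancel g h -> cancel h g -> wcb n2 n1 (fun=> 1 : C) g 1 ->
  let V := wco (m := n1) n2 (fun=> 1 : C) h in let V' := wco (m := n2) n1 (fun=> 1 : C) g in
  unitary V /\ uinv V = V'.
Proof.
move=> gK hKg w' V V'; have w := push_wcb.
have VV' y : V (V' y) = y.
  have [f f2 ->] := cls_surj y; have w2 := wcb_sqint w' f2.
  rewrite /V /V' (wcoE w')// (wcoE w)//; congr cls; apply/funext => p.
  by rewrite !mul1r hKg.
have uV : unitary V by split; [exact: (wco_bop w).1|exact: push_ip|move=> y; exists (V' y)].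
split=> //; apply/funext => y.
by rewrite -{1}[y]VV' (Vuinv uV).
Qed.

End Push.

Section Gpd.
Variables (R : realType) (G : topGroupoid).
Hypotheses (lc : locally_compact [set: G]) (hd : hausdorff_space G).
Hypothesis sc : @second_countable G.
Local Notation C := R[i].
Local Notation U := (gunits G).
Local Notation Gb := (borel G).
Local Notation Ub := (borel U).
Variable lam : U -> {measure set Gb -> \bar R}.
Hypothesis lamH : is_Haar_system lam.
Variable mu : {measure set Ub -> \bar R}.
Hypothesis mu_radon : radon mu.
Hypothesis full : full_support mu.
Variables nu nui : {measure set Gb -> \bar R}.
Hypotheses (nuE : is_nu mu lam nu) (nuiE : is_nu mu (haar_inv lam) nui).
Hypotheses (nu_ac : nu `<< nui) (nui_ac : nui `<< nu).
Variables (D : G -> R) (DE : is_density nu nui D).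
Local Notation K := (L2space mu).
Local Notation H := (L2space nu).
Local Notation lcU := (gpd_lcU lc hd).
Local Notation hdU := (gpd_hdU hd).
Local Notation scU := (gpd_scU sc).
Local Notation mufin := (gpd_mufin mu_radon).
Local Notation cal := (@cal R G mu nu).
Local Notation chb := (@chb R G mu nu D).
Local Notation jA := (@jA R G mu nu).
Local Notation jB := (@jB R G mu nu D).
Let lamk := lam_kern hd lamH.
Let lamik := lami_kern hd lamH.
Let fdA := fibd_alpha hd lamH nuE.
Let fdB := fibd_hbeta lc hd sc lamH mu_radon nuE nuiE nui_ac DE.
Let aA : amod (mulC0 mu) cal := cal_amod lc hd sc lamH mu_radon full nuE.
Let aB : amod (mulC0 mu) chb := chb_amod lc hd sc lamH mu_radon full nuE nuiE nu_ac nui_ac DE.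
Let hK : hilbert K := @hilbert_L2 _ _ _ mu.

Variable nu2sr : {measure set (borel (fib_sr G)) -> \bar R}.
Variable nu2rr : {measure set (borel (fib_rr G)) -> \bar R}.
Hypotheses (srE : is_nu2_sr mu lam nu2sr) (rrE : is_nu2_rr mu lam nu2rr).
Local Notation SR := (borel (fib_sr G)).
Local Notation RR := (borel (fib_rr G)).
Local Notation sx := (@sx G).
Local Notation sy := (@sy G).
Local Notation rx := (@rx G).
Local Notation ry := (@ry G).
Let msx := @sx_meas G.
Let msy := @sy_meas G.
Let fsr1 := fibd_sr1 lc hd sc lamH mu_radon nuE nuiE nui_ac DE srE.
Let GG := (Gb * Gb)%type.

Lemma sr_ext (A : set SR) : measurable A ->
  exists2 A' : set GG, measurable A' & A = (fun p => (sx p, sy p)) @^-1` A'.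
Proof.
pose S := preimage_set_system [set: SR] (fun p => (sx p, sy p)) (@measurable _ GG).
have sS : sigma_algebra setT S.
  by apply: sigma_algebra_preimage; exact: sigma_algebra_measurable.
have h : measurable `<=` S.
  apply: (gN_borel lc hd sc (@val_sr_cont G) (@val_sr_nbhs G) sS) => B mB.
    exists (B `*` setT); first exact: measurableX.
    by rewrite setTI; apply/seteqP; split=> p /=; [move=> []|].
  exists (setT `*` B); first exact: measurableX.
  by rewrite setTI; apply/seteqP; split=> p /=; [move=> []|].
by move=> /h[B mB <-]; exists B => //; rewrite setTI.
Qed.

(** A Borel extension of the inclusion of composable pairs to all pairs, so that integrals over
    [nu2sr] of arbitrary functions can be written as iterated integrals. *)
Definition mk_sr (p : GG) : SR :=
  match pselect (gs (p.1 : G) = gr (p.2 : G)) with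
  | left e => exist (fun q : G * G => q \in [set p : G * G | gs p.1 = gr p.2]) p (mem_set e)
  | right _ => point : fib_sr G
  end.

Lemma mk_srE p : gs p.1 = gr p.2 -> (sx (mk_sr p), sy (mk_sr p)) = p.
Proof. by move=> e; rewrite /mk_sr; case: pselect => // e'; rewrite /sx /sy /= -surjective_pairing. Qed.

Lemma mk_srK (t : SR) : mk_sr (sx t, sy t) = t.
Proof.
rewrite /mk_sr; case: pselect => [e|ne]; last by case: ne; exact: (sr_eq t).
by apply: val_inj; rewrite /= /sx /sy -surjective_pairing.
Qed.

Lemma fib_meas : measurable ([set p : GG | gs p.1 = gr p.2] : set GG).
Proof.
rewrite -[X in measurable X]setCK; apply: measurableC.
rewrite -(borel_prod R lc hd sc lc hd sc); apply: sub_sigma_algebra.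
exact: closed_openC (@fib_sr_closed G hd).
Qed.

Lemma mk_sr_meas : measurable_fun setT mk_sr.
Proof.
move=> _ A mA; rewrite setTI; have [A' mA' AE] := sr_ext mA.
have mF := fib_meas.
have -> : mk_sr @^-1` A = (A' `&` [set p : GG | gs p.1 = gr p.2]) `|`
   ([set p : GG | A (point : fib_sr G)] `&` ~` [set p : GG | gs p.1 = gr p.2]).
  apply/seteqP; split=> p /=.
    move=> Ap; have [e|ne] := pselect (gs p.1 = gr p.2).
      by left; split=> //; move: Ap; rewrite AE /= mk_srE.
    by right; split=> //; move: Ap; rewrite /mk_sr; case: pselect.
  move=> [[Ap e]|[Ap ne]]; first by rewrite AE /= mk_srE.
  by rewrite /mk_sr; case: pselect.
apply: measurableU; first exact: measurableI.
apply: measurableI; last exact: measurableC.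
have [h|h] := pselect (A (point : fib_sr G)).
  by rewrite (_ : [set _ | _] = setT)//; apply/seteqP; split.
by rewrite (_ : [set _ | _] = set0)//; apply/seteqP; split.
Qed.

Lemma sr_intF (F : SR -> \bar R) : measurable_fun setT F -> (forall p, 0 <= F p)%E ->
  (\int[nu2sr]_p F p = \int[nu]_x \int[lam (gs x)]_y F (mk_sr (x, y)))%E.
Proof.
move=> mF F0; have mF' := measurableT_comp mF mk_sr_meas.
rewrite -(sr_int lc hd sc lamH nuE srE mF' (fun p => F0 _)).
by apply: eq_integral => p _; rewrite -{1}[p]mk_srK /sx /sy -surjective_pairing.
Qed.

Lemma shear_meas : measurable_fun setT (@shear G : RR -> SR).
Proof. exact: (continuous_borel (@shear_cont G)). Qed.
Lemma unshear_meas : measurable_fun setT (@unshear G : SR -> RR).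
Proof. exact: (continuous_borel (@unshear_cont G)). Qed.

(** For fixed x this is left translation by x^{-1} on the fibre over r(x), that is, [lam_inv] at
    [ginv x]. *)
Lemma shear_int (F : SR -> \bar R) : measurable_fun setT F -> (forall p, 0 <= F p)%E ->
  (\int[nu2rr]_p F (shear p) = \int[nu2sr]_p F p)%E.
Proof.
move=> mF F0; have mF' := measurableT_comp mF mk_sr_meas.
pose h (p : GG) : GG := (p.1, gm (ginv p.1, p.2)).
have mh : measurable_fun setT h.
  apply/measurable_fun_pairP; split; first exact: measurable_fst.
  apply: (measurableT_comp (gm_meas R lc hd sc)); apply/measurable_fun_pairP; split.
    exact: measurableT_comp (@ginv_meas G) measurable_fst.
  exact: measurable_snd.
have mF2 := measurableT_comp mF' mh.
rewrite sr_intF// (eq_integral (fun p : RR => F (mk_sr (h (val (p : fib_rr G)))))); last first.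
  move=> p _; rewrite -[in LHS](mk_srK (shear p)); congr (F (mk_sr (_, _))).
  by rewrite gmE // gs_inv; exact: rr_eq.
rewrite (rr_int lc hd sc lamH nuE rrE mF2 (fun p => F0 _)).
apply: eq_integral => x _.
have mx : measurable_fun setT (fun y : Gb => F (mk_sr (x, y))).
  exact: (measurableT_comp mF' (pair1_measurable (x : Gb))).
have e := lam_inv lc hd sc lamH (ginv x) mx (fun y => F0 _).
by rewrite gs_inv gr_inv in e.
Qed.

Lemma unshear_int (F : RR -> \bar R) : measurable_fun setT F -> (forall p, 0 <= F p)%E ->
  (\int[nu2sr]_p F (unshear p) = \int[nu2rr]_p F p)%E.
Proof.
move=> mF F0; have mF' := measurableT_comp mF unshear_meas.
rewrite -(shear_int mF' (fun p => F0 _)); apply: eq_integral => p _.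
by rewrite /= shearK.
Qed.

Definition gpd_V : L2space nu2sr -> L2space nu2rr := wco nu2rr (fun=> 1) (@shear G : RR -> SR).
Definition gpd_Vinv : L2space nu2rr -> L2space nu2sr := wco nu2sr (fun=> 1) (@unshear G : SR -> RR).
Let wV := push_wcb shear_meas shear_int.
Let wVi := push_wcb unshear_meas unshear_int.

Lemma gpd_V_unitary : unitary gpd_V /\ uinv gpd_V = gpd_Vinv.
Proof. exact: (push_unitary shear_meas shear_int (@unshearK G) (@shearK G) wVi). Qed.

Section Half.
Variables (N1 N2 : ptopologicalType) (n1 : {measure set (borel N1) -> \bar R}) (n2 : {measure set (borel N2) -> \bar R}).
Variables (v1 : N1 -> G * G) (v2 : N2 -> G * G) (h : N2 -> N1) (g : N1 -> N2).
Hypotheses (hN1 : hausdorff_space N1) (hN2 : hausdorff_space N2).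
Hypotheses (vc1 : continuous v1) (vcl1 : closed (range v1)).
Hypothesis vi1 : forall p W, nbhs p W -> exists2 V, nbhs (v1 p) V & v1 @^-1` V `<=` W.
Hypotheses (vc2 : continuous v2) (vcl2 : closed (range v2)).
Hypothesis vi2 : forall p W, nbhs p W -> exists2 V, nbhs (v2 p) V & v2 @^-1` V `<=` W.
Hypotheses (ch : continuous h) (cg : continuous g) (hKg : cancel h g).
Hypothesis wh : wcb n1 n2 (fun=> 1 : C) (h : borel N2 -> borel N1) 1.
Variables (W1 : borel N1 -> C) (Q1 : borel N1 -> Ub) (W2 : borel N2 -> C) (Q2 : borel N2 -> Ub).
Hypotheses (mW2 : cmeas W2) (mQ2 : measurable_fun setT Q2).
Hypothesis bd1 : forall xi eta : G -> C, Cc xi -> Cc eta ->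
  exists M, wcb mu n1 (fun p => W1 p * (xi (v1 p).1 * eta (v1 p).2)) Q1 M.
Hypothesis bd2 : forall xi eta : G -> C, Cc xi -> Cc eta ->
  exists M, wcb mu n2 (fun p => W2 p * (xi (v2 p).1 * eta (v2 p).2)) Q2 M.
Hypothesis hQ : forall p, Q1 (h p) = Q2 p.
Hypothesis hW : {ae n2, forall p : borel N2, W1 (h p) = W2 p}.

(** Composing a generator with the homeomorphism h gives the operator of a C_c function on N2, and
    [Cc_tens_op] puts it in the target span. Weights are compared almost everywhere, base maps
    pointwise. *)
Lemma tens_push T : opspan (@tens_ops R U G N1 mu n1 v1 W1 Q1) T ->
  opspan (@tens_ops R U G N2 mu n2 v2 W2 Q2) (wco n2 (fun=> 1) (h : borel N2 -> borel N1) \o T).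
Proof.
have cl := opcomp_closedl (wco_bop wh) (@opspan_opclosed _ _ _ (@tens_ops R U G N2 mu n2 v2 W2 Q2)).
move=> hT; apply: (opspan_min cl _ hT).2 => _ [xi [eta [c ce ->]]].
have [M hM] := bd1 c ce; split; first exact: (wco_bop hM).
have cw1 := Cc_tens hd hN1 vc1 vcl1 vi1 c ce.
have cw2 := Cc_homeo hN2 ch cg hKg cw1.
have [M' hM'] := Cc_tens_wcb lc hd vc2 mW2 mQ2 bd2 cw2.
rewrite (wco_comp wh hM) (wco_ext (wcb_comp wh hM) hM' hQ).
  exact: (Cc_tens_op lc hd vc2 vcl2 vi2 mW2 mQ2 bd2 cw2).
by apply: filterS hW => p e; rewrite mul1r e.
Qed.
End Half.

Lemma mk_sx p : gs p.1 = gr p.2 -> sx (mk_sr p) = p.1.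
Proof. by move=> /mk_srE e; exact: (congr1 fst e). Qed.
Lemma mk_sy p : gs p.1 = gr p.2 -> sy (mk_sr p) = p.2.
Proof. by move=> /mk_srE e; exact: (congr1 snd e). Qed.

Let gmm := gm_meas R lc hd sc.
Let mpair d (T : measurableType d) d1 (T1 : measurableType d1) d2 (T2 : measurableType d2)
  (f : T -> T1) (g : T -> T2) : measurable_fun setT f -> measurable_fun setT g ->
  measurable_fun setT (fun x => (f x, g x)).
Proof. by move=> mf mg; apply/measurable_fun_pairP; split. Qed.

Lemma sr_gm_meas : measurable_fun setT (fun p : SR => gm (sx p, sy p) : Gb).
Proof. exact: measurableT_comp gmm (mpair msx msy). Qed.

(** [iter_cocycle] with F an indicator says that the squares of both sides have equal integrals over
    every Borel set; both sides are nonnegative reals, so equality of squares suffices. *)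
Lemma sr_cocycle : {ae nu2sr, forall p : SR, Dm12 D (sx p) * Dm12 D (sy p) = Dm12 D (gm (sx p, sy p))}.
Proof.
have mD := Dm12_meas DE; have mw := cmeas_sqn mD; have mgp := sr_gm_meas.
pose c1 (p : SR) : R := sqn (Dm12 D (gm (sx p, sy p))).
pose c2 (p : SR) : R := sqn (Dm12 D (sx p)) * sqn (Dm12 D (sy p)).
have mc1 : measurable_fun setT c1 := measurableT_comp mw mgp.
have mc2 : measurable_fun setT c2.
  by apply: measurable_funM; [exact: measurableT_comp mw msx|exact: measurableT_comp mw msy].
have c10 p : 0 <= c1 p := sqn_ge0 _.
have eqA (A : set SR) : measurable A -> (\int[nu2sr]_(p in A) (c1 p)%:E = \int[nu2sr]_(p in A) (c2 p)%:E)%E.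
  move=> mA; have [A' mA' AE] := sr_ext mA.
  pose F (q : GG) : \bar R := (\1_A' q)%:E.
  have pF : posmeas F.
    by split; [apply/measurable_EFinP; exact: measurable_indic|move=> q; rewrite lee_fin].
  have := iter_cocycle lc hd sc lamH mu_radon nuE nuiE nui_ac DE pF.
  have i1 (k : GG -> \bar R) : measurable_fun setT k -> (forall q, 0 <= k q)%E ->
    (\int[nu2sr]_(p in A) k (sx p, sy p) = iter_int lam nu (fun q => (F q * k q)%E))%E.
    move=> mk k0; rewrite /iter_int.
    have mFk : measurable_fun setT (fun q => (F q * k q)%E) by apply: emeasurable_funM => //; exact: pF.1.
    rewrite -(sr_int lc hd sc lamH nuE srE mFk (fun q => mule_ge0 (pF.2 q) (k0 q))).
    rewrite integral_mkcond; apply: eq_integral => p _.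
    rewrite patchE AE /F indicE (surjective_pairing (val (p : fib_sr G))).
    have -> : (p \in (fun p : SR => (sx p, sy p)) @^-1` A') = ((sx p, sy p) \in A').
      by apply/idP/idP => /set_mem; rewrite inE.
    by rewrite /sx /sy; case: (_ \in A'); rewrite ?mul1e ?mul0e.
  have mw1 : measurable_fun setT (fun q : GG => wD D q.1) by exact: measurableT_comp (wD_meas DE) measurable_fst.
  have mw2 : measurable_fun setT (fun q : GG => wD D q.2) by exact: measurableT_comp (wD_meas DE) measurable_snd.
  have mw3 : measurable_fun setT (fun q : GG => wD D (gm q)) by exact: measurableT_comp (wD_meas DE) gmm.
  rewrite -(i1 _ mw3 (fun q => wD_ge0 _ _)) => <-.
  rewrite (_ : (fun p : GG => _) = fun q => (F q * (wD D q.1 * wD D q.2))%E); last first.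
    by apply/funext => q; rewrite muleA.
  rewrite -i1; [|exact: emeasurable_funM|by move=> q; rewrite mule_ge0 ?wD_ge0].
  by apply: eq_integral => p _; rewrite /wD /c2 EFinM.
have [E [PE cE]] := precompact_cover R lc hd sc.
have gX := precompact_opens_gen R lc hd sc.
have [B [PB cB]] := rects_cover sx sy PE PE cE cE.
have mB k : measurable (B k).
  have [A1 PA1 [A2 PA2 <-]] := PB k; apply: measurableI; rewrite -[X in measurable X]setTI.
    exact: msx (precompact_meas PA1).
  exact: msy (precompact_meas PA2).
have fB k : (nu2sr (B k) < +oo)%E.
  have [A1 PA1 [A2 PA2 <-]] := PB k.
  apply: (rect_fin lc hd lamk (fibd_sr2 lc hd sc lamH nuE srE) gX) => //.
  by move=> A; exact: (nu_precompact lc hd sc lamH mu_radon nuE).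
(* Truncating at level l on a set of finite measure makes [c1] integrable, as the comparison of
   integrals requires; countably many such sets cover the space. *)
pose Dk k l := B k `&` [set p | c1 p <= l%:R].
have mDk k l : measurable (Dk k l).
  apply: measurableI => //; rewrite -[X in measurable X]setTI.
  have := mc1 measurableT [set` `]-oo, l%:R]] (measurable_itv _); congr measurable.
have ae k l : ae_eq nu2sr (Dk k l) (EFin \o c1) (EFin \o c2).
  apply: integral_ae_eq => //.
  - apply/integrableP; split; first by apply/measurable_EFinP; exact: measurable_funTS.
    apply: (@le_lt_trans _ _ (\int[nu2sr]_(p in Dk k l) (cst l%:R%:E p))%E).
      apply: ge0_le_integral => //.
      + by apply: measurableT_comp => //; apply/measurable_EFinP; exact: measurable_funTS.
      + by move=> p [_ h]; rewrite /= lee_fin ger0_norm.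
    rewrite integral_cst// lte_mul_pinfty// ?lee_fin//.
    by apply: le_lt_trans (fB k); apply: le_measure; rewrite ?inE//; exact: subIsetl.
  - by apply/measurable_EFinP; exact: measurable_funTS.
  - by move=> S _ mS; exact: eqA.
have : \forall p \ae nu2sr, forall k l, Dk k l p -> (c1 p)%:E = (c2 p)%:E.
  apply: ae_foralln => k; apply: ae_foralln => l; apply: filterS (ae k l) => p h /h; exact.
apply: filterS => p h; have : (\bigcup_k B k) p by rewrite cB.
move=> [k _ Bp]; have e : c1 p = c2 p.
  apply: EFin_inj; apply: (h k (Num.truncn (c1 p)).+1); split=> //=.
  exact: ltW (truncnS_gt _).
move: e; rewrite /c1 /c2 -sqnM /Dm12 -rmorphM !sqnR => /eqP.
by rewrite eqrXn2 ?mulr_ge0 ?powR_ge0// => /eqP <-.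
Qed.

Variable n3 : {measure set (SR * Gb)%type -> \bar R}.
Hypothesis n3E : forall F : SR * Gb -> \bar R, measurable_fun setT F -> (forall p, 0 <= F p)%E ->
  (\int[n3]_p F p = \int[nu2sr]_t \int[lam (gs (sy t))]_z F (t, z))%E.

Let kl (xi : G -> C) u : \bar R := \int[lam u]_x (sqn (xi x))%:E.
Let klm xi : Cc xi -> measurable_fun setT (kl xi : Ub -> _).
Proof.
move=> c; rewrite (_ : kl xi = fun u => (complex.Re (kip lam xi xi u))%:E); last first.
  by apply/funext => u; rewrite /kl (ka_sqnE lamk).
by apply/measurable_EFinP; have [m1 _] := ccont_meas (kip_Cc hd lamk c c).1.
Qed.
Let klb xi : Cc xi -> exists2 M : R, 0 <= M & forall u, (kl xi u <= M%:E)%E.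
Proof.
by move=> c; have [M M0 h] := kip_bound hd lamk c; exists M => // u; rewrite /kl (ka_sqnE lamk)// lee_fin.
Qed.
Let kl0 xi u : (0 <= kl xi u)%E. Proof. by apply: integral_ge0 => x _; rewrite lee_fin sqn_ge0. Qed.
Let smeas (xi : G -> C) : Cc xi -> measurable_fun setT (fun x : Gb => (sqn (xi x))%:E).
Proof. by move=> c; apply: cmeas_esqn; exact: ccont_meas c.1. Qed.

Let ple d (T : measurableType d) (m : {measure set T -> \bar R}) (f k : T -> \bar R) (M : R) : 0 <= M ->
  measurable_fun setT f -> measurable_fun setT k -> (forall t, 0 <= f t)%E -> (forall t, 0 <= k t)%E ->
  (forall t, k t <= M%:E)%E -> (\int[m]_t (f t * k t) <= M%:E * \int[m]_t f t)%E.
Proof.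
move=> M0 mf mk f0 k0 kM; rewrite -ge0_integralZl_EFin//; apply: ge0_le_integral => //.
- by move=> t _; rewrite mule_ge0.
- exact: emeasurable_funM.
- exact: measurable_funeM.
by move=> t _; rewrite muleC lee_wpmul2r.
Qed.

(** A triple (x, y, z) is stored as ((x, y), z). The four maps into [SR] are the face maps (x, y),
    (y, z), (x, yz), (xy, z) of the nerve of the groupoid on composable triples, extended to all
    triples. *)
Definition pxy (p : SR * Gb) : SR := p.1.
Definition pyz (p : SR * Gb) : SR := mk_sr (sy p.1, p.2).
Definition px_yz (p : SR * Gb) : SR := mk_sr (sx p.1, gm (sy p.1, p.2)).
Definition pxy_z (p : SR * Gb) : SR := mk_sr (gm (sx p.1, sy p.1), p.2).
Definition pxyz (p : SR * Gb) : Gb := gm (sx p.1, gm (sy p.1, p.2)).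

Let mx3 : measurable_fun setT (fun p : SR * Gb => sx p.1) := measurableT_comp msx measurable_fst.
Let my3 : measurable_fun setT (fun p : SR * Gb => sy p.1) := measurableT_comp msy measurable_fst.
Let mz3 : measurable_fun setT (fun p : SR * Gb => p.2) := measurable_snd.
Let myz3 : measurable_fun setT (fun p : SR * Gb => gm (sy p.1, p.2) : Gb).
Proof. exact: measurableT_comp gmm (mpair my3 mz3). Qed.
Lemma pyz_meas : measurable_fun setT pyz.
Proof. exact: measurableT_comp mk_sr_meas (mpair my3 mz3). Qed.
Lemma px_yz_meas : measurable_fun setT px_yz.
Proof. exact: measurableT_comp mk_sr_meas (mpair mx3 myz3). Qed.
Lemma pxy_z_meas : measurable_fun setT pxy_z.
Proof.
exact: measurableT_comp mk_sr_meas (mpair (measurableT_comp gmm (mpair mx3 my3)) mz3).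
Qed.
Lemma pxyz_meas : measurable_fun setT pxyz.
Proof. exact: measurableT_comp gmm (mpair mx3 myz3). Qed.

Let sec d (T : measurableType d) (F : GG -> T) (x : Gb) : measurable_fun setT F -> measurable_fun setT (fun y : Gb => F (x, y)).
Proof. by move=> mF; exact: measurableT_comp mF (pair1_measurable (x : Gb)). Qed.

(** This bound and the three that follow concern the operators that turn out to be [F7], [F1], [F5]
    and [F2] in the pentagon criterion. Here left invariance, used at y and at x, removes both from
    the inner integral. *)
Lemma wcb_xyz eta : Cc eta -> exists M, wcb nu2sr n3 (fun p => eta (pxyz p)) pxy M.
Proof.
move=> c; have [M M0 hM] := klb c; exists M; split=> //.
- by have [? ?] := cmeas_comp pxyz_meas (ccont_meas c.1).
- exact: measurable_fst.
move=> F mF F0; have ms := smeas c.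
have m1 : measurable_fun setT (fun p => (sqn (eta (pxyz p)))%:E * F (pxy p))%E.
  by apply: emeasurable_funM; [exact: measurableT_comp ms pxyz_meas|exact: measurableT_comp mF measurable_fst].
rewrite n3E//; last by move=> p; rewrite mule_ge0// lee_fin sqn_ge0.
have -> : (\int[nu2sr]_t \int[lam (gs (sy t))]_z ((sqn (eta (pxyz (t, z))))%:E * F (pxy (t, z))) =
    \int[nu2sr]_t (F t * kl eta (gr (sx t))))%E.
  apply: eq_integral => t _; rewrite /pxyz /pxy /=.
  have e0 : measurable_fun setT (fun y : Gb => (sqn (eta (gm (sx t, y))))%:E).
    exact: measurableT_comp ms (gm_meas1 R lc hd sc (sx t)).
  have s0 (y : Gb) : (0 <= (sqn (eta (gm (sx t, y))))%:E)%E by rewrite lee_fin sqn_ge0.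
  under eq_integral do rewrite muleC.
  have e1 : measurable_fun setT (fun z : Gb => (sqn (eta (gm (sx t, gm (sy t, z)))))%:E).
    exact: (measurableT_comp e0 (gm_meas1 R lc hd sc (sy t))).
  rewrite ge0_integralZl//.
  congr (_ * _)%E; rewrite (lam_inv lc hd sc lamH (sy t) e0 s0) -(sr_eq t).
  by apply: (lam_inv lc hd sc lamH (sx t) ms) => x; rewrite lee_fin sqn_ge0.
by apply: ple => //; exact: measurableT_comp (klm c) (measurableT_comp (@gr_meas G) msx).
Qed.

Let lamint2 (F : GG -> \bar R) : measurable_fun setT F -> (forall p, 0 <= F p)%E ->
  measurable_fun setT (fun x : Gb => \int[lam (gs x)]_y F (x, y))%E.
Proof. by move=> mF F0; exact: (lam_kint lc hd sc lamH (@gs_meas G)). Qed.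

Lemma wcb_yz zeta : Cc zeta -> exists M,
  wcb nu2sr n3 (fun p => zeta (sx p.1) * Dm12 D (sx p.1)) pyz M.
Proof.
move=> c; have [M h] := fop_wcb hd lamik fsr1 c; have [mc _ M0 le] := h; exists M; split=> //.
- by have [? ?] := cmeas_comp (@measurable_fst _ _ SR Gb) mc.
- exact: pyz_meas.
move=> F mF F0; have mF' := measurableT_comp mF mk_sr_meas.
have ms := cmeas_esqn mc.
rewrite n3E; first last.
- by move=> p; rewrite mule_ge0// lee_fin sqn_ge0.
- apply: emeasurable_funM; first exact: measurableT_comp ms measurable_fst.
  exact: measurableT_comp mF pyz_meas.
have -> : (\int[nu2sr]_t \int[lam (gs (sy t))]_z ((sqn (zeta (sx (t, z).1) * Dm12 D (sx (t, z).1)))%:E * F (pyz (t, z))) =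
    \int[nu2sr]_t ((sqn (zeta (sx t) * Dm12 D (sx t)))%:E * \int[lam (gs (sy t))]_z F (mk_sr (sy t, z))))%E.
  apply: eq_integral => t _; have mt : measurable_fun setT (fun z : Gb => F (mk_sr (sy t, z))) := sec (sy t) mF'.
  by rewrite /pyz /= ge0_integralZl// lee_fin sqn_ge0.
apply: (le_trans (le _ (lamint2 mF' (fun p => F0 _)) (fun x => integral_ge0 _ (fun y _ => F0 _)))).
by rewrite -sr_intF.
Qed.

Lemma wcb_x_yz xi : Cc xi -> exists M, wcb nu2sr n3 (fun p => xi (sy p.1)) px_yz M.
Proof.
move=> c; have [M M0 hM] := klb c; exists M; split=> //.
- by have [? ?] := cmeas_comp my3 (ccont_meas c.1).
- exact: px_yz_meas.
move=> F mF F0; have mF' := measurableT_comp mF mk_sr_meas; have ms := smeas c.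
have mFx (x : Gb) : measurable_fun setT (fun w : Gb => F (mk_sr (x, w))) := sec x mF'.
rewrite n3E; first last.
- by move=> p; rewrite mule_ge0// lee_fin sqn_ge0.
- apply: emeasurable_funM; first exact: measurableT_comp ms my3.
  exact: measurableT_comp mF px_yz_meas.
pose g x := (\int[lam (gs x)]_w F (mk_sr (x, w)))%E.
have mg : measurable_fun setT (g : Gb -> _) := lamint2 mF' (fun p => F0 _).
have g0 x : (0 <= g x)%E by exact: integral_ge0.
have -> : (\int[nu2sr]_t \int[lam (gs (sy t))]_z ((sqn (xi (sy (t, z).1)))%:E * F (px_yz (t, z))) =
   \int[nu2sr]_t (g (sx t) * (sqn (xi (sy t)))%:E))%E.
  apply: eq_integral => t _; rewrite /px_yz /=.
  have mt : measurable_fun setT (fun z : Gb => F (mk_sr (sx t, gm (sy t, z)))).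
    exact: (measurableT_comp (mFx (sx t)) (gm_meas1 R lc hd sc (sy t))).
  rewrite ge0_integralZl ?lee_fin ?sqn_ge0//.
  by rewrite (lam_inv lc hd sc lamH (sy t) (mFx (sx t)) (fun w => F0 _)) -(sr_eq t) muleC.
have := fop_int lamk (fibd_sr2 lc hd sc lamH nuE srE) c mg g0 => e.
have -> : (\int[nu2sr]_t (g (sx t) * (sqn (xi (sy t)))%:E) =
    \int[nu2sr]_t ((sqn (xi (sy t) * 1))%:E * g (sx t)))%E.
  by apply: eq_integral => t _; rewrite mulr1 muleC.
rewrite e sr_intF//; apply: ple => //.
- by have := measurableT_comp (klm c) (@gs_meas G); congr measurable_fun; apply/funext => x; rewrite /= /kl (ka_sqnE lamk).
- by move=> x; rewrite -(ka_sqnE lamk)//; exact: kl0.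
- by move=> x; rewrite -(ka_sqnE lamk)//; exact: hM.
Qed.

(** The inner integral depends on the product xy alone. Left invariance in y makes xy a free
    variable of the same range as x, and [nu_swap] then integrates out x. *)
Lemma wcb_xy_z eta : Cc eta -> exists M, wcb nu2sr n3 (fun p => eta (sx p.1)) pxy_z M.
Proof.
move=> c; have [M M0 hM] := klb c; exists M; split=> //.
- by have [? ?] := cmeas_comp mx3 (ccont_meas c.1).
- exact: pxy_z_meas.
move=> F mF F0; have mF' := measurableT_comp mF mk_sr_meas; have ms := smeas c.
have mFx (x : Gb) : measurable_fun setT (fun w : Gb => F (mk_sr (x, w))) := sec x mF'.
rewrite n3E; first last.
- by move=> p; rewrite mule_ge0// lee_fin sqn_ge0.
- apply: emeasurable_funM; first exact: measurableT_comp ms mx3.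
  exact: measurableT_comp mF pxy_z_meas.
pose g x := (\int[lam (gs x)]_w F (mk_sr (x, w)))%E.
have mg : measurable_fun setT (g : Gb -> _) := lamint2 mF' (fun p => F0 _).
have g0 x : (0 <= g x)%E by exact: integral_ge0.
have s0 (x : Gb) : (0 <= (sqn (eta x))%:E)%E by rewrite lee_fin sqn_ge0.
have -> : (\int[nu2sr]_t \int[lam (gs (sy t))]_z ((sqn (eta (sx (t, z).1)))%:E * F (pxy_z (t, z))) =
   \int[nu2sr]_t ((sqn (eta (sx t)))%:E * g (gm (sx t, sy t))))%E.
  apply: eq_integral => t _; rewrite /pxy_z /=.
  rewrite ge0_integralZl//; congr (_ * _)%E; rewrite /g.
  by rewrite gmE ?gs_mul//; exact: (sr_eq t).
have mgg : measurable_fun setT (fun q : GG => (sqn (eta q.1))%:E * g (gm q))%E.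
  by apply: emeasurable_funM; [exact: measurableT_comp ms measurable_fst|exact: measurableT_comp mg gmm].
have e := sr_int lc hd sc lamH nuE srE mgg (fun q => mule_ge0 (s0 _) (g0 _)).
have -> : (\int[nu2sr]_t ((sqn (eta (sx t)))%:E * g (gm (sx t, sy t))) =
    \int[nu2sr]_p ((sqn (eta (val (p : fib_sr G)).1))%:E * g (gm (val (p : fib_sr G)))))%E.
  by apply: eq_integral => t _; rewrite /sx /sy -surjective_pairing.
rewrite e.
have -> : (\int[nu]_x \int[lam (gs x)]_y ((sqn (eta (x, y).1))%:E * g (gm (x, y))) =
    \int[nu]_x ((sqn (eta x))%:E * \int[lam (gr x)]_y g y))%E.
  apply: eq_integral => x _ /=; have mt : measurable_fun setT (fun y : Gb => g (gm (x, y))).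
    exact: (measurableT_comp mg (gm_meas1 R lc hd sc x)).
  by rewrite ge0_integralZl// (lam_inv lc hd sc lamH).
rewrite (nu_swap lc hd sc lamH nuE ms mg s0 g0) sr_intF//; apply: ple => //.
- exact: measurableT_comp (klm c) (@gr_meas G).
- by move=> t; exact: kl0.
- by move=> t; exact: hM.
Qed.

End Gpd.

Lemma wcb_eq d (T : measurableType d) d' (N : measurableType d') (R : realType)
    (m : {measure set T -> \bar R}) (n : {measure set N -> \bar R}) (c c' : N -> R[i]) (phi : N -> T) :
  (forall p, c p = c' p) -> (exists M, wcb m n c phi M) -> exists M, wcb m n c' phi M.
Proof. by move=> /funext->. Qed.

Lemma wco_ext_ae d (T : measurableType d) d' (N : measurableType d') (R : realType)
    (m : {measure set T -> \bar R}) (n : {measure set N -> \bar R}) (c c' : N -> R[i]) (phi phi' : N -> T) M M' :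
  wcb m n c phi M -> wcb m n c' phi' M' -> {ae n, forall p, c p = c' p /\ phi p = phi' p} ->
  wco (m := m) n c phi = wco n c' phi'.
Proof.
move=> h h' ae; apply/funext => x; have [f f2 ->] := cls_surj x.
rewrite (wcoE h)// (wcoE h')//; apply/cls_eqP; [exact: (wcb_sqint h)|exact: (wcb_sqint h')|].
by apply: filterS ae => p [-> ->].
Qed.

Lemma mulop_wco d (T : measurableType d) d' (N : measurableType d') (R : realType)
    (m : {measure set T -> \bar R}) (n : {measure set N -> \bar R}) (c g : N -> R[i]) (phi : N -> T) M :
  wcb m n c phi M -> bmeas g -> mulop n g \o wco (m := m) n c phi = wco n (fun p => g p * c p) phi.
Proof. by move=> h bg; have [M' h'] := bmeas_wcb n bg; rewrite /mulop (wco_comp h' h). Qed.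

Lemma wco_mulop d (T : measurableType d) d' (N : measurableType d') (R : realType)
    (m : {measure set T -> \bar R}) (n : {measure set N -> \bar R}) (c : N -> R[i]) (f : T -> R[i]) (phi : N -> T) M :
  wcb m n c phi M -> bmeas f -> wco (m := m) n c phi \o mulop m f = wco n (fun p => c p * f (phi p)) phi.
Proof. by move=> h bf; have [M' h'] := bmeas_wcb m bf; rewrite /mulop (wco_comp h h'). Qed.

Lemma ae_pull d (T : measurableType d) d' (N : measurableType d') (R : realType)
    (m : {measure set T -> \bar R}) (n : {measure set N -> \bar R}) (h : N -> T) (P : T -> Prop) :
  measurable_fun setT h -> (forall F : T -> \bar R, measurable_fun setT F -> (forall x, 0 <= F x)%E ->
    (\int[n]_p F (h p) = \int[m]_p F p)%E) ->
  {ae m, forall p, P p} -> {ae n, forall p, P (h p)}.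
Proof.
move=> mh hE [A [mA A0 AP]]; have mhA : measurable (h @^-1` A) by rewrite -[X in measurable X]setTI; exact: mh.
exists (h @^-1` A); split=> //; last by move=> p np; exact: AP.
rewrite -A0 -(int_indicT n mhA) -(int_indicT m mA) -hE//.
by apply/measurable_EFinP; exact: measurable_indic.
Qed.

Lemma comm_opclosed (R : realType) (K H : ipSpace R) (r : H -> H) (c : K -> K) :
  bounded_op r -> bounded_op c -> opclosed [set T : K -> H | bounded_op T /\ r \o T = T \o c].
Proof.
move=> br bc; have [M M0 hM] := bop_bound br; split.
- split; first exact: bop_0.
  by apply/funext => x; exact: (bop0 br).
- move=> a S T [bS hS] [bT hT]; split; first exact: bopP.
  apply/funext => x; have e1 := congr1 (@^~ x) hS; have e2 := congr1 (@^~ x) hT.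
  rewrite -[LHS]/(r (a *: S x + T x)) (bop_lin br).
  by rewrite -[r (S x)]/((r \o S) x) -[r (T x)]/((r \o T) x) hS hT.
- move=> T bT h; split=> //; apply/funext => x /=.
  apply: (@hnorm_lim0 R H _ _ (M * hnorm x + hnorm (c x))) => e /andP[e0 _].
  have [S [bS hS] c1] := h e e0; exists (r (S x)).
  have n1 := hnorm_ge0 x; have n2 := hnorm_ge0 (c x); split.
    rewrite -(bopB br); apply: (le_trans (hM _)).
    apply: (@le_trans _ _ (M * (e * hnorm x))); first by rewrite ler_pM2l//; exact: c1.
    by rewrite mulrDl mulrAC -mulrA mulrA lerDl mulr_ge0// ltW.
  rewrite -[r (S x)]/((r \o S) x) hS; apply: (le_trans (c1 _)).
  by rewrite mulrC ler_pM2r// lerDr mulr_ge0// ltW.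
Qed.

(** * Kets and module structures in coordinates, and the action of V on them *)

Section Gpd.
Variables (R : realType) (G : topGroupoid).
Hypotheses (lc : locally_compact [set: G]) (hd : hausdorff_space G).
Hypothesis sc : @second_countable G.
Local Notation C := R[i].
Local Notation U := (gunits G).
Local Notation Gb := (borel G).
Local Notation Ub := (borel U).
Variable lam : U -> {measure set Gb -> \bar R}.
Hypothesis lamH : is_Haar_system lam.
Variable mu : {measure set Ub -> \bar R}.
Hypothesis mu_radon : radon mu.
Hypothesis full : full_support mu.
Variables nu nui : {measure set Gb -> \bar R}.
Hypotheses (nuE : is_nu mu lam nu) (nuiE : is_nu mu (haar_inv lam) nui).
Hypotheses (nu_ac : nu `<< nui) (nui_ac : nui `<< nu).
Variables (D : G -> R) (DE : is_density nu nui D).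
Local Notation K := (L2space mu).
Local Notation H := (L2space nu).
Local Notation lcU := (gpd_lcU lc hd).
Local Notation hdU := (gpd_hdU hd).
Local Notation scU := (gpd_scU sc).
Local Notation mufin := (gpd_mufin mu_radon).
Local Notation cal := (@cal R G mu nu).
Local Notation chb := (@chb R G mu nu D).
Local Notation jA := (@jA R G mu nu).
Local Notation jB := (@jB R G mu nu D).
Let lamk := lam_kern hd lamH.
Let lamik := lami_kern hd lamH.
Let fdA := fibd_alpha hd lamH nuE.
Let fdB := fibd_hbeta lc hd sc lamH mu_radon nuE nuiE nui_ac DE.
Let aA : amod (mulC0 mu) cal := cal_amod lc hd sc lamH mu_radon full nuE.
Let aB : amod (mulC0 mu) chb := chb_amod lc hd sc lamH mu_radon full nuE nuiE nu_ac nui_ac DE.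
Let hK : hilbert K := @hilbert_L2 _ _ _ mu.
Variable nu2sr : {measure set (borel (fib_sr G)) -> \bar R}.
Variable nu2rr : {measure set (borel (fib_rr G)) -> \bar R}.
Hypotheses (srE : is_nu2_sr mu lam nu2sr) (rrE : is_nu2_rr mu lam nu2rr).
Local Notation SR := (borel (fib_sr G)).
Local Notation RR := (borel (fib_rr G)).
Local Notation sx := (@sx G).
Local Notation sy := (@sy G).
Local Notation rx := (@rx G).
Local Notation ry := (@ry G).
Let fsr2 := fibd_sr2 lc hd sc lamH nuE srE.
Let frr2 := fibd_rr2 lc hd sc lamH nuE rrE.
Let frr1 := fibd_rr1 lc hd sc lamH nuE rrE.
Let fsr1 := fibd_sr1 lc hd sc lamH mu_radon nuE nuiE nui_ac DE srE.

Lemma tot_sr2 : hspan [set x | exists xi h, Cc xi /\ x = fop (m := nu) nu2sr sx sy (fun=> 1) xi h] = setT.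
Proof.
have [E [PE cE]] := precompact_cover R lc hd sc.
apply: (fop_tot lc hd sc lamk fsr2 (precompact_opens_gen R lc hd sc) (precompact_opensI hd) PE cE).
  by move=> A; exact: (nu_precompact lc hd sc lamH mu_radon nuE).
exact: (gN_borel lc hd sc (@val_sr_cont G) (@val_sr_nbhs G)).
Qed.

Lemma tot_rr2 : hspan [set x | exists xi h, Cc xi /\ x = fop (m := nu) nu2rr rx ry (fun=> 1) xi h] = setT.
Proof.
have [E [PE cE]] := precompact_cover R lc hd sc.
apply: (fop_tot lc hd sc lamk frr2 (precompact_opens_gen R lc hd sc) (precompact_opensI hd) PE cE).
  by move=> A; exact: (nu_precompact lc hd sc lamH mu_radon nuE).
exact: (gN_borel lc hd sc (@val_rr_cont G) (@val_rr_nbhs G)).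
Qed.

Lemma rtp_sr_ex : exists t : (K -> H) -> K -> (K -> H) -> L2space nu2sr, is_rtp chb cal t /\
  forall xi z eta, Cc eta -> chb xi -> t xi z (jA eta) = fop nu2sr sx sy (fun=> 1) eta (xi z).
Proof.
apply: (rtp_fop hd lamH nuE fsr2 tot_sr2 (am_bop aB) (am_tot aB)).
by move=> f xi; exact: (mulop_cmod hd lamik (@gs_cont G) fdB).
Qed.

Lemma rtp_rr_ex : exists t : (K -> H) -> K -> (K -> H) -> L2space nu2rr, is_rtp cal cal t /\
  forall xi z eta, Cc eta -> cal xi -> t xi z (jA eta) = fop nu2rr rx ry (fun=> 1) eta (xi z).
Proof.
apply: (rtp_fop hd lamH nuE frr2 tot_rr2 (am_bop aA) (am_tot aA)).
by move=> f xi; exact: (mulop_cmod hd lamk (@gr_cont G) fdA).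
Qed.

Variables (tsr : (K -> H) -> K -> (K -> H) -> L2space nu2sr) (tr : is_rtp chb cal tsr).
Hypothesis tE : forall xi z eta, Cc eta -> chb xi ->
  tsr xi z (jA eta) = fop nu2sr sx sy (fun=> 1) eta (xi z).
Variables (trr : (K -> H) -> K -> (K -> H) -> L2space nu2rr) (tr' : is_rtp cal cal trr).
Hypothesis tE' : forall xi z eta, Cc eta -> cal xi ->
  trr xi z (jA eta) = fop nu2rr rx ry (fun=> 1) eta (xi z).
Local Notation X := (Rtp tr).
Local Notation Y := (Rtp tr').
Let comB := @mulC0_com R U mu.
Let fX : rtp cal chb := flip comB X aB aA.
Let fY : rtp cal cal := flip comB Y aA aA.
Let cA := @cal_jA R G hd lam lamH mu nu nuE.
Let cB := @chb_jB R G lc hd sc lam lamH mu mu_radon nu nui nuE nuiE nui_ac D DE.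

Let wA xi : Cc xi -> exists M, wcb mu nu (fun x : Gb => xi x * 1) (@gr G : Gb -> Ub) M.
Proof. exact: (fop_wcb hd lamk fdA). Qed.
Let wB xi : Cc xi -> exists M, wcb mu nu (fun x : Gb => xi x * Dm12 D x) (@gs G : Gb -> Ub) M.
Proof. exact: (fop_wcb hd lamik fdB). Qed.
Let wS2 xi : Cc xi -> exists M, wcb nu nu2sr (fun p => xi (sy p) * 1) sx M.
Proof. exact: (fop_wcb hd lamk fsr2). Qed.
Let wS1 xi : Cc xi -> exists M, wcb nu nu2sr (fun p => xi (sx p) * Dm12 D (sx p)) sy M.
Proof. exact: (fop_wcb hd lamik fsr1). Qed.
Let wR2 xi : Cc xi -> exists M, wcb nu nu2rr (fun p => xi (ry p) * 1) rx M.
Proof. exact: (fop_wcb hd lamk frr2). Qed.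
Let wR1 xi : Cc xi -> exists M, wcb nu nu2rr (fun p => xi (rx p) * 1) ry M.
Proof. exact: (fop_wcb hd lamk frr1). Qed.

Lemma ket2X xi : Cc xi -> ket2 X (jA xi) = fop nu2sr sx sy (fun=> 1) xi.
Proof.
move=> c; apply: (ket2_uniq hK aB aA (cA c)); first exact: (fop_bop hd lamk fsr2 c).
by move=> eta z be; rewrite /= tE.
Qed.

Lemma ket2Y xi : Cc xi -> ket2 Y (jA xi) = fop nu2rr rx ry (fun=> 1) xi.
Proof.
move=> c; apply: (ket2_uniq hK aA aA (cA c)); first exact: (fop_bop hd lamk frr2 c).
by move=> eta z be; rewrite /= tE'.
Qed.

(** [tE] describes the kets of the second leg. Evaluated on the total vectors [jA eta z] it also
    determines the kets of the first leg, because s(x) = r(y) on the fibre product. *)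
Lemma ket1X xi : Cc xi -> ket1 X (jB xi) = fop nu2sr sy sx (fun p => Dm12 D (sx p)) xi.
Proof.
move=> c; have bk : bounded_op (ket1 X (jB xi)) := ket2_bop hK fX aA aB (cB c).
apply: (bop_ext_on bk (fop_bop hd lamik fsr1 c) (jA_tot lc hd sc lamH mu_radon full nuE)).
move=> _ [eta [z [ce ->]]].
have -> : ket1 X (jB xi) (jA eta z) = tsr (jB xi) z (jA eta).
  exact: (ket2E hK fX aA aB z (cB c) (cA ce)).
rewrite tE//; last exact: cB.
have [M1 h1] := wA ce; have [M2 h2] := wB c; have [M3 h3] := wS2 ce; have [M4 h4] := wS1 c.
rewrite -[LHS]/((fop nu2sr sx sy (fun=> 1) eta \o jB xi) z) -[RHS]/((fop nu2sr sy sx _ xi \o jA eta) z).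
congr (_ z); rewrite /fop /jA /jB /fop (wco_comp h3 h2) (wco_comp h4 h1).
apply: (wco_ext (wcb_comp h3 h2) (wcb_comp h4 h1)) => [p|]; first exact: sr_eq.
by apply: aeW => p; ring.
Qed.

Lemma ket1Y xi : Cc xi -> ket1 Y (jA xi) = fop nu2rr ry rx (fun=> 1) xi.
Proof.
move=> c; have bk : bounded_op (ket1 Y (jA xi)) := ket2_bop hK fY aA aA (cA c).
apply: (bop_ext_on bk (fop_bop hd lamk frr1 c) (jA_tot lc hd sc lamH mu_radon full nuE)).
move=> _ [eta [z [ce ->]]].
have -> : ket1 Y (jA xi) (jA eta z) = trr (jA xi) z (jA eta).
  exact: (ket2E hK fY aA aA z (cA c) (cA ce)).
rewrite tE'//; last exact: cA.
have [M1 h1] := wA ce; have [M2 h2] := wA c; have [M3 h3] := wR2 ce; have [M4 h4] := wR1 c.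
rewrite -[LHS]/((fop nu2rr rx ry (fun=> 1) eta \o jA xi) z) -[RHS]/((fop nu2rr ry rx _ xi \o jA eta) z).
congr (_ z); rewrite /fop /jA /fop (wco_comp h3 h2) (wco_comp h4 h1).
apply: (wco_ext (wcb_comp h3 h2) (wcb_comp h4 h1)) => [p|]; first exact: rr_eq.
by apply: aeW => p; ring.
Qed.

Let dA eta : cal eta -> forall e : R, 0 < e -> exists2 eta0, [set jA xi | xi in @Cc R G] eta0 & op_close eta eta0 e.
Proof. by move=> [_ h] e /h[xi c xiT]; exists (jA xi) => //; exists xi. Qed.
Let dB eta : chb eta -> forall e : R, 0 < e -> exists2 eta0, [set jB xi | xi in @Cc R G] eta0 & op_close eta eta0 e.
Proof. by move=> [_ h] e /h[xi c xiT]; exists (jB xi) => //; exists xi. Qed.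
Let sA : [set jA xi | xi in @Cc R G] `<=` cal. Proof. by move=> _ [xi c <-]; exact: cA. Qed.
Let sB : [set jB xi | xi in @Cc R G] `<=` chb. Proof. by move=> _ [xi c <-]; exact: cB. Qed.
Let clA : opclosed cal. Proof. exact: (cmod_opclosed hd lamk fdA). Qed.
Let clB : opclosed chb. Proof. exact: (cmod_opclosed hd lamik fdB). Qed.
Let rA f : C0 f -> rho cal (mulop mu f) = mulop nu (fun y : Gb => f (gr y)).
Proof. exact: (cal_rho lc hd sc lamH mu_radon full nuE). Qed.
Let rB f : C0 f -> rho chb (mulop mu f) = mulop nu (fun y : Gb => f (gs y)).
Proof. exact: (chb_rho lc hd sc lamH mu_radon full nuE nuiE nu_ac nui_ac DE). Qed.

Local Notation tens n v W Q := (@tens_ops R U G _ mu n v W Q).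
Local Notation vs := (val : fib_sr G -> G * G).
Local Notation vr := (val : fib_rr G -> G * G).

Let opmul_r (N : ptopologicalType) (n : {measure set (borel N) -> \bar R}) (v : N -> G * G) W Q
    (H1 : ipSpace R) (kt : (G -> C) -> H1 -> L2space n) (ds : (G -> C) -> K -> H1) A B :
  A = [set kt xi | xi in @Cc R G] -> B = [set ds xi | xi in @Cc R G] ->
  (forall xi eta, Cc xi -> Cc eta -> kt eta \o ds xi = wco n (fun p => W p * (xi (v p).1 * eta (v p).2)) Q) ->
  opmul A B = tens n v W Q.
Proof.
move=> -> -> h; apply/seteqP; split=> T.
  by move=> [_ [eta ce <-] [_ [xi c <-] <-]]; exists xi, eta; split=> //; exact: h.
move=> [xi [eta [c ce ->]]]; rewrite -h//.
by exists (kt eta); [exists eta|exists (ds xi) => //; exists xi].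
Qed.

Let opmul_l (N : ptopologicalType) (n : {measure set (borel N) -> \bar R}) (v : N -> G * G) W Q
    (H1 : ipSpace R) (kt : (G -> C) -> H1 -> L2space n) (ds : (G -> C) -> K -> H1) A B :
  A = [set kt xi | xi in @Cc R G] -> B = [set ds xi | xi in @Cc R G] ->
  (forall xi eta, Cc xi -> Cc eta -> kt xi \o ds eta = wco n (fun p => W p * (xi (v p).1 * eta (v p).2)) Q) ->
  opmul A B = tens n v W Q.
Proof.
move=> -> -> h; apply/seteqP; split=> T.
  by move=> [_ [eta ce <-] [_ [xi c <-] <-]]; exists eta, xi; split=> //; exact: h.
move=> [xi [eta [c ce ->]]]; rewrite -h//.
by exists (kt xi); [exists xi|exists (ds eta) => //; exists eta].
Qed.

Let im (T1 T2 : Type) (k : T1 -> T2) (j : (G -> C) -> T1) (g : (G -> C) -> T2) :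
  (forall xi, Cc xi -> k (j xi) = g xi) ->
  [set k eta | eta in [set j xi | xi in @Cc R G]] = [set g xi | xi in @Cc R G].
Proof.
move=> h; apply/seteqP; split=> T; first by move=> [_ [xi c <-] <-]; exists xi => //; rewrite h.
by move=> [xi c <-]; exists (j xi); [exists xi|exact: h].
Qed.

(** In this family of lemmas the weight collects the factors D^{-1/2} contributed by the legs, and
    the last map records through which arrow a function on the units is pulled back. *)
Lemma trilX : tril X cal = opspan (tens nu2sr vs (fun=> 1) (fun p => gr (sx p))).
Proof.
rewrite (tril_gen lcU hdU mufin full (@gs_meas G) aB aA clA rB X sA sA dA dA (am_bop aA)).
congr opspan; apply: (opmul_r (im ket2X) erefl) => xi eta c ce.
have [M1 h1] := wA c; have [M2 h2] := wS2 ce.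
rewrite /fop /jA /fop (wco_comp h2 h1); congr (wco _ _ _); apply/funext => p /=.
ring.
Qed.

Lemma trirX_al : trir X cal = opspan (tens nu2sr vs (fun p => Dm12 D (sx p)) (fun p => gr (sy p))).
Proof.
rewrite -[LHS]/(tril fX cal).
rewrite (tril_gen lcU hdU mufin full (@gr_meas G) aA aB clB rA fX sB sA dB dA (am_bop aA)).
congr opspan; apply: (opmul_l (im ket1X) erefl) => xi eta c ce.
have [M1 h1] := wA ce; have [M2 h2] := wS1 c.
rewrite /fop /jA /fop (wco_comp h2 h1); congr (wco _ _ _); apply/funext => p /=.
ring.
Qed.

Lemma trirX_hb : trir X chb =
  opspan (tens nu2sr vs (fun p => Dm12 D (sx p) * Dm12 D (sy p)) (fun p => gs (sy p))).
Proof.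
rewrite -[LHS]/(tril fX chb).
rewrite (tril_gen lcU hdU mufin full (@gr_meas G) aA aB clB rA fX sB sB dB dB (am_bop aB)).
congr opspan; apply: (opmul_l (im ket1X) erefl) => xi eta c ce.
have [M1 h1] := wB ce; have [M2 h2] := wS1 c.
rewrite /fop /jB /fop (wco_comp h2 h1); congr (wco _ _ _); apply/funext => p /=.
ring.
Qed.

Lemma trilY : tril Y cal = opspan (tens nu2rr vr (fun=> 1) (fun p => gr (rx p))).
Proof.
rewrite (tril_gen lcU hdU mufin full (@gr_meas G) aA aA clA rA Y sA sA dA dA (am_bop aA)).
congr opspan; apply: (opmul_r (im ket2Y) erefl) => xi eta c ce.
have [M1 h1] := wA c; have [M2 h2] := wR2 ce.
rewrite /fop /jA /fop (wco_comp h2 h1); congr (wco _ _ _); apply/funext => p /=.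
ring.
Qed.

Lemma trilY_hb : tril Y chb = opspan (tens nu2rr vr (fun p => Dm12 D (rx p)) (fun p => gs (rx p))).
Proof.
rewrite (tril_gen lcU hdU mufin full (@gr_meas G) aA aA clA rA Y sA sB dA dB (am_bop aB)).
congr opspan; apply: (opmul_r (im ket2Y) erefl) => xi eta c ce.
have [M1 h1] := wB c; have [M2 h2] := wR2 ce.
rewrite /fop /jB /fop (wco_comp h2 h1); congr (wco _ _ _); apply/funext => p /=.
ring.
Qed.

Lemma trirY : trir Y cal = opspan (tens nu2rr vr (fun=> 1) (fun p => gr (ry p))).
Proof.
rewrite -[LHS]/(tril fY cal).
rewrite (tril_gen lcU hdU mufin full (@gr_meas G) aA aA clA rA fY sA sA dA dA (am_bop aA)).
congr opspan; apply: (opmul_l (im ket1Y) erefl) => xi eta c ce.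
have [M1 h1] := wA ce; have [M2 h2] := wR1 c.
rewrite /fop /jA /fop (wco_comp h2 h1); congr (wco _ _ _); apply/funext => p /=.
ring.
Qed.

Lemma trirY_hb : trir Y chb = opspan (tens nu2rr vr (fun p => Dm12 D (ry p)) (fun p => gs (ry p))).
Proof.
rewrite -[LHS]/(tril fY chb).
rewrite (tril_gen lcU hdU mufin full (@gr_meas G) aA aA clA rA fY sA sB dA dB (am_bop aB)).
congr opspan; apply: (opmul_l (im ket1Y) erefl) => xi eta c ce.
have [M1 h1] := wB ce; have [M2 h2] := wR1 c.
rewrite /fop /jB /fop (wco_comp h2 h1); congr (wco _ _ _); apply/funext => p /=.
ring.
Qed.

Let clM : opspan (mulC0 mu) = mulC0 mu := mulC0_span lcU hdU mufin full.
Let adjM := @mulC0_adj R U mu.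
Let bm (N : ptopologicalType) (q : N -> U) f : C0 f -> continuous q -> bmeas (fun p : borel N => f (q p) : C).
Proof. by move=> f0 cq; exact: (C0_bmeas_comp f0 cq). Qed.
Let csx : continuous (sx : fib_sr G -> G) := @val1_sr_cont G.
Let csy : continuous (sy : fib_sr G -> G) := @val2_sr_cont G.
Let crx : continuous (rx : fib_rr G -> G) := @val1_rr_cont G.
Let cry : continuous (ry : fib_rr G -> G) := @val2_rr_cont G.
Let grsx : continuous (fun p : fib_sr G => gr (sx p)) := cont_comp csx (@gr_cont G).
Let grsy : continuous (fun p : fib_sr G => gr (sy p)) := cont_comp csy (@gr_cont G).
Let gssy : continuous (fun p : fib_sr G => gs (sy p)) := cont_comp csy (@gs_cont G).
Let grrx : continuous (fun p : fib_rr G => gr (rx p)) := cont_comp crx (@gr_cont G).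
Let grry : continuous (fun p : fib_rr G => gr (ry p)) := cont_comp cry (@gr_cont G).
Let gsrx : continuous (fun p : fib_rr G => gs (rx p)) := cont_comp crx (@gs_cont G).
Let gsry : continuous (fun p : fib_rr G => gs (ry p)) := cont_comp cry (@gs_cont G).

Let stA (q : G -> U) f d : continuous q -> C0 f -> cal d -> cal (mulop nu (fun y : Gb => f (q y)) \o d).
Proof.
move=> cq f0 cd.
have e : opspan (opmul [set mulop nu (fun y : Gb => f (q y)) | f in @C0 R U] cal) = cal.
  exact: (cmod_mulq lcU hdU hd lamk fdA cq).
rewrite -e; apply: opspan_sub.
  by apply: bop_comp; [apply: mulop_bop; exact: bm|exact: cmod_bop cd].
by exists (mulop nu (fun y : Gb => f (q y))); [exists f|exists d].
Qed.
Let stB (q : G -> U) f d : continuous q -> C0 f -> chb d -> chb (mulop nu (fun y : Gb => f (q y)) \o d).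
Proof.
move=> cq f0 cd.
have e : opspan (opmul [set mulop nu (fun y : Gb => f (q y)) | f in @C0 R U] chb) = chb.
  exact: (cmod_mulq lcU hdU hd lamik fdB cq).
rewrite -e; apply: opspan_sub.
  by apply: bop_comp; [apply: mulop_bop; exact: bm|exact: cmod_bop cd].
by exists (mulop nu (fun y : Gb => f (q y))); [exists f|exists d].
Qed.

(** The relation is checked on kets of C_c functions, where it is a computation with multipliers,
    and passes to all of [ga] since kets depend continuously on their label and the relation is
    closed. *)
Let rX (be ga : set (K -> H)) (Z : rtp be ga) (q : Gb -> Ub) (j : (G -> C) -> K -> H) (r : Z -> Z) (c : H -> H) :
  measurable_fun setT q -> amod (mulC0 mu) be -> amod (mulC0 mu) ga -> opclosed ga ->
  (forall f, C0 f -> rho be (mulop mu f) = mulop nu (fun t => f (q t))) ->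
  (forall eta, ga eta -> forall e : R, 0 < e -> exists2 eta0, [set j xi | xi in @Cc R G] eta0 & op_close eta eta0 e) ->
  [set j xi | xi in @Cc R G] `<=` ga -> bounded_op r -> bounded_op c ->
  (forall xi, Cc xi -> r \o ket2 Z (j xi) = ket2 Z (j xi) \o c) ->
  forall eta, ga eta -> r \o ket2 Z eta = ket2 Z eta \o c.
Proof.
move=> mq abe aga cga brho gad gas br bc h eta ge.
have [_ _ cl] := comm_opclosed br bc.
have bk e : ga e -> bounded_op (ket2 Z e) by move=> g; exact: (ket2_bop hK Z abe aga g).
apply: (cl (ket2 Z eta) (bk _ ge) _).2 => e e0.
have [_ [xi cx <-] c1] := gad _ ge e e0; have gj : ga (j xi) by apply: gas; exists xi.
exists (ket2 Z (j xi)); first by split; [exact: bk|exact: h].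
exact: (ket2_close lcU hdU mufin full mq abe aga cga brho Z ge gj (ltW e0) c1).
Qed.

Lemma amX1 : amod (mulC0 mu) (tril X cal).
Proof.
apply: (@tril_amod R K hK (mulC0 mu) clM adjM H H chb cal X aB aA cal aA).
  by move=> _ d /mulC0P[f f0 ->] cd; rewrite (rB f0); exact: (stA (@gs_cont G) f0 cd).
move=> _ /mulC0P[f f0 ->]; rewrite (rA f0).
have b1 := bm f0 grsx; have b2 := bm f0 (@gr_cont G).
exists (mulop nu2sr (fun p : SR => f (gr (sx p)))); split; first exact: mulop_bop.
apply: (rX (@gs_meas G) aB aA clA rB dA sA); try exact: mulop_bop.
move=> xi c; rewrite ket2X// /fop; have [M h] := wS2 c.
by rewrite (mulop_wco h b1) (wco_mulop h b2); congr (wco _ _ _); apply/funext => p; rewrite mulrC.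
Qed.

Lemma amX2 : amod (mulC0 mu) (trir X cal).
Proof.
apply: (@tril_amod R K hK (mulC0 mu) clM adjM H H cal chb fX aA aB cal aA).
  by move=> _ d /mulC0P[f f0 ->] cd; rewrite (rA f0); exact: (stA (@gr_cont G) f0 cd).
move=> _ /mulC0P[f f0 ->]; rewrite (rA f0).
have b1 := bm f0 grsy; have b2 := bm f0 (@gr_cont G).
exists (mulop nu2sr (fun p : SR => f (gr (sy p)))); split; first exact: mulop_bop.
apply: (rX (@gr_meas G) aA aB clB rA dB sB); try exact: mulop_bop.
move=> xi c; rewrite -[ket2 fX _]/(ket1 X (jB xi)) ket1X// /fop; have [M h] := wS1 c.
by rewrite (mulop_wco h b1) (wco_mulop h b2); congr (wco _ _ _); apply/funext => p; rewrite mulrC.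
Qed.

Lemma amX3 : amod (mulC0 mu) (trir X chb).
Proof.
apply: (@tril_amod R K hK (mulC0 mu) clM adjM H H cal chb fX aA aB chb aB).
  by move=> _ d /mulC0P[f f0 ->] cd; rewrite (rA f0); exact: (stB (@gr_cont G) f0 cd).
move=> _ /mulC0P[f f0 ->]; rewrite (rB f0).
have b1 := bm f0 gssy; have b2 := bm f0 (@gs_cont G).
exists (mulop nu2sr (fun p : SR => f (gs (sy p)))); split; first exact: mulop_bop.
apply: (rX (@gr_meas G) aA aB clB rA dB sB); try exact: mulop_bop.
move=> xi c; rewrite -[ket2 fX _]/(ket1 X (jB xi)) ket1X// /fop; have [M h] := wS1 c.
by rewrite (mulop_wco h b1) (wco_mulop h b2); congr (wco _ _ _); apply/funext => p; rewrite mulrC.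
Qed.

Local Notation V := (@gpd_V R G nu2sr nu2rr).
Local Notation V' := (@gpd_Vinv R G nu2sr nu2rr).
Let uV : unitary V := (gpd_V_unitary lc hd sc lamH nuE srE rrE).1.
Let uVi : uinv V = V' := (gpd_V_unitary lc hd sc lamH nuE srE rrE).2.
Let iV := shear_int lc hd sc lamH nuE srE rrE.
Let iVi := unshear_int lc hd sc lamH nuE srE rrE.
Let wV := push_wcb (@shear_meas G) iV.
Let wVi := push_wcb (@unshear_meas G) iVi.

Let cls_sr : closed (range vs). Proof. by rewrite fib_sr_range; exact: fib_sr_closed. Qed.
Let cls_rr : closed (range vr). Proof. by rewrite fib_rr_range; exact: fib_rr_closed. Qed.

(** Both inclusions are instances of [tens_push], one for the shear and one for its inverse; the
    almost everywhere identity of weights is pulled back along the inverse for the second. *)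
Let Vrel (W1 : SR -> C) (Q1 : fib_sr G -> U) (W2 : RR -> C) (Q2 : fib_rr G -> U) :
  cmeas W1 -> continuous Q1 -> cmeas W2 -> continuous Q2 ->
  (forall xi eta, Cc xi -> Cc eta -> exists M, wcb mu nu2sr (fun p => W1 p * (xi (vs p).1 * eta (vs p).2)) (Q1 : SR -> Ub) M) ->
  (forall xi eta, Cc xi -> Cc eta -> exists M, wcb mu nu2rr (fun p => W2 p * (xi (vr p).1 * eta (vr p).2)) (Q2 : RR -> Ub) M) ->
  (forall p, Q1 (shear p) = Q2 p) -> {ae nu2rr, forall p : RR, W1 (shear p) = W2 p} ->
  [set V \o T | T in opspan (tens nu2sr vs W1 Q1)] = opspan (tens nu2rr vr W2 Q2).
Proof.
move=> mW1 cQ1 mW2 cQ2 bd1 bd2 hQ hW.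
have hsr := @fib_sr_hausdorff G hd; have hrr := @fib_rr_hausdorff G hd.
apply/seteqP; split=> S.
  move=> [T hT <-].
  exact: (tens_push lc hd hsr hrr (@val_sr_cont G) cls_sr (@val_sr_nbhs G) (@val_rr_cont G) cls_rr
    (@val_rr_nbhs G) (@shear_cont G) (@unshear_cont G) (@shearK G) wV mW2 (continuous_borel cQ2) bd1 bd2 hQ hW hT).
move=> hS; exists (V' \o S); last first.
  by apply/funext => x; rewrite /= -uVi (uinvK uV).
have hQ' p : Q2 (unshear p) = Q1 p by rewrite -hQ unshearK.
have hW' : {ae nu2sr, forall p : SR, W2 (unshear p) = W1 p}.
  have := ae_pull (@unshear_meas G) iVi hW; apply: filterS => p <-.
  by congr W1; exact: unshearK.
exact: (tens_push lc hd hrr hsr (@val_rr_cont G) cls_rr (@val_rr_nbhs G) (@val_sr_cont G) cls_sr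
    (@val_sr_nbhs G) (@unshear_cont G) (@shear_cont G) (@unshearK G) wVi mW1 (continuous_borel cQ1) bd2 bd1 hQ' hW' hS).
Qed.

Let mD := Dm12_meas DE.
Let mDc (N : ptopologicalType) (h : N -> G) : continuous h -> cmeas (fun p : borel N => Dm12 D (h p)).
Proof. by move=> ch; have [? ?] := cmeas_comp (continuous_borel ch) mD. Qed.

Let bXl xi eta : Cc xi -> Cc eta ->
  exists M, wcb mu nu2sr (fun p => 1 * (xi (vs p).1 * eta (vs p).2)) (fun p : SR => gr (sx p) : Ub) M.
Proof.
move=> c ce; have [M1 h1] := wA c; have [M2 h2] := wS2 ce.
by apply: (wcb_eq _ (ex_intro _ _ (wcb_comp h2 h1))) => p /=; rewrite !mulr1 mul1r mulrC.
Qed.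
Let bXra xi eta : Cc xi -> Cc eta ->
  exists M, wcb mu nu2sr (fun p => Dm12 D (sx p) * (xi (vs p).1 * eta (vs p).2)) (fun p : SR => gr (sy p) : Ub) M.
Proof.
move=> c ce; have [M1 h1] := wA ce; have [M2 h2] := wS1 c.
by apply: (wcb_eq _ (ex_intro _ _ (wcb_comp h2 h1))) => p /=; rewrite !mulr1 mulrCA mulrA.
Qed.
Let bXrh xi eta : Cc xi -> Cc eta ->
  exists M, wcb mu nu2sr (fun p => Dm12 D (sx p) * Dm12 D (sy p) * (xi (vs p).1 * eta (vs p).2)) (fun p : SR => gs (sy p) : Ub) M.
Proof.
move=> c ce; have [M1 h1] := wB ce; have [M2 h2] := wS1 c.
by apply: (wcb_eq _ (ex_intro _ _ (wcb_comp h2 h1))) => p /=; rewrite mulrACA mulrC.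
Qed.
Let bYl xi eta : Cc xi -> Cc eta ->
  exists M, wcb mu nu2rr (fun p => 1 * (xi (vr p).1 * eta (vr p).2)) (fun p : RR => gr (rx p) : Ub) M.
Proof.
move=> c ce; have [M1 h1] := wA c; have [M2 h2] := wR2 ce.
by apply: (wcb_eq _ (ex_intro _ _ (wcb_comp h2 h1))) => p /=; rewrite !mulr1 mul1r mulrC.
Qed.
Let bYlh xi eta : Cc xi -> Cc eta ->
  exists M, wcb mu nu2rr (fun p => Dm12 D (rx p) * (xi (vr p).1 * eta (vr p).2)) (fun p : RR => gs (rx p) : Ub) M.
Proof.
move=> c ce; have [M1 h1] := wB c; have [M2 h2] := wR2 ce.
by apply: (wcb_eq _ (ex_intro _ _ (wcb_comp h2 h1))) => p /=; rewrite /rx /ry; ring.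
Qed.
Let bYr xi eta : Cc xi -> Cc eta ->
  exists M, wcb mu nu2rr (fun p => 1 * (xi (vr p).1 * eta (vr p).2)) (fun p : RR => gr (ry p) : Ub) M.
Proof.
move=> c ce; have [M1 h1] := wA ce; have [M2 h2] := wR1 c.
by apply: (wcb_eq _ (ex_intro _ _ (wcb_comp h2 h1))) => p /=; rewrite !mulr1 mul1r.
Qed.
Let bYrh xi eta : Cc xi -> Cc eta ->
  exists M, wcb mu nu2rr (fun p => Dm12 D (ry p) * (xi (vr p).1 * eta (vr p).2)) (fun p : RR => gs (ry p) : Ub) M.
Proof.
move=> c ce; have [M1 h1] := wB ce; have [M2 h2] := wR1 c.
by apply: (wcb_eq _ (ex_intro _ _ (wcb_comp h2 h1))) => p /=; rewrite /rx /ry; ring.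
Qed.

Let one_meas (N : ptopologicalType) : cmeas (fun _ : borel N => 1 : C).
Proof. exact: (@cmeas_cst _ _ _ 1). Qed.

Lemma gpd_V1 : [set V \o T | T in tril X cal] = trir Y cal.
Proof.
have hQ (p : fib_rr G) : gr (sx (shear p)) = gr (ry p) by exact: (rr_eq p).
have hW : {ae nu2rr, forall p : RR, (1 : C) = 1} by apply: aeW.
by rewrite trilX trirY; exact: (Vrel (one_meas _) grsx (one_meas _) grry bXl bYr hQ hW).
Qed.

Lemma gpd_V2 : [set V \o T | T in trir X cal] = tril Y chb.
Proof.
have hQ (p : fib_rr G) : gr (sy (shear p)) = gs (rx p) by exact: (esym (sr_eq (shear p))).
have hW : {ae nu2rr, forall p : RR, Dm12 D (sx (shear p)) = Dm12 D (rx p)} by apply: aeW.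
by rewrite trirX_al trilY_hb; exact: (Vrel (mDc csx) grsy (mDc crx) gsrx bXra bYlh hQ hW).
Qed.

Lemma gpd_V3 : [set V \o T | T in trir X chb] = trir Y chb.
Proof.
have hQ (p : fib_rr G) : gs (sy (shear p)) = gs (ry p).
  by rewrite /sy /ry /= gs_mul// gs_inv; exact: (rr_eq p).
have hW : {ae nu2rr, forall p : RR, Dm12 D (sx (shear p)) * Dm12 D (sy (shear p)) = Dm12 D (ry p)}.
  (* The product of x and x^{-1} y is y, so the cocycle identity pulled back along the shear reads
     D^{-1/2}(x) D^{-1/2}(x^{-1} y) = D^{-1/2}(y). *)
  have := ae_pull (@shear_meas G) iV (sr_cocycle lc hd sc lamH mu_radon nuE nuiE nui_ac DE srE).
  apply: filterS => p ->; rewrite gmE; last exact: (sr_eq (shear p)).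
  by have := congr1 (fun q : fib_rr G => Dm12 (R := R) D (val q).2) (shearK p); rewrite val_unshear.
by rewrite trirX_hb trirY_hb; exact: (Vrel (cmeasM (mDc csx) (mDc csy)) gssy (mDc cry) gsry bXrh bYrh hQ hW).
Qed.

Lemma gpd_V4 : [set V \o T | T in tril X cal] = tril Y cal.
Proof.
have hQ (p : fib_rr G) : gr (sx (shear p)) = gr (rx p) by [].
have hW : {ae nu2rr, forall p : RR, (1 : C) = 1} by apply: aeW.
by rewrite trilX trilY; exact: (Vrel (one_meas _) grsx (one_meas _) grrx bXl bYl hQ hW).
Qed.

Lemma trirX_mulop f T : C0 f -> trir X chb T ->
  mulop nu2sr (fun p : SR => f (gs (sy p))) \o T = T \o mulop mu f.
Proof.
move=> f0; rewrite trirX_hb => hT.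
have b1 := bm f0 gssy; have b2 : bmeas (f : Ub -> C) := C0_bmeas f0.
have cl := comm_opclosed (K := K) (mulop_bop nu2sr b1) (mulop_bop mu b2).
apply: (opspan_min cl _ hT).2 => _ [xi [eta [c ce ->]]]; have [M h] := bXrh c ce.
split; first exact: (wco_bop h).
by rewrite (mulop_wco h b1) (wco_mulop h b2); congr (wco _ _ _); apply/funext => p; rewrite mulrC.
Qed.

Let gX := precompact_opens_gen R lc hd sc.
Let nuP A : precompact_opens A -> (nu A < +oo)%E.
Proof. exact: (nu_precompact lc hd sc lamH mu_radon nuE). Qed.
Let RS : set (set SR) := rects (@precompact_opens G : set (set Gb)) (@precompact_opens G : set (set Gb)) sx sy.
Let RSfin A : RS A -> (nu2sr A < +oo)%E.
Proof. by move=> [A1 PA1 [A2 PA2 <-]]; exact: (rect_fin lc hd lamk fsr2 gX nuP PA1 PA2). Qed.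
Let RSgen : @measurable _ SR = <<s RS >>.
Proof.
have [E [PE cE]] := precompact_cover R lc hd sc.
exact: (rect_gen gX gX PE PE cE cE (@sx_meas G) (@sy_meas G) (gN_borel lc hd sc (@val_sr_cont G) (@val_sr_nbhs G))).
Qed.
Let RSI : setI_closed RS.
Proof. exact: (@rectsI _ Gb _ Gb _ SR (@precompact_opens G) (@precompact_opens G) sx sy (precompact_opensI hd) (precompact_opensI hd)). Qed.

Lemma n3_ex : exists n3 : {measure set (SR * Gb)%type -> \bar R},
  forall F : SR * Gb -> \bar R, measurable_fun setT F -> (forall p, 0 <= F p)%E ->
  (\int[n3]_p F p = \int[nu2sr]_t \int[lam (gs (sy t))]_z F (t, z))%E.
Proof.
have [E [PE cE]] := precompact_cover R lc hd sc.
have [B [PB cvB]] := rects_cover sx sy PE PE cE cE.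
apply: (@kprod_ex _ _ SR Gb R nu2sr (fun t => lam (gs (sy t))) B E) => //.
- by move=> k; rewrite RSgen; apply: sub_sigma_algebra; exact: PB.
- by move=> k; apply: RSfin; exact: PB.
- by move=> k; apply: precompact_meas; exact: PE.
- by move=> k; have [r rP] := lam_bound lc hd lamH (PE k); exists r => t; exact: rP.
- move=> A mA; exact: (measurableT_comp (lam_meas lc hd sc lamH mA) (measurableT_comp (@gs_meas G) (@sy_meas G))).
Qed.

Local Notation pxy := (@pxy G).
Local Notation pyz := (@pyz G).
Local Notation px_yz := (@px_yz G).
Local Notation pxy_z := (@pxy_z G).
Local Notation pxyz := (@pxyz G).

(** * The pentagon equation *)

Section Triple.
Variable n3 : {measure set (SR * Gb)%type -> \bar R}.
Hypothesis n3E : forall F : SR * Gb -> \bar R, measurable_fun setT F -> (forall p, 0 <= F p)%E ->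
  (\int[n3]_p F p = \int[nu2sr]_t \int[lam (gs (sy t))]_z F (t, z))%E.

Lemma fibd_triple : fibd lam nu2sr n3 (fst : SR * Gb -> SR) (snd : SR * Gb -> Gb) (fun=> 1) (fun t : SR => gs (sy t) : Ub).
Proof.
have mq : measurable_fun setT (fun t : SR => gs (sy t) : Ub) := measurableT_comp (@gs_meas G) (@sy_meas G).
split=> //.
move=> psi F mp mF p0 F0.
have -> : (\int[n3]_p ((sqn (1 : C))%:E * psi p.2 * F p.1) = \int[n3]_p (F p.1 * psi p.2))%E.
  by apply: eq_integral => p _; rewrite (sqnR (1 : R)) expr1n mul1e muleC.
rewrite n3E; first last.
- by move=> p; exact: mule_ge0.
- by apply: emeasurable_funM; [exact: measurableT_comp mF measurable_fst|exact: measurableT_comp mp measurable_snd].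
by apply: eq_integral => t _ /=; rewrite ge0_integralZl.
Qed.

Lemma rtp_triple_ex : exists t : (K -> L2space nu2sr) -> K -> (K -> H) -> L2space n3,
  is_rtp (trir X chb) cal t /\
  forall xi z eta, Cc eta -> trir X chb xi -> t xi z (jA eta) = fop n3 fst snd (fun=> 1) eta (xi z).
Proof.
have [E [PE cE]] := precompact_cover R lc hd sc.
have [B [PB cvB]] := rects_cover sx sy PE PE cE cE.
have tot : hspan [set x | exists xi h, Cc xi /\ x = fop (m := nu2sr) n3 fst snd (fun=> 1) xi h] = setT.
  apply: (fop_tot lc hd sc lamk fibd_triple RSgen RSI PB cvB RSfin) => S sS h1 h2.
  rewrite measurable_prod_measurableType; apply: smallest_sub => // _ [A mA [A' mA' <-]].
  rewrite -(sigma_algebra_id sS).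
  have -> : A `*` A' = fst @^-1` A `&` snd @^-1` A' by [].
  apply: (@measurableI _ (g_sigma_algebraType S)); apply: sub_sigma_algebra; [exact: h1|exact: h2].
apply: (rtp_fop hd lamH nuE fibd_triple tot (am_bop amX3) (am_tot amX3)) => f xi f0 hx.
exact: trirX_mulop.
Qed.

Variables (t3 : (K -> L2space nu2sr) -> K -> (K -> H) -> L2space n3) (r3 : is_rtp (trir X chb) cal t3).
Hypothesis t3E : forall xi z eta, Cc eta -> trir X chb xi -> t3 xi z (jA eta) = fop n3 fst snd (fun=> 1) eta (xi z).
Local Notation T1 := (Rtp r3).

Let w3 xi : Cc xi -> exists M, wcb nu2sr n3 (fun p => xi p.2 * 1) fst M.
Proof. exact: (fop_wcb hd lamk fibd_triple). Qed.

Lemma ket2T xi : Cc xi -> ket2 T1 (jA xi) = fop n3 fst snd (fun=> 1) xi.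
Proof.
move=> c; apply: (ket2_uniq hK amX3 aA (cA c)); first exact: (fop_bop hd lamk fibd_triple c).
by move=> eta z be; rewrite /= t3E.
Qed.

(** The measure [n3] is defined on a full product but is concentrated on composable triples, because
    each fibre measure is concentrated on its fibre. Weighted composition operators may thus be
    compared on composable triples alone. *)
Lemma n3_ae : {ae n3, forall p : SR * Gb, gs (sy p.1) = gr p.2}.
Proof.
pose N : set (SR * Gb) := ~` [set p | gs (sy p.1) = gr p.2].
have mN : measurable N.
  apply: measurableC; have m2 : measurable_fun setT (fun p : SR * Gb => (sy p.1, p.2)).
    by apply/measurable_fun_pairP; split; [exact: measurableT_comp (@sy_meas G) measurable_fst|exact: measurable_snd].
  have := m2 measurableT _ (fib_meas R lc hd sc); rewrite setTI; exact.
exists N; split=> //; rewrite -(int_indicT n3 mN) n3E; first last.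
- by move=> p; rewrite lee_fin.
- by apply/measurable_EFinP; exact: measurable_indic.
rewrite (_ : (fun t => _) = cst 0%E) ?integral0//; apply/funext => t.
have mi : measurable_fun setT (fun z : Gb => (\1_N (t, z) : R)%:E).
  apply: (measurableT_comp (f := fun p : SR * Gb => (\1_N p : R)%:E)); last exact: (pair1_measurable (t : SR)).
  by apply/measurable_EFinP; exact: measurable_indic.
rewrite (lam_eq hd lamH (F' := cst 0%E) mi)//.
- by rewrite integral0.
- by move=> z e; rewrite indicE memNset// /N /=; apply; rewrite e.
Qed.

Let bxyz eta (c : Cc eta) := wcb_xyz lc hd sc lamH n3E c.
Let byz eta (c : Cc eta) := wcb_yz lc hd sc lamH mu_radon nuE nuiE nui_ac DE srE n3E c.
Let bx_yz eta (c : Cc eta) := wcb_x_yz lc hd sc lamH nuE srE n3E c.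
Let bxy_z eta (c : Cc eta) := wcb_xy_z lc hd sc lamH nuE srE n3E c.

Let run (t : SR) : rx (unshear t) = sx t. Proof. by rewrite /rx val_unshear. Qed.
Let rym (t : SR) : ry (unshear t) = gm (sx t, sy t).
Proof. by rewrite /ry val_unshear gmE//; exact: (sr_eq t). Qed.
Let gmr (x y : G) : gs x = gr y -> gr (gm (x, y)) = gr x. Proof. by move=> e; rewrite gmE// gr_mul. Qed.
Let gms (x y : G) : gs x = gr y -> gs (gm (x, y)) = gs y. Proof. by move=> e; rewrite gmE// gs_mul. Qed.

Let pts (p : SR * Gb) : gs (sy p.1) = gr p.2 ->
  [/\ sx (pyz p) = sy p.1, sy (pyz p) = p.2, sx (px_yz p) = sx p.1 & sy (px_yz p) = gm (sy p.1, p.2)] /\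
  [/\ sx (pxy_z p) = gm (sx p.1, sy p.1), sy (pxy_z p) = p.2 &
      gm (gm (sx p.1, sy p.1), p.2) = gm (sx p.1, gm (sy p.1, p.2))].
Proof.
move=> e; have e1 : gs (sx p.1) = gr (sy p.1) := sr_eq p.1.
have e2 : gs (sx p.1) = gr (gm (sy p.1, p.2)) by rewrite gmr.
have e3 : gs (gm (sx p.1, sy p.1)) = gr p.2 by rewrite gms.
split; split; rewrite ?mk_sx ?mk_sy//.
by rewrite (gmE e3) (gmE e2) (gmE e1) (gmE e) gmulA.
Qed.

Lemma F1E F1 zeta : bounded_op F1 -> Cc zeta ->
  (forall xi, cal xi -> F1 \o ket2 X xi = ket2 T1 xi \o ket1 X (jB zeta)) ->
  F1 = wco n3 (fun p => zeta (sx p.1) * Dm12 D (sx p.1)) pyz.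
Proof.
move=> bF c h; have [M hM] := byz c.
apply: (bop_ext_on bF (wco_bop hM) tot_sr2) => _ [xi [x [cx ->]]].
rewrite -[LHS]/((F1 \o fop nu2sr sx sy (fun=> 1) xi) x) -(ket2X cx) (h _ (cA cx)) (ket2T cx) (ket1X c) (ket2X cx).
have [M1 h1] := w3 cx; have [M2 h2] := wS1 c; have [M3 h3] := wS2 cx.
rewrite -[RHS]/((wco n3 _ pyz \o fop nu2sr sx sy (fun=> 1) xi) x); congr (_ x).
rewrite /fop (wco_comp h1 h2) (wco_comp hM h3); apply: (wco_ext_ae (wcb_comp h1 h2) (wcb_comp hM h3)).
by apply: filterS n3_ae => p /pts[[-> -> _ _] _]; split=> //=; rewrite !mulr1 mulrC.
Qed.

Lemma F2E F2 eta : bounded_op F2 -> Cc eta ->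
  (forall xi, cal xi -> F2 \o ket2 X xi = ket2 T1 xi \o uinv V \o ket1 Y (jA eta)) ->
  F2 = wco n3 (fun p => eta (sx p.1)) pxy_z.
Proof.
move=> bF c h; have [M hM] := bxy_z c.
apply: (bop_ext_on bF (wco_bop hM) tot_sr2) => _ [xi [x [cx ->]]].
rewrite -[LHS]/((F2 \o fop nu2sr sx sy (fun=> 1) xi) x) -(ket2X cx) (h _ (cA cx)) uVi (ket2T cx) (ket1Y c) (ket2X cx).
have [M1 h1] := w3 cx; have [M2 h2] := wR1 c; have [M3 h3] := wS2 cx.
rewrite -[RHS]/((wco n3 _ pxy_z \o fop nu2sr sx sy (fun=> 1) xi) x); congr (_ x).
rewrite /fop (wco_comp h1 wVi) (wco_comp (wcb_comp h1 wVi) h2) (wco_comp hM h3).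
apply: (wco_ext_ae (wcb_comp (wcb_comp h1 wVi) h2) (wcb_comp hM h3)).
apply: filterS n3_ae => p /pts[_ [-> -> _]]; rewrite /= run rym; split=> //=.
by rewrite !mulr1 mulrC.
Qed.

(** The hypothesis gives [F5] on kets of the first leg, while the total set [tot_sr2] consists of
    kets of the second leg; on vectors [jB zeta y] the two are exchanged by symmetry of the
    tensor. *)
Lemma F5E F5 xi : bounded_op F5 -> Cc xi ->
  (forall zeta, Cc zeta -> F5 \o ket1 X (jB zeta) =
     wco n3 (fun p => zeta (sx p.1) * Dm12 D (sx p.1)) pyz \o uinv V \o ket1 Y (jA xi)) ->
  F5 = wco n3 (fun p => xi (sy p.1)) px_yz.
Proof.
move=> bF c h; have [M hM] := bx_yz c; have bG := wco_bop hM.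
apply: (bop_ext_on bF bG tot_sr2) => _ [eta [x [ce ->]]].
have bf := fop_bop hd lamk fsr2 ce.
rewrite -[LHS]/((F5 \o fop nu2sr sx sy (fun=> 1) eta) x) -[RHS]/((wco n3 _ px_yz \o fop nu2sr sx sy (fun=> 1) eta) x).
congr (_ x); apply: (bop_ext_on (bop_comp bF bf) (bop_comp bG bf) (jB_tot lc hd sc lamH mu_radon full nuE nuiE nu_ac nui_ac DE)).
move=> _ [zeta [y [cz ->]]].
(* Both sides are the elementary tensor of [jB zeta], [y] and [jA eta], read through one leg or the
   other. *)
have sw : fop nu2sr sx sy (fun=> 1) eta (jB zeta y) = ket1 X (jB zeta) (jA eta y).
  rewrite -(ket2X ce) (ket2E hK X aB aA y (cA ce) (cB cz)).
  by apply/esym; exact: (ket2E hK fX aA aB y (cB cz) (cA ce)).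
rewrite /= sw -[LHS]/((F5 \o ket1 X (jB zeta)) (jA eta y)) (h _ cz) uVi (ket1Y c) (ket1X cz).
have [M1 h1] := byz cz; have [M2 h2] := wR1 c; have [M3 h3] := wS1 cz.
rewrite -[RHS]/((wco n3 _ px_yz \o fop nu2sr sy sx _ zeta) (jA eta y)); congr (_ (jA eta y)).
rewrite /fop (wco_comp h1 wVi) (wco_comp (wcb_comp h1 wVi) h2) (wco_comp hM h3).
apply: (wco_ext_ae (wcb_comp (wcb_comp h1 wVi) h2) (wcb_comp hM h3)).
apply: filterS n3_ae => p /pts[[e1 e2 -> ->] _]; rewrite /= run rym e1 e2; split=> //=.
by rewrite !mulr1 mulrC.
Qed.

Lemma F7E F7 eta : bounded_op F7 -> Cc eta ->
  (forall xi, Cc xi -> F7 \o ket2 X (jA xi) =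
     wco n3 (fun p => xi (sy p.1)) px_yz \o uinv V \o ket2 Y (jA eta)) ->
  F7 = wco n3 (fun p => eta (pxyz p)) pxy.
Proof.
move=> bF c h; have [M hM] := bxyz c.
apply: (bop_ext_on bF (wco_bop hM) tot_sr2) => _ [xi [x [cx ->]]].
rewrite -[LHS]/((F7 \o fop nu2sr sx sy (fun=> 1) xi) x) -(ket2X cx) (h _ cx) uVi (ket2Y c) (ket2X cx).
have [M1 h1] := bx_yz cx; have [M2 h2] := wR2 c; have [M3 h3] := wS2 cx.
rewrite -[RHS]/((wco n3 _ pxy \o fop nu2sr sx sy (fun=> 1) xi) x); congr (_ x).
rewrite /fop (wco_comp h1 wVi) (wco_comp (wcb_comp h1 wVi) h2) (wco_comp hM h3).
apply: (wco_ext_ae (wcb_comp (wcb_comp h1 wVi) h2) (wcb_comp hM h3)).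
apply: filterS n3_ae => p /pts[[_ _ e1 e2] _]; rewrite /= run rym e1 e2; split=> //=.
by rewrite !mulr1 mulrC.
Qed.

Let com (a b : set (K -> H)) (q q' : G -> U) : continuous q -> continuous q' ->
  (forall f, C0 f -> rho a (mulop mu f) = mulop nu (fun y : Gb => f (q y))) ->
  (forall f, C0 f -> rho b (mulop mu f) = mulop nu (fun y : Gb => f (q' y))) ->
  forall S T, mulC0 mu S -> mulC0 mu T -> rho a S \o rho b T = rho b T \o rho a S.
Proof.
move=> cq cq' ra rb _ _ /mulC0P[f f0 ->] /mulC0P[g g0 ->]; rewrite ra// rb//.
rewrite !mulop_comp; try exact: bm.
by congr mulop; apply/funext => y; rewrite mulrC.
Qed.

Lemma gpd_pentagon : @pentagon R (gpd_base mu) H chb cal cal X Y V.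
Proof.
have cgr := @gr_cont G; have cgs := @gs_cont G.
apply: (@pentagon_criterion R (gpd_base mu) hK comB H chb cal cal aB aA aA
  (com cgr cgr rA rA) (com cgr cgs rA rB) (com cgr cgs rA rB) X Y V uV
  gpd_V1 gpd_V2 gpd_V3 gpd_V4 amX1 amX2 amX3 amX1 T1 [set jA xi | xi in @Cc R G] [set jA xi | xi in @Cc R G] sA sA dA dA).
move=> F1 F5 F7 F2 bF1 bF5 bF7 bF2 e1 e5 e7 e2 _ _ [xi c <-] [eta ce <-].
have F1k zeta : Cc zeta -> F1 (jB zeta) = wco n3 (fun p => zeta (sx p.1) * Dm12 D (sx p.1)) pyz.
  by move=> cz; exact: (F1E (bF1 _ (cB cz)) cz (fun x ax => e1 _ _ (cB cz) ax)).
have F5k x : Cc x -> F5 (jA x) = wco n3 (fun p => x (sy p.1)) px_yz.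
  move=> cx; apply: (F5E (bF5 _ (cA cx)) cx) => zeta cz.
  by rewrite -(F1k _ cz); exact: (e5 _ _ (cA cx) (cB cz)).
have F7k : F7 (jA eta) = wco n3 (fun p => eta (pxyz p)) pxy.
  apply: (F7E (bF7 _ (cA ce)) ce) => x cx.
  by rewrite -(F5k _ cx); exact: (e7 _ _ (cA ce) (cA cx)).
have F2k : F2 (jA xi) = wco n3 (fun p => xi (sx p.1)) pxy_z.
  exact: (F2E (bF2 _ (cA c)) c (fun x ax => e2 _ _ (cA c) ax)).
(* Both sides send f to xi(x) eta(.) f(xy) on triples (x, y, z); the argument of eta is x(yz) on the
   left and (xy)z on the right, so associativity concludes. *)
rewrite F7k F2k.
rewrite uVi (ket1Y c) (ket2Y ce) /fop.
have [M1 h1] := bxyz ce; have [M2 h2] := wR1 c; have [M3 h3] := bxy_z c; have [M4 h4] := wR2 ce.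
rewrite (wco_comp h1 wVi) (wco_comp (wcb_comp h1 wVi) h2) (wco_comp h3 wVi) (wco_comp (wcb_comp h3 wVi) h4).
apply: (wco_ext_ae (wcb_comp (wcb_comp h1 wVi) h2) (wcb_comp (wcb_comp h3 wVi) h4)).
apply: filterS n3_ae => p /pts[_ [e3 e4 e6]]; rewrite /= !run !rym e3 e4 /pxy /pxyz e6; split=> //=.
by rewrite !mulr1 mulrC.
Qed.

End Triple.

Lemma gpd_Cpmu : @is_Cpmu R (gpd_base mu) H chb cal cal X Y V.
Proof.
split.
- exact: (L2_Cbase lcU hdU scU mufin full).
- exact: (gpd_multimodule lc hd sc lamH mu_radon full nuE nuiE nu_ac nui_ac DE).
- exact: uV.
- by split; [exact: gpd_V1|exact: gpd_V2|exact: gpd_V3|exact: gpd_V4].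
have [n3 n3E] := n3_ex; have [t3 [r3 t3E]] := rtp_triple_ex n3E.
exact: (gpd_pentagon n3E r3 t3E).
Qed.

End Gpd.
Theorem theorem2p7 (R : realType) (G : topGroupoid)
    (G_lc : locally_compact [set: G]) (G_hausdorff : hausdorff_space G)
    (G_sc : @second_countable G)
    (lam : gunits G -> {measure set (borel G) -> \bar R})
    (lam_Haar : is_Haar_system lam)
    (mu : {measure set (borel (gunits G)) -> \bar R})
    (mu_radon : radon mu) (mu_supp : full_support mu)
    (nu nui : {measure set (borel G) -> \bar R})
    (nuE : is_nu mu lam nu) (nuiE : is_nu mu (haar_inv lam) nui)
    (mu_qinv : nu `<< nui /\ nui `<< nu)
    (D : G -> R) (DE : is_density nu nui D)
    (nu2sr : {measure set (borel (fib_sr G)) -> \bar R})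
    (nu2srE : is_nu2_sr mu lam nu2sr)
    (nu2rr : {measure set (borel (fib_rr G)) -> \bar R})
    (nu2rrE : is_nu2_rr mu lam nu2rr) :
  let hbeta := gpd_hbeta mu nu D lam in
  let alpha := gpd_alpha mu nu lam in
  let beta := gpd_beta mu nu lam in
  exists (tsr : (L2space mu -> L2space nu) -> L2space mu ->
                (L2space mu -> L2space nu) -> L2space nu2sr)
         (trr : (L2space mu -> L2space nu) -> L2space mu ->
                (L2space mu -> L2space nu) -> L2space nu2rr)
         (tsr_rtp : is_rtp hbeta alpha tsr)
         (trr_rtp : is_rtp alpha beta trr),
  [/\ identifies_sr D tsr, identifies_rr trr &
  exists V : L2space nu2sr -> L2space nu2rr,
    @is_Cpmu R (gpd_base mu) (L2space nu) hbeta alpha beta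
      (Rtp tsr_rtp) (Rtp trr_rtp) V /\
    forall w : fib_sr G -> R[i], Cc w ->
      V (cls nu2sr w) = cls nu2rr (fun p : fib_rr G => w (shear p))].
Proof.
have [nu_ac nui_ac] := mu_qinv.
cbv zeta; rewrite /gpd_beta (gpd_alphaE G_lc G_hausdorff G_sc lam_Haar mu_radon mu_supp nuE).
rewrite (gpd_hbetaE G_lc G_hausdorff G_sc lam_Haar mu_radon mu_supp nuE nuiE nui_ac DE).
have [tsr [tr tE]] := rtp_sr_ex G_lc G_hausdorff G_sc lam_Haar mu_radon mu_supp nuE nuiE mu_qinv.1 nui_ac DE nu2srE.
have [trr [tr' tE']] := rtp_rr_ex G_lc G_hausdorff G_sc lam_Haar mu_radon mu_supp nuE nu2rrE.
have iA := is_jE G_lc G_hausdorff G_sc lam_Haar mu_radon nuE.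
have iB := is_jhatE G_lc G_hausdorff G_sc lam_Haar mu_radon nuE nuiE nui_ac DE.
have cA eta := cal_jA G_hausdorff lam_Haar nuE (xi := eta).
have cB eta := chb_jB G_lc G_hausdorff G_sc lam_Haar mu_radon nuE nuiE nui_ac DE (xi := eta).
have z2 := Cc_sqint_m (gpd_mufin mu_radon).
exists tsr, trr, tr, tr'; split.
(* An operator satisfying [is_jhat] or [is_j] for a C_c function is determined by its values on the
   total set C_c, so it is [jB eta] or [jA xi]. *)
- move=> eta xi z S T ce cx cz /(iB _ _ ce) -> /(iA _ _ cx) ->; rewrite tE//; last exact: cB.
  have fB := fibd_hbeta G_lc G_hausdorff G_sc lam_Haar mu_radon nuE nuiE nui_ac DE.
  have f2 := fibd_sr2 G_lc G_hausdorff G_sc lam_Haar nuE nu2srE.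
  have kA := lam_kern G_hausdorff lam_Haar; have kB := lami_kern G_hausdorff lam_Haar.
  rewrite /jB (fopE G_hausdorff kB fB ce (z2 _ cz)).
  rewrite (fopE G_hausdorff kA f2 cx (fop_sqint G_hausdorff kB fB ce (z2 _ cz))).
  by congr cls; apply/funext => p; rewrite /sx /sy /=; ring.
- move=> eta xi z S T ce cx cz /(iA _ _ ce) -> /(iA _ _ cx) ->; rewrite tE'//; last exact: cA.
  have fA := fibd_alpha G_hausdorff lam_Haar nuE.
  have f2 := fibd_rr2 G_lc G_hausdorff G_sc lam_Haar nuE nu2rrE.
  have kA := lam_kern G_hausdorff lam_Haar.
  rewrite /jA (fopE G_hausdorff kA fA ce (z2 _ cz)).
  rewrite (fopE G_hausdorff kA f2 cx (fop_sqint G_hausdorff kA fA ce (z2 _ cz))).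
  by congr cls; apply/funext => p; rewrite /rx /ry /=; ring.
exists (@gpd_V R G nu2sr nu2rr); split.
  exact: (gpd_Cpmu G_lc G_hausdorff G_sc lam_Haar mu_radon mu_supp nuE nuiE nu_ac nui_ac DE nu2srE nu2rrE tr tE tr' tE').
move=> w wc.
have wV := push_wcb (@shear_meas G) (shear_int G_lc G_hausdorff G_sc lam_Haar nuE nu2srE nu2rrE).
have w2 : (w : borel (fib_sr G) -> R[i]) \in sqint nu2sr.
  (* Finiteness on compact sets is derived for the measure on the fibre product: a compact set lies
     over a rectangle of precompact open sets, which has finite measure by [rect_fin]. *)
  apply: Cc_sqint_gen wc => A kA.
  have [B1 PB1 AB1] := compact_in_precompact_open R G_lc G_hausdorff
    (continuous_compact (continuous_subspaceT (@val1_sr_cont G)) kA).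
  have [B2 PB2 AB2] := compact_in_precompact_open R G_lc G_hausdorff
    (continuous_compact (continuous_subspaceT (@val2_sr_cont G)) kA).
  have f2 := fibd_sr2 G_lc G_hausdorff G_sc lam_Haar nuE nu2srE.
  have nuP B : precompact_opens B -> (nu B < +oo)%E.
    exact: (nu_precompact G_lc G_hausdorff G_sc lam_Haar mu_radon nuE).
  have := rect_fin G_lc G_hausdorff (lam_kern G_hausdorff lam_Haar) f2
    (precompact_opens_gen R G_lc G_hausdorff G_sc) nuP PB1 PB2.
  apply: le_lt_trans; apply: le_measure; rewrite ?inE.
  - apply: closed_borel; apply: compact_closed kA; exact: fib_sr_hausdorff.
  - apply: measurableI; rewrite -[X in measurable X]setTI.
      exact: (@sx_meas G measurableT _ (precompact_meas PB1)).
    exact: (@sy_meas G measurableT _ (precompact_meas PB2)).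
  - by move=> p Ap; split; [apply: AB1|apply: AB2]; exists p.
by rewrite /gpd_V (wcoE wV w2); congr cls; apply/funext => p; rewrite mul1r.
Qed.
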